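(* Let $\Gamma^m\subset\mathbb R^2$ be a polygonal curve network with vertex vector $X^m\in\mathbb R^{2N_{\rm tot}}$, and let $\Lambda=\Lambda_{\Gamma^m}$, $\mathcal D_h$, $M_v$, $B_n$, $A_\gamma^m$, $E_h$ be as defined in the context. Assume that $\operatorname{cap}(\partial\mathcal R_r)<1$ for every bounded region $\mathcal R_r$ of $\Gamma^m$, and that $\Gamma^m$ is non-degenerate, i.e. $s_{i,l}(\ell_j(X^m))>0$ for every $1\le i\le I_S$, every edge $j$ of $\Gamma^m_i$ and every $1\le l\le L_i$. Then, for every $\Delta t>0$, any solution $(\mathbf W^{m+1},\kappa^{m+1},X^{m+1})\in\mathbb R^{I_PN_{\rm tot}}\times\mathbb R^{N_a}\times\mathbb R^{2N_{\rm tot}}$, $\mathbf W^{m+1}=(W_0^{m+1};\dots;W_{I_P-1}^{m+1})$, of \[ (\mathrm I_{I_P}\otimes\Lambda)\mathbf W^{m+1}-\tfrac1{\Delta t}\mathcal D_hM_vB_n(X^{m+1}-X^m)=0,\quad \mathcal D_h^\top\mathbf W^{m+1}-\kappa^{m+1}=0,\quad B_n^\top M_v\kappa^{m+1}+A_\gamma^mX^{m+1}=0 \] satisfies \[ E_h(X^{m+1})+\Delta t\sum_{p=0}^{I_P-1}(W_p^{m+1})^\top\Lambda\,W_p^{m+1}\le E_h(X^m). \] In particular, $E_h(X^{m+1})\le E_h(X^m)$ for every $\Delta t>0$.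
   Context: **Polygonal network.** $\Gamma^m$ is an embedded network of oriented polygonal curves $\Gamma^m_1,\dots,\Gamma^m_{I_S}$ ($I_S\ge1$), each a simple closed polygon or a simple open polygonal arc. The endpoints of the open curves are exactly the triple junctions ($I_T\ge 0$ of them), at each of which exactly three distinct open curves end; the curves meet nowhere else. The connected components of $\mathbb R^2\setminus\Gamma^m$ are the regions $\mathcal R_1,\dots,\mathcal R_{I_R}$, exactly one of which, $\mathcal R_{I_R}$, is unbounded. Each region is assigned to one of the phases $0,\dots,I_P-1$ ($I_P\ge2$), the unbounded one to phase $0$. Every curve $\Gamma^m_i$ separates two different phases $p_i^-$ and $p_i^+$, and its unit normal, equal to $-\tau^\perp$ for the unit tangent $\tau$ of the orientation ($(a_1,a_2)^\perp=(-a_2,a_1)$), points from $p_i^-$ to $p_i^+$. Thus the boundary of each region is a finite disjoint union of simple closed polygons. $N_{\rm tot}$ is the number of distinct vertices; $X\in\mathbb R^{2N_{\rm tot}}$ lists vertex positions $X_j\in\mathbb R^2$. The vertices of $\Gamma_i^m$ in curve order are $X_{i,k}=X_{\iota_i(k)}$, $1\le k\le N_i$ (both endpoints included if open; periodic index in $k$ if closed), and $N_a=\sum_iN_i$; vectors in $\mathbb R^{N_a}$ are indexed by pairs $(i,k)$. **Logarithmic capacity.** $\operatorname{cap}(\Sigma)=\exp(-\inf_\mu I(\mu))$, infimum over probability measures $\mu$ supported in the compact set $\Sigma$, $I(\mu)=-\iint\log|x-y|\,d\mu(x)d\mu(y)$. **Discrete Dirichlet-to-Neumann matrix.** Let $G(x)=-\frac1{2\pi}\log|x|$.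 For a region $\mathcal R$ with outward unit normal $\nu_{\mathcal R}$ and $\partial\mathcal R$ oriented by $\nu_{\mathcal R}^\perp$, let $E_1,\dots,E_{N_Y}$ be its boundary edges, $\chi_i=\mathbf 1_{E_i}$, and $\varphi_1,\dots,\varphi_{N_X}$ the continuous edgewise affine nodal basis on $\partial\mathcal R$. With the single-layer operator $(\mathcal V\psi)(x)=\int_{\partial\mathcal R}G(x-y)\psi(y)ds_y$, the double-layer boundary operator $(\mathcal K\phi)(x)=\int_{\partial\mathcal R}\partial_{\nu_{\mathcal R}(y)}[G(x-y)]\phi(y)ds_y$ and the hypersingular operator $\mathcal W\phi=-\partial_{\nu_{\mathcal R}}$(double-layer potential of $\phi$), set $V_{ij}=\langle\chi_i,\mathcal V\chi_j\rangle$, $K_{ij}=\langle\chi_i,\mathcal K\varphi_j\rangle$, $W_{ij}=\langle\varphi_i,\mathcal W\varphi_j\rangle$, $M_{ij}=\int\chi_i\varphi_j\,ds$; by the Maue identity $W=D^\top VD$, where $\partial_s\varphi_j=\sum_iD_{ij}\chi_i$. Put $J=\frac12M+K$, $\ell=M\mathbf 1_{N_X}$. For bounded $\mathcal R$: $S_{\mathcal R}=W+J^\top V^{-1}J$ ($\operatorname{cap}(\partial\mathcal R)<1$ implies $V$ symmetric positive definite). For unbounded $\mathcal R$: $S_{\mathcal R}=W+J^\top CJ$, where $Cy=\rho$ is the first component of the unique solution of $V\rho+c\ell=y$, $\ell^\top\rho=0$. With $P_{\mathcal R}$ the restriction of global nodal vectors to the vertices of $\partial\mathcal R$, $\Lambda=\Lambda_{\Gamma^m}=\sum_{r=1}^{I_R}P_{\mathcal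 R_r}^\top S_{\mathcal R_r}P_{\mathcal R_r}\in\mathbb R^{N_{\rm tot}\times N_{\rm tot}}$. **Incidence, mass, normals.** $m_{p,i}=1$ if $p=p_i^+$, $-1$ if $p=p_i^-$, $0$ otherwise. $\mathcal D_h\in\mathbb R^{I_PN_{\rm tot}\times N_a}$ is defined by $(\mathcal D_h^\top\mathbf W)_{(i,k)}=\sum_{p}m_{p,i}(W_p)_{\iota_i(k)}$. With $h_{i,k}=|X^m_{i,k+1}-X^m_{i,k}|$, let $\mu_{i,k}=\frac12(h_{i,k-1}+h_{i,k})$, except $\mu_{i,1}=\frac12h_{i,1}$ and $\mu_{i,N_i}=\frac12h_{i,N_i-1}$ at the ends of an open curve; $M_v=\operatorname{diag}(\mu_{i,k})\in\mathbb R^{N_a\times N_a}$. Edge normals: $\nu_{i,k}=-(X^m_{i,k+1}-X^m_{i,k})^\perp/h_{i,k}$. Vertex normals: $\omega_{i,k}=\frac{h_{i,k-1}\nu_{i,k-1}+h_{i,k}\nu_{i,k}}{h_{i,k-1}+h_{i,k}}$, except $\omega_{i,1}=\nu_{i,1}$ and $\omega_{i,N_i}=\nu_{i,N_i-1}$ at the ends of an open curve. $B_n\in\mathbb R^{N_a\times2N_{\rm tot}}$: $(B_nZ)_{(i,k)}=Z_{\iota_i(k)}\cdot\omega_{i,k}$. **Anisotropy.** For each $i$, $c_i>0$ and $G_{i,1},\dots,G_{i,L_i}\in\mathbb R^{2\times2}$ are symmetric positive definite (the energy density on curve $i$ is $\gamma_i(\nu)=c_i\sum_l\sqrt{\nu^\top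 G_{i,l}\nu}$). $\widetilde G_{i,l}=R^\top G_{i,l}R$ with $R=\begin{pmatrix}0&-1\\1&0\end{pmatrix}$, $s_{i,l}(q)=\sqrt{q^\top\widetilde G_{i,l}q}$. For an edge $j$ of $\Gamma_i^m$ from vertex $k$ to vertex $k+1$ and $Z\in\mathbb R^{2N_{\rm tot}}$, $\ell_j(Z)=Z_{\iota_i(k+1)}-Z_{\iota_i(k)}$. $A^m_\gamma\in\mathbb R^{2N_{\rm tot}\times2N_{\rm tot}}$ is given by $\eta^\top A_\gamma^mX=\sum_{i}c_i\sum_{j}\sum_{l}\dfrac{\ell_j(X)^\top\widetilde G_{i,l}\,\ell_j(\eta)}{s_{i,l}(\ell_j(X^m))}$ (sum over curves $i$, edges $j$ of $\Gamma_i^m$, $1\le l\le L_i$), and $E_h(X)=\sum_ic_i\sum_j\sum_ls_{i,l}(\ell_j(X))$. *)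

(* Defs.v *)
From HB Require Import structures.
From mathcomp Require Import all_boot all_order all_algebra.
From mathcomp Require Import all_classical all_reals all_analysis.
Set Implicit Arguments.
Unset Strict Implicit.
Unset Printing Implicit Defensive.
Import Order.TTheory GRing.Theory Num.Theory.
Import numFieldNormedType.Exports.
Local Open Scope classical_set_scope.
Local Open Scope ring_scope.

(* The plane is [R * R]; the library norm on it is the sup norm, hence [enorm]. *)
Section Plane.
Context {R : realType}.
Implicit Types x y : R * R.

Definition dot x y : R := x.1 * y.1 + x.2 * y.2.
Definition enorm x : R := Num.sqrt (dot x x).
Definition perp x : R * R := (- x.2, x.1).
Definition crd (c : 'I_2) x : R := if c == ord0 then x.1 else x.2.
Definition colv x : 'cV[R]_2 := \col_c crd c x.

Definition rotmx : 'M[R]_2 :=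
  \matrix_(i, j) (if i == j then 0 else if i == ord0 then -1 else 1).

Lemma colv_perp x : colv (perp x) = rotmx *m colv x.
Proof.
apply/matrixP => i j; rewrite !mxE !big_ord_recl big_ord0 !mxE /crd /=.
by case: i => [[|[|//]] hi] /=; rewrite ?mul0r ?mul1r ?mulN1r ?addr0 ?add0r.
Qed.

Definition spd (G : 'M[R]_2) : Prop :=
  G^T = G /\ forall v : 'cV[R]_2, v != 0 -> 0 < (v^T *m G *m v) ord0 ord0.

(* Position of node [j] in a stacked vector of [n] planar positions. *)
Definition pos n (Z : 'cV[R]_(\sum_(j < n) 2)) (j : 'I_n) : R * R :=
  let z : 'cV[R]_2 := submxcol Z j in (z ord0 ord0, z ord_max ord0).

Definition boundary (A : set (R * R)) : set (R * R) := closure A `\` interior A.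

(* [lne 0 = -oo]: the kernel is [+oo] on the diagonal, so that measures with   *)
(* atoms have infinite energy.                                                *)
Definition log_energy (mu : probability (R * R)%type R) : \bar R :=
  (\int[mu]_x \int[mu]_y (- lne (enorm (x - y))%:E))%E.

Definition capacity (S : set (R * R)) : \bar R :=
  expeR (- ereal_inf [set log_energy mu | mu in
                      [set mu : probability (R * R)%type R | mu S = 1%E]])%E.

(* Since [ln 0 = 0] in the library, [Gfun 0 = 0] instead of [+oo]; below, the  *)
(* argument only vanishes on null sets of the integrals it occurs in.         *)
Definition Gfun x : R := - (2 * pi)^-1 * ln (enorm x).

End Plane.

(* Curve [i] has vertices [vert i k], [k < nv i]; indices are 0-based.  There   *)
(* are [nbnd + 1] regions, the unbounded one being the last.                  *)
Record network (R : realType) := Network {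
  nS : nat;
  nP : nat;
  nN : nat;
  nbnd : nat;
  nv : 'I_nS -> nat;
  isopen : 'I_nS -> bool;
  vert : forall i : 'I_nS, 'I_(nv i) -> 'I_nN;
  vpos : 'cV[R]_(\sum_(j < nN) 2);
  reg : 'I_nbnd.+1 -> set (R * R);
  phase : 'I_nbnd.+1 -> 'I_nP;
  pminus : 'I_nS -> 'I_nP;
  pplus : 'I_nS -> 'I_nP }.

Section Network.
Context {R : realType} (Ga : network R).
Local Notation N := (nN Ga).

(* Index pairs (i, k).  The pair also denotes the edge from vertex [k] to      *)
(* vertex [k + 1] (cyclically) of curve [i], provided [is_edge] holds, i.e.    *)
(* except for the last vertex of an open curve.                               *)
Definition vidx : finType := {i : 'I_(nS Ga) & 'I_(nv i)}.
Definition ix (i : 'I_(nS Ga)) (k : 'I_(nv i)) : vidx :=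
  Tagged (fun i => 'I_(nv i)) k.
Implicit Types a b : vidx.

Definition nxt a : vidx := ix (ordS (tagged a)).
Definition prv a : vidx := ix (ord_pred (tagged a)).
Definition vx a : 'I_N := vert (tagged a).
Definition is_first a : bool := isopen (tag a) && (tagged a == 0%N :> nat).
Definition is_last a : bool :=
  isopen (tag a) && ((tagged a).+1 == nv (tag a)).
Definition is_end a : bool := is_first a || is_last a.
Definition is_edge a : bool := ~~ is_last a.

Definition ell a (Z : 'cV[R]_(\sum_(j < N) 2)) : R * R :=
  pos Z (vx (nxt a)) - pos Z (vx a).
Definition hlen a : R := enorm (ell a (vpos Ga)).
Definition nu a : R * R := - ((hlen a)^-1 *: perp (ell a (vpos Ga))).
Definition epoint a (t : R) : R * R :=
  pos (vpos Ga) (vx a) + t *: ell a (vpos Ga).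
Definition eseg a : set (R * R) := [set epoint a t | t in `[0, 1]].
Definition support_set : set (R * R) :=
  [set x | exists2 a, is_edge a & eseg a x].

Record is_network : Prop := {
  nS_gt0 : (0 < nS Ga)%N;
  nP_gt1 : (1 < nP Ga)%N;
  nv_open : forall i : 'I_(nS Ga), isopen i -> (2 <= nv i)%N;
  nv_closed : forall i : 'I_(nS Ga), ~~ isopen i -> (3 <= nv i)%N;
  vpos_inj : injective (pos (vpos Ga));
  vx_onto : forall j : 'I_N, exists a, vx a = j;
  (* simple curves; distinct curves share at most ends of open curves *)
  vert_inj : forall i, injective (@vert R Ga i);
  vx_shared : forall a b, a <> b -> vx a = vx b -> is_end a /\ is_end b;
  triple_junction : forall a, is_end a ->
    #|[set tag b | b : vidx & is_end b && (vx b == vx a)]%SET| = 3;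
  edges_meet : forall a b x, is_edge a -> is_edge b -> a <> b ->
    eseg a x -> eseg b x ->
    exists j : 'I_N, [/\ x = pos (vpos Ga) j,
      j = vx a \/ j = vx (nxt a) & j = vx b \/ j = vx (nxt b)];
  (* [reg] enumerates the connected components of the complement *)
  reg_component : forall r : 'I_(nbnd Ga).+1,
    exists2 x, (~` support_set) x & reg r = connected_component (~` support_set) x;
  reg_cover : forall x, (~` support_set) x -> exists r, reg (n := Ga) r x;
  reg_inj : injective (@reg R Ga);
  reg_bounded : forall r : 'I_(nbnd Ga).+1, bounded_set (reg (n := Ga) r) <-> r <> ord_max;
  phase_unbounded : phase (n := Ga) ord_max = 0%N :> nat;
  phase_neq : forall i : 'I_(nS Ga), pminus i <> pplus i;
  (* the normal of curve [i] points from phase [pminus i] to [pplus i] *)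
  phase_minus : forall a (s : R), is_edge a -> 0 < s < 1 ->
    \forall t \near 0^'+, exists2 r,
      reg r (epoint a s - t *: nu a) & phase r = pminus (tag a);
  phase_plus : forall a (s : R), is_edge a -> 0 < s < 1 ->
    \forall t \near 0^'+, exists2 r,
      reg r (epoint a s + t *: nu a) & phase r = pplus (tag a) }.

Section Region.
Variable r : 'I_(nbnd Ga).+1.

Definition bedges : {set vidx} :=
  [set a | is_edge a && `[< eseg a `<=` boundary (reg r) >]]%SET.
Definition bverts : {set 'I_N} :=
  [set j | `[< boundary (reg r) (pos (vpos Ga) j) >]]%SET.
Local Notation nY := #|bedges|.
Local Notation nX := #|bverts|.

(* Outward unit normal: [nu a] or [- nu a], whichever points out of the region. *)
Definition nuR a : R * R :=
  if `[< \forall t \near 0^'+, reg r (epoint a 2^-1 - t *: nu a) >]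
  then nu a else - nu a.

(* A function on the boundary of the region is given, edge by edge, in terms of *)
(* the affine parameter [t] of the point [epoint a t], 0 <= t <= 1.            *)
Definition bfun := vidx -> R -> R.
Implicit Types f psi phi : bfun.

Definition bint f : R :=
  \sum_(a in bedges) hlen a * \int[lebesgue_measure]_(t in `[0, 1]) f a t.
Definition bpair f psi : R := bint (fun a t => f a t * psi a t).
Definition trace (u : R * R -> R) : bfun := fun a t => u (epoint a t).

Definition slp psi (x : R * R) : R :=
  bint (fun a t => Gfun (x - epoint a t) * psi a t).
Definition dlp phi (x : R * R) : R :=
  bint (fun a t => 'D_(nuR a) (fun y => Gfun (x - y)) (epoint a t) * phi a t).
(* - d/d nu of the double-layer potential, as a limit taken from the region    *)
(* (the limit from the other side is the same).                               *)
Definition hypersing phi : bfun := fun a t =>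
  - lim ('D_(nuR a) (dlp phi) (epoint a t - e *: nuR a) @[e --> 0^'+]).

Definition chi (i : 'I_nY) : bfun := fun a _ => (a == enum_val i)%:R.
Definition hat (j : 'I_nX) : bfun := fun a t =>
  (1 - t) * (vx a == enum_val j)%:R + t * (vx (nxt a) == enum_val j)%:R.

Definition Vmx : 'M[R]_nY := \matrix_(i, j) bpair (chi i) (trace (slp (chi j))).
Definition Kmx : 'M[R]_(nY, nX) :=
  \matrix_(i, j) bpair (chi i) (trace (dlp (hat j))).
Definition Wmx : 'M[R]_nX := \matrix_(i, j) bpair (hat i) (hypersing (hat j)).
Definition Mmx : 'M[R]_(nY, nX) := \matrix_(i, j) bpair (chi i) (hat j).
Definition Jmx : 'M[R]_(nY, nX) := 2^-1 *: Mmx + Kmx.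
Definition lvec : 'cV[R]_nY := Mmx *m const_mx 1.
(* The map y |-> rho, where V rho + c l = y and l^T rho = 0. *)
Definition Cmx : 'M[R]_nY := ulsubmx (invmx (block_mx Vmx lvec lvec^T 0)).

Definition Smx : 'M[R]_nX :=
  Wmx + Jmx^T *m (if r == ord_max then Cmx else invmx Vmx) *m Jmx.
Definition Pmx : 'M[R]_(nX, N) := \matrix_(i, j) (enum_val i == j)%:R.

End Region.

Definition Lambda : 'M[R]_N := \sum_r (Pmx r)^T *m Smx r *m Pmx r.

(* Kronecker product of the identity of size I_P with Lambda; [W] is stacked   *)
(* phase by phase, see [submxcol_ILambda].                                    *)
Definition ILambda : 'M[R]_(\sum_(p < nP Ga) N) := \mxdiag_(p < nP Ga) Lambda.

(* Vectors indexed by pairs (i, k) are stacked curve by curve.                *)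
Definition incid (p : 'I_(nP Ga)) (i : 'I_(nS Ga)) : R :=
  (p == pplus i)%:R - (p == pminus i)%:R.
Definition Dh : 'M[R]_(\sum_(p < nP Ga) N, \sum_(i < nS Ga) nv i) :=
  \mxblock_(p < nP Ga, i < nS Ga)
    \matrix_(j < N, k < nv i) (incid p i * (vx (ix k) == j)%:R).

Definition mass a : R :=
  if is_first a then hlen a / 2
  else if is_last a then hlen (prv a) / 2
  else (hlen (prv a) + hlen a) / 2.
Definition Mv : 'M[R]_(\sum_(i < nS Ga) nv i) :=
  \mxdiag_(i < nS Ga) diag_mx (\row_(k < nv i) mass (ix k)).

Definition omega a : R * R :=
  if is_first a then nu a
  else if is_last a then nu (prv a)
  else (hlen (prv a) + hlen a)^-1 *:
         (hlen (prv a) *: nu (prv a) + hlen a *: nu a).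
Definition Bn : 'M[R]_(\sum_(i < nS Ga) nv i, \sum_(j < N) 2) :=
  \mxblock_(i < nS Ga, j < N)
    \matrix_(k < nv i, c < 2) ((vx (ix k) == j)%:R * crd c (omega (ix k))).

End Network.

Record anisotropy (R : realType) (n : nat) := Anisotropy {
  cw : 'I_n -> R;
  nL : 'I_n -> nat;
  Gmx : forall i : 'I_n, 'I_(nL i) -> 'M[R]_2 }.

Definition is_anisotropy (R : realType) (n : nat) (g : anisotropy R n) : Prop :=
  [/\ forall i : 'I_n, 0 < cw g i, forall i : 'I_n, (0 < nL g i)%N &
      forall (i : 'I_n) (l : 'I_(nL g i)), spd (Gmx l)].

Section Anisotropy.
Context {R : realType} (Ga : network R) (g : anisotropy R (nS Ga)).
Local Notation N := (nN Ga).
Local Notation npos := 'cV[R]_(\sum_(j < N) 2).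

Definition Gt (i : 'I_(nS Ga)) (l : 'I_(nL g i)) : 'M[R]_2 :=
  rotmx^T *m Gmx l *m rotmx.
Definition gtform i (l : 'I_(nL g i)) (p q : R * R) : R :=
  ((colv p)^T *m Gt l *m colv q) ord0 ord0.
Definition sdens i (l : 'I_(nL g i)) (q : R * R) : R := Num.sqrt (gtform l q q).

Definition Eh (Z : npos) : R :=
  \sum_i cw g i * \sum_(k < nv i | is_edge (ix k)) \sum_(l < nL g i)
    sdens l (ell (ix k) Z).

Definition Aform (eta Z : npos) : R :=
  \sum_i cw g i * \sum_(k < nv i | is_edge (ix k)) \sum_(l < nL g i)
    gtform l (ell (ix k) Z) (ell (ix k) eta) / sdens l (ell (ix k) (vpos Ga)).
(* The matrix of the bilinear form [Aform]; see [AgammaE]. *)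
Definition Agamma : 'M[R]_(\sum_(j < N) 2) :=
  \matrix_(a, b) Aform (delta_mx a ord0) (delta_mx b ord0).

Definition nondegenerate_network : Prop :=
  forall i (k : 'I_(nv i)) (l : 'I_(nL g i)),
    is_edge (ix k) -> 0 < sdens l (ell (ix k) (vpos Ga)).

Lemma AgammaE (eta Z : npos) :
  (eta^T *m Agamma *m Z) ord0 ord0 = Aform eta Z.
Proof.
have posD (a b : npos) c j : pos (c *: a + b) j = c *: pos a j + pos b j.
  by rewrite /pos /submxcol !mxE.
have ellD e (a b : npos) c : ell e (c *: a + b) = c *: ell e a + ell e b.
  by rewrite /ell !posD scalerBr opprD addrACA.
have colD c p q : colv (c *: p + q) = c *: colv p + colv q :> 'cV[R]_2.
  by apply/matrixP => i j; rewrite !mxE /crd; case: ifP.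
have Dl c a b z : Aform (c *: a + b) z = c * Aform a z + Aform b z.
  rewrite /Aform mulr_sumr -big_split /=; apply: eq_bigr => i _.
  rewrite mulrCA -mulrDr; congr (_ * _).
  rewrite mulr_sumr -big_split /=; apply: eq_bigr => k _.
  rewrite mulr_sumr -big_split /=; apply: eq_bigr => l _.
  rewrite mulrA -mulrDl; congr (_ / _).
  by rewrite /gtform ellD colD mulmxDr -scalemxAr !mxE.
have Dr c a b z : Aform z (c *: a + b) = c * Aform z a + Aform z b.
  rewrite /Aform mulr_sumr -big_split /=; apply: eq_bigr => i _.
  rewrite mulrCA -mulrDr; congr (_ * _).
  rewrite mulr_sumr -big_split /=; apply: eq_bigr => k _.
  rewrite mulr_sumr -big_split /=; apply: eq_bigr => l _.
  rewrite mulrA -mulrDl; congr (_ / _).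
  by rewrite /gtform ellD colD linearP /= !mulmxDl -!scalemxAl !mxE.
have A0l z : Aform 0 z = 0.
  by have := Dl 1 0 0 z; rewrite scaler0 addr0 mul1r => /esym/eqP; rewrite -subr_eq0 addrK => /eqP.
have A0r z : Aform z 0 = 0.
  by have := Dr 1 0 0 z; rewrite scaler0 addr0 mul1r => /esym/eqP; rewrite -subr_eq0 addrK => /eqP.
have Sl (I : finType) (u : I -> R) (v : I -> npos) z :
    Aform (\sum_a u a *: v a) z = \sum_a u a * Aform (v a) z.
  by elim/big_rec2: _ => [|a y x _ <-]; rewrite ?A0l ?Dl.
have Sr (I : finType) (u : I -> R) (v : I -> npos) z :
    Aform z (\sum_a u a *: v a) = \sum_a u a * Aform z (v a).
  by elim/big_rec2: _ => [|a y x _ <-]; rewrite ?A0r ?Dr.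
have dec (z : npos) : z = \sum_a z a ord0 *: delta_mx a ord0.
  by rewrite [LHS]matrix_sum_delta; apply: eq_bigr => a _; rewrite big_ord1.
rewrite {2}(dec Z) Sr mxE; apply: eq_bigr => b _.
rewrite mulrC; congr (_ * _).
rewrite {2}(dec eta) Sl mxE; apply: eq_bigr => a _.
by rewrite !mxE.
Qed.

Lemma BnE (Z : npos) (i : 'I_(nS Ga)) (k : 'I_(nv i)) :
  (submxcol (Bn Ga *m Z) i : 'cV[R]_(nv i)) k ord0 =
  dot (pos Z (vx (ix k))) (omega (ix k)).
Proof.
rewrite -[Z in LHS]submxcolK mul_mxblock_mxrow mxcolK summxE.
rewrite (bigD1 (vx (ix k))) //= big1 => [|j /negPf jk].
  rewrite addr0 mxE !big_ord_recl big_ord0 addr0 !mxE eqxx !mul1r /crd /=.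
  rewrite /dot /pos /submxcol !mxE /=.
  have -> : lift ord0 ord0 = ord_max :> 'I_2 by apply: val_inj.
  by congr (_ + _); rewrite mulrC.
by rewrite !mxE big1 // => c _; rewrite !mxE eq_sym jk !mul0r.
Qed.

Lemma tr_DhE (W : 'cV[R]_(\sum_(p < nP Ga) N)) (i : 'I_(nS Ga)) (k : 'I_(nv i)) :
  (submxcol ((Dh Ga)^T *m W) i : 'cV[R]_(nv i)) k ord0 =
  \sum_p incid p i * (submxcol W p : 'cV[R]_N) (vx (ix k)) ord0.
Proof.
rewrite -[W in LHS]submxcolK tr_mxblock mul_mxblock_mxrow mxcolK summxE.
apply: eq_bigr => p _; rewrite !mxE (bigD1 (vx (ix k))) //= big1 ?addr0.
  by rewrite !mxE eqxx mulr1.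
by move=> j /negPf jk; rewrite !mxE eq_sym jk mulr0 mul0r.
Qed.

Lemma submxcol_ILambda (W : 'cV[R]_(\sum_(p < nP Ga) N)) (p : 'I_(nP Ga)) :
  submxcol (ILambda Ga *m W) p = Lambda Ga *m (submxcol W p : 'cV[R]_N).
Proof. by rewrite -[W in LHS]submxcolK mul_mxdiag_mxcol mxcolK. Qed.

End Anisotropy.

(* Main.v *)
Require Import Defs.
From HB Require Import structures.
From mathcomp Require Import all_boot all_order all_algebra.
From mathcomp Require Import all_classical all_reals all_analysis.
From mathcomp Require Import measurable_realfun ring lra.
Import Order.TTheory GRing.Theory Num.Theory.
Import numFieldNormedType.Exports.
Set Implicit Arguments.
Unset Strict Implicit.
Unset Printing Implicit Defensive.
Local Open Scope classical_set_scope.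
Local Open Scope ring_scope.

(* Testing the equations with [W], [kappa] and [X - X^m] gives
     dt * sum_p W_p^T Lambda W_p = - (X - X^m)^T A X,
   and the first inequality follows by summing [s(p) <= s(q) + p^T G (p - q) / s(q)] over
   the edges.  The second one needs [Lambda], hence every [S_r], to be positive
   semidefinite.

   [J] plays no role there: [J^T V^-1 J] and [J^T C J] are semidefinite as soon as [V] is,
   on all densities for a bounded region, and strictly on densities of mean zero for the
   unbounded one.  For [W], Maue's formula expresses the quadratic form as the logarithmic
   energy of the edgewise constant density obtained by differentiating along the boundary.
   It requires, at every vertex, that as many boundary edges of the region leave as enter,
   for the orientation given by the outward normal.  The boundary density has mean zero for
   the same reason.

   Energy of mean zero densities is nonnegative: on a ball and with a regularization
   [eps], [|x - y|^2 + eps] is a product of functions of one variable times [1 - k], with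
   [k] positive semidefinite and [|k| < 1], and [- ln (1 - k)] is a power series in [k] with
   nonnegative coefficients.  If the capacity is less than one, a near-minimizer [p] among
   probability densities has, by the maximum principle, a potential that is almost bounded
   by its positive energy; comparing a density of mass one with [p] then shows that its
   energy is nonnegative as well. *)

(** * Logarithmic kernel in the plane *)

(** The analysis is done for an abstract finite measure whose discs of radius [r] have mass at most
    [A * r], as for arc length on finitely many segments. This growth controls every integral: near
    the diagonal the logarithm is dominated by [|x - y| ^ (- 1 / 2)], whose integral is bounded
    uniformly in [x]. Potentials are then continuous, points are null sets, and the value [ln 0 = 0]
    on the diagonal is harmless. A minimizer of the energy need not have a bounded density;
    near-minimizers replace it, so that no weak compactness of measures enters. [Wmx] is built from
    one-sided limits of normal derivatives, so its form as an energy has to be derived in spite of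
    singularities at every vertex. The boundary of a region is not parametrized by closed polygons:
    the balance of edges at each vertex takes the place of closedness. Strictness for mean zero is
    forced by [invmx], which returns a singular matrix unchanged. For [V] this default preserves
    semidefiniteness, but for the bordered matrix behind [Cmx] it would leave [V] itself in the
    corner, so that matrix must be shown invertible. *)

Section PlaneNorm.
Context {R : realType}.
Implicit Types x y z : R * R.

Lemma dotC x y : dot x y = dot y x.
Proof. by rewrite /dot mulrC [x.2 * _]mulrC. Qed.

Lemma dotDl x y z : dot (x + y) z = dot x z + dot y z.
Proof. by rewrite /dot /=; ring. Qed.

Lemma dotDr x y z : dot x (y + z) = dot x y + dot x z.
Proof. by rewrite /dot /=; ring. Qed.

Lemma dotZl (c : R) x y : dot (c *: x) y = c * dot x y.
Proof. by rewrite /dot /= /GRing.scale /=; ring. Qed.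

Lemma dotZr (c : R) x y : dot x (c *: y) = c * dot x y.
Proof. by rewrite /dot /= /GRing.scale /=; ring. Qed.

Lemma dotNl x y : dot (- x) y = - dot x y.
Proof. by rewrite /dot /=; ring. Qed.

Lemma dotNr x y : dot x (- y) = - dot x y.
Proof. by rewrite /dot /=; ring. Qed.

Definition dotE := (dotDl, dotDr, dotZl, dotZr, dotNl, dotNr).

Lemma dot_ge0 x : 0 <= dot x x.
Proof. by rewrite /dot -!expr2 addr_ge0 // sqr_ge0. Qed.

Lemma dot_eq0 x : (dot x x == 0) = (x == 0).
Proof.
rewrite /dot -!expr2 paddr_eq0 ?sqr_ge0 // !sqrf_eq0.
by case: x => a b; rewrite /= xpair_eqE.
Qed.

Lemma dot_gt0 x : (0 < dot x x) = (x != 0).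
Proof. by rewrite lt_def dot_ge0 andbT dot_eq0. Qed.

Lemma enorm_ge0 x : 0 <= enorm x. Proof. exact: sqrtr_ge0. Qed.

Lemma sqr_enorm x : enorm x ^+ 2 = dot x x.
Proof. by rewrite /enorm sqr_sqrtr // dot_ge0. Qed.

Lemma enorm_gt0 x : (0 < enorm x) = (x != 0).
Proof. by rewrite /enorm sqrtr_gt0 dot_gt0. Qed.

Lemma enorm_eq0 x : (enorm x == 0) = (x == 0).
Proof. by rewrite -sqrf_eq0 sqr_enorm dot_eq0. Qed.

Lemma enorm0 : enorm (0 : R * R) = 0.
Proof. by apply/eqP; rewrite enorm_eq0. Qed.

Lemma enormN x : enorm (- x) = enorm x.
Proof. by rewrite /enorm dotNl dotNr opprK. Qed.

Lemma enormB x y : enorm (x - y) = enorm (y - x).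
Proof. by rewrite -enormN opprB. Qed.

Lemma enormZ (c : R) x : enorm (c *: x) = `|c| * enorm x.
Proof.
by rewrite /enorm dotZl dotZr mulrA -expr2 sqrtrM ?sqr_ge0 // sqrtr_sqr.
Qed.

Lemma cauchy_schwarz x y : dot x y ^+ 2 <= dot x x * dot y y.
Proof.
rewrite -subr_ge0.
suff -> : dot x x * dot y y - dot x y ^+ 2 = (x.1 * y.2 - x.2 * y.1) ^+ 2.
  exact: sqr_ge0.
by rewrite /dot; ring.
Qed.

Lemma ler_dot x y : `|dot x y| <= enorm x * enorm y.
Proof.
rewrite -ler_sqr ?nnegrE ?mulr_ge0 ?enorm_ge0 //.
by rewrite real_normK ?num_real // exprMn !sqr_enorm cauchy_schwarz.
Qed.

Lemma ler_enormD x y : enorm (x + y) <= enorm x + enorm y.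
Proof.
rewrite -ler_sqr ?nnegrE ?addr_ge0 ?enorm_ge0 //.
rewrite sqrrD !sqr_enorm !dotDl !dotDr (dotC y x).
have := ler_dot x y; rewrite ler_norml => /andP[_]; lra.
Qed.

Lemma ler_enormB x y : `|enorm x - enorm y| <= enorm (x - y).
Proof.
rewrite ler_norml; have := ler_enormD (x - y) y; rewrite subrK => h1.
have := ler_enormD (y - x) x; rewrite subrK enormB => h2.
by apply/andP; split; lra.
Qed.

Lemma ler_norm_enorm x : `|x| <= enorm x.
Proof.
rewrite prod_normE ge_max /enorm /dot -!sqrtr_sqr !ler_sqrt; last 2 first.
- by rewrite addr_ge0 // -expr2 sqr_ge0.
- by rewrite addr_ge0 // -expr2 sqr_ge0.
by rewrite !expr2 lerDl lerDr -!expr2 !sqr_ge0.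
Qed.

Lemma ler_enorm_norm x : enorm x <= 2 * `|x|.
Proof.
have h1 : `|x.1| <= `|x| by rewrite prod_normE le_max lexx.
have h2 : `|x.2| <= `|x| by rewrite prod_normE le_max lexx orbT.
rewrite -ler_sqr ?nnegrE ?mulr_ge0 ?enorm_ge0 //.
rewrite sqr_enorm /dot exprMn -!expr2 -(real_normK (num_real x.1)).
rewrite -(real_normK (num_real x.2)).
have e1 : `|x.1| ^+ 2 <= `|x| ^+ 2 by rewrite ler_sqr ?nnegrE.
have e2 : `|x.2| ^+ 2 <= `|x| ^+ 2 by rewrite ler_sqr ?nnegrE.
have : 0 <= `|x| ^+ 2 by exact: sqr_ge0.
lra.
Qed.

Lemma continuous_enorm : continuous (@enorm R).
Proof.
move=> x; apply/cvgrPdist_lt => e e0.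
near=> y.
apply: le_lt_trans (ler_enormB _ _) _.
apply: le_lt_trans (ler_enorm_norm _) _.
rewrite -ltr_pdivlMl //.
by near: y; apply: cvgr_dist_lt; rewrite // mulr_gt0 // invr_gt0.
Unshelve. all: by end_near. Qed.

(** Neighbourhoods come from the sup norm of the product; the two norms differ by a factor of at
    most 2, hence the radius [e / 2]. *)
Lemma nbhs_enorm x (P : set (R * R)) :
  nbhs x P <-> exists2 e : R, 0 < e & forall y, enorm (x - y) < e -> P y.
Proof.
split=> [|[e e0 eP]].
  move=> /nbhs_ballP[e /= e0 eP]; exists e => // y xy; apply: eP.
  by rewrite -ball_normE /=; apply: le_lt_trans (ler_norm_enorm _) xy.
apply/nbhs_ballP; exists (e / 2) => /=; first by rewrite divr_gt0.
move=> y; rewrite -ball_normE /= => xy; apply: eP.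
apply: le_lt_trans (ler_enorm_norm _) _.
by rewrite mulrC -ltr_pdivlMr.
Qed.

Lemma measurable_dot d (T : measurableType d) (f g : T -> R * R) :
  measurable_fun setT f -> measurable_fun setT g ->
  measurable_fun setT (fun t => dot (f t) (g t)).
Proof.
move=> mf mg; rewrite /dot.
by apply: measurable_funD; apply: measurable_funM;
  [exact: (measurableT_comp measurable_fst)|
   exact: (measurableT_comp measurable_fst)|
   exact: (measurableT_comp measurable_snd)|
   exact: (measurableT_comp measurable_snd)].
Qed.

Lemma measurable_enorm d (T : measurableType d) (f : T -> R * R) :
  measurable_fun setT f -> measurable_fun setT (fun t => enorm (f t)).
Proof.
move=> mf; rewrite /enorm.
apply: (@measurableT_comp _ _ _ _ _ _ (@Num.sqrt R)).
  by apply: continuous_measurable_fun; exact: sqrt_continuous.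
exact: measurable_dot.
Qed.

Lemma measurable_subp d (T : measurableType d) (f g : T -> R * R) :
  measurable_fun setT f -> measurable_fun setT g ->
  measurable_fun setT (fun t => f t - g t).
Proof.
move=> mf mg.
have -> : (fun t => f t - g t) = (fun t => ((f t).1 - (g t).1, (f t).2 - (g t).2)).
  by apply/funext => t; case: (f t) => a b; case: (g t).
apply/measurable_fun_pairP; split; rewrite /comp /=; apply: measurable_funB;
  [exact: (measurableT_comp measurable_fst)|
   exact: (measurableT_comp measurable_fst)|
   exact: (measurableT_comp measurable_snd)|
   exact: (measurableT_comp measurable_snd)].
Qed.

End PlaneNorm.

(** * Borel sets of the plane *)

Section PlaneMeasurable.
Context {R : realType}.

(** The measurable structure of the plane is the product one; an open set is a union of countably
    many rational boxes. *)
Lemma open_measurable_plane (A : set (R * R)) : open A -> measurable A.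
Proof.
move=> oA.
pose box (q : rat * rat * (rat * rat)) : set (R * R) :=
  `]ratr q.1.1, ratr q.1.2[ `*` `]ratr q.2.1, ratr q.2.2[.
have -> : A = \bigcup_(q in [set q | box q `<=` A]) box q.
  apply/seteqP; split=> [[x y] Axy|]; last by move=> x [q]; apply.
  have : nbhs (x, y) A by move: oA; rewrite openE; apply.
  case=> -[/= U V] [/= Ux Vy] UVA.
  have [e e0 eU] : exists2 e : R, 0 < e & ball x e `<=` U by exact/nbhs_ballP.
  have [d d0 dV] : exists2 d : R, 0 < d & ball y d `<=` V by exact/nbhs_ballP.
  have [x1 x2 y1 y2] : [/\ x - e < x, x < x + e, y - d < y & y < y + d].
    by rewrite !ltrBlDr !ltrDl.
  have [a ha] := rat_in_itvoo x1; have [b hb] := rat_in_itvoo x2.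
  have [a' ha'] := rat_in_itvoo y1; have [b' hb'] := rat_in_itvoo y2.
  move: ha hb ha' hb'; rewrite !in_itv /=.
  move=> /andP[a1 a2] /andP[b1 b2] /andP[c1 c2] /andP[d1 d2].
  exists (a, b, (a', b')); last first.
    by split => /=; rewrite in_itv /=; apply/andP.
  move=> [u v] [/=]; rewrite !in_itv /= => /andP[u1 u2] /andP[v1 v2].
  apply: UVA; split => /=.
    by apply: eU; rewrite /ball /= ltr_distl; lra.
  by apply: dV; rewrite /ball /= ltr_distl; lra.
rewrite bigcup_mkcond; apply: countable_bigcupT_measurable => [|q].
  exact: countableP.
by case: ifP => // _; exact: measurableX.
Qed.

Lemma closed_measurable_plane (A : set (R * R)) : closed A -> measurable A.
Proof.
move=> cA; rewrite -(setCK A); apply: measurableC.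
by apply: open_measurable_plane; exact: closed_openC.
Qed.

Lemma continuous_measurable_plane (f : R * R -> R) :
  continuous f -> measurable_fun setT f.
Proof.
move=> cf; apply: (measurability _ (RGenOpens.measurableE R)) => _ [_ [a [b ->] <-]].
rewrite setTI; apply: open_measurable_plane.
by apply: open_comp => // x _; exact: cf.
Qed.

End PlaneMeasurable.

(** * Estimates for the logarithmic kernel and its regularization *)

Section KernelBounds.
Context {R : realType}.
Implicit Types x y : R * R.

(** Majorant of the logarithm near the diagonal. Measures of linear growth integrate
    [|x - y| ^ (- s)] for every [s < 1]; the exponent [1 / 2] also allows [kq_int_bound] to split a
    singularity of order one evenly. On the diagonal the value is 0. *)
Definition rootker x y : R := (Num.sqrt (enorm (x - y)))^-1.
Definition logker x y : R := - ln (enorm (x - y)).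
(* The fourth power makes the distance to [logker] at most [2 * c * rootker]. *)
Definition regker (c : R) x y : R := - (2^-1 * ln (dot (x - y) (x - y) + c ^+ 4)).

Lemma rootker_ge0 x y : 0 <= rootker x y.
Proof. by rewrite invr_ge0 sqrtr_ge0. Qed.

Lemma logkerC x y : logker x y = logker y x.
Proof. by rewrite /logker enormB. Qed.

Lemma ln_sqrt (a : R) : 0 <= a -> ln (Num.sqrt a) = 2^-1 * ln a.
Proof.
rewrite le_eqVlt => /predU1P[<-|a0]; first by rewrite sqrtr0 ln0 // mulr0.
have s0 : 0 < Num.sqrt a by rewrite sqrtr_gt0.
have : ln a = ln (Num.sqrt a ^+ 2) by rewrite sqr_sqrtr // ltW.
by rewrite lnXn // mulr2n => ->; lra.
Qed.

Lemma logkerE x y : logker x y = - (2^-1 * ln (dot (x - y) (x - y))).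
Proof. by rewrite /logker /enorm ln_sqrt // dot_ge0. Qed.

(** [ln t <= t] is applied to the distance and to the inverse of its square root. *)
Lemma norm_logker_le x y : `|logker x y| <= 2 * rootker x y + enorm (x - y).
Proof.
rewrite /logker /rootker; have := enorm_ge0 (x - y).
set d := enorm _; rewrite le_eqVlt => /predU1P[<-|d0].
  by rewrite ln0 // sqrtr0 invr0 oppr0 normr0; lra.
have s0 : 0 < Num.sqrt d by rewrite sqrtr_gt0.
have h1 : ln d <= d by rewrite ltW // ln_sublinear.
have h2 : - (2^-1 * ln d) < (Num.sqrt d)^-1.
  by rewrite -ln_sqrt ?ltW // -lnV ?posrE // ln_sublinear // invr_gt0.
have j0 : 0 < (Num.sqrt d)^-1 by rewrite invr_gt0.
rewrite normrN ler_norml; apply/andP; split; lra.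
Qed.

(** With [w = c / sqrt d] the difference is [ln (1 + w ^ 4) / 2], and [1 + w ^ 4 <= (1 + w) ^ 4]
    makes it at most [2 * w]. *)
Lemma logker_regker_le (c : R) x y : 0 < c -> x != y ->
  `|logker x y - regker c x y| <= 2 * c * rootker x y.
Proof.
move=> c0 xy; have d0 : 0 < enorm (x - y) by rewrite enorm_gt0 subr_eq0.
rewrite /logker /regker /rootker -sqr_enorm; set d := enorm _ in d0 *.
have s0 : 0 < Num.sqrt d by rewrite sqrtr_gt0.
pose z := c ^+ 2 / d.
have z0 : 0 < z by rewrite divr_gt0 ?exprn_gt0.
have -> : d ^+ 2 + c ^+ 4 = d ^+ 2 * (1 + z ^+ 2).
  by rewrite /z; field; rewrite gt_eqF.
have zz : 0 < 1 + z ^+ 2 by rewrite addr_gt0 ?exprn_gt0.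
rewrite lnM ?posrE ?exprn_gt0 // lnXn // mulr2n.
have -> : - ln d - - (2^-1 * (ln d + ln d + ln (1 + z ^+ 2))) =
          2^-1 * ln (1 + z ^+ 2) by field.
have l0 : 0 <= ln (1 + z ^+ 2) by rewrite ln_ge0 // lerDl sqr_ge0.
rewrite ger0_norm ?mulr_ge0 //.
pose w := c / Num.sqrt d.
have w0 : 0 < w by rewrite divr_gt0.
have zw : z = w ^+ 2 by rewrite /z /w expr_div_n sqr_sqrtr // ltW.
have w4 : 1 + z ^+ 2 <= (1 + w) ^+ 4.
  rewrite zw; have w2 : 0 <= w ^+ 2 by rewrite sqr_ge0.
  have w3 : 0 <= w ^+ 3 by rewrite exprn_ge0 // ltW.
  have -> : (1 + w) ^+ 4 = 1 + (w ^+ 2) ^+ 2 + 4 * w + 6 * w ^+ 2 + 4 * w ^+ 3 by ring.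
  lra.
have : ln (1 + z ^+ 2) <= ln ((1 + w) ^+ 4).
  by rewrite ler_ln // posrE ?exprn_gt0 // addr_gt0.
rewrite lnXn ?addr_gt0 // => h.
have h1 : ln (1 + w) <= w by apply: le_ln1Dx; lra.
move: h; rewrite -mulr_natl /w -mulrA; move: h1; rewrite /w.
lra.
Qed.

(** Where [4 ^ - (k + 1) <= |x - y| < 4 ^ - k], the kernel is at most [2 ^ (k + 1)]; the summand 1
    covers distances of at least 1. *)
Lemma rootker_le_series x y :
  ((rootker x y)%:E <= 1 + \sum_(0 <= k <oo)
     (2 ^+ k.+1 * \1_[set z | enorm (x - z) < 4^-1 ^+ k]%R y)%:E)%E.
Proof.
rewrite /rootker; have := enorm_ge0 (x - y); move: {-2}(enorm _) (erefl (enorm (x - y))).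
move=> d dE dge0; have ser0 k : (0 <= (2 ^+ k.+1 * \1_[set z | enorm (x - z) < 4^-1 ^+ k]%R y)%:E :> \bar R)%E.
  by rewrite lee_fin mulr_ge0 ?exprn_ge0 // indicE.
have [d1|d1] := leP 1 d.
  rewrite (@le_trans _ _ 1%E) //.
    rewrite lee_fin invf_le1 ?sqrtr_gt0 ?(lt_le_trans ltr01) //.
    by rewrite -[leLHS]sqrtr1 ler_sqrt.
  by rewrite leeDl // nneseries_ge0.
have [d0|d0] := leP d 0.
  have -> : d = 0 by apply/eqP; rewrite eq_le d0.
  by rewrite sqrtr0 invr0 adde_ge0 // nneseries_ge0.
have ex : exists k, 4^-1 ^+ k.+1 <= d.
  have : (fun k => 4^-1 ^+ k : R) @ \oo --> 0.
    by apply: cvg_expr; rewrite ger0_norm; lra.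
  move/cvgrPdist_lt => /(_ _ d0)[N _ /(_ N.+1 (leqnSn _))].
  rewrite sub0r normrN ger0_norm ?exprn_ge0 ?invr_ge0 //.
  by move=> /ltW ?; exists N.
case: (ex_minnP ex) => k kd kmin.
have dk : d < 4^-1 ^+ k.
  case: k kd kmin => [|k] kd kmin; first by rewrite expr0.
  by rewrite ltNge; apply/negP => /kmin; rewrite ltnn.
apply: (@le_trans _ _ (2 ^+ k.+1 * \1_[set z | enorm (x - z) < 4^-1 ^+ k]%R y)%:E).
  rewrite indicE mem_set /=; last by rewrite -dE.
  rewrite mulr1 lee_fin.
  have -> : 2 ^+ k.+1 = (2^-1 ^+ k.+1)^-1 :> R by rewrite exprVn invrK.
  rewrite lef_pV2 ?posrE ?sqrtr_gt0 ?exprn_gt0 ?invr_gt0 //.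
  rewrite -(@ler_sqr R) ?nnegrE ?sqrtr_ge0 ?exprn_ge0 ?invr_ge0 //.
  rewrite sqr_sqrtr ?(ltW d0) // -exprM mulnC exprM; apply: le_trans kd.
  by rewrite (_ : 2^-1 ^+ 2 = 4^-1) // expr2; field.
apply: (@le_trans _ _ (\sum_(0 <= k <oo)
     (2 ^+ k.+1 * \1_[set z | enorm (x - z) < 4^-1 ^+ k]%R y)%:E)%E).
  rewrite (@nneseriesD1 _ _ k) //.
  by rewrite leeDl // nneseries_ge0.
by rewrite leeDr.
Qed.

End KernelBounds.

(** * Potentials of regular measures *)

Lemma measurable_invr (R : realType) : measurable_fun setT (@GRing.inv R).
Proof.
rewrite (_ : setT = ~` [set 0] `|` [set 0 : R]); last by rewrite setUC setUv.
have m0 : measurable [set 0 : R] by [].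
apply/(measurable_funU _ (measurableC m0) m0); split; last exact: measurable_fun_set1.
apply: open_continuous_measurable_fun.
  by have := @open_neq R 0; congr open; apply/seteqP; split=> x /eqP.
by move=> x; rewrite inE /= => /eqP x0; exact: inv_continuous.
Qed.

Lemma ltr_distl3 (R : realDomainType) (p q u v a b e : R) : `|p - u| <= a ->
  `|q - v| <= a -> `|u - v| <= b -> a + b + a < e -> `|p - q| < e.
Proof.
rewrite !ler_norml ltr_norml => /andP[u1 u2] /andP[u3 u4] /andP[u5 u6] u7.
by apply/andP; split; lra.
Qed.

Section MeasurableKernels.
Context {R : realType} d (T : measurableType d).
Variables f g : T -> R * R.
Hypotheses (mf : measurable_fun setT f) (mg : measurable_fun setT g).

Lemma measurable_enormB : measurable_fun setT (fun t => enorm (f t - g t)).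
Proof. by apply: measurable_enorm; exact: measurable_subp. Qed.

Lemma measurable_rootker : measurable_fun setT (fun t => rootker (f t) (g t)).
Proof.
rewrite /rootker; apply: (@measurableT_comp _ _ _ _ _ _ (@GRing.inv R)).
  exact: measurable_invr.
apply: (@measurableT_comp _ _ _ _ _ _ (@Num.sqrt R)).
  by apply: continuous_measurable_fun; exact: sqrt_continuous.
exact: measurable_enormB.
Qed.

Lemma measurable_logker : measurable_fun setT (fun t => logker (f t) (g t)).
Proof.
rewrite /logker; apply: measurable_funN.
apply: (@measurableT_comp _ _ _ _ _ _ (@ln R)); first exact: measurable_ln.
exact: measurable_enormB.
Qed.

Lemma measurable_regker c : measurable_fun setT (fun t => regker c (f t) (g t)).
Proof.
rewrite /regker; apply: measurable_funN; apply: measurable_funM; first exact: measurable_cst.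
apply: (@measurableT_comp _ _ _ _ _ _ (@ln R)); first exact: measurable_ln.
apply: measurable_funD; last exact: measurable_cst.
by apply: measurable_dot; exact: measurable_subp.
Qed.

End MeasurableKernels.

Section MeasurableKernels1.
Context {R : realType} (x : R * R).

Lemma measurable_enormB1 : measurable_fun setT (fun y : R * R => enorm (x - y)).
Proof. by apply: measurable_enormB; [exact: measurable_cst|exact: measurable_id]. Qed.

Lemma measurable_rootker1 : measurable_fun setT (rootker x).
Proof. by apply: measurable_rootker; [exact: measurable_cst|exact: measurable_id]. Qed.

Lemma measurable_logker1 : measurable_fun setT (logker x).
Proof. by apply: measurable_logker; [exact: measurable_cst|exact: measurable_id]. Qed.

Lemma measurable_regker1 c : measurable_fun setT (regker c x).
Proof. by apply: measurable_regker; [exact: measurable_cst|exact: measurable_id]. Qed.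

End MeasurableKernels1.

(** The two logarithms are compared through the ratio of their arguments, which is bounded
    independently of [y]; then [ln (1 + t) <= t]. *)
Lemma regker_lipschitz (R : realType) (c : R) (x x' y : R * R) : 0 < c ->
  `|regker c x y - regker c x' y| <=
  enorm (x - x') / c ^+ 2 + enorm (x - x') ^+ 2 / c ^+ 4.
Proof.
move=> c0; have c2 : 0 < c ^+ 2 by rewrite exprn_gt0.
have c4 : 0 < c ^+ 4 by rewrite exprn_gt0.
suff one z z' : regker c z y - regker c z' y <=
    enorm (z - z') / c ^+ 2 + enorm (z - z') ^+ 2 / c ^+ 4.
  rewrite ler_norml one andbT -lerNl opprB.
  by have := one x' x; rewrite enormB.
rewrite /regker -!sqr_enorm.
set a := enorm (z - y); set b := enorm (z' - y); set e := enorm (z - z').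
have a0 : 0 <= a by exact: enorm_ge0.
have b0 : 0 <= b by exact: enorm_ge0.
have e0 : 0 <= e by exact: enorm_ge0.
have be : b <= a + e.
  have := ler_enormD (z' - z) (z - y).
  by rewrite addrA subrK [leRHS]addrC -(enormB z z').
have a2 : 0 < a ^+ 2 + c ^+ 4 by rewrite ltr_wpDl ?sqr_ge0.
have b2 : 0 < b ^+ 2 + c ^+ 4 by rewrite ltr_wpDl ?sqr_ge0.
have le1 : ln (b ^+ 2 + c ^+ 4) <= ln ((a ^+ 2 + c ^+ 4) * (1 + e / c ^+ 2 + e ^+ 2 / c ^+ 4)).
  have q1 : 0 <= e / c ^+ 2 by rewrite divr_ge0 // ltW.
  have q2 : 0 <= e ^+ 2 / c ^+ 4 by rewrite divr_ge0 ?sqr_ge0 // ltW.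
  rewrite ler_ln ?posrE ?mulr_gt0 //; last by lra.
  have : b ^+ 2 <= (a + e) ^+ 2 by rewrite ler_sqr ?nnegrE ?addr_ge0.
  (* The square [(a / c - c) ^+ 2] is the arithmetic-geometric mean inequality that absorbs the
     cross term [2 * a * e] of [(a + e) ^+ 2]. *)
  have -> : (a ^+ 2 + c ^+ 4) * (1 + e / c ^+ 2 + e ^+ 2 / c ^+ 4) =
     a ^+ 2 + c ^+ 4 + e * (a / c - c) ^+ 2 + 2 * a * e + a ^+ 2 * (e ^+ 2 / c ^+ 4) + e ^+ 2.
    by field; rewrite gt_eqF.
  have h1 : 0 <= e * (a / c - c) ^+ 2 by rewrite mulr_ge0 ?sqr_ge0.
  have h2 : 0 <= a ^+ 2 * (e ^+ 2 / c ^+ 4) by rewrite mulr_ge0 ?sqr_ge0.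
  rewrite sqrrD -mulr_natl; lra.
have q : 0 <= e / c ^+ 2 + e ^+ 2 / c ^+ 4.
  by rewrite addr_ge0 // divr_ge0 ?sqr_ge0 // ltW.
move: le1; rewrite lnM ?posrE //; last by lra.
have := @le_ln1Dx _ (e / c ^+ 2 + e ^+ 2 / c ^+ 4).
rewrite addrA => /(_ _) h; have {}h := h ltac:(lra); lra.
Qed.

Lemma norm_regker_le (R : realType) (c : R) (x y : R * R) : 0 < c ->
  `|regker c x y| <= enorm (x - y) ^+ 2 + c ^+ 4 + c ^- 4.
Proof.
move=> c0; rewrite /regker -sqr_enorm; have c4 : 0 < c ^+ 4 by rewrite exprn_gt0.
have e0 := sqr_ge0 (enorm (x - y)).
have s0 : 0 < enorm (x - y) ^+ 2 + c ^+ 4 by rewrite ltr_wpDl.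
have h1 := ln_sublinear s0.
have h2 : - ln (enorm (x - y) ^+ 2 + c ^+ 4) < (enorm (x - y) ^+ 2 + c ^+ 4)^-1.
  by rewrite -lnV ?posrE // ln_sublinear // invr_gt0.
have h3 : (enorm (x - y) ^+ 2 + c ^+ 4)^-1 <= c ^- 4.
  by rewrite lef_pV2 ?posrE // lerDr.
have h4 : 0 < c ^- 4 by rewrite invr_gt0.
rewrite normrN ler_norml; apply/andP; split; lra.
Qed.

Section RegularMeasure.
Context {R : realType} (mu : {finite_measure set (R * R)%type -> \bar R}) (A D : R).
Hypothesis A0 : 0 <= A.
Hypothesis D0 : 0 <= D.
Hypothesis mureg : forall (x : R * R) (r : R), 0 < r ->
  (mu [set y | (enorm (x - y) < r)%R] <= (A * r)%:E)%E.
Implicit Types (x y : R * R) (f g : R * R -> R).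

Let mass := fine (mu setT).
(** Bound for the integral of [rootker]: the disc of radius [4 ^ - k] has mass at most
    [A * 4 ^ - k], so the terms of [rootker_le_series] contribute [2 * A * 2 ^ - k], in total
    [4 * A]; [mass] comes from the summand 1. *)
Definition jmass : R := mass + 4 * A.

Let mass_ge0 : 0 <= mass. Proof. by rewrite fine_ge0. Qed.

Let massE : mu setT = mass%:E.
Proof. by rewrite fineK // fin_num_measure. Qed.

Let integral_mass (k : R) : (\int[mu]_y k%:E = (k * mass)%:E)%E.
Proof. by rewrite integral_cst // EFinM; congr (_ * _)%E; exact: massE. Qed.

Let measurable_eball x r : measurable [set y | (enorm (x - y) < r)%R].
Proof.
have -> : [set y | (enorm (x - y) < r)%R] = (fun y => enorm (x - y)) @^-1` `]-oo, r[.
  by apply/seteqP; split=> y /=; rewrite in_itv.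
rewrite -[X in measurable X]setTI.
by apply: measurable_enormB1.
Qed.

Lemma integral_rootker_le x : (\int[mu]_y (rootker x y)%:E <= jmass%:E)%E.
Proof.
pose F k y : \bar R := (2 ^+ k.+1 * \1_[set z | enorm (x - z) < 4^-1 ^+ k]%R y)%:E.
have F0 k y : (0 <= F k y)%E by rewrite lee_fin mulr_ge0 ?exprn_ge0 // indicE.
have mF k : measurable_fun setT (F k).
  apply/measurable_EFinP; apply: measurable_funM; first exact: measurable_cst.
  by apply: measurable_indic; exact: measurable_eball.
have mS : measurable_fun setT (fun y => \sum_(0 <= k <oo) F k y)%E.
  by apply: ge0_emeasurable_sum => // k y _ _; exact: F0.
apply: (@le_trans _ _ (\int[mu]_y (1 + \sum_(0 <= k <oo) F k y))%E).
  apply: ge0_le_integral => //.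
  - by move=> y _; rewrite lee_fin rootker_ge0.
  - apply/measurable_EFinP; exact: measurable_rootker1.
  - by apply: emeasurable_funD => //; exact: measurable_cst.
  - by move=> y _; exact: rootker_le_series.
rewrite ge0_integralD //; last by move=> y _; rewrite nneseries_ge0.
rewrite integral_mass mul1r /jmass EFinD leeD2l //.
rewrite integral_nneseries //.
apply: (le_trans _ (@epsilon_trick0 R (4 * A) xpredT _)); last by rewrite mulr_ge0.
apply: lee_nneseries => [k _ _|k _]; first by rewrite integral_ge0.
rewrite /F; under eq_integral do rewrite EFinM.
rewrite ge0_integralZl //; last by apply/measurable_EFinP; exact: measurable_indic.
rewrite integral_indic // setIT.
have r0 : 0 < 4^-1 ^+ k :> R by rewrite exprn_gt0 // invr_gt0.
apply: (@le_trans _ _ ((2 ^+ k.+1)%:E * (A * 4^-1 ^+ k)%:E)%E).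
  by rewrite lee_pmul // ?lee_fin ?exprn_ge0 // mureg.
rewrite -EFinM lee_fin natrX.
have -> : (4^-1 ^+ k = 2^-1 ^+ k * 2^-1 ^+ k :> R)%R.
  by rewrite -exprMn; congr (_ ^+ _); field.
rewrite -exprVn !exprS.
have : 2 ^+ k * 2^-1 ^+ k = 1 :> R by rewrite -exprMn divff // expr1n.
move: (2 ^+ k) (2^-1 ^+ k) => u v uv.
have -> : 2 * u * (A * (v * v)) = 2 * A * v * (u * v) by ring.
by rewrite uv mulr1; lra.
Qed.

(** Discs around [x] have arbitrarily small mass. Without atoms, the conventional value of a kernel
    on the diagonal never matters. *)
Lemma measure_point0 x : mu [set x] = 0%E.
Proof.
have mx : measurable [set x].
  have -> : [set x] = setT `&` (fun y => enorm (x - y)) @^-1` [set 0].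
    rewrite setTI; apply/seteqP; split=> y /=; first by move=> ->; rewrite subrr enorm0.
    by move=> /eqP; rewrite enorm_eq0 subr_eq0 => /eqP.
  by apply: measurable_enormB1.
apply/eqP; rewrite eq_le measure_ge0 andbT.
apply/lee_addgt0Pr => e e0; rewrite add0e.
have r0 : 0 < e / (A + 1) by rewrite divr_gt0 // ltr_wpDl.
apply: (@le_trans _ _ (mu [set y | (enorm (x - y) < e / (A + 1))%R])).
  by apply: le_measure; rewrite ?inE // => y ->; rewrite /= subrr enorm0.
apply: (le_trans (mureg _ r0)); rewrite lee_fin mulrCA ger_pMr //.
by rewrite ler_pdivrMr ?mul1r ?ltr_wpDl // lerDl.
Qed.

Lemma integral_norm_rootker_bound x g (M K : R) : 0 <= M -> 0 <= K ->
  measurable_fun setT g -> (forall y, `|g y| <= M * rootker x y + K) ->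
  (\int[mu]_y `|(g y)%:E| <= (M * jmass + K * mass)%:E)%E.
Proof.
move=> M0 K0 mg gle.
have mj : measurable_fun setT (fun y => (rootker x y)%:E).
  apply/measurable_EFinP; exact: measurable_rootker1.
apply: (@le_trans _ _ (\int[mu]_y (M%:E * (rootker x y)%:E + K%:E))%E).
  apply: ge0_le_integral => //.
  - by apply: measurableT_comp => //; exact/measurable_EFinP.
  - apply: emeasurable_funD; last exact: measurable_cst.
    exact: measurable_funeM.
  - by move=> y _; rewrite -EFinM -EFinD lee_fin gle.
rewrite ge0_integralD //; last 2 first.
- by move=> y _; rewrite -EFinM lee_fin mulr_ge0 // rootker_ge0.
- exact: measurable_funeM.
rewrite integral_mass ge0_integralZl //; last first.
  by move=> y _; rewrite lee_fin rootker_ge0.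
rewrite EFinD leeD2r // EFinM lee_pmul ?lee_fin // ?integral_rootker_le //.
by rewrite integral_ge0 // => y _; rewrite lee_fin rootker_ge0.
Qed.

Lemma integrable_rootker_bound x g (M K : R) : 0 <= M -> 0 <= K ->
  measurable_fun setT g -> (forall y, `|g y| <= M * rootker x y + K) ->
  mu.-integrable setT (EFin \o g) /\ `|\int[mu]_y g y| <= M * jmass + K * mass.
Proof.
move=> M0 K0 mg gle; have bnd := integral_norm_rootker_bound M0 K0 mg gle.
have ig : mu.-integrable setT (EFin \o g).
  apply/integrableP; split; first exact/measurable_EFinP.
  by apply: le_lt_trans bnd _; rewrite ltry.
split => //; rewrite -lee_fin EFin_normr_Rintegral //.
by apply: le_trans bnd; apply: le_abse_integral => //; exact/measurable_EFinP.
Qed.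

(** Signed charges are bounded densities with respect to a fixed [mu], all vanishing outside one
    disc. They form a linear space on which the logarithmic kernel is absolutely integrable. *)
Definition dens f : Prop := [/\ measurable_fun setT f,
  exists M : R, forall x, `|f x| <= M & forall x, D < enorm x -> f x = 0].

Lemma dens_bound f : dens f -> exists2 M : R, 0 <= M & forall x, `|f x| <= M.
Proof. by move=> [_ [M h] _]; exists M => //; apply: le_trans (h 0). Qed.

Lemma dens_measurable f : dens f -> measurable_fun setT f.
Proof. by case. Qed.

Lemma densD f g : dens f -> dens g -> dens (fun x => f x + g x).
Proof.
move=> df dg; have [M M0 hM] := dens_bound df; have [N N0 hN] := dens_bound dg.
case: df dg => mf _ f0 [mg _ g0]; split; first exact: measurable_funD.
  by exists (M + N) => x; apply: le_trans (ler_normD _ _) _; exact: lerD.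
by move=> x Dx; rewrite f0 // g0 // addr0.
Qed.

Lemma densM f g : dens f -> measurable_fun setT g ->
  (exists M : R, forall x, enorm x <= D -> `|g x| <= M) -> dens (fun x => g x * f x).
Proof.
move=> df mg [N hN]; have [M M0 hM] := dens_bound df.
case: df => mf _ f0; split; first exact: measurable_funM.
  exists (`|N| * M) => x; rewrite normrM; have [xD|Dx] := leP (enorm x) D.
    by apply: ler_pM => //; apply: le_trans (hN _ xD) _; exact: ler_norm.
  by rewrite f0 // normr0 mulr0 mulr_ge0.
by move=> x Dx; rewrite f0 // mulr0.
Qed.

Lemma densZ f c : dens f -> dens (fun x => c * f x).
Proof.
by move=> df; apply: (densM (g := fun=> c)) => //; exists `|c|.
Qed.

Lemma dens_indic f (E : set (R * R)) : dens f -> measurable E ->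
  dens (fun x => \1_E x * f x).
Proof.
move=> df mE; apply: (densM (g := \1_E)) => //; exists 1 => x _.
by rewrite indicE; case: (_ \in _); rewrite ?normr1 ?normr0.
Qed.

Lemma dens_integrable f : dens f -> mu.-integrable setT (EFin \o f).
Proof.
move=> df; have [M M0 hM] := dens_bound df; case: df => mf _ _.
have [||? _] // := @integrable_rootker_bound 0 f 0 M _ M0 mf.
by move=> y; rewrite mul0r add0r.
Qed.

Lemma dens_norm_integral f (M : R) : 0 <= M -> dens f -> (forall x, `|f x| <= M) ->
  `|\int[mu]_x f x| <= M * mass.
Proof.
move=> M0 [mf _ _] hM.
have [||_] // := @integrable_rootker_bound 0 f 0 M _ M0 mf.
  by move=> y; rewrite mul0r add0r.
by rewrite mul0r add0r.
Qed.

Definition pot f x : R := \int[mu]_y (logker x y * f y).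
Definition energy f g : R := \int[mu]_x (pot g x * f x).
Definition rpot c f x : R := \int[mu]_y (regker c x y * f y).

Lemma norm_logker_dens_le f (M : R) x y : dens f -> 0 <= M -> (forall x, `|f x| <= M) ->
  `|logker x y * f y| <= 2 * M * rootker x y + (enorm x + D) * M.
Proof.
move=> [_ _ f0] M0 hM.
have R0 : 0 <= 2 * M * rootker x y + (enorm x + D) * M.
  by rewrite addr_ge0 // mulr_ge0 ?addr_ge0 ?enorm_ge0 ?mulr_ge0 ?rootker_ge0.
have [yD|Dy] := leP (enorm y) D; last by rewrite f0 // mulr0 normr0.
rewrite normrM.
have h1 := norm_logker_le x y; have h2 := ler_enormD x (- y); rewrite enormN in h2.
have h3 : `|logker x y| <= 2 * rootker x y + (enorm x + D) by lra.
have -> : 2 * M * rootker x y + (enorm x + D) * M = (2 * rootker x y + (enorm x + D)) * M.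
  by ring.
exact: ler_pM.
Qed.

Lemma pot_integrable f x : dens f ->
  mu.-integrable setT (EFin \o (fun y => logker x y * f y)).
Proof.
move=> df; have [M M0 hM] := dens_bound df.
have m : measurable_fun setT (fun y => logker x y * f y).
  apply: measurable_funM; last exact: dens_measurable.
  exact: measurable_logker1.
have [|||] // := @integrable_rootker_bound x _ (2 * M) ((enorm x + D) * M) _ _ m.
- by rewrite mulr_ge0.
- by rewrite mulr_ge0 // addr_ge0 // enorm_ge0.
- by move=> y; exact: norm_logker_dens_le.
Qed.

Lemma norm_pot_le f (M : R) x : dens f -> 0 <= M -> (forall x, `|f x| <= M) ->
  `|pot f x| <= 2 * M * jmass + (enorm x + D) * M * mass.
Proof.
move=> df M0 hM.
have m : measurable_fun setT (fun y => logker x y * f y).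
  apply: measurable_funM; last exact: dens_measurable.
  exact: measurable_logker1.
have [|||] // := @integrable_rootker_bound x _ (2 * M) ((enorm x + D) * M) _ _ m.
- by rewrite mulr_ge0.
- by rewrite mulr_ge0 // addr_ge0 // enorm_ge0.
- by move=> y; exact: norm_logker_dens_le.
Qed.

Lemma potD f g x : dens f -> dens g ->
  pot (fun y => f y + g y) x = pot f x + pot g x.
Proof.
move=> df dg; rewrite /pot -RintegralD //; try exact: pot_integrable.
by apply: eq_Rintegral => y _; rewrite mulrDr.
Qed.

Lemma potZ f c x : dens f -> pot (fun y => c * f y) x = c * pot f x.
Proof.
move=> df; rewrite /pot -RintegralZl //; last exact: pot_integrable.
by apply: eq_Rintegral => y _; rewrite mulrCA.
Qed.

Lemma norm_regker_dens_le f (M c : R) x y : dens f -> 0 <= M ->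
  (forall x, `|f x| <= M) -> 0 < c ->
  `|regker c x y * f y| <= ((enorm x + D) ^+ 2 + c ^+ 4 + c ^- 4) * M.
Proof.
move=> [_ _ f0] M0 hM c0.
have R0 : 0 <= (enorm x + D) ^+ 2 + c ^+ 4 + c ^- 4.
  by rewrite !addr_ge0 ?sqr_ge0 ?invr_ge0 // exprn_ge0 // ltW.
have [yD|Dy] := leP (enorm y) D; last by rewrite f0 // mulr0 normr0 mulr_ge0.
rewrite normrM ler_pM //; apply: le_trans (norm_regker_le _ _ c0) _.
rewrite !lerD2r ler_sqr ?nnegrE ?addr_ge0 ?enorm_ge0 //.
by have h2 := ler_enormD x (- y); rewrite enormN in h2; lra.
Qed.

Lemma rpot_integrable f (c : R) x : dens f -> 0 < c ->
  mu.-integrable setT (EFin \o (fun y => regker c x y * f y)).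
Proof.
move=> df c0; have [M M0 hM] := dens_bound df.
have m : measurable_fun setT (fun y => regker c x y * f y).
  apply: measurable_funM; last exact: dens_measurable.
  exact: measurable_regker1.
have [|||? _] // := @integrable_rootker_bound x _ 0 (((enorm x + D) ^+ 2 + c ^+ 4 + c ^- 4) * M) _ _ m.
  by rewrite mulr_ge0 // !addr_ge0 ?sqr_ge0 ?invr_ge0 // exprn_ge0 // ltW.
by move=> y; rewrite mul0r add0r; exact: norm_regker_dens_le.
Qed.

Lemma pot_regpot_le f (M c : R) x : dens f -> 0 <= M -> (forall x, `|f x| <= M) ->
  0 < c -> `|pot f x - rpot c f x| <= 2 * c * M * jmass.
Proof.
move=> df M0 hM c0; have mf := dens_measurable df.
(* At [y = x] the default [ln 0 = 0] breaks the estimate of the difference; this point is removed as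
   a null set. *)
pose g y := if y == x then 0 else (logker x y - regker c x y) * f y.
have mx : measurable [set x].
  have -> : [set x] = setT `&` (fun y => enorm (x - y)) @^-1` [set 0].
    rewrite setTI; apply/seteqP; split=> y /=; first by move=> ->; rewrite subrr enorm0.
    by move=> /eqP; rewrite enorm_eq0 subr_eq0 => /eqP.
  by apply: measurable_enormB1.
have mg0 : measurable_fun setT (fun y => (logker x y - regker c x y) * f y).
  apply: measurable_funM => //; apply: measurable_funB.
    exact: measurable_logker1.
  exact: measurable_regker1.
have mg : measurable_fun setT g.
  apply: measurable_fun_ifT => //.
  apply: (measurable_fun_bool true).
  by rewrite setTI (_ : _ @^-1` _ = [set x]) //; apply/seteqP; split=> y /= /eqP.
have gle y : `|g y| <= 2 * c * M * rootker x y + 0.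
  rewrite addr0 /g; case: eqVneq => [_|yx].
    by rewrite normr0 !mulr_ge0 ?rootker_ge0 // ltW.
  rewrite normrM; apply: le_trans (ler_pM _ _ (logker_regker_le c0 _) (hM y)) _ => //.
    by rewrite eq_sym.
  by rewrite mulrAC.
have M2 : 0 <= 2 * c * M by rewrite !mulr_ge0 // ltW.
have [_] := integrable_rootker_bound M2 (lexx 0) mg gle.
rewrite mul0r addr0 => h; apply: le_trans h.
rewrite le_eqVlt; apply/orP; left; apply/eqP; congr (`|_|).
transitivity (\int[mu]_y ((logker x y - regker c x y) * f y)).
  rewrite /pot /rpot -RintegralB //; last 2 first.
  - exact: pot_integrable.
  - exact: rpot_integrable.
  by apply: eq_Rintegral => y _; rewrite mulrBl.
congr fine; apply: ae_eq_integral => //; try exact/measurable_EFinP.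
exists [set x]; split => //; first exact: measure_point0.
move=> y /= /not_implyP[_]; rewrite /g; case: eqVneq => //.
Qed.

Lemma rpot_lipschitz f (M c : R) x x' : dens f -> 0 <= M ->
  (forall x, `|f x| <= M) -> 0 < c ->
  `|rpot c f x - rpot c f x'| <=
    (enorm (x - x') / c ^+ 2 + enorm (x - x') ^+ 2 / c ^+ 4) * M * mass.
Proof.
move=> df M0 hM c0; have mf := dens_measurable df.
rewrite /rpot -RintegralB //; try exact: rpot_integrable.
have q : 0 <= enorm (x - x') / c ^+ 2 + enorm (x - x') ^+ 2 / c ^+ 4.
  by rewrite addr_ge0 // divr_ge0 ?sqr_ge0 ?enorm_ge0 // exprn_ge0 // ltW.
have mm : measurable_fun setT (fun y => regker c x y * f y - regker c x' y * f y).
  by apply: measurable_funB; apply: measurable_funM => //; exact: measurable_regker1.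
have qM : 0 <= (enorm (x - x') / c ^+ 2 + enorm (x - x') ^+ 2 / c ^+ 4) * M by rewrite mulr_ge0.
have [|_] // := @integrable_rootker_bound x _ 0 _ (lexx _) qM mm.
  move=> y; rewrite mul0r add0r -mulrBl normrM ler_pM //; exact: regker_lipschitz.
by rewrite mul0r add0r.
Qed.

(** A uniform limit, as [c] tends to 0, of the regularized potentials, whose continuity is
    quantified by [rpot_lipschitz]. *)
Lemma continuous_pot f : dens f -> continuous (pot f).
Proof.
move=> df x; have [M M0 hM] := dens_bound df; have mf := dens_measurable df.
apply/cvgrPdist_lt => e e0.
have e34 : e / 4 + e / 4 + e / 4 < e by lra.
have J0 : 0 <= jmass by rewrite addr_ge0 // mulr_ge0.
(* The regularization error [2 * c * M * jmass] is then at most [e / 4] at each of the two points; a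
   third quarter is left for the oscillation of the regularized potential. *)
pose c := e / (8 * (M * jmass + 1)).
have MJ : 0 <= M * jmass by rewrite mulr_ge0.
have c0 : 0 < c by rewrite divr_gt0 // mulr_gt0 //; lra.
have cb : 2 * c * M * jmass <= e / 4.
  have -> : 2 * c * M * jmass = (e / 4) * (M * jmass / (M * jmass + 1)).
    by rewrite /c; field; lra.
  rewrite ler_piMr //; first by lra.
  by rewrite ler_pdivrMr ?mul1r; lra.
pose L := (c ^- 2 + c ^- 4) * M * mass + 1.
have L0 : 0 < L.
  rewrite ltr_wpDl // mulr_ge0 // mulr_ge0 //.
  by rewrite addr_ge0 // invr_ge0 exprn_ge0 // ltW.
near=> z.
have ez : enorm (x - z) < Num.min 1 (e / (4 * L)).
  near: z; apply/nbhs_enorm; exists (Num.min 1 (e / (4 * L))) => //.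
  by rewrite lt_min ltr01 divr_gt0 // mulr_gt0.
move: ez; rewrite lt_min => /andP[z1 z2].
have h1 := pot_regpot_le x df M0 hM c0.
have h2 := pot_regpot_le z df M0 hM c0.
have h3 := rpot_lipschitz x z df M0 hM c0.
have h4 : (enorm (x - z) / c ^+ 2 + enorm (x - z) ^+ 2 / c ^+ 4) * M * mass <= e / 4.
  have n0 := enorm_ge0 (x - z).
  apply: (@le_trans _ _ (enorm (x - z) * L)).
    rewrite /L; have i4 : 0 <= c ^- 4 by rewrite invr_ge0 exprn_ge0 // ltW.
    have : enorm (x - z) ^+ 2 * c ^- 4 <= enorm (x - z) * c ^- 4.
      by rewrite ler_wpM2r // expr2 ler_piMr // ltW.
    have Mm : 0 <= M * mass by rewrite mulr_ge0.
    move=> h; rewrite mulrDr mulr1 ler_wpDr // !mulrA ler_wpM2r // ler_wpM2r //.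
    by rewrite mulrDr; lra.
  rewrite -ler_pdivlMr //; apply: le_trans (ltW z2) _.
  by rewrite invfM mulrA.
apply: (ltr_distl3 h1 h2 (le_trans h3 h4)).
apply: (@le_lt_trans _ _ (e / 4 + e / 4 + e / 4)); first by rewrite !lerD.
exact: e34.
Unshelve. all: by end_near. Qed.

Lemma dens_pot f g : dens f -> dens g -> dens (fun x => pot g x * f x).
Proof.
move=> df dg; apply: densM => //.
  by apply: continuous_measurable_plane; exact: continuous_pot.
have [M M0 hM] := dens_bound dg.
exists (2 * M * jmass + (D + D) * M * mass) => x xD.
apply: le_trans (norm_pot_le _ dg M0 hM) _.
by rewrite lerD2l ler_wpM2r // ler_wpM2r // lerD2r.
Qed.

(** Fubini for a symmetric kernel. Integrability on the product follows from a bound on the inner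
    integral that is uniform because [f] vanishes outside the disc. *)
Lemma energyC f g : dens f -> dens g -> energy f g = energy g f.
Proof.
move=> df dg.
have mf := dens_measurable df; have mg := dens_measurable dg.
pose h (z : (R * R) * (R * R)) : \bar R := (logker z.1 z.2 * f z.1 * g z.2)%:E.
have mh : measurable_fun setT h.
  apply/measurable_EFinP; apply: measurable_funM.
    apply: measurable_funM; first exact: (measurable_logker measurable_fst measurable_snd).
    exact: (measurableT_comp mf measurable_fst).
  exact: (measurableT_comp mg measurable_snd).
have [M M0 hM] := dens_bound df; have [N N0 hN] := dens_bound dg.
have ih : (mu \x mu)%E.-integrable setT h.
  apply/integrable12ltyP => //.
  pose K := (2 * N * jmass + (D + D) * N * mass) * M.
  apply: (@le_lt_trans _ _ (\int[mu]_x K%:E)%E); last first.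
    by rewrite integral_mass ltry.
  have J0 : 0 <= jmass by rewrite addr_ge0 // mulr_ge0.
  apply: ge0_le_integral => //.
  - by move=> x _; exact: integral_ge0.
  - apply: (measurable_fun_fubini_tonelli_F (abse \o h)) => //.
    exact: measurableT_comp.
    by move=> z; exact: abse_ge0.
  move=> x _.
  have mm : measurable_fun setT (fun y => logker x y * f x * g y).
    by apply: measurable_funM => //; apply: measurable_funM => //; exact: measurable_logker1.
  have bnd y : `|logker x y * f x * g y| <= 2 * N * M * rootker x y + (D + D) * N * M.
    have R0 := rootker_ge0 x y.
    have [xD|Dx] := leP (enorm x) D; last first.
      have -> : f x = 0 by case: df => _ _ /(_ _ Dx).
      by rewrite mulr0 mul0r normr0 addr_ge0 ?mulr_ge0 // addr_ge0.
    rewrite mulrAC normrM.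
    apply: (@le_trans _ _ ((2 * N * rootker x y + (D + D) * N) * M)).
      apply: ler_pM => //; apply: le_trans (norm_logker_dens_le x y dg N0 hN) _.
      by rewrite lerD2l ler_wpM2r // lerD2r.
    by rewrite -subr_ge0 [X in 0 <= X](_ : _ = 0) //; ring.
  have B0 : 0 <= 2 * N * M by rewrite !mulr_ge0.
  have C0 : 0 <= (D + D) * N * M by rewrite !mulr_ge0 // addr_ge0.
  apply: le_trans (integral_norm_rootker_bound B0 C0 mm bnd) _.
  by rewrite lee_fin; rewrite -subr_ge0 [X in 0 <= X](_ : _ = 0) // /K; ring.
have inner (u v : R * R -> R) x : dens v ->
    (\int[mu]_y (logker x y * u x * v y)%:E = (pot v x * u x)%:E)%E.
  move=> dv; rewrite -RintegralZr //; last exact: pot_integrable.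
  rewrite /Rintegral fineK; last first.
    apply: integrable_fin_num => //.
    rewrite /=; under eq_fun do rewrite EFinM.
    by apply: integrableZr => //; exact: pot_integrable.
  by apply: eq_integral => y _; rewrite mulrAC.
have := Fubini ih; rewrite /fubini_F /fubini_G /=.
under eq_integral do rewrite inner //.
under [X in _ = X -> _]eq_integral => y _.
  under eq_integral => x _ do rewrite /h /= logkerC mulrAC.
  rewrite inner //; over.
by rewrite /energy /Rintegral => ->.
Qed.

End RegularMeasure.

(** * Energy of densities of mean zero *)

Section LogSeries.
Context {R : realType}.

(** Taylor polynomial of [- ln (1 - t)] at 0. *)
Definition logsum (N : nat) (t : R) : R := \sum_(n < N) t ^+ n.+1 / n.+1%:R.

Lemma is_derive_logsum N (t : R) :
  is_derive t 1 (logsum N) (\sum_(n < N) t ^+ n).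
Proof.
elim: N => [|N IH].
  have -> : logsum 0 = cst 0 by apply/funext => x; rewrite /logsum big_ord0.
  by rewrite big_ord0; exact: is_derive_cst.
have -> : logsum N.+1 = logsum N + (fun x => x ^+ N.+1 * N.+1%:R^-1).
  by apply/funext => x; rewrite /logsum big_ord_recr.
rewrite big_ord_recr /=; apply: is_deriveD.
have h : is_derive t 1 (fun x : R => x ^+ N.+1) (N.+1%:R * t ^+ N).
  have -> : (fun x : R => x ^+ N.+1) = (@id R) ^+ N.+1.
    by apply/funext => x; rewrite exprfctE.
  apply: (is_derive_eq (@is_deriveX R R id N.+1 t 1 1 (is_derive_id t 1))).
  by rewrite /GRing.scale /= mulr1.
have := is_deriveM h (is_derive_cst (N.+1%:R^-1 : R) t 1).
move=> h2; apply: (is_derive_eq h2).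
rewrite scaler0 add0r /GRing.scale /=; field.
by rewrite addrC natr1 pnatr_eq0.
Qed.

(** The remainder has derivative [t ^+ N / (1 - t)]; the mean value theorem is applied between 0 and
    [t], an interval of length less than 1. *)
Lemma ln_series_bound N (q t : R) : 0 <= q < 1 -> `|t| <= q ->
  `|- ln (1 - t) - logsum N t| <= q ^+ N / (1 - q).
Proof.
move=> /andP[q0 q1] tq.
pose F (x : R) := - ln (1 - x) - logsum N x.
pose dF (x : R) := (1 - x)^-1 - \sum_(n < N) x ^+ n.
have dFE (x : R) : `|x| <= q -> dF x = x ^+ N / (1 - x).
  move=> xq; have x1 : 1 - x != 0.
    by rewrite gt_eqF // subr_gt0 (le_lt_trans (ler_norm _)) // (le_lt_trans xq).
  apply: (mulIf x1); rewrite mulrBl mulVf // mulrAC -mulrA divff // mulr1.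
  rewrite mulrC -[1 - x]opprB mulNr -subrX1.
  by ring.
have dF1 (x : R) : `|x| <= q -> is_derive x 1 F (dF x).
  move=> xq; have x1 : 0 < 1 - x.
    by rewrite subr_gt0 (le_lt_trans (ler_norm _)) // (le_lt_trans xq).
  have h1 : is_derive x 1 (fun y : R => 1 - y) (-1).
    have := is_deriveB (is_derive_cst (1 : R) x 1) (is_derive_id x 1).
    by rewrite sub0r.
  have h2 := @is_derive1_comp _ (@ln R) (fun y => 1 - y) x _ _ (is_derive1_ln x1) h1.
  have h3 := is_deriveB (is_deriveN h2) (is_derive_logsum N x).
  apply: (is_derive_eq h3).
  by rewrite /dF mulrN1 opprK.
have cF a b : a <= b -> -q <= a -> b <= q -> {within `[a, b], continuous F}.
  move=> ab qa bq; apply: derivable_within_continuous => x; rewrite in_itv /= => /andP[ax xb].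
  have xq : `|x| <= q by rewrite ler_norml (le_trans qa) // (le_trans xb).
  by have [] := dF1 x xq.
have main a b : a <= b -> -q <= a -> b <= q -> b - a <= 1 ->
    `|F b - F a| <= q ^+ N / (1 - q).
  move=> ab qa bq ba1.
  have [|c] := MVT_segment ab _ (cF _ _ ab qa bq) (df := dF).
    move=> x; rewrite in_itv /= => /andP[ax xb]; apply: dF1.
    by rewrite ler_norml (le_trans qa (ltW ax)) // (le_trans (ltW xb)).
  rewrite in_itv /= => /andP[ac cb] ->.
  have cq : `|c| <= q by rewrite ler_norml (le_trans qa) // (le_trans cb).
  rewrite dFE // !normrM normfV normrX.
  have c1 : 0 < 1 - c.
    by rewrite subr_gt0 (le_lt_trans (ler_norm _)) // (le_lt_trans cq).
  rewrite (gtr0_norm c1) (@ger0_norm _ (b - a)) ?subr_ge0 //.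
  apply: (@le_trans _ _ (`|c| ^+ N / (1 - c))).
    by rewrite ler_piMr // divr_ge0 ?exprn_ge0 // ltW.
  apply: ler_pM; rewrite ?exprn_ge0 ?invr_ge0 ?(ltW c1) //.
    by rewrite lerXn2r ?nnegrE.
  have q1' : 0 < 1 - q by rewrite subr_gt0.
  by rewrite lef_pV2 ?posrE // lerB // (le_trans (ler_norm _)).
have F0 : F 0 = 0.
  rewrite /F subr0 ln1 oppr0 sub0r /logsum big1 ?oppr0 // => n _.
  by rewrite expr0n mul0r.
have := tq; rewrite ler_norml => /andP[t1 t2].
rewrite -/(F t); have [t0|t0] := leP 0 t.
  by have := main 0 t; rewrite F0 !subr0; apply => //; lra.
by have := main t 0 (ltW t0) t1 q0; rewrite F0 [0 - F t]sub0r normrN; apply; lra.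
Qed.

End LogSeries.

(** * Positive semidefinite kernels and the regularized energy *)

Section EnergyMeanZero.
Context {R : realType} (mu : {finite_measure set (R * R)%type -> \bar R}) (A D : R).
Hypothesis A0 : 0 <= A.
Hypothesis D0 : 0 <= D.
Hypothesis mureg : forall (x : R * R) (r : R), 0 < r ->
  (mu [set y | (enorm (x - y) < r)%R] <= (A * r)%:E)%E.
Implicit Types (x y : R * R) (f g u v : R * R -> R) (K : R * R -> R * R -> R).

Let mass := fine (mu setT).
Let mass_ge0 : 0 <= mass. Proof. by rewrite fine_ge0. Qed.

(** Boundedness is asked for on the disc, outside which the densities vanish; kernels that grow at
    infinity are thus allowed. *)
Definition bker K : Prop :=
  measurable_fun setT (fun z : (R * R) * (R * R) => K z.1 z.2) /\
  exists2 C : R, 0 <= C & forall x y, enorm x <= D -> enorm y <= D -> `|K x y| <= C.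

Definition dint K u v : R := \int[(mu \x mu)%E]_z (K z.1 z.2 * u z.1 * v z.2).

Let mprod_fin : ((mu \x mu)%E setT = (mass * mass)%:E)%E.
Proof.
rewrite -setXTT product_measure1E // EFinM /mass.
by rewrite fineK // fin_num_measure.
Qed.

Let measurable_kuv K u v : bker K -> dens D u -> dens D v ->
  measurable_fun setT (fun z : (R * R) * (R * R) => K z.1 z.2 * u z.1 * v z.2).
Proof.
move=> [mK _] [mu' _ _] [mv _ _]; apply: measurable_funM.
  apply: measurable_funM => //; exact: (measurableT_comp mu' measurable_fst).
exact: (measurableT_comp mv measurable_snd).
Qed.

Let kuv_le K u v (C M N : R) : 0 <= C -> 0 <= M -> 0 <= N ->
  (forall x y, enorm x <= D -> enorm y <= D -> `|K x y| <= C) ->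
  (forall x, `|u x| <= M) -> (forall x, `|v x| <= N) ->
  dens D u -> dens D v -> forall z, `|K z.1 z.2 * u z.1 * v z.2| <= C * M * N.
Proof.
move=> C0 M0 N0 hC hM hN [_ _ u0] [_ _ v0] [x y] /=.
have CMN : 0 <= C * M * N by rewrite !mulr_ge0.
have [xD|Dx] := leP (enorm x) D; last by rewrite u0 // mulr0 mul0r normr0.
have [yD|Dy] := leP (enorm y) D; last by rewrite v0 // mulr0 normr0.
by rewrite !normrM; apply: ler_pM; rewrite ?mulr_ge0 //; apply: ler_pM; rewrite ?hC.
Qed.

Let bounded_prod (h : (R * R) * (R * R) -> R) (C : R) : 0 <= C ->
  measurable_fun setT h -> (forall z, `|h z| <= C) ->
  (mu \x mu)%E.-integrable setT (EFin \o h) /\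
  `|\int[(mu \x mu)%E]_z h z| <= C * (mass * mass).
Proof.
move=> C0 mh hC.
have bnd : (\int[(mu \x mu)]_z `|(h z)%:E| <= (C * (mass * mass))%:E)%E.
  apply: (@le_trans _ _ (\int[(mu \x mu)]_z C%:E)%E).
    apply: ge0_le_integral => //.
      by apply: measurableT_comp => //; exact/measurable_EFinP.
    by move=> z _; rewrite lee_fin.
  by rewrite integral_cst // EFinM -mprod_fin.
have ig : (mu \x mu)%E.-integrable setT (EFin \o h).
  apply/integrableP; split; first exact/measurable_EFinP.
  by apply: le_lt_trans bnd _; rewrite ltry.
split => //; rewrite -lee_fin EFin_normr_Rintegral //.
by apply: le_trans bnd; apply: le_abse_integral => //; exact/measurable_EFinP.
Qed.

Lemma dint_integrable K u v : bker K -> dens D u -> dens D v ->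
  (mu \x mu)%E.-integrable setT (EFin \o (fun z => K z.1 z.2 * u z.1 * v z.2)).
Proof.
move=> bK du dv; have [_ [C C0 hC]] := bK.
have [M M0 hM] := dens_bound du; have [N N0 hN] := dens_bound dv.
have CMN : 0 <= C * M * N by rewrite !mulr_ge0.
by have [] := bounded_prod CMN (measurable_kuv bK du dv) (kuv_le C0 M0 N0 hC hM hN du dv).
Qed.

Lemma norm_dint_le K u v (C M N : R) : bker K -> 0 <= C -> 0 <= M -> 0 <= N ->
  (forall x y, enorm x <= D -> enorm y <= D -> `|K x y| <= C) ->
  (forall x, `|u x| <= M) -> (forall x, `|v x| <= N) ->
  dens D u -> dens D v -> `|dint K u v| <= C * M * N * (mass * mass).
Proof.
move=> bK C0 M0 N0 hC hM hN du dv.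
have CMN : 0 <= C * M * N by rewrite !mulr_ge0.
by have [] := bounded_prod CMN (measurable_kuv bK du dv) (kuv_le C0 M0 N0 hC hM hN du dv).
Qed.

Lemma bkerD K K' : bker K -> bker K' -> bker (fun x y => K x y + K' x y).
Proof.
move=> [mK [C C0 hC]] [mK' [C' C0' hC']]; split; first exact: measurable_funD.
exists (C + C') => [|x y xD yD]; first exact: addr_ge0.
by apply: le_trans (ler_normD _ _) _; rewrite lerD ?hC ?hC'.
Qed.

Lemma bkerM K K' : bker K -> bker K' -> bker (fun x y => K x y * K' x y).
Proof.
move=> [mK [C C0 hC]] [mK' [C' C0' hC']]; split; first exact: measurable_funM.
exists (C * C') => [|x y xD yD]; first exact: mulr_ge0.
by rewrite normrM ler_pM ?hC ?hC'.
Qed.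

Lemma bker_cst (c : R) : bker (fun _ _ => c).
Proof. by split; [exact: measurable_cst|exists `|c|]. Qed.

Lemma dintD K K' u v : bker K -> bker K' -> dens D u -> dens D v ->
  dint (fun x y => K x y + K' x y) u v = dint K u v + dint K' u v.
Proof.
move=> bK bK' du dv; rewrite /dint -RintegralD //; try exact: dint_integrable.
by apply: eq_Rintegral => z _; rewrite !mulrDl.
Qed.

Lemma dintZ K (c : R) u v : bker K -> dens D u -> dens D v ->
  dint (fun x y => c * K x y) u v = c * dint K u v.
Proof.
move=> bK du dv; rewrite /dint -RintegralZl //; try exact: dint_integrable.
by apply: eq_Rintegral => z _; rewrite !mulrA.
Qed.

Lemma dint_iterated K u v : bker K -> dens D u -> dens D v ->
  dint K u v = \int[mu]_x ((\int[mu]_y (K x y * v y)) * u x).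
Proof.
move=> bK du dv.
have ih := dint_integrable bK du dv.
rewrite /dint /Rintegral -(integral12_prod_meas1 ih); congr fine.
apply: eq_integral => x _; rewrite /fubini_F /=.
have [uD|Du] := leP (enorm x) D; last first.
  have -> : u x = 0 by case: du => _ _; apply.
  by under eq_integral do rewrite mulr0 mul0r; rewrite integral0 mulr0.
have [_ [C C0 hC]] := bK; have [N N0 hN] := dens_bound dv.
have mKx : measurable_fun setT (fun y => K x y).
  exact: (measurableT_comp bK.1 (measurable_pair1 x)).
have dKv : dens D (fun y => K x y * v y).
  by apply: densM => //; exists C => y yD; exact: hC.
have ii := dens_integrable A0 mureg dKv.
have -> : fine (\int[mu]_y (K x y * v y)%:E) * u x = \int[mu]_y (K x y * v y * u x).
  by rewrite RintegralZr.
rewrite /Rintegral fineK; first by apply: eq_integral => y _; rewrite mulrAC.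
apply: integrable_fin_num => //.
rewrite /=; under eq_fun do rewrite EFinM.
exact: integrableZr.
Qed.

Lemma dint1 u v : dens D u -> dens D v ->
  dint (fun _ _ => 1) u v = (\int[mu]_x u x) * (\int[mu]_x v x).
Proof.
move=> du dv; rewrite dint_iterated //; last exact: bker_cst.
under eq_Rintegral do (under eq_Rintegral do rewrite mul1r).
rewrite RintegralZl //; first by rewrite mulrC.
exact: (dens_integrable A0 mureg du).
Qed.

Definition bmeas (h : R * R -> R) : Prop := measurable_fun setT h /\
  exists M : R, forall x, enorm x <= D -> `|h x| <= M.

Lemma bker_mul g h : bmeas g -> bmeas h -> bker (fun x y => g x * h y).
Proof.
move=> [mg [M hM]] [mh [N hN]]; split.
  apply: measurable_funM; first exact: (measurableT_comp mg measurable_fst).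
  exact: (measurableT_comp mh measurable_snd).
exists (`|M| * `|N|) => [|x y xD yD]; first exact: mulr_ge0.
rewrite normrM ler_pM //.
  by apply: le_trans (hM _ xD) _; exact: ler_norm.
by apply: le_trans (hN _ yD) _; exact: ler_norm.
Qed.

Lemma dint_mul K g h u v : bker K -> bmeas g -> bmeas h -> dens D u -> dens D v ->
  dint (fun x y => g x * h y * K x y) u v =
  dint K (fun x => g x * u x) (fun y => h y * v y).
Proof. by move=> *; apply: eq_Rintegral => z _ /=; ring. Qed.

Lemma eq_dint K K' u v : dens D u -> dens D v ->
  (forall x y, enorm x <= D -> enorm y <= D -> K x y = K' x y) ->
  dint K u v = dint K' u v.
Proof.
move=> [_ _ u0] [_ _ v0] KK'; apply: eq_Rintegral => -[x y] _ /=.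
have [xD|Dx] := leP (enorm x) D; last by rewrite (u0 x) // !mulr0 !mul0r.
have [yD|Dy] := leP (enorm y) D; last by rewrite (v0 y) // !mulr0.
by rewrite KK'.
Qed.

(** Schur's product theorem for a kernel of finite rank: one factor of the power is expanded and
    each [g i x * g i y] absorbed into the density; the exponent 0 gives the square of the total
    charge. *)
Lemma dint_pow_ge0 (I : finType) (g : I -> R * R -> R) n u :
  (forall i, bmeas (g i)) -> dens D u ->
  bker (fun x y => (\sum_i g i x * g i y) ^+ n) /\
  0 <= dint (fun x y => (\sum_i g i x * g i y) ^+ n) u u.
Proof.
move=> hg; elim: n u => [|n IH] u du.
  split; first by under eq_fun do (under eq_fun do rewrite expr0); exact: bker_cst.
  have -> : (fun x y : R * R => (\sum_i g i x * g i y) ^+ 0) = (fun _ _ => 1).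
    by apply/funext => x; apply/funext => y; rewrite expr0.
  by rewrite dint1 // -expr2 sqr_ge0.
pose S x y := (\sum_i g i x * g i y).
have bS : forall s : seq I, bker (fun x y => \sum_(i <- s) g i x * g i y).
  elim=> [|a s IHs].
    have -> : (fun x y : R * R => \sum_(i <- [::]) g i x * g i y) = (fun _ _ => 0).
      by apply/funext => x; apply/funext => y; rewrite big_nil.
    exact: bker_cst.
  have -> : (fun x y : R * R => \sum_(i <- a :: s) g i x * g i y) =
            (fun x y => g a x * g a y + \sum_(i <- s) g i x * g i y).
    by apply/funext => x; apply/funext => y; rewrite big_cons.
  by apply: bkerD => //; exact: bker_mul.
have bSn : bker (fun x y => S x y ^+ n) by have [] := IH u du.
have -> : (fun x y : R * R => (\sum_i g i x * g i y) ^+ n.+1) =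
          (fun x y => S x y * S x y ^+ n).
  by apply/funext => x; apply/funext => y; rewrite exprS.
split; first by apply: bkerM => //; exact: bS.
suff : forall s : seq I, 0 <= dint (fun x y => (\sum_(i <- s) g i x * g i y) * S x y ^+ n) u u by apply.
elim=> [|a s IHs].
  have -> : (fun x y => (\sum_(i <- [::]) g i x * g i y) * S x y ^+ n) = (fun _ _ => 0).
    by apply/funext => x; apply/funext => y; rewrite big_nil mul0r.
  rewrite /dint; under eq_Rintegral do rewrite !mul0r.
  by rewrite Rintegral_ge0.
have -> : (fun x y => (\sum_(i <- a :: s) g i x * g i y) * S x y ^+ n) =
   (fun x y => g a x * g a y * S x y ^+ n + (\sum_(i <- s) g i x * g i y) * S x y ^+ n).
  by apply/funext => x; apply/funext => y; rewrite big_cons mulrDl.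
rewrite dintD //; last 2 first.
- by apply: bkerM => //; exact: bker_mul.
- by apply: bkerM => //; exact: bS.
rewrite addr_ge0 // dint_mul //.
have [ma [M hM]] := hg a.
by apply: (IH _ _).2; apply: densM => //; exists M.
Qed.

Lemma continuous_rpot (c : R) f : 0 < c -> dens D f -> continuous (rpot mu c f).
Proof.
move=> c0 df x; have [M M0 hM] := dens_bound df.
apply/cvgrPdist_lt => e e0.
pose L := (c ^- 2 + c ^- 4) * M * mass + 1.
have i2 : 0 <= c ^- 2 by rewrite invr_ge0 exprn_ge0 // ltW.
have i4 : 0 <= c ^- 4 by rewrite invr_ge0 exprn_ge0 // ltW.
have Mm : 0 <= M * mass by rewrite mulr_ge0.
have L0 : 0 < L by rewrite ltr_wpDl // -mulrA mulr_ge0 // addr_ge0.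
apply/nbhs_enorm; exists (Num.min 1 (e / L)).
  by rewrite lt_min ltr01 divr_gt0.
move=> z; rewrite lt_min => /andP[z1]; rewrite ltr_pdivlMr // => z2 /=.
apply: le_lt_trans (rpot_lipschitz A0 D0 mureg x z df M0 hM c0) _.
apply: le_lt_trans z2; have n0 := enorm_ge0 (x - z).
have : enorm (x - z) ^+ 2 * c ^- 4 <= enorm (x - z) * c ^- 4.
  by rewrite ler_wpM2r // expr2 ler_piMr // ltW.
move=> h; rewrite /L mulrDr mulr1 ler_wpDr // !mulrA ler_wpM2r // ler_wpM2r //.
by rewrite mulrDr lerD2l.
Qed.

Section Regularized.
Variable c : R.
Hypothesis c0 : 0 < c.
Let eps := c ^+ 4.
Let eps0 : 0 < eps. Proof. by rewrite exprn_gt0. Qed.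
Let a x := dot x x + eps.
Let a0 x : 0 < a x. Proof. by rewrite ltr_wpDl // dot_ge0. Qed.

(* Schoenberg's trick: [1 - kap x y] is [|x - y|^2 + eps] up to factors depending
   on one variable, while [kap] is positive semidefinite. *)
Let gfac (i : 'I_3) x : R :=
  match val i with 0 => dot x x / a x | 1 => Num.sqrt 2 * c ^+ 2 * (x.1 / a x)
  | _ => Num.sqrt 2 * c ^+ 2 * (x.2 / a x) end.
Let kap x y := \sum_i gfac i x * gfac i y.

Let kapE x y : kap x y =
  (dot x x * dot y y + 2 * eps * dot x y) / (a x * a y).
Proof.
rewrite /kap !big_ord_recl big_ord0 /gfac /= addr0.
have s2 : Num.sqrt 2 * Num.sqrt 2 = 2 :> R by rewrite -expr2 sqr_sqrtr.
have -> : Num.sqrt 2 * c ^+ 2 * (x.1 / a x) * (Num.sqrt 2 * c ^+ 2 * (y.1 / a y)) =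
    (Num.sqrt 2 * Num.sqrt 2) * c ^+ 4 * (x.1 / a x * (y.1 / a y)) by ring.
have -> : Num.sqrt 2 * c ^+ 2 * (x.2 / a x) * (Num.sqrt 2 * c ^+ 2 * (y.2 / a y)) =
    (Num.sqrt 2 * Num.sqrt 2) * c ^+ 4 * (x.2 / a x * (y.2 / a y)) by ring.
rewrite s2 -/eps /(dot x y); field.
by rewrite !gt_eqF.
Qed.

Let kap1 x y : 1 - kap x y = eps * (dot (x - y) (x - y) + eps) / (a x * a y).
Proof.
rewrite kapE; have ax := a0 x; have ay := a0 y.
apply: (@mulIf _ (a x * a y)); first by rewrite gt_eqF ?mulr_gt0.
rewrite mulrBl !divfK ?gt_eqF ?mulr_gt0 //.
by rewrite /a /dot /=; ring.
Qed.

(** Both [1 - kap x y] and [1 + kap x y] are at least [eps ^+ 2 / (a x * a y)], and [a] is at most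
    [D ^+ 2 + eps] on the disc. *)
Let q := 1 - eps ^+ 2 / (D ^+ 2 + eps) ^+ 2.

Let q01 : 0 <= q < 1.
Proof.
have p : 0 < (D ^+ 2 + eps) ^+ 2 by rewrite exprn_gt0 // ltr_wpDl ?sqr_ge0.
apply/andP; split.
  rewrite subr_ge0 ler_pdivrMr // mul1r ler_sqr ?nnegrE ?(ltW eps0) //.
    by rewrite lerDr sqr_ge0.
  by rewrite addr_ge0 ?sqr_ge0 // ltW.
by rewrite /q ltrBlDr ltrDl divr_gt0 // exprn_gt0.
Qed.

Let aD x : enorm x <= D -> a x <= D ^+ 2 + eps.
Proof. by move=> xD; rewrite lerD2r -sqr_enorm ler_sqr ?nnegrE ?enorm_ge0. Qed.

Let kap_le x y : enorm x <= D -> enorm y <= D -> `|kap x y| <= q.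
Proof.
move=> xD yD; have ax := a0 x; have ay := a0 y.
have low : eps ^+ 2 / (D ^+ 2 + eps) ^+ 2 <= eps ^+ 2 / (a x * a y).
  have Dp : 0 < D ^+ 2 + eps by rewrite ltr_wpDl ?sqr_ge0.
  rewrite ler_pM2l ?exprn_gt0 // lef_pV2 ?posrE ?mulr_gt0 ?exprn_gt0 //.
  by rewrite expr2; apply: ler_pM; rewrite ?aD // ltW.
rewrite ler_norml /q; apply/andP; split.
  rewrite opprB lerBlDl; apply: (le_trans low).
  have -> : 1 + kap x y = (a x * a y + dot x x * dot y y + 2 * eps * dot x y) / (a x * a y).
    by rewrite kapE; field; rewrite !gt_eqF.
  rewrite ler_pM2r ?invr_gt0 ?mulr_gt0 //.
  (* The numerator exceeds [eps ^+ 2] by [eps * |x + y| ^ 2 + 2 * |x| ^ 2 * |y| ^ 2]. *)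
  have := dot_ge0 (x + y); rewrite !dotE (dotC y x) => h.
  have : 0 <= eps * (dot x x + dot x y + (dot x y + dot y y)) by rewrite mulr_ge0 // ltW.
  have : 0 <= dot x x * dot y y by rewrite mulr_ge0 ?dot_ge0.
  by rewrite /a => h1 h2; rewrite -subr_ge0; apply: (le_trans (addr_ge0 (mulr_ge0 (ler0n _ 2) h1) h2));
    rewrite -subr_ge0 [X in 0 <= X](_ : _ = 0) //; ring.
rewrite lerBrDl -lerBrDr; apply: (le_trans low); rewrite kap1 ler_pM2r ?invr_gt0 ?mulr_gt0 //.
by rewrite expr2 ler_pM2l // lerDr dot_ge0.
Qed.

Let regkerE x y : regker c x y = 2^-1 * (- ln (1 - kap x y)) +
  (2^-1 * (2^-1 * ln eps - ln (a x)) + 2^-1 * (2^-1 * ln eps - ln (a y))).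
Proof.
rewrite kap1 /regker -/eps.
have s0 : 0 < dot (x - y) (x - y) + eps by rewrite ltr_wpDl ?dot_ge0.
have axy : 0 < a x * a y by rewrite mulr_gt0.
have es : 0 < eps * (dot (x - y) (x - y) + eps) by rewrite mulr_gt0.
rewrite ln_div ?posrE // lnM ?posrE // lnM ?posrE //.
by field.
Qed.

Let ma : measurable_fun setT a.
Proof.
by apply: measurable_funD => //; apply: measurable_dot; exact: measurable_id.
Qed.

Let gfac_bmeas i : bmeas (gfac i).
Proof.
have mi : measurable_fun setT (fun x => (a x)^-1).
  exact: (measurableT_comp (@measurable_invr R) ma).
have ai x : (a x)^-1 <= eps^-1.
  by rewrite lef_pV2 ?posrE // /a lerDr dot_ge0.
have x1 x : enorm x <= D -> `|x.1| <= D.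
  by move=> xD; apply: le_trans xD; apply: le_trans (ler_norm_enorm _); rewrite prod_normE le_max lexx.
have x2 x : enorm x <= D -> `|x.2| <= D.
  by move=> xD; apply: le_trans xD; apply: le_trans (ler_norm_enorm _); rewrite prod_normE le_max lexx orbT.
have nai x : `|(a x)^-1| <= eps^-1 by rewrite ger0_norm // invr_ge0 ltW.
rewrite /bmeas /gfac; case: i => [[|[|[|//]]] hi] /=.
- split; first by apply: measurable_funM => //; apply: measurable_dot; exact: measurable_id.
  exists (D ^+ 2 * eps^-1) => x xD; rewrite normrM ler_pM // -sqr_enorm normrX.
  by rewrite ler_sqr ?nnegrE ?ger0_norm // enorm_ge0.
- split; first by apply: measurable_funM => //; apply: measurable_funM => //; exact: measurable_fst.
  exists (`|Num.sqrt 2 * c ^+ 2| * (D * eps^-1)) => x xD; rewrite normrM ler_wpM2l //.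
  by rewrite normrM ler_pM // x1.
- split; first by apply: measurable_funM => //; apply: measurable_funM => //; exact: measurable_snd.
  exists (`|Num.sqrt 2 * c ^+ 2| * (D * eps^-1)) => x xD; rewrite normrM ler_wpM2l //.
  by rewrite normrM ler_pM // x2.
Qed.

Let kap_bker n u : dens D u -> bker (fun x y => kap x y ^+ n).
Proof. by move=> du; have [] := dint_pow_ge0 n gfac_bmeas du. Qed.

Let logsum_ge0 N u : dens D u ->
  bker (fun x y => logsum N (kap x y)) /\ 0 <= dint (fun x y => logsum N (kap x y)) u u.
Proof.
move=> du; elim: N => [|N [IH1 IH2]].
  have -> : (fun x y => logsum 0 (kap x y)) = (fun _ _ => 0).
    by apply/funext => x; apply/funext => y; rewrite /logsum big_ord0.
  split; first exact: bker_cst.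
  rewrite /dint; under eq_Rintegral do rewrite !mul0r.
  by rewrite Rintegral_ge0.
have -> : (fun x y => logsum N.+1 (kap x y)) =
    (fun x y => logsum N (kap x y) + N.+1%:R^-1 * kap x y ^+ N.+1).
  by apply/funext => x; apply/funext => y; rewrite /logsum big_ord_recr /= (mulrC _^-1).
have bk := kap_bker N.+1 du.
have bk' : bker (fun x y => N.+1%:R^-1 * kap x y ^+ N.+1).
  by apply: bkerM => //; exact: bker_cst.
split; first exact: bkerD.
rewrite dintD // addr_ge0 // dintZ // mulr_ge0 ?invr_ge0 //.
by have [_] := dint_pow_ge0 N.+1 gfac_bmeas du.
Qed.

Let lnkap_bker u : dens D u -> bker (fun x y => - ln (1 - kap x y)).
Proof.
move=> du; have [mk _] := kap_bker 1 du; split.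
  apply: measurable_funN; apply: (@measurableT_comp _ _ _ _ _ _ (@ln R)).
    exact: measurable_ln.
  apply: measurable_funB; first exact: measurable_cst.
  by under eq_fun do rewrite -[kap _ _]expr1.
have /andP[q0 q1] := q01.
exists ((1 - q)^-1) => [|x y xD yD]; first by rewrite invr_ge0 subr_ge0 ltW.
have := ln_series_bound 0 q01 (kap_le xD yD).
by rewrite /logsum big_ord0 subr0 expr0 mul1r.
Qed.

Let lnkap_ge0 u : dens D u -> 0 <= dint (fun x y => - ln (1 - kap x y)) u u.
Proof.
move=> du; have [M M0 hM] := dens_bound du; have /andP[q0 q1] := q01.
set V := dint _ u u.
(* The Taylor polynomial contributes a nonnegative amount by [logsum_ge0]; only the tail of the
   series, uniformly small on the disc, can be negative. *)
have low N : - (q ^+ N / (1 - q) * M * M * (mass * mass)) <= V.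
  have [b1 p1] := logsum_ge0 N du.
  have b2 : bker (fun x y => - ln (1 - kap x y) + (-1) * logsum N (kap x y)).
    apply: bkerD; first exact: lnkap_bker du.
    by apply: bkerM => //; exact: bker_cst.
  have qn : 0 <= q ^+ N / (1 - q) by rewrite mulr_ge0 ?exprn_ge0 // invr_ge0 subr_ge0 ltW.
  have := norm_dint_le b2 qn M0 M0 _ hM hM du du.
  have -> : V = dint (fun x y => logsum N (kap x y) + (- ln (1 - kap x y) + (-1) * logsum N (kap x y))) u u.
    by apply: eq_dint => // x y _ _; ring.
  rewrite dintD // => h; have {h} := h _; rewrite ler_norml.
  case/(_ _)/andP; last by move=> h _; rewrite (le_trans h) // lerDr.
  by move=> x y xD yD; rewrite mulN1r; apply: ln_series_bound => //; exact: kap_le.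
rewrite leNgt; apply/negP => V0.
have : geometric (1 / (1 - q) * M * M * (mass * mass)) q @ \oo --> 0.
  by apply: cvg_geometric; rewrite ger0_norm.
move/cvgrPdist_lt => /(_ (- V)); rewrite oppr_gt0 => /(_ V0)[N _ /(_ N (leqnn _))].
rewrite sub0r normrN => /(le_lt_trans (ler_norm _)) /=.
have := low N; rewrite mul1r => h1 h2.
move: h1; rewrite lerNl leNgt => /negP; apply.
by apply: le_lt_trans h2; rewrite -subr_ge0 [X in 0 <= X](_ : _ = 0) //; ring.
Qed.

(** By [regkerE] the kernel is half of [- ln (1 - kap)] plus a function of [x] and a function of
    [y], and a charge of mean zero annihilates the last two. *)
Lemma dint_regker_ge0 f : dens D f -> \int[mu]_x f x = 0 ->
  bker (regker c) /\ 0 <= dint (regker c) f f.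
Proof.
move=> df f0.
have bh : bmeas (fun x => 2^-1 * (2^-1 * ln eps - ln (a x))).
  split.
    apply: measurable_funM => //; apply: measurable_funB => //.
    by apply: (@measurableT_comp _ _ _ _ _ _ (@ln R)) => //; exact: measurable_ln.
  exists (2^-1 * (2^-1 * `|ln eps| + (D ^+ 2 + eps + eps^-1))) => x xD.
  rewrite normrM ger0_norm ?invr_ge0 // ler_wpM2l ?invr_ge0 //.
  apply: le_trans (ler_normB _ _) _; rewrite normrM ger0_norm ?invr_ge0 // lerD2l.
  have h1 := ln_sublinear (a0 x).
  have h2 : - ln (a x) < (a x)^-1 by rewrite -lnV ?posrE // ln_sublinear // invr_gt0.
  have h3 : (a x)^-1 <= eps^-1 by rewrite lef_pV2 ?posrE // /a lerDr dot_ge0.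
  have h4 := aD xD; have h5 : 0 < eps^-1 by rewrite invr_gt0.
  have h6 := a0 x.
  by rewrite ler_norml; apply/andP; split; lra.
set h := (fun x => _) in bh.
have b1 : bmeas (fun _ => 1) by split; [exact: measurable_cst|exists 1 => x _; rewrite normr1].
have bb1 : bker (fun x y => h x * 1) by exact: (bker_mul bh b1).
have bb2 : bker (fun x y => 1 * h y) by exact: (bker_mul b1 bh).
have bl : bker (fun x y => 2^-1 * (- ln (1 - kap x y))).
  by apply: bkerM; [exact: bker_cst|exact: lnkap_bker df].
have -> : regker c = (fun x y => 2^-1 * (- ln (1 - kap x y)) + (h x * 1 + 1 * h y)).
  by apply/funext => x; apply/funext => y; rewrite regkerE mulr1 mul1r.
split; first by apply: bkerD => //; exact: bkerD.
rewrite dintD //; last exact: bkerD.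
rewrite dintD // dintZ //; last exact: lnkap_bker df.
have dhf : dens D (fun x => h x * f x) by case: bh => mh [H hH]; apply: densM => //; exists H.
have d1f : dens D (fun x => 1 * f x) by under eq_fun do rewrite mul1r.
have mul1K (k : R * R -> R * R -> R) : k = (fun x y => k x y * 1).
  by apply/funext => x; apply/funext => y; rewrite mulr1.
rewrite [X in dint X f f + _](mul1K) (dint_mul (K := fun _ _ => 1)) //; last exact: bker_cst.
rewrite [X in _ + dint X f f](mul1K) (dint_mul (K := fun _ _ => 1)) //; last exact: bker_cst.
rewrite !dint1 //.
have z : \int[mu]_x (1 * f x) = 0 by under eq_Rintegral do rewrite mul1r.
by rewrite z mulr0 mul0r !addr0 mulr_ge0 ?invr_ge0 // lnkap_ge0.
Qed.

End Regularized.

(** Regularization changes the energy by an amount linear in [c], so a negative energy would stay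
    negative for small [c]. *)
Lemma energy_mean0_ge0 f : dens D f -> \int[mu]_x f x = 0 -> 0 <= energy mu f f.
Proof.
move=> df f0; have [M M0 hM] := dens_bound df.
have J0 : 0 <= jmass mu A by rewrite addr_ge0 // mulr_ge0.
rewrite leNgt; apply/negP => E0.
pose B := 2 * M * jmass mu A * M * mass + 1.
have B0 : 0 < B by rewrite ltr_wpDl // !mulr_ge0.
(* [c * B] is minus the energy, whereas the regularization error is at most [c * (B - 1)]. *)
pose c := - energy mu f f / B.
have c0 : 0 < c by rewrite divr_gt0 // oppr_gt0.
have [bk] := dint_regker_ge0 c0 df f0.
rewrite dint_iterated //.
have dp : dens D (fun x => pot mu f x * f x) by exact: (dens_pot A0 D0 mureg).
have dr : dens D (fun x => rpot mu c f x * f x).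
  apply: densM => //.
    by apply: continuous_measurable_plane; exact: continuous_rpot.
  have [_ [C C0 hC]] := bk.
  exists (C * M * mass) => x xD.
  have db : dens D (fun y => regker c x y * f y).
    apply: densM => //; first exact: measurable_regker1.
    by exists C => y yD; exact: hC.
  have CM : 0 <= C * M by rewrite mulr_ge0.
  apply: (dens_norm_integral A0 mureg CM db) => y.
  have [yD|Dy] := leP (enorm y) D; first by rewrite normrM ler_pM // hC.
  by have -> : f y = 0; [case: df => _ _; apply|rewrite mulr0 normr0].
have : `|\int[mu]_x (pot mu f x * f x - rpot mu c f x * f x)| <= 2 * c * M * jmass mu A * M * mass.
  apply: (dens_norm_integral A0 mureg).
  - by rewrite mulr_ge0 // mulr_ge0 // mulr_ge0 // mulr_ge0 // ltW.
  - have := densD dp (densZ (-1) dr); congr (dens D _); apply/funext => x; ring.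
  move=> x; rewrite -mulrBl normrM ler_pM // ; exact: (pot_regpot_le A0 D0 mureg).
rewrite RintegralB //; [|exact: (dens_integrable A0 mureg dp)|exact: (dens_integrable A0 mureg dr)].
rewrite -/(energy mu f f) => h1 h2.
have := ler_norm (- (energy mu f f - \int[mu]_x (rpot mu c f x * f x))); rewrite normrN => h3.
have h4 : 2 * c * M * jmass mu A * M * mass < - energy mu f f.
  have -> : - energy mu f f = c * B by rewrite /c divfK // gt_eqF.
  have -> : c * B = 2 * c * M * jmass mu A * M * mass + c by rewrite /B; ring.
  by rewrite ltrDl.
have := le_lt_trans (le_trans h3 h1) h4; rewrite opprB ltrBlDr addNr.
by rewrite ltNge h2.
Qed.

End EnergyMeanZero.

(** * Energy on sets of capacity less than one *)

(* The four points [z + h i^k] satisfy [prod_k |z + h i^k| = |z^4 - h^4|]. *)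
Lemma four_points_logker (R : realType) (x y : R * R) (h r : R) :
  0 < h -> h < r -> r <= enorm (x - y) ->
  - (h ^+ 4 / r ^+ 4) <=
  logker (x + (h, 0)) y + logker (x - (h, 0)) y + logker (x + (0, h)) y
  + logker (x - (0, h)) y - 4 * logker x y.
Proof.
move=> h0 hr rxy; have r0 : 0 < r by exact: lt_trans hr.
have pos d : enorm d = h -> 0 < dot (x + d - y) (x + d - y).
  move=> dh; rewrite dot_gt0 -enorm_gt0.
  have := ler_enormB (x - y) (- d); rewrite enormN dh opprK addrAC ler_norml => /andP[_].
  by apply: lt_le_trans; rewrite subr_gt0 (lt_le_trans hr).
have nh (d : R * R) : dot d d = h ^+ 2 -> enorm d = h.
  by move=> dd; rewrite /enorm dd sqrtr_sqr gtr0_norm.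
have e1 : dot (h, 0) (h, 0) = h ^+ 2 by rewrite /dot /=; ring.
have e2 : dot (0, h) (0, h) = h ^+ 2 by rewrite /dot /=; ring.
have p1 := pos _ (nh _ e1); have p3 := pos _ (nh _ e2).
have p2 := pos (- (h, 0)); rewrite enormN (nh _ e1) in p2; have {}p2 := p2 erefl.
have p4 := pos (- (0, h)); rewrite enormN (nh _ e2) in p4; have {}p4 := p4 erefl.
rewrite !logkerE.
have D0 : 0 < dot (x - y) (x - y).
  by rewrite -sqr_enorm exprn_gt0 // (lt_le_trans r0).
have rD : r ^+ 4 <= dot (x - y) (x - y) ^+ 2.
  by rewrite -sqr_enorm -exprM lerXn2r // nnegrE ?enorm_ge0 // ltW.
have r4 : 0 < r ^+ 4 by rewrite exprn_gt0.
have h4 : 0 < h ^+ 4 by rewrite exprn_gt0.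
(* Square of [|z ^ 4 - h ^ 4| <= |z| ^ 4 + h ^ 4] for the complex number [z = x - y]; the two sides
   differ by [4 * h ^ 4 * (Re (z ^ 2)) ^ 2]. *)
have main : dot (x + (h, 0) - y) (x + (h, 0) - y) * dot (x - (h, 0) - y) (x - (h, 0) - y)
    * (dot (x + (0, h) - y) (x + (0, h) - y) * dot (x - (0, h) - y) (x - (0, h) - y))
    <= (dot (x - y) (x - y) ^+ 2 + h ^+ 4) ^+ 2.
  rewrite -subr_ge0.
  set a := x.1 - y.1; set b := x.2 - y.2.
  have -> : (dot (x - y) (x - y) ^+ 2 + h ^+ 4) ^+ 2 -
     dot (x + (h, 0) - y) (x + (h, 0) - y) * dot (x - (h, 0) - y) (x - (h, 0) - y)
    * (dot (x + (0, h) - y) (x + (0, h) - y) * dot (x - (0, h) - y) (x - (0, h) - y))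
    = 4 * h ^+ 4 * (a ^+ 2 - b ^+ 2) ^+ 2.
    by rewrite /dot /= /a /b; ring.
  by rewrite mulr_ge0 ?sqr_ge0 // mulr_ge0 // ltW.
have lnmain := main.
rewrite -ler_ln ?posrE ?exprn_gt0 ?addr_gt0 ?mulr_gt0 ?exprn_gt0 // in lnmain.
move: lnmain; rewrite lnM ?posrE ?mulr_gt0 // lnM ?posrE // lnM ?posrE //.
rewrite lnXn ?addr_gt0 ?exprn_gt0 // mulr2n.
have -> : dot (x - y) (x - y) ^+ 2 + h ^+ 4 =
    dot (x - y) (x - y) ^+ 2 * (1 + h ^+ 4 / dot (x - y) (x - y) ^+ 2).
  by field; rewrite gt_eqF.
have q0 : 0 < h ^+ 4 / dot (x - y) (x - y) ^+ 2 by rewrite divr_gt0 ?exprn_gt0.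
have D2 : 0 < dot (x - y) (x - y) ^+ 2 by rewrite exprn_gt0.
have D3 : 0 < 1 + h ^+ 4 / dot (x - y) (x - y) ^+ 2 by rewrite addr_gt0.
rewrite lnM ?posrE // lnXn // mulr2n.
have l1 : ln (1 + h ^+ 4 / dot (x - y) (x - y) ^+ 2) <= h ^+ 4 / dot (x - y) (x - y) ^+ 2.
  by apply: le_ln1Dx; apply: lt_trans q0; rewrite oppr_lt0.
have l2 : h ^+ 4 / dot (x - y) (x - y) ^+ 2 <= h ^+ 4 / r ^+ 4.
  by rewrite ler_pM2l // lef_pV2 ?posrE // exprn_gt0.
move: (le_trans l1 l2); move: (ln (1 + _)) (h ^+ 4 / r ^+ 4) => L q' Lq.
move: (ln _) (ln _) (ln _) (ln _) (ln _) => a b c d e ineq.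
by clear -Lq ineq; lra.
Qed.

(** * Linear inequalities used in the energy estimates *)

Section Arithmetic.
Variable R : realFieldType.
Implicit Types a b c d e : R.

Fact arith_max1 m a b d e :
  a + e <= b + d -> 0 <= e :> R -> d <= (a - m) / 2 -> m < a -> m < b.
Proof. by move=> *; lra. Qed.

Fact arith_max2 e q F u1 u2 u3 u4 u0 a1 a2 a3 a4 s0 : a1 + a2 + a3 + a4 = s0 + e ->
  u1 + a1 <= u0 + s0 / 4 -> u2 + a2 <= u0 + s0 / 4 -> u3 + a3 <= u0 + s0 / 4 ->
  u4 + a4 <= u0 + s0 / 4 -> - (q * F) <= u1 + u2 + u3 + u4 - 4 * u0 :> R -> e <= q * F.
Proof. by move=> *; lra. Qed.

Fact arith_max3 a b d : a + b <= d :> R -> 4 * d <= a -> 0 < b -> 0 < d -> False.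
Proof. by move=> *; lra. Qed.

Fact arith_cap1 a b c z lam D I0 : c + z <= lam + 2 * D -> a <= lam ->
  - b <= 2 * D -> 0 <= z -> lam <= I0 -> a - 2 * b + c <= 2 * I0 + 6 * D :> R.
Proof. by move=> *; lra. Qed.

Fact arith_cap2 d del e :
  2 * d + 2 * del <= - e -> - d <= e :> R -> 0 <= d -> 0 < del -> False.
Proof. by move=> *; lra. Qed.

Fact arith_cap3 T z lam D I0 : - (2 * D) <= z -> lam <= I0 -> T <= I0 ->
  T - 2 * z + lam <= 2 * I0 + 4 * D :> R.
Proof. by move=> *; lra. Qed.

Fact arith_cap4 a b z lam : - a <= 2 * (z - lam) -> a <= 2 * b -> lam - b <= z :> R.
Proof. by move=> *; lra. Qed.

Fact arith_cap5 x y z w lam del ka mm D e ke P : 0 <= x - 2 * (y - z) + lam ->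
  (1 + mm) * (lam - del * ka) <= y -> mm * (2 * D * e) <= mm * (2 * D * (del * ke)) ->
  w <= P * (del * ke) -> z <= (lam + del + 2 * D * e) * mm + w -> 0 <= lam ->
  - (2 * ((1 + mm) * ka + mm * (1 + 2 * D * ke) + P * ke) * del) <= x :> R.
Proof. by move=> *; lra. Qed.

End Arithmetic.

(** * Maximum principle, monotonicity and near-minimizers of the energy *)

Section Energy.
Context {R : realType} (mu : {finite_measure set (R * R)%type -> \bar R}) (A D : R).
Hypothesis A0 : 0 <= A.
Hypothesis D0 : 0 <= D.
Hypothesis mureg : forall (x : R * R) (r : R), 0 < r ->
  (mu [set y | (enorm (x - y) < r)%R] <= (A * r)%:E)%E.
Implicit Types (x y : R * R) (f g u v p : R * R -> R).

Let mass := fine (mu setT).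
Let mass_ge0 : 0 <= mass. Proof. by rewrite fine_ge0. Qed.
Local Notation E := (energy mu).
Let intd f (df : dens D f) := dens_integrable A0 mureg df.
Let dpot f g (df : dens D f) (dg : dens D g) := dens_pot A0 D0 mureg df dg.

Lemma energyDl f g u : dens D f -> dens D g -> dens D u ->
  E (fun x => f x + g x) u = E f u + E g u.
Proof.
move=> df dg du; rewrite /energy -RintegralD //; try (exact: (intd (dpot _ _))).
by apply: eq_Rintegral => x _; rewrite mulrDr.
Qed.

Lemma energyZl c f u : dens D f -> dens D u -> E (fun x => c * f x) u = c * E f u.
Proof.
move=> df du; rewrite /energy -RintegralZl //; try (exact: (intd (dpot _ _))).
by apply: eq_Rintegral => x _; rewrite mulrCA.
Qed.

Lemma energyDr f g u : dens D f -> dens D g -> dens D u ->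
  E u (fun x => f x + g x) = E u f + E u g.
Proof.
move=> df dg du; rewrite (energyC A0 D0 mureg du (densD df dg)).
rewrite energyDl // (energyC A0 D0 mureg df du).
by rewrite (energyC A0 D0 mureg dg du).
Qed.

Lemma energyZr c f u : dens D f -> dens D u -> E u (fun x => c * f x) = c * E u f.
Proof.
move=> df du; rewrite (energyC A0 D0 mureg du (densZ c df)).
by rewrite energyZl // (energyC A0 D0 mureg df du).
Qed.

Lemma energy_sqrD c f g : dens D f -> dens D g ->
  E (fun x => f x + c * g x) (fun x => f x + c * g x) =
  E f f + 2 * c * E f g + c ^+ 2 * E g g.
Proof.
move=> df dg; have dcg := densZ c dg; have ds := densD df dcg.
rewrite energyDl // energyDr // energyDr // energyZl // energyZl // energyZr //.
rewrite energyZr // (energyC A0 D0 mureg dg df).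
move: (E f f) (E f g) (E g g) => a b d; ring.
Qed.

Lemma integral_densD f g c : dens D f -> dens D g ->
  \int[mu]_x (f x + c * g x) = \int[mu]_x f x + c * \int[mu]_x g x.
Proof.
move=> df dg; rewrite RintegralD //; try exact: intd.
- by rewrite RintegralZl //; exact: intd.
- exact: (intd (densZ c dg)).
Qed.

(** All distances from [x] to the charge are at least 1, where [- ln] is nonpositive. *)
Lemma pot_le0 f x : dens D f -> (forall y, 0 <= f y) -> D + 1 <= enorm x ->
  pot mu f x <= 0.
Proof.
move=> df f0 Dx; rewrite -oppr_ge0 /pot.
have -> : - (\int[mu]_y (logker x y * f y)) = \int[mu]_y (- (logker x y * f y)).
  rewrite -mulN1r -RintegralZl //; last exact: (pot_integrable A0 D0 mureg).
  by apply: eq_Rintegral => y _; rewrite mulN1r.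
apply: Rintegral_ge0 => y _.
have [yD|Dy] := leP (enorm y) D; last first.
  by case: df => _ _ /(_ y Dy) ->; rewrite mulr0 oppr0.
rewrite -mulNr mulr_ge0 // /logker opprK ln_ge0 //.
have := ler_enormB x y; rewrite ler_norml => /andP[_]; apply: le_trans.
by rewrite lerBrDr (le_trans _ Dx) // addrC lerD2r.
Qed.

(** Off [K] the potential is harmonic and adding [eta * |x| ^ 2] makes it strictly subharmonic, so
    the sum has no maximum there. Harmonicity enters through the mean over four points: an error of
    fourth order in the step against a gain of second order. *)
Lemma max_principle f (K : set (R * R)) (m : R) : dens D f ->
  (forall y, 0 <= f y) -> closed K -> (forall y, ~ K y -> f y = 0) ->
  0 <= m -> (forall x, K x -> pot mu f x <= m) -> forall x, pot mu f x <= m.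
Proof.
move=> df f0 cK Kf m0 Km xs; rewrite leNgt; apply/negP => ms.
(* The box contains [xs], and also every point within distance 1 of the maximizer once the latter is
   known to have norm below [D + 1]. *)
pose L := D + 2 + enorm xs.
have L0 : 0 < L by rewrite ltr_wpDr ?enorm_ge0 // ltr_wpDl.
(* On the box [|x| ^ 2 <= 2 * L ^+ 2], so the perturbation costs at most half of the excess of the
   potential over [m]. *)
pose eta := (pot mu f xs - m) / (4 * L ^+ 2).
have L2 : 0 < 4 * L ^+ 2 by rewrite mulr_gt0 // exprn_gt0.
have eta0 : 0 < eta by rewrite divr_gt0 // subr_gt0.
pose v x := pot mu f x + eta * enorm x ^+ 2.
have cv : continuous v.
  move=> x; apply: cvgD; first exact: (continuous_pot A0 D0 mureg df).
  apply: cvgM; first exact: cvg_cst.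
  by rewrite expr2; under eq_fun do rewrite expr2; apply: cvgM; exact: continuous_enorm.
pose box : set (R * R) := `[- L, L] `*` `[- L, L].
have cbox : compact box by apply: compact_setX; exact: segment_compact.
have xsbox : box xs.
  have := ler_norm_enorm xs; rewrite prod_normE ge_max => /andP[h1 h2].
  have xL : enorm xs <= L by rewrite /L lerDr addr_ge0.
  by split; rewrite /= in_itv /= -ler_norml; apply: le_trans xL.
have [||x0 /set_mem x0box x0max] := @compact_EVT_max _ _ v box _ cbox.
- by exists xs.
- by apply: continuous_subspaceT => x; exact: cv.
have x0L : enorm x0 ^+ 2 <= 2 * L ^+ 2.
  move: x0box => -[]; rewrite /= !in_itv /= -!ler_norml => h1 h2.
  rewrite sqr_enorm /dot -!expr2 -(real_normK (num_real x0.1)) -(real_normK (num_real x0.2)).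
  by rewrite mulr_natl mulr2n lerD // ler_sqr ?nnegrE // ltW.
have big : m < pot mu f x0.
  have := x0max xs (mem_set xsbox); rewrite /v => h.
  have h1 : 0 <= eta * enorm xs ^+ 2 by rewrite mulr_ge0 ?sqr_ge0 // ltW.
  have h2 : eta * enorm x0 ^+ 2 <= (pot mu f xs - m) / 2.
    apply: (@le_trans _ _ (eta * (2 * L ^+ 2))); first by rewrite ler_pM2l.
    by rewrite -subr_ge0 [X in 0 <= X](_ : _ = 0) // /eta; field; rewrite gt_eqF.
  move: h h1 h2 ms; move: (pot mu f xs) (pot mu f x0) (eta * _) (eta * _) => a b d e.
  exact: arith_max1.
have nK : ~ K x0 by move=> /Km; rewrite leNgt big.
have x0D : enorm x0 < D + 1.
  by rewrite ltNge; apply/negP => /(pot_le0 df f0); rewrite leNgt (le_lt_trans m0).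
have [r r0 rK] : exists2 r : R, 0 < r & forall y, enorm (x0 - y) < r -> ~ K y.
  have : nbhs x0 (~` K) by move: (closed_openC cK); rewrite openE; apply.
  by move/nbhs_enorm.
have [I I0 hI] := dens_bound df.
pose F := \int[mu]_y f y.
have F0 : 0 <= F by apply: Rintegral_ge0 => y _.
(* For a small step, the quadratic term beats the error of the four-point formula. *)
pose h := Num.min (r / 2) (Num.min 1 (Num.sqrt (eta * r ^+ 4 / (F + 1)))).
have r4 : 0 < r ^+ 4 by rewrite exprn_gt0.
have F1 : 0 < F + 1 by rewrite ltr_wpDl.
have s0 : 0 < eta * r ^+ 4 / (F + 1) by rewrite divr_gt0 // mulr_gt0.
have h0 : 0 < h by rewrite !lt_min ltr01 sqrtr_gt0 s0 divr_gt0.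
have hr : h < r.
  by apply: (@le_lt_trans _ _ (r / 2)); rewrite ?ge_min ?lexx // ltr_pdivrMr // ltr_pMr // ltr1n.
have h1 : h <= 1 by rewrite !ge_min lexx orbT.
have hs : h ^+ 2 * (F + 1) <= eta * r ^+ 4.
  rewrite -ler_pdivlMr //.
  have : h <= Num.sqrt (eta * r ^+ 4 / (F + 1)) by rewrite !ge_min lexx !orbT.
  rewrite -ler_sqr ?nnegrE ?sqrtr_ge0 ?(ltW h0) // sqr_sqrtr //; exact: ltW.
have boxh (d : R * R) : `|d.1| <= 1 -> `|d.2| <= 1 -> box (x0 + d).
  move=> d1 d2; have := ler_norm_enorm x0; rewrite prod_normE ge_max => /andP[c1 c2].
  have xs0 := enorm_ge0 xs.
  split; rewrite /= in_itv /= -ler_norml; apply: le_trans (ler_normD _ _) _; rewrite /L; lra.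
have ih x := pot_integrable A0 D0 mureg x df.
pose k y := logker (x0 + (h, 0)) y + logker (x0 - (h, 0)) y + logker (x0 + (0, h)) y
    + logker (x0 - (0, h)) y - 4 * logker x0 y.
have i1 := ih (x0 + (h, 0)); have i2 := ih (x0 - (h, 0)).
have i3 := ih (x0 + (0, h)); have i4 := ih (x0 - (0, h)).
have i5 : mu.-integrable setT (EFin \o (fun y => 4 * (logker x0 y * f y))).
  exact: (integrableZl measurableT 4 (ih x0)).
have i12 := integrableD measurableT i1 i2.
have i123 := integrableD measurableT i12 i3.
have i1234 := integrableD measurableT i123 i4.
have ik : mu.-integrable setT (EFin \o (fun y => k y * f y)).
  move: (integrableB measurableT i1234 i5); apply: eq_integrable => // y _ /=.
  by rewrite -!EFinD /k; congr (_%:E); ring.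
have four : - (h ^+ 4 / r ^+ 4 * F) <= pot mu f (x0 + (h, 0)) + pot mu f (x0 - (h, 0)) +
    pot mu f (x0 + (0, h)) + pot mu f (x0 - (0, h)) - 4 * pot mu f x0.
  have -> : pot mu f (x0 + (h, 0)) + pot mu f (x0 - (h, 0)) +
      pot mu f (x0 + (0, h)) + pot mu f (x0 - (0, h)) - 4 * pot mu f x0 =
      \int[mu]_y (k y * f y).
    rewrite /pot -(RintegralZl 4 measurableT (ih x0)) -(RintegralD measurableT i1 i2).
    rewrite -(RintegralD measurableT i12 i3) -(RintegralD measurableT i123 i4).
    rewrite -(RintegralB measurableT i1234 i5).
    by apply: eq_Rintegral => y _; rewrite /k; ring.
  rewrite -mulNr /F -RintegralZl //; last exact: intd.
  apply: le_Rintegral => //.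
  - exact: (integrableZl measurableT _ (intd df)).
  move=> y _; have [/rK /Kf ->|ry] := ltP (enorm (x0 - y)) r; first by rewrite !mulr0.
  by rewrite ler_wpM2r //; exact: four_points_logker.
have vle d : box (x0 + d) -> v (x0 + d) <= v x0 by move=> b; apply: x0max; rewrite inE.
have habs : `|h| <= 1 by rewrite gtr0_norm.
have n0 : `|0 : R| <= 1 by rewrite normr0.
have nN : `|- h| <= 1 by rewrite normrN.
have v1 := vle (h, 0) (boxh (h, 0) habs n0).
have v2 := vle (- (h, 0)) (boxh (- (h, 0)) nN ltac:(by rewrite /= normrN)).
have v3 := vle (0, h) (boxh (0, h) n0 habs).
have v4 := vle (- (0, h)) (boxh (- (0, h)) ltac:(by rewrite /= normrN) nN).
have sq : enorm (x0 + (h, 0)) ^+ 2 + enorm (x0 - (h, 0)) ^+ 2 + enorm (x0 + (0, h)) ^+ 2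
    + enorm (x0 - (0, h)) ^+ 2 = 4 * enorm x0 ^+ 2 + 4 * h ^+ 2.
  by rewrite !sqr_enorm /dot /=; ring.
have key : 4 * (eta * h ^+ 2) <= h ^+ 4 / r ^+ 4 * F.
  have s4 : eta * enorm x0 ^+ 2 = (4 * (eta * enorm x0 ^+ 2)) / 4 by field.
  move: v1 v2 v3 v4 four; rewrite /v s4; apply: arith_max2.
  by rewrite -!mulrDr sq; ring.
have h2 : 0 < h ^+ 2 by rewrite exprn_gt0.
have : 4 * (eta * h ^+ 2) * r ^+ 4 <= h ^+ 4 * F.
  by apply: le_trans (ler_wpM2r (ltW r4) key) _; rewrite mulrAC divfK // gt_eqF.
have -> : h ^+ 4 * F = h ^+ 2 * (h ^+ 2 * F) by ring.
have -> : 4 * (eta * h ^+ 2) * r ^+ 4 = h ^+ 2 * (4 * (eta * r ^+ 4)) by ring.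
rewrite ler_pM2l // => h5.
have e4 : 0 < eta * r ^+ 4 by rewrite mulr_gt0.
by move: hs; rewrite mulrDr mulr1 => hs; exact: (arith_max3 hs h5 h2 e4).
Qed.

Lemma energy_sub_sqr f g : dens D f -> dens D g ->
  E (fun x => f x + -1 * g x) (fun x => f x + -1 * g x) = E f f - 2 * E f g + E g g.
Proof. by move=> df dg; rewrite energy_sqrD // sqrrN expr1n mul1r mulrN1 mulNr. Qed.

Lemma energy_lin2 e f g : dens D f -> dens D g ->
  E (fun x => e * f x + -1 * g x) (fun x => e * f x + -1 * g x) =
  e ^+ 2 * E f f - 2 * (e * E f g) + E g g.
Proof.
move=> df dg; have def := densZ e df; rewrite energy_sub_sqr //.
by rewrite (energyZl _ df def) (energyZr _ df df) (energyZl _ df dg) mulrA -expr2.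
Qed.

Lemma logker_ge x y : enorm x <= D -> enorm y <= D -> - (2 * D) <= logker x y.
Proof.
move=> xD yD; rewrite /logker lerN2.
have xy : enorm (x - y) <= 2 * D.
  have := ler_enormD x (- y); rewrite enormN => h; apply: le_trans h _.
  by rewrite mulr_natl mulr2n lerD.
have [->|n0] := eqVneq (enorm (x - y)) 0; first by rewrite ln0 // mulr_ge0.
by apply: le_trans xy; apply: ltW; apply: ln_sublinear; rewrite lt_neqAle eq_sym n0 enorm_ge0.
Qed.

(** The logarithmic kernel changes sign, but [logker + 2 * D] is nonnegative on the disc; adding
    [2 * D] times the total charge restores monotonicity. *)
Lemma pot_mono f g x : dens D f -> dens D g -> (forall y, f y <= g y) ->
  enorm x <= D ->
  pot mu f x + 2 * D * (\int[mu]_y f y) <= pot mu g x + 2 * D * (\int[mu]_y g y).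
Proof.
move=> df dg fg xD.
have ip u : dens D u -> mu.-integrable setT (EFin \o (fun y => logker x y * u y)).
  by move=> du; exact: (pot_integrable A0 D0 mureg).
have iz u : dens D u -> mu.-integrable setT (EFin \o (fun y => 2 * D * u y)).
  by move=> du; exact: (integrableZl measurableT (2 * D) (intd du)).
have isum u : dens D u -> mu.-integrable setT (EFin \o (fun y => logker x y * u y + 2 * D * u y)).
  by move=> du; exact: (integrableD measurableT (ip u du) (iz u du)).
have H u : dens D u -> pot mu u x + 2 * D * (\int[mu]_y u y) =
    \int[mu]_y (logker x y * u y + 2 * D * u y).
  move=> du; rewrite -(RintegralZl (2 * D) measurableT (intd du)) /pot.
  by rewrite -(RintegralD measurableT (ip u du) (iz u du)).
rewrite !H //; apply: le_Rintegral => //; try exact: isum.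
move=> y _; rewrite -!mulrDl; have [yD|Dy] := leP (enorm y) D.
  by rewrite ler_wpM2l // -lerBlDr sub0r logker_ge.
by case: df => _ _ /(_ y Dy) ->; case: dg => _ _ /(_ y Dy) ->.
Qed.

Let dens0 : dens D (fun=> 0).
Proof. by split => //; exists 0 => x; rewrite normr0. Qed.

Let pot0 x : pot mu (fun=> 0) x = 0.
Proof. by rewrite /pot; under eq_Rintegral do rewrite mulr0; rewrite Rintegral_cst // mul0r. Qed.

Let int0 : \int[mu]_x (fun=> 0 : R) x = 0.
Proof. by rewrite Rintegral_cst // mul0r. Qed.

Lemma pot_ge f x : dens D f -> (forall y, 0 <= f y) -> enorm x <= D ->
  - (2 * D * (\int[mu]_y f y)) <= pot mu f x.
Proof.
move=> df f0 xD; have := pot_mono dens0 df f0 xD.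
by rewrite pot0 int0 mulr0 addr0 -lerBlDr sub0r.
Qed.

Lemma energy_mono_l f g u : dens D f -> dens D g -> dens D u -> (forall y, f y <= g y) ->
  (forall y, 0 <= u y) ->
  E u f + 2 * D * (\int[mu]_y f y) * (\int[mu]_y u y) <=
  E u g + 2 * D * (\int[mu]_y g y) * (\int[mu]_y u y).
Proof.
move=> df dg du fg u0.
have iz (c : R) : mu.-integrable setT (EFin \o (fun y => c * u y)).
  exact: (integrableZl measurableT c (intd du)).
have ip v : dens D v -> mu.-integrable setT (EFin \o (fun y => pot mu v y * u y)).
  by move=> dv; exact: (intd (dpot du dv)).
rewrite -!(RintegralZl _ measurableT (intd du)) /energy.
rewrite -(RintegralD measurableT (ip f df) (iz _)) -(RintegralD measurableT (ip g dg) (iz _)).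
apply: le_Rintegral => //.
- exact: (integrableD measurableT (ip f df) (iz _)).
- exact: (integrableD measurableT (ip g dg) (iz _)).
move=> y _; rewrite -!mulrDl; have [yD|Dy] := leP (enorm y) D.
  by rewrite ler_wpM2r // pot_mono.
by case: du => _ _ /(_ y Dy) ->; rewrite !mulr0.
Qed.

Lemma energy_mono f g : dens D f -> dens D g -> (forall y, 0 <= f y) -> (forall y, f y <= g y) ->
  E f f + 2 * D * (\int[mu]_y f y) ^+ 2 <= E g g + 2 * D * (\int[mu]_y g y) ^+ 2.
Proof.
move=> df dg f0 fg.
have g0 y : 0 <= g y by exact: le_trans (fg y).
have := energy_mono_l df dg df fg f0.
have := energy_mono_l df dg dg fg g0.
rewrite (energyC A0 D0 mureg dg df) -!mulrA -!expr2 (mulrC (\int[mu]_y g y) (\int[mu]_y f y)).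
rewrite !mulrA => h1 h2; exact: le_trans h2 h1.
Qed.

(** * From probability densities to signed densities *)

Section Capacity.
Hypothesis pos_energy : forall p, dens D p -> (forall x, 0 <= p x) ->
  \int[mu]_x p x = 1 -> 0 <= E p p.

Let prob p := [/\ dens D p, forall x, 0 <= p x & \int[mu]_x p x = 1].

Lemma near_minimizer p0 (s : R) : prob p0 -> 0 < s ->
  exists2 p, prob p & forall q, prob q -> E p p <= E q q + s.
Proof.
move=> pp0 s0.
have hinf : has_inf [set E p p | p in prob].
  split; first by exists (E p0 p0); exists p0.
  by exists 0 => _ [p [dp p0' ip] <-]; exact: pos_energy.
have [_ [p pp <-] hp] := inf_adherent s0 hinf.
exists p => // q pq; apply: le_trans (ltW hp) _; rewrite lerD2r.
by apply: ge_inf; [case: hinf|exists q].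
Qed.

(** First order condition at a near-minimizer: the slack [s ^+ 2] has the size of the second order
    term, so division by [s] leaves an error of order [s]. *)
Lemma variation p v (s : R) : prob p -> dens D v -> 0 < s ->
  prob (fun x => p x + s * v x) -> (forall q, prob q -> E p p <= E q q + s ^+ 2) ->
  - (s * (1 + E v v)) <= 2 * E p v.
Proof.
move=> [dp p0 ip] dv s0 pv /(_ _ pv); rewrite energy_sqrD // => h.
have : 0 <= s * (2 * E p v + s * (1 + E v v)).
  rewrite (_ : s * _ = (E p p + 2 * s * E p v + s ^+ 2 * E v v + s ^+ 2) - E p p).
    by rewrite subr_ge0.
  by move: (E p p) (E p v) (E v v) => a b d; ring.
by rewrite pmulr_rge0 // -lerBlDr sub0r.
Qed.

Lemma energy_ge f g : dens D f -> dens D g -> (forall y, 0 <= f y) -> (forall y, 0 <= g y) ->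
  - (2 * D * (\int[mu]_y g y) * (\int[mu]_y f y)) <= E f g.
Proof.
move=> df dg f0 g0; have := energy_mono_l dens0 dg df g0 f0.
have -> : E f (fun=> 0) = 0.
  by rewrite /energy; under eq_Rintegral do rewrite pot0 mul0r; rewrite int0.
by rewrite int0 mulr0 mul0r addr0 -lerBlDr sub0r.
Qed.

Lemma integral_pot_le f g (m : R) : dens D f -> dens D g -> (forall y, 0 <= f y) ->
  (forall x, enorm x <= D -> pot mu g x <= m) -> E f g <= m * (\int[mu]_y f y).
Proof.
move=> df dg f0 hm; rewrite -(RintegralZl m measurableT (intd df)) /energy.
apply: le_Rintegral => //.
- exact: (intd (dpot df dg)).
- exact: (integrableZl measurableT m (intd df)).
move=> y _; have [yD|Dy] := leP (enorm y) D; first by rewrite ler_wpM2r // hm.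
by case: df => _ _ /(_ y Dy) ->; rewrite !mulr0.
Qed.

(* A near-minimizer [p] of the energy has potential at most its energy [lam], up to
   a small error, outside a set of small [p]-mass; removing that set, the maximum
   principle bounds the potential everywhere. *)
Lemma near_minimizer_pot p (I0 del : R) : prob p ->
  (forall q, prob q -> E p p <= E q q + (del ^+ 2) ^+ 2) -> 0 < del -> del <= 1 -> E p p <= I0 ->
  exists p1, [/\ dens D p1, forall x, 0 <= p1 x <= p x,
    \int[mu]_x p1 x <= del * ((1 + (2 * I0 + 6 * D)) / 2) &
    forall x, pot mu p x - pot mu p1 x <= E p p + del + 2 * D * \int[mu]_x p1 x].
Proof.
move=> pp pmin del0 del1 lamI; have [dp p0 ip] := pp.
have [lam lamE] : {lam | lam = E p p} by exists (E p p).
have lam0 : 0 <= lam by rewrite lamE; exact: pos_energy.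
rewrite -lamE in lamI *.
pose bad := [set x | lam + del < pot mu p x].
have cpot : continuous (pot mu p) by exact: (continuous_pot A0 D0 mureg dp).
have obad : open bad.
  rewrite (_ : bad = pot mu p @^-1` [set r | lam + del < r]) //.
  by apply: open_comp.
have mbad : measurable bad by exact: open_measurable_plane.
pose p1 x := \1_bad x * p x.
have dp1 : dens D p1 by exact: dens_indic.
have p1b x : 0 <= p1 x <= p x.
  by rewrite /p1 indicE; case: (_ \in _); rewrite ?mul1r ?mul0r lexx ?p0.
have p10 x : 0 <= p1 x by case/andP: (p1b x).
have p1p x : p1 x <= p x by case/andP: (p1b x).
have [e eE] : {e | e = \int[mu]_x p1 x} by exists (\int[mu]_x p1 x).
have e0 : 0 <= e by rewrite eE; apply: Rintegral_ge0 => x _; exact: p10.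
have e1 : e <= 1.
  rewrite eE -ip; apply: le_Rintegral => //; exact: intd.
have t0 : 0 < del ^+ 2 by rewrite exprn_gt0.
have t1 : del ^+ 2 <= 1 by rewrite exprn_ile1 // ltW.
(* The mass [e] of the bad set is redistributed proportionally to [p]. The variation has mean zero,
   and [p + del ^+ 2 * v] stays nonnegative because [del <= 1]. *)
pose v x := e * p x + -1 * p1 x.
have dep : dens D (fun x => e * p x) by exact: densZ.
have dv : dens D v by apply: densD => //; exact: densZ.
have iv : \int[mu]_x v x = 0.
  rewrite (integral_densD _ dep dp1) (RintegralZl e measurableT (intd dp)) ip -eE; ring.
have pv : prob (fun x => p x + del ^+ 2 * v x).
  split.
  - by apply: densD => //; exact: densZ.
  - move=> x; rewrite (_ : _ + _ = p x * (1 - del ^+ 2) + del ^+ 2 * (e * p x) + del ^+ 2 * (p x - p1 x)).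
      by rewrite !addr_ge0 // !mulr_ge0 ?subr_ge0 // ltW.
    by rewrite /v; ring.
  - by rewrite (integral_densD _ dp dv) iv mulr0 addr0.
have Epp1 : (lam + del) * e <= E p p1.
  rewrite (energyC A0 D0 mureg dp dp1) eE -(RintegralZl _ measurableT (intd dp1)).
  apply: le_Rintegral => //.
  - exact: (integrableZl measurableT _ (intd dp1)).
  - exact: (intd (dpot dp1 dp)).
  move=> x _; rewrite /p1 indicE; have [xb|] := boolP (x \in bad); last by rewrite mul0r !mulr0.
  by rewrite mul1r ler_wpM2r // ltW //; move: xb; rewrite inE.
(* On the bad set the potential of [p] exceeds its mean [lam] by more than [del]. *)
have Epv : E p v <= - (e * del).
  have -> : E p v = e * lam + -1 * E p p1.
    rewrite energyDr //; last exact: densZ.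
    by rewrite (energyZr _ dp dp) (energyZr _ dp1 dp) -lamE.
  by rewrite mulN1r lerBlDr addrC -lerBlDr opprK -mulrDr mulrC.
have Evv : E v v <= 2 * I0 + 6 * D.
  have -> : E v v = e ^+ 2 * lam - 2 * (e * E p p1) + E p1 p1.
    by rewrite lamE; exact: energy_lin2.
  have h1 := energy_mono dp1 dp p10 p1p; rewrite -eE ip -lamE expr1n mulr1 in h1.
  have h2 := energy_ge dp dp1 p0 p10; rewrite -eE ip mulr1 in h2.
  have h3 : e ^+ 2 * lam <= lam by rewrite ler_piMl // exprn_ile1.
  have h4 : - (e * E p p1) <= 2 * D.
    apply: (@le_trans _ _ (e * (2 * D * e))); first by rewrite -mulrN ler_wpM2l // lerNl.
    by rewrite mulrCA ler_piMr ?mulr_ge0 // mulr_ile1.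
  have h5 : 0 <= 2 * D * e ^+ 2 by rewrite mulr_ge0 ?sqr_ge0 // mulr_ge0.
  exact: arith_cap1 h1 h3 h4 h5 lamI.
(* [variation] with step [del ^+ 2] gives [2 * e * del <= del ^+ 2 * (1 + E v v)]. *)
have ebound : e <= del * ((1 + (2 * I0 + 6 * D)) / 2).
  have h := variation pp dv t0 pv pmin.
  rewrite mulrA ler_pdivlMr // -(ler_pM2l del0) mulrCA mulrC -mulrA.
  apply: (@le_trans _ _ (- (2 * E p v))); first by rewrite lerNr mulrC -mulrA -mulrN ler_pM2l // mulrC.
  rewrite lerNl; apply: le_trans h; rewrite lerN2 mulrA -expr2.
  by rewrite ler_pM2l // lerD2l.
exists p1; rewrite -eE; split => //.
(* Off [K] the density [p - p1] vanishes: the point is bad or outside the disc. On [K] subtracting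
   [p1] raises the potential by at most [2 * D * e], by [pot_ge]. *)
pose K := [set x | pot mu p x <= lam + del] `&` [set x | enorm x <= D].
have cK : closed K.
  apply: closedI.
    rewrite (_ : [set _ | _] = pot mu p @^-1` [set r | r <= lam + del]) //.
    by apply: closed_comp.
  rewrite (_ : [set _ | _] = (@enorm R) @^-1` [set r | r <= D]) //.
  by apply: closed_comp => //; move=> x _; exact: continuous_enorm.
pose p' x := p x + -1 * p1 x.
have dp' : dens D p' by apply: densD => //; exact: densZ.
have potp' x : pot mu p' x = pot mu p x - pot mu p1 x.
  rewrite (potD A0 D0 mureg x dp (densZ (-1) dp1)) (potZ A0 D0 mureg) //.
  by rewrite mulN1r.
move=> x; rewrite -potp'; apply: (max_principle dp' _ cK).
- by move=> y; rewrite /p' mulN1r subr_ge0.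
- move=> y /not_andP[|] /negP; rewrite -ltNge => h.
    rewrite /p' /p1 indicE mem_set //=; ring.
  by case: dp' => _ _; apply.
- by rewrite !addr_ge0 ?mulr_ge0 // ltW.
- move=> y [yl yD]; rewrite potp' lerD // lerNl eE; exact: pot_ge.
Qed.

(** [sg - p] has mean zero, whence [E sg sg >= 2 * E sg p - E p p]. The near-minimizer [p] has a
    nearly constant potential [lam = E p p] as far as the bounds require, so [E sg p] is at least
    about [lam], [sg] having unit charge. What remains is [lam >= 0] up to an error linear in
    [del]. *)
Lemma energy_mean1_ge0 sg : dens D sg -> \int[mu]_x sg x = 1 -> 0 <= E sg sg.
Proof.
move=> dsg isg; have [M M0 hM] := dens_bound dsg.
have [msg _ sg0] := dsg.
pose sp x := 2^-1 * (`|sg x| + sg x); pose sm x := 2^-1 * (`|sg x| - sg x).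
have sp0 x : 0 <= sp x by rewrite mulr_ge0 ?invr_ge0 // -lerBlDr sub0r -normrN ler_norm.
have sm0 x : 0 <= sm x by rewrite mulr_ge0 ?invr_ge0 // subr_ge0 ler_norm.
have spm x : sg x = sp x + -1 * sm x by rewrite /sp /sm; field.
have dabs : dens D (fun x => `|sg x|).
  split; first exact: measurableT_comp.
    by exists M => x; rewrite normr_id.
  by move=> x Dx; rewrite sg0 // normr0.
have dsp : dens D sp by apply: densZ; exact: densD.
have dsm : dens D sm.
  apply: densZ; apply: densD => //.
  by under eq_fun do rewrite -mulN1r; exact: densZ.
have smM x : `|sm x| <= M.
  rewrite ger0_norm // ler_pdivrMl // mulr_natl mulr2n lerD //.
  by apply: le_trans (hM x); rewrite -normrN ler_norm.
have [mp mpE] : {r | r = \int[mu]_x sp x} by exists (\int[mu]_x sp x).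
have [mm mmE] : {r | r = \int[mu]_x sm x} by exists (\int[mu]_x sm x).
have mm0 : 0 <= mm by rewrite mmE; apply: Rintegral_ge0 => x _; exact: sm0.
have sgE : sg = (fun x => sp x + -1 * sm x) by apply/funext.
have mpm : mp - mm = 1.
  by rewrite mpE mmE -isg sgE (integral_densD _ dsp dsm) mulN1r.
have mp0 : 0 < mp by rewrite -[mp](subrK mm) mpm ltr_wpDr.
pose tau x := mp^-1 * sp x.
have dtau : dens D tau by exact: densZ.
have ptau : prob tau.
  split => // [x|]; first by rewrite mulr_ge0 // invr_ge0 ltW.
  by rewrite (RintegralZl _ measurableT (intd dsp)) -mpE mulVf // gt_eqF.
have [_ tau0 itau] := ptau.
have [T TE] : {r | r = E tau tau} by exists (E tau tau).
have T0 : 0 <= T by rewrite TE; exact: pos_energy.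
pose I0 := T + 1.
pose P := 2 * M * jmass mu A + (D + D) * M * mass.
have P0 : 0 <= P.
  by rewrite addr_ge0 // !mulr_ge0 // ?addr_ge0 // mulr_ge0.
pose ke := (1 + (2 * I0 + 6 * D)) / 2.
have ke0 : 0 <= ke by rewrite divr_ge0 // !addr_ge0 ?mulr_ge0 // addr_ge0.
pose ka := (1 + (2 * I0 + 4 * D)) / 2.
have ka0 : 0 <= ka by rewrite divr_ge0 // !addr_ge0 ?mulr_ge0 // addr_ge0.
pose C := 2 * (mp * ka + mm * (1 + 2 * D * ke) + P * ke).
have C0 : 0 <= C.
  rewrite mulr_ge0 // !addr_ge0 // mulr_ge0 ?(ltW mp0) //.
  by rewrite addr_ge0 // mulr_ge0 // mulr_ge0.
suff main del : 0 < del -> del <= 1 -> - (C * del) <= E sg sg.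
  rewrite leNgt; apply/negP => E0.
  pose del := Num.min 1 (- E sg sg / (2 * (C + 1))).
  have C1 : 0 < 2 * (C + 1) by rewrite mulr_gt0 // ltr_wpDl.
  have del0 : 0 < del by rewrite lt_min ltr01 divr_gt0 // oppr_gt0.
  have del1 : del <= 1 by rewrite ge_min lexx.
  have del2 : del * (2 * (C + 1)) <= - E sg sg.
    by rewrite -ler_pdivlMr // ge_min lexx orbT.
  have Cd : 0 <= C * del by rewrite mulr_ge0 // ltW.
  have del3 : 2 * (C * del) + 2 * del <= - E sg sg.
    by apply: le_trans del2; rewrite le_eqVlt; apply/orP; left; apply/eqP; ring.
  exact: (arith_cap2 del3 (main _ del0 del1) Cd del0).
move=> del0 del1.
have d20 : 0 < del ^+ 2 by rewrite exprn_gt0.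
have d40 : 0 < (del ^+ 2) ^+ 2 by rewrite exprn_gt0.
have d21 : del ^+ 2 <= del by rewrite expr2 ler_piMl // ltW.
have [p pp pmin] := near_minimizer ptau d40.
have [dp p0 ip] := pp.
have [lam lamE] : {r | r = E p p} by exists (E p p).
have lam0 : 0 <= lam by rewrite lamE; exact: pos_energy.
have lamI : lam <= I0.
  rewrite lamE; apply: le_trans (pmin _ ptau) _; rewrite -TE lerD2l.
  by rewrite exprn_ile1 ?(ltW d20) // (le_trans d21).
have lamI' : E p p <= I0 by rewrite -lamE.
have [p1 [dp1 p1b ep1 potb]] := near_minimizer_pot pp pmin del0 del1 lamI'.
have [e eE] : {r | r = \int[mu]_x p1 x} by exists (\int[mu]_x p1 x).
rewrite -eE -/ke in ep1; rewrite -lamE -eE in potb.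
have p10 x : 0 <= p1 x by case/andP: (p1b x).
have e0 : 0 <= e by rewrite eE; apply: Rintegral_ge0 => x _; exact: p10.
(* Lower bound for the positive part: moving from [p] towards [tau] can hardly decrease the
   energy. *)
have Etp : lam - del * ka <= E tau p.
  pose v x := 1 * tau x + -1 * p x.
  have dv : dens D v by apply: densD; exact: densZ.
  have pv : prob (fun x => p x + del ^+ 2 * v x).
    split.
    - by apply: densD => //; exact: densZ.
    - move=> x; rewrite (_ : _ + _ = (1 - del ^+ 2) * p x + del ^+ 2 * tau x).
        by rewrite addr_ge0 // mulr_ge0 // ?subr_ge0 ?(le_trans d21) // ltW.
      by rewrite /v; ring.
    - rewrite (integral_densD _ dp dv) (integral_densD _ (densZ 1 dtau) dp).
      by rewrite (RintegralZl _ measurableT (intd dtau)) itau ip; ring.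
  have := variation pp dv d20 pv pmin.
  rewrite energy_lin2 // -lamE -TE.
  have -> : E p v = E tau p - lam.
    rewrite (energyDr (densZ 1 dtau) (densZ (-1) dp) dp) (energyZr _ dtau dp) (energyZr _ dp dp).
    by rewrite (energyC A0 D0 mureg dp dtau) mul1r mulN1r -lamE.
  have := energy_ge dtau dp tau0 p0; rewrite itau ip !mulr1 expr1n !mul1r.
  move: (E tau p) => z z1 z2.
  have z3 : T - 2 * z + lam <= 2 * I0 + 4 * D by apply: arith_cap3 z1 lamI _; rewrite /I0 lerDl.
  have z4 : - (del ^+ 2 * (1 + (2 * I0 + 4 * D))) <= 2 * (z - lam).
    by apply: le_trans z2; rewrite lerN2 ler_pM2l // lerD2l.
  have z5 : del ^+ 2 * (1 + (2 * I0 + 4 * D)) <= 2 * (del * ka).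
    rewrite /ka (_ : 2 * (del * (_ / 2)) = del * (1 + (2 * I0 + 4 * D))); last by field.
    by rewrite ler_wpM2r // !addr_ge0 ?mulr_ge0 // addr_ge0.
  exact: arith_cap4 z4 z5.
(* Upper bound for the negative part: [near_minimizer_pot] controls the potential of [p - p1], and
   the small charge [p1] is estimated crudely. *)
have Esp : E sm p <= (lam + del + 2 * D * e) * mm + P * e.
  pose p' x := p x + -1 * p1 x.
  have dp' : dens D p' by apply: densD => //; exact: densZ.
  have -> : E sm p = E sm p' + E sm p1.
    rewrite (energyDr dp (densZ (-1) dp1) dsm) (energyZr _ dp1 dsm).
    by rewrite mulN1r subrK.
  apply: lerD.
    rewrite mmE; apply: integral_pot_le => // x xD.
    rewrite (potD A0 D0 mureg x dp (densZ (-1) dp1)) (potZ A0 D0 mureg) //.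
    by rewrite mulN1r.
  rewrite (energyC A0 D0 mureg dsm dp1) eE; apply: integral_pot_le => // x xD.
  apply: le_trans (ler_norm _) _; apply: le_trans (norm_pot_le A0 D0 mureg x dsm M0 smM) _.
  by rewrite lerD2l // ler_wpM2r // ler_wpM2r // lerD2r.
have Esg : E sg p = mp * E tau p - E sm p.
  have {1}-> : sg = (fun x => mp * tau x + -1 * sm x).
    by apply/funext => x; rewrite spm /tau (mulrA mp) divff ?gt_eqF // mul1r.
  rewrite (energyDl (densZ mp dtau) (densZ (-1) dsm) dp) (energyZl _ dtau dp).
  by rewrite (energyZl _ dsm dp) mulN1r.
have : 0 <= E sg sg - 2 * E sg p + E p p.
  rewrite -energy_sub_sqr //; apply: (energy_mean0_ge0 A0 D0 mureg).
    by apply: densD => //; exact: densZ.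
  by rewrite (integral_densD _ dsg dp) isg ip mulN1r subrr.
rewrite Esg -lamE => fin.
have mpe : mp = 1 + mm by rewrite -mpm subrK.
have f1 : (1 + mm) * (lam - del * ka) <= mp * E tau p by rewrite -mpe ler_pM2l.
have f2 : mm * (2 * D * e) <= mm * (2 * D * (del * ke)).
  by rewrite ler_wpM2l // ler_wpM2l // mulr_ge0.
have f3 : P * e <= P * (del * ke) by rewrite ler_wpM2l.
rewrite /C [in X in - (_ * (X * _ + _ + _) * _)]mpe.
exact: arith_cap5 fin f1 f2 f3 Esp lam0.
Qed.

Lemma energy_ge0 sg : dens D sg -> 0 <= E sg sg.
Proof.
move=> dsg; have [m0|m0] := eqVneq (\int[mu]_x sg x) 0.
  exact: (energy_mean0_ge0 A0 D0 mureg).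
pose m := \int[mu]_x sg x.
have dn := densZ m^-1 dsg.
have := energy_mean1_ge0 dn; rewrite (RintegralZl _ measurableT (intd dsg)) -/m mulVf //.
move=> /(_ erefl); rewrite energyZl // energyZr // mulrA.
by rewrite pmulr_rge0 // -expr2 lt_def sqr_ge0 sqrf_eq0 invr_eq0 m0.
Qed.

End Capacity.

End Energy.

(** * Charges on families of segments *)

Section SegmentMeasure.
Context {R : realType}.
Local Notation leb := (@lebesgue_measure R).
Local Notation segment := ((R * R) * (R * R))%type.
Local Notation I01 := (`[0, 1]%classic : set R).
Implicit Type e : segment.

Definition seg e (t : R) : R * R := e.1 + t *: e.2.

Lemma continuous_seg e : continuous (seg e).
Proof.
by move=> t; apply: cvgD; [exact: cvg_cst|apply: cvgZr_tmp; exact: cvg_id].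
Qed.

Lemma measurable_seg e : measurable_fun setT (seg e).
Proof.
have -> : seg e = (fun t => (e.1.1 + t * e.2.1, e.1.2 + t * e.2.2)) by [].
by apply/measurable_fun_pairP; split; rewrite /comp /=; apply: measurable_funD => //;
  exact: measurable_funM.
Qed.

(* The Borel structure carrying [lebesgue_measure] is a synonym of the canonical one. *)
Lemma measurable_fun_leb d (T : measurableType d) (f : R -> T) :
  measurable_fun setT f -> measurable_fun (setT : set (measurableTypeR R)) f.
Proof. by move=> mf _ A mA; exact: (mf measurableT A mA). Qed.

Lemma measurable_fun_segleb d (T : measurableType d) (f : R * R -> T) e
    (D : set (measurableTypeR R)) :
  measurable_fun setT f -> measurable_fun D (fun t => f (seg e t)).
Proof.
move=> mf; apply: measurable_funTS; apply: measurable_fun_leb.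
exact: (measurableT_comp mf (measurable_seg e)).
Qed.

Definition segm1 e (A : set (R * R)) : \bar R := leb (seg e @^-1` A `&` I01).

Let mpre e A : measurable A -> measurable (seg e @^-1` A).
Proof.
by move=> mA; rewrite -[X in measurable X]setTI; apply: measurable_seg.
Qed.

Let segm10 e : segm1 e set0 = 0%E.
Proof. by rewrite /segm1 preimage_set0 set0I measure0. Qed.

Let segm1_ge0 e A : (0 <= segm1 e A)%E.
Proof. exact: measure_ge0. Qed.

Let segm1_sigma_additive e : semi_sigma_additive (segm1 e).
Proof.
move=> F mF tF mUF; rewrite /segm1 preimage_bigcup setI_bigcupl.
apply: measure_semi_sigma_additive.
- by move=> n; apply: measurableI => //; exact: mpre.
- apply/trivIsetP => /= i j _ _ ij; rewrite setIACA setIid -preimage_setI.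
  by move/trivIsetP : tF => /(_ _ _ Logic.I Logic.I ij) ->; rewrite preimage_set0 set0I.
- rewrite -setI_bigcupl -preimage_bigcup; apply: measurableI => //; exact: mpre.
Qed.

HB.instance Definition _ e := isMeasure.Build _ _ _ (segm1 e)
  (segm10 e) (segm1_ge0 e) (@segm1_sigma_additive e).

(** Arc length of the family, with multiplicity on overlaps; [enorm e.2] is the speed of the
    parametrization by [[0, 1]]. *)
Definition segm (s : seq segment) : set (R * R) -> \bar R :=
  msum (fun k => mscale (NngNum (enorm_ge0 (nth 0 s k).2)) (segm1 (nth 0 s k))) (size s).

HB.instance Definition _ s := Measure.on (segm s).

Lemma segmE s A : segm s A = (\sum_(e <- s) (enorm e.2)%:E * segm1 e A)%E.
Proof. by rewrite /segm /msum (big_nth 0) big_mkord. Qed.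

Let segm1_le1 e A : measurable A -> (segm1 e A <= 1)%E.
Proof.
move=> mA; apply: (@le_trans _ _ (leb I01)).
  by apply: le_measure; rewrite ?inE //; apply: measurableI => //; exact: mpre.
by rewrite lebesgue_measure_itv /= lte_fin ltr01 oppr0 adde0.
Qed.

Let segm_fin s : fin_num_fun (segm s).
Proof.
move=> A mA; rewrite segmE; apply/sum_fin_numP => e _ _.
rewrite fin_numM // ge0_fin_numE // ; apply: le_lt_trans (segm1_le1 e mA) _.
exact: ltry.
Qed.

HB.instance Definition _ s := Measure_isFinite.Build _ _ _ (segm s) (@segm_fin s).

Lemma ge0_integral_segm1 e (f : R * R -> \bar R) : measurable_fun setT f ->
  (forall x, 0 <= f x)%E ->
  (\int[segm1 e]_x f x = \int[leb]_(t in I01) f (seg e t))%E.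
Proof.
move=> mf f0.
pose m := mrestr leb (measurable_itv `[0%R, 1%R]).
have ms := measurable_fun_leb (measurable_seg e).
have f0' : {in setT, forall x, (0 <= f x)%E} by move=> x _.
have -> : (\int[segm1 e]_x f x = \int[m]_x f (seg e x))%E.
  exact: (ge0_integral_pushforward ms m measurableT mf f0').
have mI : measurable (I01 : set (measurableTypeR R)) by [].
transitivity (\int[m]_(t in I01) f (seg e t))%E; last first.
  by apply: eq_measure_integral => A mA AI; rewrite /= /mrestr setIidl.
have := @ge0_negligible_integral _ _ _ m setT (~` (I01 : set (measurableTypeR R)))
  (fun t => f (seg e t)) (measurableC mI) measurableT
  (measurable_fun_segleb e (D := setT) mf) (fun t _ => f0 _).
rewrite setDE setCK setTI => ->//.
by rewrite /= /mrestr setICl measure0.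
Qed.

Lemma ge0_integral_segm s (f : R * R -> \bar R) : measurable_fun setT f ->
  (forall x, 0 <= f x)%E ->
  (\int[segm s]_x f x =
   \sum_(e <- s) (enorm e.2)%:E * \int[leb]_(t in I01) f (seg e t))%E.
Proof.
move=> mf f0; rewrite (ge0_integral_measure_sum _ measurableT) //.
rewrite (big_nth 0) big_mkord; apply: eq_bigr => k _.
by rewrite ge0_integral_mscale // ge0_integral_segm1.
Qed.

Definition nondeg (s : seq segment) := {in s, forall e, e.2 != 0}.

Lemma segm_Rintegral s (f : R * R -> R) : nondeg s -> measurable_fun setT f ->
  (segm s).-integrable setT (EFin \o f) ->
  {in s, forall e, leb.-integrable I01 (EFin \o (f \o seg e))} /\
  \int[segm s]_x f x = \sum_(e <- s) enorm e.2 * \int[leb]_(t in I01) f (seg e t).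
Proof.
move=> nd mf /integrableP[_ fi].
have mEf : measurable_fun setT (EFin \o f) by exact/measurable_EFinP.
have fin (w : R) (I : \bar R) : 0 < w -> (0 <= I)%E -> (w%:E * I < +oo)%E -> (I < +oo)%E.
  by move=> w0; case: I => [z| |] //; rewrite ?ltry // gt0_muley ?lte_fin.
have ie : {in s, forall e, leb.-integrable I01 (EFin \o (f \o seg e))}.
  move=> e es; apply/integrableP; split; first exact: (measurable_fun_segleb e mEf).
  move: fi; rewrite ge0_integral_segm //; last exact: measurableT_comp.
  rewrite (big_rem e es) /= => h.
  have : ((enorm e.2)%:E * \int[leb]_(t in I01) `|(f (seg e t))%:E| < +oo)%E.
    apply: le_lt_trans h; rewrite leeDl // sume_ge0 // => k _.
    by rewrite mule_ge0 ?lee_fin ?enorm_ge0 // integral_ge0.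
  have w0 : 0 < enorm e.2 by rewrite enorm_gt0 nd.
  apply: (fin _ _ w0); exact: integral_ge0.
split=> //.
have mI : measurable (I01 : set (measurableTypeR R)) by [].
rewrite /Rintegral integralE.
rewrite !ge0_integral_segm //; try exact: measurable_funepos; try exact: measurable_funeneg.
under [in RHS]eq_big_seq => e es do rewrite integralE.
have pE e : (fun t => (EFin \o f)^\+ (seg e t))%E = ((EFin \o (f \o seg e))^\+)%E.
  by apply/funext => t; rewrite !funeposE.
have nE e : (fun t => (EFin \o f)^\- (seg e t))%E = ((EFin \o (f \o seg e))^\-)%E.
  by apply/funext => t; rewrite !funenegE.
have fp e : e \in s -> (\int[leb]_(t in I01) (EFin \o f)^\+ (seg e t) \is a fin_num)%E.
  by move=> es; rewrite pE; exact: (@integrable_pos_fin_num _ _ _ _ _ mI _ (ie e es)).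
have fn e : e \in s -> (\int[leb]_(t in I01) (EFin \o f)^\- (seg e t) \is a fin_num)%E.
  by move=> es; rewrite nE; exact: (@integrable_neg_fin_num _ _ _ _ _ mI _ (ie e es)).
have sumE (g : segment -> \bar R) : {in s, forall e, g e \is a fin_num} ->
   (\sum_(e <- s) (enorm e.2)%:E * g e = (\sum_(e <- s) enorm e.2 * fine (g e))%:E)%E.
  move=> hg; rewrite -sumEFin; apply: eq_big_seq => e es.
  by rewrite EFinM fineK // hg.
rewrite !sumE // -EFinB /= -sumrB; apply: eq_big_seq => e es.
rewrite -mulrBr; congr (_ * _).
rewrite -fineB ?pE ?nE // -?pE -?nE; [exact: fp|exact: fn].
Qed.

(** Parameters of two points of one segment in the disc differ by at most [2 * r / enorm e.2], which
    confines them to an interval of length [4 * r / enorm e.2]. *)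
Lemma segm_regular s (x : R * R) (r : R) : nondeg s -> 0 < r ->
  (segm s [set y | (enorm (x - y) < r)%R] <= ((4 * (size s)%:R) * r)%:E)%E.
Proof.
move=> nd r0; rewrite segmE.
have one e : e \in s -> ((enorm e.2)%:E * segm1 e [set y | (enorm (x - y) < r)%R] <= (4 * r)%:E)%E.
  move=> es; have w0 : 0 < enorm e.2 by rewrite enorm_gt0 nd.
  set B := [set y | _].
  have [[t0 [t0B _]]|emp] := pselect ((seg e @^-1` B `&` I01) !=set0); last first.
    rewrite /segm1; have -> : seg e @^-1` B `&` I01 = set0.
      by apply/seteqP; split=> // t ht; apply: emp; exists t.
    by rewrite measure0 mule0 lee_fin mulr_ge0 // ltW.
  have sub : seg e @^-1` B `&` I01 `<=` `[t0 - 2 * r / enorm e.2, t0 + 2 * r / enorm e.2].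
    move=> t [tB _]; rewrite /= in_itv /= -ler_distlC.
    rewrite ler_pdivlMr // -enormZ.
    have -> : (t0 - t) *: e.2 = (x - seg e t) - (x - seg e t0).
      by apply: injective_projections; rewrite /= /GRing.scale /=; ring.
    rewrite mulr_natl mulr2n; apply: le_trans (ler_enormD _ _) _.
    by rewrite enormN lerD // ltW.
  apply: (@le_trans _ _ ((enorm e.2)%:E * (4 * r / enorm e.2)%:E)%E).
    rewrite lee_pmul2l ?lte_fin //.
    apply: (@le_trans _ _ (leb `[t0 - 2 * r / enorm e.2, t0 + 2 * r / enorm e.2])).
      apply: le_measure; rewrite ?inE //; apply: measurableI => //; apply: mpre.
      have := @measurable_enormB1 R x measurableT `]-oo, r[%classic (measurable_itv _).
      by rewrite setTI; congr measurable; apply/seteqP; split=> y /=; rewrite in_itv.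
    rewrite lebesgue_measure_itv /=; case: ifPn => _; rewrite -?EFinD lee_fin.
      by rewrite -subr_ge0 [X in 0 <= X](_ : _ = 0) //; field; rewrite gt_eqF.
    by rewrite divr_ge0 ?mulr_ge0 // ltW.
  by rewrite -EFinM lee_fin mulrCA divff ?gt_eqF // mulr1.
rewrite big_seq; apply: (@le_trans _ _ (\sum_(e <- s | e \in s) (4 * r)%:E)%E).
  by apply: lee_sum => e es; exact: one.
rewrite -big_seq sumEFin lee_fin big_const_seq count_predT iter_addr addr0.
by rewrite -[leLHS]mulr_natr mulrAC.
Qed.

End SegmentMeasure.

(** * Probability measures given by a density *)

Section Density.
Context d (T : measurableType d) {R : realType} (mu : {finite_measure set T -> \bar R}).
Variable p : T -> R.
Hypotheses (ip : mu.-integrable setT (EFin \o p)) (p0 : forall x, 0 <= p x).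
Hypothesis p1 : \int[mu]_x p x = 1.

Let mp : measurable_fun setT (EFin \o p).
Proof. exact: measurable_int ip. Qed.

Definition density_measure (A : set T) : \bar R := (\int[mu]_(x in A) (p x)%:E)%E.

Let dens0 : density_measure set0 = 0%E.
Proof. exact: integral_set0. Qed.

Let dens_ge0 A : (0 <= density_measure A)%E.
Proof. by apply: integral_ge0 => x _; rewrite lee_fin. Qed.

Let dens_sigma_additive : semi_sigma_additive density_measure.
Proof.
move=> F mF tF mUF; rewrite /density_measure integral_bigcup //=; last first.
  exact: integrableS ip.
apply: is_cvg_nneseries_cond => n _ _; exact: dens_ge0.
Qed.

HB.instance Definition _ := isMeasure.Build _ _ _ density_measure
  dens0 dens_ge0 dens_sigma_additive.

Let dens_setT : density_measure setT = 1%E.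
Proof.
rewrite /density_measure -[LHS]fineK; last exact: (integrable_fin_num measurableT ip).
by congr EFin.
Qed.

HB.instance Definition _ := Measure_isProbability.Build _ _ _ density_measure dens_setT.

(** [F] may take the value [+oo], as the energy kernel does on the diagonal, and [G] is its real
    version. The Radon-Nikodym derivative equals [p] almost everywhere; positive and negative parts
    are integrated separately. *)
Lemma integral_density (F : T -> \bar R) (G : T -> R) : measurable_fun setT F ->
  measurable_fun setT G -> {ae mu, forall x, F x = (G x)%:E} ->
  mu.-integrable setT (EFin \o (fun x => G x * p x)) ->
  (\int[density_measure]_x F x)%E = (\int[mu]_x (G x * p x))%:E.
Proof.
move=> mF mG FG iGp.
have dom : density_measure `<< mu.
  apply/null_content_dominatesP => A mA muA0; rewrite /= /density_measure.
  apply: null_set_integral => //; exact: measurable_funTS.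
pose g := Radon_Nikodym_SigmaFinite.f density_measure mu.
have ig : mu.-integrable setT g by exact: Radon_Nikodym_SigmaFinite.f_integrable.
have gp : ae_eq mu setT g (EFin \o p).
  apply: integral_ae_eq => // A _ mA.
  by rewrite -Radon_Nikodym_SigmaFinite.f_integral.
have part (H : T -> \bar R) (K : T -> R) : measurable_fun setT H -> measurable_fun setT K ->
    (forall x, 0 <= H x)%E -> {ae mu, forall x, H x = (K x)%:E} ->
    (\int[density_measure]_x H x = \int[mu]_x (K x * p x)%:E)%E.
  move=> mH mK H0 HK.
  rewrite -(Radon_Nikodym_SigmaFinite.change_of_variables dom) //.
  apply: ae_eq_integral => //.
  - by apply: emeasurable_funM => //; exact: measurable_int ig.
  - by apply/measurable_EFinP; apply: measurable_funM => //; exact/measurable_EFinP.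
  move: HK gp; apply: filterS2 => x -> gpx _.
  by rewrite EFinM -[(p x)%:E]gpx.
rewrite integralE.
have -> := part (F^\+)%E (fun x => Num.max (G x) 0); last 4 first.
- exact: measurable_funepos.
- exact: measurable_maxr.
- by move=> x; exact: funepos_ge0.
- by move: FG; apply: filterS => x Fx; rewrite funeposE Fx -EFin_max.
have -> := part (F^\-)%E (fun x => Num.max (- G x) 0); last 4 first.
- exact: measurable_funeneg.
- by apply: measurable_maxr => //; exact: measurable_funN.
- by move=> x; exact: funeneg_ge0.
- by move: FG; apply: filterS => x Fx; rewrite funenegE Fx -EFin_max.
rewrite -[RHS]/((fine _)%:E) fineK ?integrable_fin_num // [RHS]integralE.
by congr (_ - _)%E; apply: eq_integral => x _; rewrite ?funeposE ?funenegE /= -EFin_max;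
  congr (_%:E); rewrite maxr_pMl ?p0 // mul0r ?mulNr.
Qed.

Lemma density_probability : exists nu : probability T R,
  (forall A, nu A = \int[mu]_(x in A) (p x)%:E)%E /\
  forall (F : T -> \bar R) (G : T -> R), measurable_fun setT F ->
  measurable_fun setT G -> {ae mu, forall x, F x = (G x)%:E} ->
  mu.-integrable setT (EFin \o (fun x => G x * p x)) ->
  (\int[nu]_x F x)%E = (\int[mu]_x (G x * p x))%:E.
Proof.
exists (density_measure : probability T R); split=> // F G mF mG FG iGp.
exact: integral_density.
Qed.

End Density.

Lemma measurable_set1_plane {R : realType} (x : R * R) : measurable [set x].
Proof.
have -> : [set x] = setT `&` (fun y => enorm (x - y)) @^-1` [set 0].
  apply/seteqP; split => y /=; first by move=> ->; rewrite subrr enorm0.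
  by move=> [_ /eqP]; rewrite enorm_eq0 subr_eq0 => /eqP ->.
exact: (measurable_enormB1 x).
Qed.

(** * Capacity below one and the energy of probability densities *)

Section CapacityEnergy.
Context {R : realType} (mu : {finite_measure set (R * R)%type -> \bar R}) (A D : R).
Hypotheses (A0 : 0 <= A) (D0 : 0 <= D).
Hypothesis mureg : forall (x : R * R) (r : R), 0 < r ->
  (mu [set y | (enorm (x - y) < r)%R] <= (A * r)%:E)%E.

(** [p] times [mu] is a probability measure on [S]. Were its energy negative, so would be the
    infimum in the capacity, which would then be at least [exp 0]. *)
Lemma capacity_lt1_energy (S : set (R * R)) : measurable S -> mu (~` S) = 0%E ->
  (capacity S < 1)%E -> forall p, dens D p -> (forall x, 0 <= p x) ->
  \int[mu]_x p x = 1 -> 0 <= energy mu p p.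
Proof.
move=> mS muS cap p dp p0 p1.
have ip := dens_integrable A0 mureg dp.
have [nu [nuE nuint]] := density_probability ip p0 p1.
have nuSC : nu (~` S) = 0%E.
  rewrite nuE; apply: null_set_integral => //; first exact: measurableC.
  apply: measurable_funTS; exact: measurable_int ip.
have nuS : nu S = 1%E.
  have : nu (S `|` ~` S) = (nu S + nu (~` S))%E.
    by rewrite measureU ?setICr //; exact: measurableC.
  by rewrite setUv probability_setT nuSC adde0.
have inner x : (\int[nu]_y (- lne (enorm (x - y))%:E) = (pot mu p x)%:E)%E.
  apply: nuint.
  - have -> : (fun y => - lne (enorm (x - y))%:E)%E =
        fun y => if enorm (x - y) == 0 then +oo%E else (logker x y)%:E.
      apply/funext => y; case: eqVneq => [->|xy]; first by rewrite le0_lneNy.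
      by rewrite lne_EFin // lt_def xy enorm_ge0.
    apply: measurable_fun_ifT => //; last by apply/measurable_EFinP; exact: measurable_logker1.
    by apply: measurable_fun_eqr => //; exact: measurable_enormB1.
  - exact: measurable_logker1.
  (* At [y = x] the extended kernel is [+oo] and the real one 0; this point has mass zero. *)
  - exists [set x]; split; first exact: measurable_set1_plane.
      exact: (measure_point0 A0 mureg).
    move=> y; apply: contra_notP => yx.
    have xy0 : 0 < enorm (x - y).
      by rewrite enorm_gt0 subr_eq0; apply/eqP => xy; exact: yx.
    by change (- lne (enorm (x - y))%:E = (logker x y)%:E)%E; rewrite lne_EFin.
  - exact: (pot_integrable A0 D0 mureg).
have -> : energy mu p p = fine (log_energy nu).
  rewrite /log_energy; under eq_integral do rewrite inner.
  have cp := continuous_pot A0 D0 mureg dp.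
  have mp := continuous_measurable_plane cp.
  rewrite (nuint _ (pot mu p)) //.
  - exact/measurable_EFinP.
  - by apply: aeW.
  - exact: (dens_integrable A0 mureg (dens_pot A0 D0 mureg dp dp)).
rewrite fine_ge0 // leNgt; apply/negP => nu0.
pose E := [set log_energy m | m in [set m : probability (R * R)%type R | m S = 1%E]].
have Enu : E (log_energy nu) by exists nu.
have inf0 := le_lt_trans (ereal_inf_lbound Enu) nu0.
move: cap; rewrite /capacity ltNge => /negP; apply.
by rewrite -[leLHS]expeR0 lee_expeR oppe_ge0 ltW.
Qed.

End CapacityEnergy.

Lemma Rintegral_open_unit {R : realType} (f : R -> R) :
  measurable_fun (`]0, 1[ : set R) f ->
  \int[lebesgue_measure]_(t in `[0, 1]) f t = \int[lebesgue_measure]_(t in `]0, 1[) f t.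
Proof.
move=> mf; have mEf : measurable_fun (`]0, 1[ : set R) (EFin \o f) by exact/measurable_EFinP.
have mEf' : measurable_fun (`[0, 1[ : set R) (EFin \o f).
  exact/emeasurable_fun_itv_obnd_cbndP.
by rewrite /Rintegral -integral_itv_bndo_bndc // -integral_itv_obnd_cbnd.
Qed.

(** The end points are exempt, since segments of a family may touch there. *)
Lemma eq_Rintegral_unit {R : realType} (f g : R -> R) :
  measurable_fun (`]0, 1[ : set R) f -> (forall t, 0 < t < 1 -> f t = g t) ->
  \int[lebesgue_measure]_(t in `[0, 1]) f t = \int[lebesgue_measure]_(t in `[0, 1]) g t.
Proof.
move=> mf fg; rewrite !Rintegral_open_unit //.
  by apply: eq_Rintegral => t; rewrite inE /= in_itv /= => /fg.
apply: eq_measurable_fun mf => t; rewrite inE /= in_itv /= => /fg; exact.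
Qed.

(** * Edgewise constant charges *)

Section SegmentFamily.
Context {R : realType} (I : finType) (e : I -> (R * R) * (R * R)).
Local Notation leb := (@lebesgue_measure R).
Local Notation I01 := (`[0, 1]%classic : set R).

Definition segimg (i : I) : set (R * R) := [set seg (e i) t | t in `[0, 1]].

(** Only interior points are kept apart: consecutive edges, and edges at a triple junction, share
    end points. *)
Definition almost_disjoint := forall i j t, i != j -> 0 < t < 1 -> ~ segimg j (seg (e i) t).

Hypothesis e0 : forall i, (e i).2 != 0.
Hypothesis disj : almost_disjoint.

Let ss := [seq e i | i <- enum I].
Let mu := segm ss.
Let hl i := enorm (e i).2.

Let nd : nondeg ss.
Proof. by move=> s /mapP[i _ ->]; exact: e0. Qed.

Definition famrad : R := \sum_i (enorm (e i).1 + enorm (e i).2).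

Lemma famrad_ge0 : 0 <= famrad.
Proof. by apply: sumr_ge0 => i _; rewrite addr_ge0 // enorm_ge0. Qed.

Lemma enorm_segimg i x : segimg i x -> enorm x <= famrad.
Proof.
move=> [t /=]; rewrite in_itv /= => /andP[t0 t1] <-.
rewrite /famrad (bigD1 i) //=; apply: le_trans (ler_enormD _ _) _.
rewrite enormZ -[leLHS]addr0 lerD //; last first.
  by apply: sumr_ge0 => k _; rewrite addr_ge0 // enorm_ge0.
by rewrite lerD2l ger0_norm // ler_piMl // enorm_ge0.
Qed.

Lemma compact_segimg i : compact (segimg i).
Proof.
apply: continuous_compact; last exact: segment_compact.
by apply: continuous_subspaceT; exact: continuous_seg.
Qed.

Lemma closed_segimg i : closed (segimg i).
Proof.
apply: compact_closed; last exact: compact_segimg.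
exact: norm_hausdorff.
Qed.

Let A : R := 4 * (size ss)%:R.
Let A0 : 0 <= A. Proof. by rewrite mulr_ge0. Qed.
Let mureg (x : R * R) (r : R) : 0 < r -> (mu [set y | (enorm (x - y) < r)%R] <= (A * r)%:E)%E.
Proof. exact: segm_regular. Qed.
Let D0 := famrad_ge0.

(** Unit charge on one segment, as a density with respect to the arc length of the whole family;
    shared end points are null. *)
Definition segind i : R * R -> R := \1_(segimg i).

Lemma measurable_segind i : measurable_fun setT (segind i).
Proof.
apply: measurable_indic; apply: closed_measurable_plane; exact: closed_segimg.
Qed.

Lemma dens_segind i : dens famrad (segind i).
Proof.
split; first exact: measurable_segind.
  by exists 1 => x; rewrite /segind indicE; case: (_ \in _) => /=; rewrite ?normr1 // normr0.
move=> x xD; rewrite /segind indicE memNset // => /enorm_segimg.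
by rewrite leNgt xD.
Qed.

Lemma segind_seg i j t : 0 < t < 1 -> segind i (seg (e j) t) = (i == j)%:R.
Proof.
move=> t01; rewrite /segind indicE; case: eqVneq => [->|ij].
  rewrite mem_set //; exists t => //=; rewrite in_itv /=.
  by case/andP: t01 => *; rewrite !ltW.
by rewrite memNset //; apply: disj; rewrite // eq_sym.
Qed.

Lemma Rintegral_segm_segind i (g : R * R -> R) : measurable_fun setT g ->
  mu.-integrable setT (EFin \o (fun x => g x * segind i x)) ->
  \int[mu]_x (g x * segind i x) = hl i * \int[leb]_(t in I01) g (seg (e i) t).
Proof.
move=> mg ig.
have mf : measurable_fun setT (fun x => g x * segind i x).
  by apply: measurable_funM => //; exact: measurable_segind.
have [_ ->] := segm_Rintegral nd mf ig.
rewrite big_map big_enum /= (bigD1 i) //= big1 ?addr0.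
  congr (_ * _); apply: eq_Rintegral_unit => [|t t01].
    by apply: measurable_funTS; apply: (measurableT_comp mf (measurable_seg (e i))).
  by rewrite segind_seg // eqxx mulr1.
move=> j ji; rewrite (@eq_Rintegral_unit _ _ (cst 0)) => [||t t01].
- by rewrite Rintegral_cst //= mul0r mulr0.
- by apply: measurable_funTS; apply: (measurableT_comp mf (measurable_seg (e j))).
- by rewrite segind_seg // eq_sym (negPf ji) mulr0.
Qed.

Lemma pot_segind j x :
  pot mu (segind j) x = hl j * \int[leb]_(u in I01) logker x (seg (e j) u).
Proof.
rewrite /pot Rintegral_segm_segind //; first exact: measurable_logker1.
exact: (pot_integrable A0 D0 mureg x (dens_segind j)).
Qed.

Lemma continuous_segpot j :
  continuous (fun x => hl j * \int[leb]_(u in I01) logker x (seg (e j) u)).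
Proof.
have -> : (fun x => hl j * \int[leb]_(u in I01) logker x (seg (e j) u)) = pot mu (segind j).
  by apply/funext => x; rewrite pot_segind.
exact: (continuous_pot A0 D0 mureg (dens_segind j)).
Qed.

(** Galerkin entry of the single layer operator for indicators of segments, without the factor
    [1 / (2 * pi)]. *)
Definition segV i j : R :=
  hl i * \int[leb]_(t in I01)
    (hl j * \int[leb]_(u in I01) logker (seg (e i) t) (seg (e j) u)).

Lemma energy_segind i j : energy mu (segind i) (segind j) = segV i j.
Proof.
pose g x := hl j * \int[leb]_(u in I01) logker x (seg (e j) u).
have gE x : pot mu (segind j) x = g x by rewrite pot_segind.
have ig : mu.-integrable setT (EFin \o (fun x => g x * segind i x)).
  rewrite (_ : (fun x => _) = (fun x => pot mu (segind j) x * segind i x)); last first.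
    by apply/funext => x; rewrite gE.
  exact: (dens_integrable A0 mureg (dens_pot A0 D0 mureg (dens_segind i) (dens_segind j))).
rewrite -[RHS](Rintegral_segm_segind _ ig); last first.
  exact: continuous_measurable_plane (@continuous_segpot j).
by apply: eq_Rintegral => x _; rewrite gE.
Qed.

Lemma segVC i j : segV i j = segV j i.
Proof. by rewrite -!energy_segind (energyC A0 D0 mureg) //; exact: dens_segind. Qed.

Definition segfun (s : seq I) (c : I -> R) x : R := \sum_(i <- s) c i * segind i x.

Lemma segfun_cons i s c : segfun (i :: s) c = fun x => c i * segind i x + segfun s c x.
Proof. by apply/funext => x; rewrite /segfun big_cons. Qed.

Lemma segfun_nil c : segfun [::] c = fun x => 0 * 0.
Proof. by apply/funext => x; rewrite /segfun big_nil mul0r. Qed.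

Lemma dens_cst0 : dens famrad (fun _ : R * R => 0).
Proof. by split => //; exists 0 => x; rewrite normr0. Qed.

Lemma dens_segfun s c : dens famrad (segfun s c).
Proof.
elim: s => [|i s IH]; first by rewrite segfun_nil; apply: densZ; exact: dens_cst0.
by rewrite segfun_cons; apply: densD => //; apply: densZ; exact: dens_segind.
Qed.

Lemma energy_segfun s c (f : R * R -> R) : dens famrad f ->
  energy mu (segfun s c) f = \sum_(i <- s) c i * energy mu (segind i) f.
Proof.
move=> df; elim: s => [|i s IH].
  by rewrite segfun_nil (energyZl A0 D0 mureg) ?mul0r ?big_nil //; exact: dens_cst0.
rewrite segfun_cons big_cons -IH (energyDl A0 D0 mureg) //; last 2 first.
- exact: densZ (dens_segind i).
- exact: dens_segfun.
by rewrite (energyZl A0 D0 mureg) //; exact: dens_segind.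
Qed.

Definition segQ (c d : I -> R) : R := \sum_i \sum_j c i * d j * segV i j.

Lemma energy_segfun2 c d :
  energy mu (segfun (index_enum I) c) (segfun (index_enum I) d) = segQ c d.
Proof.
rewrite energy_segfun; last exact: dens_segfun.
apply: eq_bigr => i _; rewrite (energyC A0 D0 mureg); [|exact: dens_segind|exact: dens_segfun].
rewrite energy_segfun; last exact: dens_segind.
rewrite mulr_sumr; apply: eq_bigr => j _.
by rewrite energy_segind segVC mulrA.
Qed.

Lemma integral_segfun s c : \int[mu]_x segfun s c x = \sum_(i <- s) c i * hl i.
Proof.
have m1 : measurable_fun setT (fun _ : R * R => 1 : R) by [].
elim: s => [|i s IH].
  by rewrite segfun_nil mul0r Rintegral_cst // mul0r big_nil.
rewrite segfun_cons big_cons RintegralD //.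
- rewrite RintegralZl //; last exact: (dens_integrable A0 mureg (dens_segind i)).
  rewrite IH; congr (c i * _ + _).
  have := @Rintegral_segm_segind i (cst 1) m1.
  rewrite /= Rintegral_cst //= lebesgue_measure_itv /= lte01 oppr0 adde0 /= mulr1 mulr1 => <-.
    by apply: eq_Rintegral => x _; rewrite mul1r.
  rewrite (_ : (fun x => _) = segind i); last by apply/funext => x; rewrite mul1r.
  exact: (dens_integrable A0 mureg (dens_segind i)).
- exact: (dens_integrable A0 mureg (densZ _ (dens_segind i))).
- exact: (dens_integrable A0 mureg (dens_segfun s c)).
Qed.

Lemma segQ_mean0_ge0 c : \sum_i c i * hl i = 0 -> 0 <= segQ c c.
Proof.
move=> c0; rewrite -energy_segfun2; apply: (energy_mean0_ge0 A0 D0 mureg).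
  exact: dens_segfun.
by rewrite integral_segfun.
Qed.

Lemma segQ_capacity_ge0 (S : set (R * R)) c : measurable S ->
  (forall i, segimg i `<=` S) -> (capacity S < 1)%E -> 0 <= segQ c c.
Proof.
move=> mS sS cap; rewrite -energy_segfun2; apply: (energy_ge0 A0 D0 mureg).
  apply: (capacity_lt1_energy A0 D0 mureg mS) => //.
  rewrite [LHS]segmE big1_seq // => s /= /mapP[i _ ->].
  rewrite /segm1 [X in leb X](_ : _ = set0) ?measure0 ?mule0 //.
  apply/seteqP; split => // t [/= nS t01]; apply: nS; apply: (sS i).
  by exists t.
exact: dens_segfun.
Qed.

End SegmentFamily.

(** * Strict positivity on charges of mean zero *)

Section Strict.
Context {R : realType}.
Local Notation leb := (@lebesgue_measure R).
Local Notation I01 := (`[0, 1]%classic : set R).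

Lemma integrable_I01 (f : R -> R) : {within I01, continuous f} -> leb.-integrable I01 (EFin \o f).
Proof. by move=> cf; apply: continuous_compact_integrable => //; exact: segment_compact. Qed.

Let mI : measurable (I01 : set (measurableTypeR R)). Proof. by []. Qed.

Lemma integrable_cst01 (k : R) : leb.-integrable I01 (EFin \o cst k).
Proof. by apply: integrable_I01; apply: continuous_subspaceT => x; exact: cvg_cst. Qed.

Lemma Rintegral_cst01 (k : R) : \int[leb]_(t in I01) k = k.
Proof. by rewrite Rintegral_cst //= lebesgue_measure_itv /= lte01 oppr0 adde0 /= mulr1. Qed.

Lemma Rintegral01_le (f : R -> R) (k : R) : leb.-integrable I01 (EFin \o f) ->
  (forall t, 0 <= t <= 1 -> f t <= k) -> \int[leb]_(t in I01) f t <= k.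
Proof.
move=> fi fk; rewrite -[leRHS]Rintegral_cst01; apply: le_Rintegral => //; exact: integrable_cst01.
Qed.

Lemma Rintegral01_ge (f : R -> R) (k : R) : leb.-integrable I01 (EFin \o f) ->
  (forall t, 0 <= t <= 1 -> k <= f t) -> k <= \int[leb]_(t in I01) f t.
Proof.
move=> fi fk; rewrite -[leLHS]Rintegral_cst01; apply: le_Rintegral => //; exact: integrable_cst01.
Qed.

Lemma Rintegral01_norm (f : R -> R) (k : R) : leb.-integrable I01 (EFin \o f) ->
  (forall t, 0 <= t <= 1 -> `|f t| <= k) -> `|\int[leb]_(t in I01) f t| <= k.
Proof.
move=> fi fk; rewrite ler_norml Rintegral01_le ?andbT.
- by apply: Rintegral01_ge => // t /fk; rewrite ler_norml => /andP[].
- by [].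
- by move=> t /fk; rewrite ler_norml => /andP[].
Qed.

Lemma integrable_sum01 (J : Type) (s : seq J) (c : J -> R) (f : J -> R -> R) :
  (forall j, leb.-integrable I01 (EFin \o f j)) ->
  leb.-integrable I01 (EFin \o (fun t => \sum_(j <- s) c j * f j t)) /\
  \int[leb]_(t in I01) (\sum_(j <- s) c j * f j t) =
  \sum_(j <- s) c j * \int[leb]_(t in I01) f j t.
Proof.
move=> fi; elim: s => [|j s [IHi IH]].
  rewrite (_ : (fun t => _) = cst 0); last by apply/funext => t; rewrite big_nil.
  by rewrite big_nil Rintegral_cst01; split => //; exact: integrable_cst01.
have jZ : leb.-integrable I01 (EFin \o (fun t => c j * f j t)).
  have := integrableZl mI (c j) (fi j).
  by apply: eq_integrable => // t _.
rewrite (_ : (fun t => _) = (fun t => c j * f j t + \sum_(k <- s) c k * f k t)); last first.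
  by apply/funext => t; rewrite big_cons.
split.
  have := integrableD mI jZ IHi.
  by apply: eq_integrable => // t _.
by rewrite RintegralD // RintegralZl // IH big_cons.
Qed.

Lemma quadratic_ge0_linear0 (b q : R) : (forall s, 0 <= 2 * s * b + s ^+ 2 * q) -> b = 0.
Proof.
move=> h; apply/eqP; rewrite -[_ == _]negbK; apply/negP => b0.
have Q0 : 0 < `|q| + 1 by rewrite ltr_wpDl.
have := h (- b / (`|q| + 1)).
have -> : 2 * (- b / (`|q| + 1)) * b + (- b / (`|q| + 1)) ^+ 2 * q =
   (b / (`|q| + 1)) ^+ 2 * (q - 2 * (`|q| + 1)) by field; rewrite gt_eqF.
rewrite pmulr_rge0; last by rewrite exprn_even_gt0 //= mulf_neq0 // invr_eq0 gt_eqF.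
have := ler_norm q; lra.
Qed.

Lemma ln_norm_le2 (x : R) : `|x - 1| <= 2^-1 -> `|ln x| <= 2 * `|x - 1|.
Proof.
move=> hx; have /andP[x1 x2] : 2^-1 <= x <= 3 / 2.
  by move: hx; rewrite ler_norml => /andP[? ?]; apply/andP; split; lra.
have x0 : 0 < x by lra.
have up : ln x <= x - 1.
  by have := @le_ln1Dx R (x - 1); rewrite addrCA subrr addr0; apply; lra.
have lo : - ln x <= x^-1 - 1.
  rewrite -lnV //; have := @le_ln1Dx R (x^-1 - 1); rewrite addrCA subrr addr0; apply.
  by rewrite ltrBrDl addrN invr_gt0.
rewrite ler_norml; apply/andP; split; last first.
  by apply: le_trans up _; have := ler_norm (x - 1); have := normr_ge0 (x - 1); lra.
rewrite lerNl; apply: le_trans lo _.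
have -> : x^-1 - 1 = (1 - x) / x by field; rewrite gt_eqF.
rewrite ler_pdivrMr // distrC -mulrA.
have := ler_norm (1 - x); have n0 := normr_ge0 (1 - x); nra.
Qed.

(* [|d + w|^2 |d - w|^2 / |d|^4 - 1] is of order [|w|^2 / |d|^2]. *)
Lemma logker_second_difference (x y w : R * R) (r : R) : 0 < r -> r <= enorm (x - y) ->
  14 * dot w w <= r ^+ 2 ->
  `|logker (x + w) y + logker (x - w) y - 2 * logker x y| <= 7 * dot w w / r ^+ 2.
Proof.
move=> r0 rxy wr; set d := x - y.
have w0 := dot_ge0 w.
have rd : r ^+ 2 <= dot d d by rewrite -sqr_enorm lerXn2r // ?nnegrE ?enorm_ge0 ?ltW.
have dd0 : 0 < dot d d by apply: lt_le_trans rd; rewrite exprn_gt0.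
pose p := dot (d + w) (d + w); pose q := dot (d - w) (d - w).
have cs : (dot d w) ^+ 2 <= dot d d * dot w w.
  have : 0 <= (d.1 * w.2 - d.2 * w.1) ^+ 2 by exact: sqr_ge0.
  rewrite /dot; nra.
have pqE : p * q = dot d d ^+ 2 + 2 * dot d d * dot w w + dot w w ^+ 2 - 4 * dot d w ^+ 2.
  by rewrite /p /q /dot /=; ring.
have w14 : 14 * dot w w <= dot d d by apply: le_trans rd.
have pq0 : 0 < p * q by rewrite pqE; nra.
have [p0 q0] : 0 < p /\ 0 < q.
  have hp : 0 <= p by exact: dot_ge0.
  have hq : 0 <= q by exact: dot_ge0.
  by split; rewrite lt_def ?hp ?hq andbT; apply/eqP => h; move: pq0; rewrite h ?mul0r ?mulr0 ltxx.
have -> : logker (x + w) y + logker (x - w) y - 2 * logker x y =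
    - (2^-1 * ln (p * q / dot d d ^+ 2)).
  rewrite /logker /enorm !ln_sqrt ?dot_ge0 //.
  have -> : x + w - y = d + w by rewrite /d addrAC.
  have -> : x - w - y = d - w by rewrite /d addrAC.
  rewrite -/p -/q -/d lnM ?posrE ?invr_gt0 ?exprn_gt0 // lnV ?posrE ?exprn_gt0 //.
  rewrite lnXn // lnM ?posrE // -mulr_natl; lra.
have E : p * q / dot d d ^+ 2 - 1 = (2 * dot d d * dot w w + dot w w ^+ 2 - 4 * dot d w ^+ 2) / dot d d ^+ 2.
  by rewrite pqE; field; rewrite gt_eqF.
have B : `|p * q / dot d d ^+ 2 - 1| <= 7 * dot w w / dot d d.
  rewrite E normrM [X in _ * X]ger0_norm ?invr_ge0 ?sqr_ge0 //.
  have -> : 7 * dot w w / dot d d = (7 * dot w w * dot d d) / dot d d ^+ 2.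
    by field; rewrite gt_eqF.
  rewrite ler_pM2r ?invr_gt0 ?exprn_gt0 // ler_norml.
  have dw := sqr_ge0 (dot d w); apply/andP; split; nra.
rewrite normrN normrM ger0_norm ?invr_ge0 //.
apply: (@le_trans _ _ (7 * dot w w / dot d d)).
  have : `|ln (p * q / dot d d ^+ 2)| <= 2 * `|p * q / dot d d ^+ 2 - 1|.
    apply: ln_norm_le2; apply: le_trans B _.
    by rewrite ler_pdivrMr //; lra.
  lra.
by rewrite ler_wpM2l ?mulr_ge0 // lef_pV2 // posrE exprn_gt0.
Qed.

Lemma half_lt (d z a : R) : 0 < d -> z <= d -> d * 2 <= a -> z < a /\ z + z <= a.
Proof. by move=> *; split; lra. Qed.

Lemma norm_bounds (a b k : R) : `|a - b| < k -> b <= a + k /\ a - k <= b.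
Proof. by rewrite ltr_norml => /andP[? ?]; split; lra. Qed.

Lemma no_mid (d a x y : R) : d + d <= a -> x < d -> y < d -> ~ a <= x + y.
Proof. by move=> *; lra. Qed.

Lemma dist_sums (a b c d l k k' : R) : `|a + b - 2 * l| <= k -> `|c + d - 2 * l| <= k' ->
  `|a + b - (c + d)| <= k + k'.
Proof. by rewrite !ler_norml => /andP[? ?] /andP[? ?]; apply/andP; split; lra. Qed.

Lemma no_gap (k d a b x y : R) : 0 < k -> 0 < d -> 3 * k = b - a -> x <= a + k ->
  b - k <= y -> 1 * (d * x) + -1 * (d * y) = 0 -> False.
Proof.
move=> k0 d0 kE hx hy; rewrite mulN1r mul1r -mulrBr => /eqP.
by rewrite mulf_eq0 gt_eqF //= => /eqP; lra.
Qed.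

Context (I : finType) (e : I -> (R * R) * (R * R)) (c : I -> R).
Hypothesis e0 : forall i, (e i).2 != 0.
Hypothesis disj : almost_disjoint e.
Hypothesis c0 : \sum_i c i * enorm (e i).2 = 0.
Hypothesis Qc0 : segQ e c c = 0.

Let P i x : R := enorm (e i).2 * \int[leb]_(u in I01) logker x (seg (e i) u).
Let LI i x : R := \int[leb]_(u in I01) logker x (seg (e i) u).
Let PE i x : P i x = enorm (e i).2 * LI i x. Proof. by []. Qed.
Let U x : R := \sum_i c i * P i x.

Let cP i : continuous (P i).
Proof. exact: continuous_segpot. Qed.

Let cU : continuous U.
Proof.
rewrite /U; elim: (index_enum I) => [|i s IH].
  by rewrite (_ : (fun x => _) = cst 0) => [x|]; [exact: cvg_cst|apply/funext => x; rewrite big_nil].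
rewrite (_ : (fun x => _) = (fun x => c i * P i x + \sum_(j <- s) c j * P j x)); last first.
  by apply/funext => x; rewrite big_cons.
by move=> x; apply: cvgD; [apply: cvgM; [exact: cvg_cst|exact: cP]|exact: IH].
Qed.

Let off x := forall i, ~ segimg e i x.

Let off_ball x : off x -> exists2 d : R, 0 < d & forall y, enorm (x - y) < d -> off y.
Proof.
move=> ox.
have : \forall y \near x, off y.
  apply: (@filter_forall _ _ (fun i => [set y | ~ segimg e i y]) (nbhs x)) => i; apply: open_nbhs_nbhs; split; last exact: ox.
  by apply: closed_openC; exact: closed_segimg.
by move=> /nbhs_enorm.
Qed.

Let U_ball x (k : R) : 0 < k ->
  exists2 d : R, 0 < d & forall y, enorm (x - y) < d -> `|U x - U y| < k.
Proof.
by move=> k0; apply/nbhs_enorm; have /cvgrPdist_lt := @cU x; apply.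
Qed.

(** Two short segments at [p] and [q] with densities [s] and [- s] are added to the family. The
    enlarged form is nonnegative and begins with the linear term [2 * s * B], as [c] has zero
    energy. Hence [B = 0], although [B] compares averages of [U] near [p] and near [q]. *)
Let lt_off p q : off p -> off q -> U p < U q -> False.
Proof.
move=> op oq Upq.
(* A third of the gap: averages within [k] of [U p] and of [U q] cannot coincide. *)
pose k := (U q - U p) / 3; have k0 : 0 < k by rewrite divr_gt0 // subr_gt0.
have [d1 d10 h1] := off_ball op; have [d2 d20 h2] := off_ball oq.
have [d3 d30 h3] := U_ball p k0; have [d4 d40 h4] := U_ball q k0.
have pq : 0 < enorm (p - q).
  by rewrite enorm_gt0 subr_eq0; apply/eqP => h; rewrite h ltxx in Upq.
pose d := Num.min (Num.min d1 d2) (Num.min (Num.min d3 d4) (enorm (p - q))) / 2.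
have d0 : 0 < d by rewrite divr_gt0 // !lt_min d10 d20 d30 d40 pq.
have dlt z : z <= d -> [/\ z < d1, z < d2, z < d3, z < d4 & z + z <= enorm (p - q)].
  have : d * 2 <= Num.min (Num.min d1 d2) (Num.min (Num.min d3 d4) (enorm (p - q))).
    by rewrite divfK.
  rewrite !le_min => /andP[/andP[h1' h2'] /andP[/andP[h3' h4'] h5']] zd.
  by split; [apply: (half_lt d0 zd h1').1|apply: (half_lt d0 zd h2').1|
    apply: (half_lt d0 zd h3').1|apply: (half_lt d0 zd h4').1|apply: (half_lt d0 zd h5').2].
pose e' (j : I + bool) := match j with
  inl i => e i | inr b => (if b then p else q, (d / 2, 0)) end.
have d2E : enorm ((d / 2, 0) : R * R) = d / 2.
  by rewrite /enorm /dot /= mul0r addr0 -expr2 sqrtr_sqr ger0_norm // divr_ge0 // ltW.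
have near_end b t : 0 <= t <= 1 -> enorm ((if b then p else q) - seg (e' (inr b)) t) < d.
  move=> /andP[t0 t1].
  have -> : (if b then p else q) - seg (e' (inr b)) t = - (t *: (d / 2, 0)).
    by rewrite /seg /= opprD addrA addrN add0r.
  rewrite enormN enormZ d2E ger0_norm //; nra.
have e'0 j : (e' j).2 != 0.
  case: j => [i|b] //=; apply/eqP => -[] /eqP.
  by rewrite mulf_eq0 invr_eq0 pnatr_eq0 orbF gt_eqF.
have off_end b t : 0 <= t <= 1 -> off (seg (e' (inr b)) t).
  move=> /(near_end b) h; have [? ? _ _ _] := dlt d (lexx d).
  case: b h => h; [apply: h1|apply: h2]; exact: lt_trans h _.
have disj' : almost_disjoint e'.
  move=> [i|b] [j|b'] t; rewrite ?(inj_eq inl_inj) ?(inj_eq inr_inj) => ij t01.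
  - exact: disj.
  - move=> [u /=]; rewrite in_itv /= => u01 h.
    apply: (off_end b' u u01 i); rewrite [seg _ _]h; exists t => //.
    by rewrite /= in_itv /=; case/andP: t01 => *; rewrite !ltW.
  - by apply: off_end; case/andP: t01 => *; rewrite !ltW.
  - move=> [u /=]; rewrite in_itv /= => u01 h.
    have t01' : 0 <= t <= 1 by case/andP: t01 => *; rewrite !ltW.
    have hb := near_end b t t01'; have := near_end b' u u01.
    rewrite [seg (e' (inr b')) u]h => hb'.
    have := ler_enormD ((if b then p else q) - seg (e' (inr b)) t)
      (- ((if b' then p else q) - seg (e' (inr b)) t)).
    rewrite enormN opprB addrA subrK.
    have [_ _ _ _ /no_mid no_mid'] := dlt d (lexx d).
    by case: b b' ij hb hb' {h} => [] [] // _ hb hb'; rewrite ?[enorm (q - p)]enormB; exact: no_mid' hb hb'.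
pose sg (b : bool) : R := if b then 1 else -1.
pose c' s (j : I + bool) := match j with inl i => c i | inr b => s * sg b end.
pose B := \sum_b sg b * ((d / 2) * \int[leb]_(t in I01) U (seg (e' (inr b)) t)).
pose Q2 := \sum_b \sum_b' sg b * sg b' * segV e' (inr b) (inr b').
have VE b : \sum_i c i * segV e' (inr b) (inl i) =
    (d / 2) * \int[leb]_(t in I01) U (seg (e' (inr b)) t).
  have [|_ ->] := integrable_sum01 (J := I) (index_enum I) c (f := fun i t => P i (seg (e' (inr b)) t)).
    move=> i; apply: integrable_I01; apply: continuous_subspaceT => t.
    by apply: continuous_comp; [exact: continuous_seg|exact: cP].
  rewrite mulr_sumr; apply: eq_bigr => i _; rewrite mulrCA; congr (_ * _).
  by rewrite /segV /= d2E.
have Q'E s : segQ e' (c' s) (c' s) = 2 * s * B + s ^+ 2 * Q2.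
  rewrite /segQ big_sumType /=.
  under eq_bigr do rewrite big_sumType /=.
  under [X in _ + X]eq_bigr do rewrite big_sumType /=.
  rewrite !big_split /= [X in X + _ + _](_ : _ = 0); last exact: Qc0.
  rewrite add0r addrA; congr (_ + _); last first.
    rewrite /Q2 mulr_sumr; apply: eq_bigr => b _; rewrite mulr_sumr.
    by apply: eq_bigr => b' _; ring.
  rewrite exchange_big /= -big_split /= /B mulr_sumr; apply: eq_bigr => b _.
  rewrite -VE !mulr_sumr -big_split /=; apply: eq_bigr => i _.
  by rewrite [segV e' (inl i) _]segVC //; ring.
have B0 : B = 0.
  apply: (@quadratic_ge0_linear0 _ Q2) => s; rewrite -Q'E.
  apply: segQ_mean0_ge0 => //.
  by rewrite big_sumType /= c0 add0r big_bool /= d2E; ring.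
have iU b : leb.-integrable I01 (EFin \o (fun t => U (seg (e' (inr b)) t))).
  apply: integrable_I01; apply: continuous_subspaceT => t.
  by apply: continuous_comp; [exact: continuous_seg|exact: cU].
have [_ _ hd3 hd4 _] := dlt d (lexx d).
have hi : \int[leb]_(t in I01) U (seg (e' (inr true)) t) <= U p + k.
  apply: (Rintegral01_le (iU true)) => t /(near_end true) h.
  by rewrite (norm_bounds (h3 _ (lt_trans h hd3))).1.
have lo : U q - k <= \int[leb]_(t in I01) U (seg (e' (inr false)) t).
  apply: (Rintegral01_ge (iU false)) => t /(near_end false) h.
  by rewrite (norm_bounds (h4 _ (lt_trans h hd4))).2.
have B0' := B0; rewrite /B big_bool /sg in B0'.
have kE : 3 * k = U q - U p by rewrite /k mulrC divfK.
by apply: (no_gap k0 _ kE hi lo B0'); rewrite divr_gt0.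
Qed.

Let U_off p q : off p -> off q -> U p = U q.
Proof.
by move=> op oq; apply/eqP; rewrite eq_le !leNgt; apply/andP; split; apply/negP => h;
  [exact: (lt_off oq op)|exact: (lt_off op oq)].
Qed.

Let L_integrable i x : ~ segimg e i x ->
  leb.-integrable I01 (EFin \o (fun u => logker x (seg (e i) u))).
Proof.
move=> xi; apply: integrable_I01; apply: continuous_in_subspaceT => u.
rewrite inE /= in_itv /= => u01.
suff h : continuous_at u (@ln R \o (fun u => enorm (x - seg (e i) u))) by exact: (cvgN h).
apply: continuous_comp.
  apply: (@continuous_comp _ _ _ (fun u => x - seg (e i) u) enorm).
    by apply: cvgB; [exact: cvg_cst|exact: continuous_seg].
  exact: continuous_enorm.
apply: continuous_ln; rewrite enorm_gt0 subr_eq0; apply/eqP => h; apply: xi.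
by exists u; rewrite //= in_itv.
Qed.

Lemma integral_indic01 (k s : R) : 0 <= s <= 2^-1 ->
  leb.-integrable I01 (EFin \o (fun u => k * \1_(`[2^-1 - s, 2^-1 + s]) u)) /\
  \int[leb]_(u in I01) (k * \1_(`[2^-1 - s, 2^-1 + s]) u) = k * (2 * s).
Proof.
move=> /andP[s0 s1].
have J : measurable (`[2^-1 - s, 2^-1 + s]%classic : set (measurableTypeR R)) by [].
have ii : leb.-integrable I01 (EFin \o (\1_(`[2^-1 - s, 2^-1 + s]) : R -> R)).
  exact: integrableS (integrable_indic_itv _ _ _ _).
split.
  have := integrableZl mI k ii.
  by apply: eq_integrable => // t _.
rewrite RintegralZl //; congr (_ * _).
rewrite /Rintegral integral_indic //.
have -> : `[2^-1 - s, 2^-1 + s]%classic `&` I01 = (`[2^-1 - s, 2^-1 + s]%classic : set R).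
  apply/setIidl => t; rewrite /= !in_itv /= => /andP[? ?]; apply/andP; split; lra.
rewrite [X in fine X](@lebesgue_measure_itv R `[2^-1 - s, 2^-1 + s]) /= lte_fin; case: ltP => h /=; lra.
Qed.

(* Testing against short extra segments, Cauchy-Schwarz makes the potential constant off
   the segments.  Compare its values at normal distances [s] and [2 * s] on both sides of
   the midpoint of the segment [a]: that segment contributes a term of exact order
   [c a * s], all the others contribute [O(s^2)]. *)
Lemma segQ_strict a : c a = 0.
Proof.
pose v := (e a).2; pose m := seg (e a) 2^-1; pose n := perp v.
have vv0 : 0 < dot v v by rewrite dot_gt0 e0.
have nn : dot n n = dot v v by rewrite /n /perp /dot /=; ring.
have h0 i : 0 < enorm (e i).2 by rewrite enorm_gt0.
have [r r0 hr] : exists2 r, 0 < r & forall y, enorm (m - y) < r -> forall i, i != a -> ~ segimg e i y.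
  apply/nbhs_enorm.
  apply: (@filter_forall _ _ (fun i => [set y | i != a -> ~ segimg e i y]) (nbhs m)) => i.
  have [->|ia] := eqVneq i a; first by apply: nearW => y.
  have : \forall y \near m, ~ segimg e i y.
    apply: open_nbhs_nbhs; split; first by apply: closed_openC; exact: closed_segimg.
    apply: disj; first by rewrite eq_sym.
    by apply/andP; split; lra.
  by apply: filterS => y ny _.
have offn s : s != 0 -> enorm (s *: n) < r -> off (m + s *: n).
  move=> s0 sr i; have [-> [u _ h]|ia] := eqVneq i a; last first.
    by apply: hr ia; rewrite opprD addrA subrr sub0r enormN.
  have : s * dot n n = dot (seg (e a) u - m) n.
    by rewrite [seg _ u]h addrAC subrr add0r dotZl.
  rewrite (_ : dot (seg (e a) u - m) n = 0); last by rewrite /m /seg /n /perp /dot /= /GRing.scale /= /v; ring.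
  by move/eqP; rewrite mulf_eq0 (negPf s0) nn gt_eqF.
(* [35 = 7 * 4 + 7] collects the bounds of [logker_second_difference] at normal distances [2 * s]
   and [s]. *)
pose M := \sum_i `|c i| * enorm (e i).2 * (35 * dot v v / r ^+ 2).
have M0 : 0 <= M.
  apply: sumr_ge0 => i _; apply: mulr_ge0; first by rewrite mulr_ge0 // ltW.
  by rewrite divr_ge0 ?exprn_ge0 ?mulr_ge0 // ltW.
have ln20 : 0 < ln 2 :> R by rewrite ln_gt0 // ltr1n.
have key s : 0 < s -> s <= 2^-1 -> 14 * (4 * s ^+ 2 * dot v v) <= r ^+ 2 ->
    `|c a| * enorm v * (ln 2 * (2 * s)) <= M * s ^+ 2.
  move=> s0 s1 sr.
  have snr k : 0 <= k -> k <= 2 -> enorm ((k * s) *: n) < r.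
    move=> k0 k2; rewrite enormZ /enorm nn ger0_norm ?mulr_ge0 // ?ltW //.
    rewrite -[ltRHS]ger0_norm ?ltW // -sqrtr_sqr -[k * s]ger0_norm ?mulr_ge0 // ?ltW //.
    rewrite -sqrtr_sqr -sqrtrM ?sqr_ge0 // ltr_sqrt ?exprn_gt0 //.
    apply: lt_le_trans sr.
    have : k ^+ 2 * (s ^+ 2 * dot v v) <= 4 * (s ^+ 2 * dot v v).
      by rewrite ler_pM2r ?mulr_gt0 ?exprn_gt0 //; nra.
    have : 0 < s ^+ 2 * dot v v by rewrite mulr_gt0 ?exprn_gt0.
    rewrite exprMn; lra.
  pose x k := m + (k * s) *: n.
  have xoff k : 1 <= `|k| <= 2 -> off (x k).
    move=> /andP[k1 k2]; apply: offn.
      by apply: mulf_neq0; [rewrite -normr_gt0; lra|rewrite gt_eqF].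
    rewrite enormZ -[n](scale1r) -[`|k * s|]normr_id normrM (ger0_norm (ltW s0)) scale1r.
    by rewrite -enormZ; apply: snr; lra.
  have o2 : off (x 2) by apply: xoff; rewrite ger0_norm; lra.
  have o2' : off (x (-2)) by apply: xoff; rewrite normrN ger0_norm; lra.
  have o1 : off (x 1) by apply: xoff; rewrite normr1; lra.
  have o1' : off (x (-1)) by apply: xoff; rewrite normrN1; lra.
  pose f i u := logker (x 2) (seg (e i) u) + logker (x (-2)) (seg (e i) u)
    - (logker (x 1) (seg (e i) u) + logker (x (-1)) (seg (e i) u)).
  have fi i : leb.-integrable I01 (EFin \o f i) /\
     P i (x 2) + P i (x (-2)) - (P i (x 1) + P i (x (-1))) = enorm (e i).2 * \int[leb]_(u in I01) f i u.
    have i2 := L_integrable (o2 i); have i2' := L_integrable (o2' i).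
    have i1 := L_integrable (o1 i); have i1' := L_integrable (o1' i).
    have i2s : leb.-integrable I01 (EFin \o (fun u =>
        logker (x 2) (seg (e i) u) + logker (x (-2)) (seg (e i) u))).
      by apply: eq_integrable (integrableD mI i2 i2') => // t _.
    have i1s : leb.-integrable I01 (EFin \o (fun u =>
        logker (x 1) (seg (e i) u) + logker (x (-1)) (seg (e i) u))).
      by apply: eq_integrable (integrableD mI i1 i1') => // t _.
    split; first by apply: eq_integrable (integrableB mI i2s i1s) => // t _.
    have E : \int[leb]_(u in I01) f i u =
        LI i (x 2) + LI i (x (-2)) - (LI i (x 1) + LI i (x (-1))).
      etransitivity; first exact: (RintegralB mI i2s i1s).
      by congr (_ - _); [exact: (RintegralD mI i2 i2')|exact: (RintegralD mI i1 i1')].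
    rewrite E !PE; move: (LI i (x 2)) (LI i (x (-2))) (LI i (x 1)) (LI i (x (-1))) => *; ring.
  have [F FE] : exists F : I -> R, forall i, \int[leb]_(u in I01) f i u = F i.
    by exists (fun i => \int[leb]_(u in I01) f i u).
  have [p pE] : exists p : I -> R * R -> R, forall i x, P i x = p i x by exists P.
  have UE y : U y = \sum_i c i * p i y by apply: eq_bigr => i _; rewrite pE.
  have sum0 : \sum_i c i * (enorm (e i).2 * F i) = 0.
    have Ei i : c i * (enorm (e i).2 * F i) =
        c i * p i (x 2) + c i * p i (x (-2)) - (c i * p i (x 1) + c i * p i (x (-1))).
      by rewrite -FE -(fi i).2 !pE; ring.
    rewrite (eq_bigr _ (fun i _ => Ei i)) sumrB !big_split /= -!UE.
    by rewrite (U_off o2 o1) (U_off o2' o1) (U_off o1' o1) subrr.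
  have other i : i != a -> `|F i| <= 35 * dot v v / r ^+ 2 * s ^+ 2.
    move=> ia; rewrite -FE; apply: Rintegral01_norm => [|u u01]; first exact: (fi i).1.
    have rm : r <= enorm (m - seg (e i) u).
      by rewrite leNgt; apply/negP => /hr /(_ i ia); apply; exists u; rewrite //= in_itv.
    have w1 : dot ((1 * s) *: n) ((1 * s) *: n) = s ^+ 2 * dot v v by rewrite dotZl dotZr nn; ring.
    have w2 : dot ((2 * s) *: n) ((2 * s) *: n) = 4 * s ^+ 2 * dot v v by rewrite dotZl dotZr nn; ring.
    have svv : 0 <= s ^+ 2 * dot v v by rewrite mulr_ge0 ?exprn_ge0 // ltW.
    have b1 := logker_second_difference r0 rm (w := (1 * s) *: n).
    have b2 := logker_second_difference r0 rm (w := (2 * s) *: n).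
    rewrite w1 in b1; rewrite w2 in b2.
    have {}b1 := b1 ltac:(lra); have {}b2 := b2 sr.
    rewrite /f /x !mulNr !scaleNr.
    have -> : 35 * dot v v / r ^+ 2 * s ^+ 2 =
      7 * (4 * s ^+ 2 * dot v v) / r ^+ 2 + 7 * (s ^+ 2 * dot v v) / r ^+ 2.
      by field; rewrite gt_eqF.
    exact: dist_sums b2 b1.
  (* With [t = u - 1 / 2] the integrand is [- ln ((4 * s ^ 2 + t ^ 2) / (s ^ 2 + t ^ 2))]: never
     positive, and at most [- ln 2] where [|t| <= s]. *)
  have own : F a <= - (ln 2 * (2 * s)).
    have s01 : 0 <= s <= 2^-1 by rewrite ltW.
    have [ii iE] := integral_indic01 (- ln 2) s01.
    rewrite -mulNr -iE -FE; apply: le_Rintegral => //; first exact: (fi a).1.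
    move=> u; rewrite /= in_itv /= => u01.
    pose t := u - 2^-1.
    have lk k : k != 0 -> logker (x k) (seg (e a) u) = - (2^-1 * ln (dot v v * ((k * s) ^+ 2 + t ^+ 2))).
      move=> k0; rewrite /logker /enorm ln_sqrt ?dot_ge0 //; congr (- (_ * ln _)).
      by rewrite /x /m /n /seg /perp /dot /t /v /= /GRing.scale /=; ring.
    rewrite /f !lk ?oppr_eq0 ?pnatr_eq0 ?oner_eq0 //.
    have q k : 1 <= k -> 0 < dot v v * ((k * s) ^+ 2 + t ^+ 2).
      move=> k1; rewrite mulr_gt0 // ltr_wpDr ?sqr_ge0 // exprn_gt0 // mulr_gt0 //; lra.
    have -> : - (2^-1 * ln (dot v v * ((2 * s) ^+ 2 + t ^+ 2))) -
      2^-1 * ln (dot v v * ((-2 * s) ^+ 2 + t ^+ 2)) -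
      (- (2^-1 * ln (dot v v * ((1 * s) ^+ 2 + t ^+ 2))) -
      2^-1 * ln (dot v v * ((-1 * s) ^+ 2 + t ^+ 2))) =
      - (ln (dot v v * ((2 * s) ^+ 2 + t ^+ 2)) - ln (dot v v * ((1 * s) ^+ 2 + t ^+ 2))).
      rewrite !mulNr !sqrrN; lra.
    rewrite mulNr lerN2 indicE; case: (boolP (_ \in _)) => [|_] /=; last first.
      rewrite mulr0 subr_ge0 ler_ln ?posrE ?q ?ler1n // ler_pM2l // lerD2r.
      by rewrite lerXn2r ?nnegrE; nra.
    rewrite inE /= in_itv /= => /andP[t1 t2].
    have q1 := q 1 (lexx 1); have q2 : 0 < dot v v * ((2 * s) ^+ 2 + t ^+ 2) by apply: q; lra.
    have q1' := q1; have q2' := q2; rewrite pmulr_rgt0 // in q1'; rewrite pmulr_rgt0 // in q2'.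
    rewrite mulr1 lerBrDr -lnM ?posrE // ler_ln ?posrE ?mulr_gt0 //.
    rewrite mulrCA ler_pM2l //.
    have : 0 <= (s - t) * (s + t) by rewrite mulr_ge0 //; rewrite /t; lra.
    have := sqr_ge0 s; move: (s) (t) => s' t' hs ht; nra.
  move: sum0; rewrite (bigD1 a) //= => /eqP; rewrite addr_eq0 => /eqP sum0.
  have up : `|c a| * enorm v * (ln 2 * (2 * s)) <= `|c a * (enorm v * F a)|.
    rewrite !normrM (ger0_norm (enorm_ge0 _)) mulrA ler_wpM2l ?mulr_ge0 ?enorm_ge0 //.
    by rewrite ler0_norm; [rewrite lerNr|apply: le_trans own _; rewrite oppr_le0 !mulr_ge0 // ltW].
  apply: le_trans up _; rewrite sum0 normrN; apply: le_trans (ler_norm_sum _ _ _) _.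
  rewrite /M mulr_suml [leRHS](bigID (xpredC1 a)) /= -[leLHS]addr0 lerD //.
    apply: ler_sum => i ia; rewrite !normrM (ger0_norm (enorm_ge0 _)) mulrA -[leRHS]mulrA.
    by rewrite ler_wpM2l ?mulr_ge0 ?enorm_ge0 ?other.
  apply: sumr_ge0 => i _; apply: mulr_ge0; last exact: sqr_ge0.
  apply: mulr_ge0; first by rewrite mulr_ge0 ?enorm_ge0.
  by rewrite divr_ge0 ?exprn_ge0 ?mulr_ge0 // ltW.
apply/eqP; apply: contraT => ca.
pose C := `|c a| * enorm v * ln 2.
have v0 : 0 < enorm v := h0 a.
have C0 : 0 < C.
  apply: mulr_gt0; last exact: ln20.
  apply: mulr_gt0; last exact: v0.
  by rewrite normr_gt0.
(* The second bound ensures the smallness condition in [key]; with the third, the linear lower bound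
   there contradicts the quadratic upper one. *)
pose s := Num.min 2^-1 (Num.min (r / (8 * enorm v)) (C / (M + 1))).
have M1 : 0 < M + 1 by rewrite ltr_wpDl.
have s0 : 0 < s.
  rewrite /s !lt_min; apply/and3P; split; first by rewrite invr_gt0.
    by apply: divr_gt0 => //; rewrite mulr_gt0.
  exact: divr_gt0.
have /and3P[s1 s2 s3] : [&& s <= 2^-1, s <= r / (8 * enorm v) & s <= C / (M + 1)].
  by rewrite /s !ge_min !lexx ?orbT.
have := key s s0 s1.
have vr : s * (8 * enorm v) <= r by rewrite -ler_pdivlMr ?mulr_gt0.
have Ms : s * (M + 1) <= C by rewrite -ler_pdivlMr.
have -> : 14 * (4 * s ^+ 2 * dot v v) <= r ^+ 2.
  rewrite -sqr_enorm; apply: (@le_trans _ _ ((s * (8 * enorm v)) ^+ 2)); first nra.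
  by rewrite lerXn2r ?nnegrE ?mulr_ge0 // ltW.
move=> /(_ isT) h0'; have h : C * (2 * s) <= M * s ^+ 2 by rewrite /C -[leLHS]mulrA.
have : C * 2 <= M * s by rewrite -(ler_pM2r s0) -mulrA; apply: le_trans h _; rewrite -[leRHS]mulrA expr2.
nra.
Qed.

End Strict.

(** * Regions of a network near edges and vertices *)

Section LocallyConstant.
Context {R : realType}.

Lemma locally_constant_interval (A : set R) (f : R -> Prop) : is_interval A ->
  (forall x, A x -> exists2 d : R, 0 < d & forall y, A y -> `|y - x| < d -> f y <-> f x) ->
  forall x y, A x -> A y -> f x -> f y.
Proof.
move=> /connected_intervalP cA lc x y Ax Ay fx.
have loc (g : R -> Prop) : (forall x, A x -> exists2 d : R, 0 < d &
    forall y, A y -> `|y - x| < d -> g x -> g y) ->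
    exists2 C, open C & A `&` [set z | g z] = A `&` C.
  move=> lg; exists (\bigcup_(z in A `&` [set z | g z]) (ball z (xget 0 [set d | 0 < d /\
      forall y, A y -> `|y - z| < d -> g z -> g y]) : set R)).
    by apply: bigcup_open => z _; exact: ball_open.
  have dP z : A z -> 0 < xget 0 [set d | 0 < d /\ forall y, A y -> `|y - z| < d -> g z -> g y] /\
      forall y, A y -> `|y - z| < xget 0 [set d | 0 < d /\ forall y, A y -> `|y - z| < d -> g z -> g y] -> g z -> g y.
    by move=> Az; case: xgetP => [d -> //|/(_ _) h]; case: (lg z Az) => d d0 hd; case: (h d).
  apply/seteqP; split => z /= [Az].
    move=> gz; split => //; exists z; first by split.
    by apply: ballxx; exact: (dP z Az).1.
  move=> [w [Aw gw]]; rewrite /ball /= distrC => zw; split => //.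
  exact: (dP w Aw).2.
have := cA (A `&` [set z | f z]); move=> /(_ _ _ _)/esym E.
have : A y by []; rewrite E => [[]//| | |].
- by exists x.
- by apply: loc => z /lc[d d0 h]; exists d => // w Aw zw; apply: (h w Aw zw).2.
- have [z /lc[d d0 h]|C oC EC] := loc (fun z => ~ f z).
    by exists d => // w Aw zw nfz fw; apply: nfz; apply/(h w Aw zw).
  exists (~` C); first exact: open_closedC.
  apply/seteqP; split => z /= [Az] h; split => //.
    by move=> Cz; have : (A `&` C) z by []; rewrite -EC => -[].
  by apply: contrapT => nf; apply: h; have : (A `&` [set z | ~ f z]) z by []; rewrite EC => -[].
Qed.

(** Values at the points themselves are ignored. Punctured neighbourhoods of nearby points overlap,
    so the local constant does not change along the line. *)
Lemma punctured_constant (h : R -> R) :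
  (forall x, exists c d, 0 < d /\ forall y, y != x -> `|y - x| < d -> h y = c) ->
  exists c, forall x, exists2 d : R, 0 < d & forall y, y != x -> `|y - x| < d -> h y = c.
Proof.
move=> lc; have [c [d0 [d00 h0]]] := lc 0; exists c.
pose f x := exists2 d : R, 0 < d & forall y, y != x -> `|y - x| < d -> h y = c.
have near2 (x y d : R) : y != x -> `|y - x| < d -> 0 < Num.min (d - `|y - x|) `|y - x| /\
    forall z, `|z - y| < Num.min (d - `|y - x|) `|y - x| -> z != x /\ `|z - x| < d.
  move=> yx dyx; split; first by rewrite lt_min subr_gt0 dyx normr_gt0 subr_eq0.
  move=> z; rewrite lt_min => /andP[z1 z2]; split.
    by apply: contraTneq z2 => ->; rewrite distrC ltxx.
  by have := ler_distD y z x; lra.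
move=> x; apply: (@locally_constant_interval setT f _ _ 0 x) => //; last by exists d0.
move=> {}x _; have [c' [d [dp hd]]] := lc x; exists d => // y _ yx.
have [->//|ny] := eqVneq y x.
have [e0 he] := near2 _ _ _ ny yx.
set e := Num.min _ _ in e0 he.
have hy z : z != y -> `|z - y| < e -> h z = c'.
  by move=> _ /he[? ?]; exact: hd.
have uniq u c1 (k1 k2 : R) : 0 < k1 -> 0 < k2 -> (forall z, z != u -> `|z - u| < k1 -> h z = c1) ->
    (forall z, z != u -> `|z - u| < k2 -> h z = c) -> c1 = c.
  move=> k10 k20 h1 h2; pose z := u + Num.min k1 k2 / 2.
  have m0 : 0 < Num.min k1 k2 by rewrite lt_min k10 k20.
  have zu : `|z - u| = Num.min k1 k2 / 2 by rewrite /z addrAC subrr add0r ger0_norm // divr_ge0 // ltW.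
  have zu' : `|z - u| < Num.min k1 k2 by rewrite zu; lra.
  have nz : z != u by rewrite -subr_eq0 -normr_gt0 zu divr_gt0.
  by move: zu'; rewrite lt_min => /andP[a b]; rewrite -(h1 z) // (h2 z).
split=> -[k k0 hk].
- by exists d => //; rewrite -(uniq _ _ _ _ e0 k0 hy hk).
- by exists e => //; rewrite -(uniq _ _ _ _ dp k0 hd hk).
Qed.

(** Subtracting the step function [st] with the prescribed jumps leaves a function that is constant
    off the points [u i]; its values far to the left and far to the right are compared. *)
Lemma sum_jumps (I : finType) (Q : pred I) (g : R -> R) (u A B : I -> R) (gm gp : R) :
  {in Q &, injective u} ->
  (forall x, (forall i, Q i -> u i != x) ->
     exists2 d : R, 0 < d & forall y, `|y - x| < d -> g y = g x) ->
  (forall i, Q i -> exists2 d : R, 0 < d &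
     forall y, `|y - u i| < d -> (y < u i -> g y = A i) /\ (u i < y -> g y = B i)) ->
  (exists M, forall y, M < y -> g y = gp) -> (exists M, forall y, y < M -> g y = gm) ->
  \sum_(i | Q i) (B i - A i) = gp - gm.
Proof.
move=> inj off at_u [Mp hp] [Mm hm].
pose st (P : pred I) (x : R) := \sum_(i | P i) (B i - A i) * (u i < x)%R%:R.
have stc (P : pred I) (x : R) : (forall i, P i -> u i != x) ->
    exists2 d : R, 0 < d & forall y, `|y - x| < d -> st P y = st P x.
  move=> Px; exists (\big[Num.min/1]_(i | P i) `|u i - x|).
    by apply: lt_bigmin => // i /Px; rewrite -subr_eq0 -normr_gt0.
  move=> y hy; apply: eq_bigr => i Pi; congr (_ * (nat_of_bool _)%:R).
  have : `|y - x| < `|u i - x| by apply: lt_le_trans hy _; exact: bigmin_le_cond.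
  have := Px i Pi; rewrite neq_lt => /orP[] ux.
  - rewrite (ltr0_norm (_ : u i - x < 0)) ?subr_lt0 // ux => /ltr_normlP[h1 h2]; lra.
  - rewrite (gtr0_norm (_ : 0 < u i - x)) ?subr_gt0 // => /ltr_normlP[h1 h2].
    by rewrite !ltNge (ltW ux) /= ltW //; lra.
have [x|c hc] := punctured_constant (h := fun x => g x - st Q x).
  have [[i /andP[Qi /eqP ui]]|nx] := pselect (exists i, Q i && (u i == x)); last first.
    have Qx i : Q i -> u i != x by move=> Qi; apply/negP => ui; apply: nx; exists i; rewrite Qi.
    have [d1 d10 h1] := off x Qx; have [d2 d20 h2] := stc Q x Qx.
    exists (g x - st Q x), (Num.min d1 d2); split; first by rewrite lt_min d10.
    by move=> y _; rewrite lt_min => /andP[? ?]; rewrite h1 // h2.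
  have Qx j : Q j && (j != i) -> u j != x.
    by move=> /andP[Qj ji]; rewrite -ui; apply: contra_neq ji; apply: inj.
  have [d1 d10 h1] := at_u i Qi; have [d2 d20 h2] := stc _ x Qx.
  exists (A i - st [pred j | Q j & j != i] x), (Num.min d1 d2); split; first by rewrite lt_min d10.
  move=> y yx; rewrite lt_min => /andP[y1 y2]; rewrite -ui in y1 yx.
  rewrite {1}/st (bigD1 i) //= -/(st [pred j | Q j & j != i] y) h2 //.
  have [l r] := h1 y y1; case: (ltgtP y (u i)) yx => // yu _.
  - by rewrite l // mulr0 add0r.
  - by rewrite r // mulr1; ring.
have [dp dp0 hdp] := hc (Num.max Mp (\big[Num.max/0]_(i | Q i) u i) + 1).
have [dm dm0 hdm] := hc (Num.min Mm (\big[Num.min/0]_(i | Q i) u i) - 1).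
set X := _ + 1 in hdp; set Y := _ - 1 in hdm.
have E1 : g (X + dp / 2) - st Q (X + dp / 2) = c.
  apply: hdp; first by rewrite -subr_eq0 addrAC subrr add0r gt_eqF // divr_gt0.
  by rewrite addrAC subrr add0r ger0_norm ?divr_ge0 // ?ltW //; lra.
have E2 : g (Y - dm / 2) - st Q (Y - dm / 2) = c.
  apply: hdm; first by rewrite -subr_eq0 addrAC subrr add0r oppr_eq0 gt_eqF // divr_gt0.
  by rewrite addrAC subrr add0r normrN ger0_norm ?divr_ge0 // ?ltW //; lra.
have XM : Num.max Mp (\big[Num.max/0]_(i | Q i) u i) < X + dp / 2 by rewrite /X; lra.
have YM : Y - dm / 2 < Num.min Mm (\big[Num.min/0]_(i | Q i) u i) by rewrite /Y; lra.
move: XM YM; rewrite gt_max lt_min => /andP[X1 X2] /andP[Y1 Y2].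
rewrite hp // in E1; rewrite hm // in E2.
have S1 : st Q (X + dp / 2) = \sum_(i | Q i) (B i - A i).
  apply: eq_bigr => i Qi; rewrite (le_lt_trans _ X2) ?mulr1 //; exact: le_bigmax_cond.
have S2 : st Q (Y - dm / 2) = 0.
  apply: big1 => i Qi; rewrite ltNge ltW ?mulr0 // (lt_le_trans Y2) //; exact: bigmin_le_cond.
rewrite S1 in E1; rewrite S2 in E2; rewrite -E2 in E1; lra.
Qed.

End LocallyConstant.

Lemma perp_dot_eq0 {R : realType} (x l : R * R) : 0 < dot l l -> dot x (perp l) = 0 ->
  x = (dot x l / dot l l) *: l.
Proof.
rewrite /dot /perp /=; case: x l => [x1 x2] [l1 l2] /= ll x0.
have {}x0 : x2 * l1 = x1 * l2 by apply/eqP; rewrite -subr_eq0; apply/eqP; rewrite -x0; ring.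
apply: injective_projections; rewrite /= /GRing.scale /= mulrAC;
  apply: (canRL (mulfK (lt0r_neq0 ll))).
- by transitivity (x1 * l1 * l1 + l2 * (x1 * l2)); [ring|rewrite -x0; ring].
- by transitivity (x2 * l2 * l2 + l1 * (x2 * l1)); [ring|rewrite x0; ring].
Qed.

(** * Regions on the two sides of an edge *)

Section Geometry.
Context {R : realType} (Ga : network R) (hGa : is_network Ga).
Local Notation vpt j := (pos (vpos Ga) j).
Local Notation lvc a := (ell a (vpos Ga)).
Local Notation Sup := (support_set Ga).
Implicit Types (a b : vidx Ga) (r : 'I_(nbnd Ga).+1) (x y : R * R).

Lemma vx_nxt_neq a : is_edge a -> vx (nxt a) != vx a.
Proof.
case: a => i k; rewrite /is_edge /is_last /nxt /vx /= => ed; apply/eqP => /(vert_inj hGa) /(congr1 val) /=.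
have n2 : (2 <= nv i)%N.
  by have [/(nv_open hGa)//|/negP/negP/(nv_closed hGa)/ltnW] := boolP (isopen i).
have := ltn_ord k; rewrite leq_eqVlt => /orP[/eqP kn|kn].
  by rewrite {1}kn modnn => k0; move: n2; rewrite -kn -k0.
by rewrite modn_small // => /eqP; rewrite -[X in _ == X]addn0 -addn1 eqn_add2l.
Qed.

Lemma ell_neq0 a : is_edge a -> (lvc a) != 0.
Proof.
move=> ed; rewrite subr_eq0; apply: contra (vx_nxt_neq ed) => /eqP /(vpos_inj hGa) ->.
exact: eqxx.
Qed.

Lemma hlen_gt0 a : is_edge a -> 0 < hlen a.
Proof. by move=> ed; rewrite enorm_gt0 ell_neq0. Qed.

Lemma epoint0 a : epoint a 0 = (vpt (vx a)).
Proof. by rewrite /epoint scale0r addr0. Qed.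

Lemma epoint1 a : epoint a 1 = (vpt (vx (nxt a))).
Proof. by rewrite /epoint scale1r addrC subrK. Qed.

Lemma epointB a t u : epoint a t - epoint a u = (t - u) *: (lvc a).
Proof. by rewrite /epoint opprD addrACA subrr add0r scalerBl. Qed.

Lemma epoint_inj a t u : is_edge a -> epoint a t = epoint a u -> t = u.
Proof.
move=> /ell_neq0 /negPf l0 /eqP; rewrite -subr_eq0 epointB scaler_eq0 l0 orbF subr_eq0.
by move/eqP.
Qed.

Lemma eseg_epoint a t : 0 <= t <= 1 -> eseg a (epoint a t).
Proof. by move=> t01; exists t; rewrite //= in_itv. Qed.

Lemma eseg_seg a : eseg a = segimg (fun _ : unit => ((vpt (vx a)), (lvc a))) tt.
Proof. by []. Qed.

Lemma closed_eseg a : closed (eseg a).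
Proof. by rewrite eseg_seg; exact: closed_segimg. Qed.

Lemma edge_interior a b t : is_edge a -> is_edge b -> a <> b -> 0 < t < 1 ->
  ~ eseg b (epoint a t).
Proof.
move=> ea eb ab /andP[t0 t1] eab.
have ta : eseg a (epoint a t) by apply: eseg_epoint; rewrite !ltW.
have [j [xj [ja|ja] _]] := edges_meet hGa ea eb ab ta eab.
  by move: xj; rewrite ja -epoint0 => /(epoint_inj ea) tE; rewrite tE ltxx in t0.
by move: xj; rewrite ja -epoint1 => /(epoint_inj ea) tE; rewrite tE ltxx in t1.
Qed.

Lemma near_off_edges (Q : pred (vidx Ga)) x : (forall a, Q a -> ~ eseg a x) ->
  exists2 d : R, 0 < d & forall y, enorm (x - y) < d -> forall a, Q a -> ~ eseg a y.
Proof.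
move=> Qx; apply/nbhs_enorm.
apply: (@filter_forall _ _ (fun a => [set y | Q a -> ~ eseg a y]) (nbhs x)) => a.
have [/Qx ax|nQ] := boolP (Q a); last by apply: nearW => y.
have : \forall y \near x, ~ eseg a y.
  apply: open_nbhs_nbhs; split => //; apply: closed_openC; exact: closed_eseg.
by apply: filterS => y ny _.
Qed.

Lemma near_off_support x : ~ Sup x ->
  exists2 d : R, 0 < d & forall y, enorm (x - y) < d -> ~ Sup y.
Proof.
move=> Sx; have [|d d0 h] := @near_off_edges (@is_edge R Ga) x.
  by move=> a ea ax; apply: Sx; exists a.
by exists d => // y /h hy [a ea ay]; exact: hy ay.
Qed.

Lemma reg_off r x : reg r x -> ~ Sup x.
Proof.
have [x0 Sx0 ->] := reg_component hGa r; exact: (@connected_component_sub _ (~` Sup) x0).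
Qed.

Lemma reg_segment r x y : (forall t, 0 <= t <= 1 -> ~ Sup (x + t *: (y - x))) ->
  reg r x -> reg r y.
Proof.
move=> off; have [x0 Sx0 ->] := reg_component hGa r => hx.
apply: (connected_component_trans hx).
exists (seg (x, y - x) @` `[0, 1]).
  split; first by exists 0; rewrite /= ?in_itv /= ?lexx ?ler01 // /seg /= scale0r addr0.
    by move=> z [t /=]; rewrite in_itv /= => t01 <-; exact: off.
  apply: connected_continuous_connected; first exact: segment_connected.
  by apply: continuous_subspaceT; exact: continuous_seg.
by exists 1; rewrite /= ?in_itv /= ?lexx ?ler01 // /seg /= scale1r addrC subrK.
Qed.

Lemma reg_unique r r' x : reg r x -> reg r' x -> r = r'.
Proof.
move=> h h'; apply: (reg_inj hGa).
have [x0 Sx0 E] := reg_component hGa r; have [x1 Sx1 E'] := reg_component hGa r'.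
rewrite E in h; rewrite E' in h'; rewrite E E'.
by rewrite (same_connected_component h) (same_connected_component h').
Qed.

Lemma reg_locally_constant x : ~ Sup x ->
  exists2 d : R, 0 < d & forall y, enorm (x - y) < d -> forall r, reg r y <-> reg r x.
Proof.
move=> /near_off_support[d d0 h]; exists d => // y xy r.
split; apply: reg_segment => t /andP[t0 t1]; apply: h.
  have -> : x - (y + t *: (x - y)) = (1 - t) *: (x - y).
    by rewrite scalerBl scale1r opprD addrA.
  by rewrite enormZ ger0_norm ?subr_ge0 //; have := enorm_ge0 (x - y); nra.
rewrite opprD addrA subrr sub0r -scalerN opprB enormZ ger0_norm //.
by have := enorm_ge0 (x - y); nra.
Qed.

Lemma open_reg r : open (reg r).
Proof.
rewrite openE => x rx; apply/nbhs_enorm.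
have [d d0 h] := reg_locally_constant (reg_off rx).
by exists d => // y /h/(_ r) ->.
Qed.

Lemma boundary_reg r : boundary (reg r) = closure (reg r) `\` reg r.
Proof. by rewrite /boundary; congr (_ `\` _); exact: (interior_id _).1 (@open_reg r). Qed.

(** Normal component relative to edge [a], scaled by [hlen a]; it is negative in the direction
    [nu a]. *)
Definition rdot a x : R := dot x (perp (lvc a)).

Lemma rdotD a x y : rdot a (x + y) = rdot a x + rdot a y. Proof. exact: dotDl. Qed.
Lemma rdotZ a (c : R) x : rdot a (c *: x) = c * rdot a x. Proof. exact: dotZl. Qed.
Lemma rdotN a x : rdot a (- x) = - rdot a x. Proof. exact: dotNl. Qed.
Lemma rdot_ell a : rdot a (lvc a) = 0.
Proof. by rewrite /rdot /dot /perp /=; ring. Qed.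
Lemma rdot_perp a : rdot a (perp (lvc a)) = hlen a ^+ 2.
Proof. by rewrite /rdot /hlen sqr_enorm /dot /perp /=; ring. Qed.

Lemma rdot_eq0 a x : is_edge a -> rdot a x = 0 -> exists c, x = c *: (lvc a).
Proof.
move=> /ell_neq0 l0 x0; exists (dot x (lvc a) / dot (lvc a) (lvc a)).
by apply: perp_dot_eq0; rewrite ?dot_gt0.
Qed.

(** The other edges are closed and miss interior points of [a]; the radius also stays clear of the
    ends of [a]. *)
Lemma edge_ball a t : is_edge a -> 0 < t < 1 -> exists2 d : R, 0 < d &
  forall x, enorm (epoint a t - x) < d -> Sup x <-> rdot a (x - epoint a t) = 0.
Proof.
move=> ea /andP[t0 t1]; have h0 := hlen_gt0 ea.
have [|d d0 hd] := @near_off_edges [pred b | is_edge b & b != a] (epoint a t).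
  by move=> b /andP[eb /eqP ba]; apply: edge_interior => //; [exact/nesym|rewrite t0].
exists (Num.min d (hlen a * Num.min t (1 - t))).
  by rewrite lt_min d0 mulr_gt0 // lt_min t0 subr_gt0.
move=> x; rewrite lt_min => /andP[xd xh]; split.
  move=> [b eb bx]; have [ba|ba] := eqVneq b a; last first.
    by case: (hd x xd b _ bx); rewrite /= eb.
  by move: bx; rewrite ba => -[u _ <-]; rewrite epointB rdotZ rdot_ell mulr0.
move=> /(rdot_eq0 ea)[c xc]; exists a => //.
have xE : x = epoint a (t + c).
  by apply/eqP; rewrite -subr_eq0 -[x](subrK (epoint a t)) xc -addrA epointB -scalerDl addrC
    opprD addrA subrr sub0r addNr scale0r.
rewrite xE; apply: eseg_epoint.
move: xh; rewrite -enormN opprB xc enormZ mulrC ltr_pM2l // lt_min => /andP[].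
by rewrite !ltr_norml => /andP[? ?] /andP[? ?]; apply/andP; split; lra.
Qed.

(** The region fills a half disc at [epoint a t]. The sign [s = 1] is the side away from [nu a],
    with phase [pminus], and [s = -1] the side with phase [pplus]. *)
Definition side r a (s t : R) : Prop := exists2 d : R, 0 < d &
  forall x, enorm (epoint a t - x) < d -> 0 < s * rdot a (x - epoint a t) -> reg r x.

(** A small half disc is convex and misses the network, so one of its points decides to which region
    it belongs. *)
Lemma half_ball a t : is_edge a -> 0 < t < 1 -> exists2 d : R, 0 < d &
  (forall r (s : R) x y, enorm (epoint a t - x) < d -> enorm (epoint a t - y) < d ->
    0 < s * rdot a (x - epoint a t) -> 0 < s * rdot a (y - epoint a t) -> reg r x -> reg r y)
  /\ forall x, enorm (epoint a t - x) < d -> Sup x <-> rdot a (x - epoint a t) = 0.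
Proof.
move=> ea t01; have [d d0 h] := edge_ball ea t01; exists d => //; split => // r s x y xd yd sx sy.
apply: reg_segment => u /andP[u0 u1].
pose p := epoint a t.
have E : x + u *: (y - x) - p = (1 - u) *: (x - p) + u *: (y - p).
  by apply: injective_projections; rewrite /= /GRing.scale /=; ring.
have zd : enorm (p - (x + u *: (y - x))) < d.
  rewrite -enormN opprB E; apply: le_lt_trans (ler_enormD _ _) _.
  rewrite !enormZ !ger0_norm ?subr_ge0 // -(enormN (x - p)) -(enormN (y - p)) !opprB.
  have x0 := enorm_ge0 (p - x); have y0 := enorm_ge0 (p - y).
  have : (1 - u) * enorm (p - x) <= (1 - u) * Num.max (enorm (p - x)) (enorm (p - y)).
    by rewrite ler_wpM2l ?subr_ge0 // le_max lexx.
  have : u * enorm (p - y) <= u * Num.max (enorm (p - x)) (enorm (p - y)).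
    by rewrite ler_wpM2l // le_max lexx orbT.
  have : Num.max (enorm (p - x)) (enorm (p - y)) < d by rewrite gt_max xd yd.
  lra.
move=> /(h _ zd); rewrite E rdotD !rdotZ => /(congr1 ( *%R s)); rewrite mulr0 mulrDr.
rewrite mulrCA [X in _ + X]mulrCA.
by have [->|un] := eqVneq u 0; [|have : 0 < u by rewrite lt_def un]; nra.
Qed.

Lemma side_of_point r a s t : is_edge a -> 0 < t < 1 -> exists2 d : R, 0 < d &
  forall x, enorm (epoint a t - x) < d -> 0 < s * rdot a (x - epoint a t) -> reg r x -> side r a s t.
Proof.
move=> ea t01; have [d d0 [h _]] := half_ball ea t01; exists d => // x xd sx rx.
by exists d => // y yd sy; exact: (h r s x y).
Qed.

Lemma common_point a (s t t' d d' : R) : is_edge a -> s != 0 -> 0 < d -> 0 < d' ->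
  hlen a * `|t' - t| < d / 2 -> exists x, [/\ enorm (epoint a t - x) < d,
    enorm (epoint a t' - x) < d', 0 < s * rdot a (x - epoint a t) & 0 < s * rdot a (x - epoint a t')].
Proof.
move=> ea s0 d0 d'0 tt; have h0 := hlen_gt0 ea.
have m0 : 0 < Num.min (d / 2) d' by rewrite lt_min d'0 divr_gt0.
have ns : 0 < `|s| by rewrite normr_gt0.
pose c := Num.min (d / 2) d' / (2 * `|s| * hlen a).
have c0 : 0 < c by rewrite divr_gt0 // !mulr_gt0.
pose w := (c * s) *: perp (lvc a).
have nw : enorm w = Num.min (d / 2) d' / 2.
  rewrite enormZ normrM (gtr0_norm c0) (_ : enorm (perp _) = hlen a); last first.
    by rewrite /hlen /enorm /dot /perp /= mulrNN addrC.
  by rewrite /c; field; rewrite !gt_eqF.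
have w0 : 0 < s * rdot a w.
  rewrite rdotZ rdot_perp (_ : s * _ = c * s ^+ 2 * hlen a ^+ 2); last by ring.
  apply: mulr_gt0; last by rewrite exprn_gt0.
  by rewrite mulr_gt0 // exprn_even_gt0.
have wd : enorm w < d / 2 /\ enorm w < d'.
  by move: m0; rewrite nw; case: (leP (d / 2) d') => ? ?; split; lra.
exists (epoint a t' + w); split.
- have -> : epoint a t - (epoint a t' + w) = (t - t') *: (lvc a) - w.
    by rewrite -epointB opprD addrA.
  apply: le_lt_trans (ler_enormD _ _) _; rewrite enormN enormZ distrC mulrC -/(hlen a).
  by have := wd.1; lra.
- by rewrite opprD addrA subrr sub0r enormN; exact: wd.2.
- have -> : epoint a t' + w - epoint a t = (t' - t) *: (lvc a) + w.
    by rewrite -epointB addrAC.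
  by rewrite rdotD rdotZ rdot_ell mulr0 add0r.
- by rewrite addrAC subrr add0r.
Qed.

(** Half discs at nearby points of the edge overlap, so the property is locally constant along the
    open edge. *)
Lemma side_constant r a s t t' : is_edge a -> s != 0 -> 0 < t < 1 -> 0 < t' < 1 ->
  side r a s t -> side r a s t'.
Proof.
move=> ea s0 t01 t'01; have h0 := hlen_gt0 ea.
apply: (@locally_constant_interval R [set u | 0 < u < 1] (side r a s)) => //.
  move=> u v /= /andP[u0 u1] /andP[v0 v1] w /andP[uw wv] /=; apply/andP; split; lra.
move=> {t t' t01 t'01} t /= t01; have [d d0 [h _]] := half_ball ea t01.
exists (d / 2 / hlen a); first by rewrite !divr_gt0.
move=> t' t'01; rewrite ltr_pdivlMr // mulrC => tt'.
split=> -[k k0 hk].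
- have [x [xd xk sx sx']] := common_point ea s0 d0 k0 tt'.
  by exists d => // y yd sy; apply: (h r s x y) => //; exact: hk.
- have [d' d'0 [h' _]] := half_ball ea t'01.
  have [x [xd xk sx sx']] := common_point ea s0 d0 d'0 tt'.
  exists d' => // y yd sy; apply: (h' r s x y) => //.
  have [|z [zd zk sz _]] := common_point (t := t) (t' := t) ea s0 d0 k0.
    by rewrite subrr normr0 mulr0 divr_gt0.
  by apply: (h r s z x) => //; apply: hk => //.
Qed.

Lemma half_unit : 0 < (2^-1 : R) < 1. Proof. by apply/andP; split; lra. Qed.

Lemma nuE a : nu a = - ((hlen a)^-1 *: perp (lvc a)). Proof. by []. Qed.

Lemma rdot_nu a : is_edge a -> rdot a (nu a) = - hlen a.
Proof.
move=> /hlen_gt0 h0; rewrite nuE rdotN rdotZ rdot_perp expr2 mulrA mulVf ?mul1r //.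
by rewrite gt_eqF.
Qed.

Lemma enorm_nu a : is_edge a -> enorm (nu a) = 1.
Proof.
move=> /hlen_gt0 h0; rewrite nuE enormN enormZ ger0_norm ?invr_ge0 ?ltW //.
rewrite (_ : enorm (perp _) = hlen a) ?mulVf ?gt_eqF //.
by rewrite /hlen /enorm /dot /perp /= mulrNN addrC.
Qed.

Lemma near_side r a (s : R) : is_edge a -> s != 0 ->
  (\forall t \near 0^'+, reg r (epoint a 2^-1 - (t * s) *: nu a)) <-> side r a s 2^-1.
Proof.
move=> ea s0; have h0 := hlen_gt0 ea; have ns : 0 < `|s| by rewrite normr_gt0.
have sgn t : 0 < t -> 0 < s * rdot a (epoint a 2^-1 - (t * s) *: nu a - epoint a 2^-1).
  move=> t0; rewrite (_ : s * _ = t * s ^+ 2 * hlen a); last first.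
    by rewrite addrAC subrr add0r rdotN rdotZ rdot_nu //; ring.
  apply: mulr_gt0 => //; apply: mulr_gt0 => //; by rewrite exprn_even_gt0.
have dist t : 0 < t -> enorm (epoint a 2^-1 - (epoint a 2^-1 - (t * s) *: nu a)) = t * `|s|.
  by move=> t0; rewrite opprB addrC subrK enormZ enorm_nu // mulr1 normrM gtr0_norm.
split=> [hr|[d d0 hd]].
  have [d d0 hd] := side_of_point r s ea half_unit.
  have nd : \forall t \near (0:R)^'+, t < d / `|s| by apply: nbhs_right_lt; rewrite divr_gt0.
  have [t [t0 td tr]] : exists t : R, [/\ 0 < t, t < d / `|s| & reg r (epoint a 2^-1 - (t * s) *: nu a)].
    by near (0:R)^'+ => t; exists t; split; near: t => //; exact: nbhs_right_gt.
  apply: hd tr; last exact: sgn.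
  by rewrite dist // -ltr_pdivlMr.
near=> t; apply: hd; last by apply: sgn; near: t; exact: nbhs_right_gt.
rewrite dist; last by near: t; exact: nbhs_right_gt.
rewrite -ltr_pdivlMr //; near: t; apply: nbhs_right_lt; rewrite divr_gt0 //.
Unshelve. all: by end_near. Qed.

Lemma side_phase r a (s : R) : is_edge a -> (s = 1 \/ s = -1) -> side r a s 2^-1 ->
  phase r = if s == 1 then pminus (tag a) else pplus (tag a).
Proof.
move=> ea s1 hs; have s0 : s != 0 by case: s1 => ->; rewrite ?oppr_eq0 oner_eq0.
have [t [r' [rt r't <-]]] : exists t r', [/\ reg r (epoint a 2^-1 - (t * s) *: nu a),
    reg r' (epoint a 2^-1 - (t * s) *: nu a) & phase r' = if s == 1 then pminus (tag a) else pplus (tag a)].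
  have := (near_side r ea s0).2 hs.
  case: s1 => s1; rewrite s1 ?eqxx => hr.
    have := phase_minus hGa ea half_unit => hp.
    near (0:R)^'+ => t.
    have [r' r't pr] : exists2 r, reg r (epoint a 2^-1 - t *: nu a) & phase r = pminus (tag a).
      by near: t.
    have rt : reg r (epoint a 2^-1 - (t * 1) *: nu a) by near: t.
    by exists t, r'; split; rewrite // mulr1.
  have := phase_plus hGa ea half_unit => hp.
  rewrite (_ : (-1 == 1 :> R) = false); last by apply/negP => /eqP; lra.
  near (0:R)^'+ => t.
  have [r' r't pr] : exists2 r, reg r (epoint a 2^-1 + t *: nu a) & phase r = pplus (tag a).
    by near: t.
  have rt : reg r (epoint a 2^-1 - (t * -1) *: nu a) by near: t.
  by exists t, r'; split; rewrite // mulrN1 scaleNr opprK.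
by rewrite (reg_unique rt r't).
Unshelve. all: by end_near. Qed.

(** The two sides of an edge carry different phases, and a region has only one. *)
Lemma side_excl r a : is_edge a -> side r a 1 2^-1 -> side r a (-1) 2^-1 -> False.
Proof.
move=> ea h1 h2; apply: (phase_neq hGa (i := tag a)).
have := side_phase ea (or_introl erefl) h1; rewrite eqxx => <-.
have := side_phase ea (or_intror erefl) h2.
by rewrite (_ : (-1 == 1 :> R) = false) //; apply/negP => /eqP; lra.
Qed.

Lemma side_boundary r a (s : R) : is_edge a -> s != 0 -> side r a s 2^-1 ->
  eseg a `<=` boundary (reg r).
Proof.
move=> ea s0 hs; have h0 := hlen_gt0 ea.
have int t : 0 < t < 1 -> closure (reg r) (epoint a t).
  move=> t01; have [d d0 hd] := side_constant ea s0 half_unit t01 hs.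
  move=> B /nbhs_enorm[k k0 hk].
  have [|x [xd xk sx _]] := common_point (t := t) (t' := t) ea s0 d0 k0.
    by rewrite subrr normr0 mulr0 divr_gt0.
  by exists x; split; [exact: hd|exact: hk].
move=> x xa; have Sx : Sup x by exists a.
rewrite boundary_reg; split; last by move/reg_off.
case: xa => t /=; rewrite in_itv /= => /andP[t0 t1] <-.
rewrite ((closure_id (closure (reg r))).1 (@closed_closure _ (reg r))).
move=> B /nbhs_enorm[k k0 hk].
have [u u01 tu] : exists2 u : R, 0 < u < 1 & hlen a * `|u - t| < k.
  pose z := Num.min 2^-1 (k / (hlen a + 1)).
  have z0 : 0 < z by rewrite lt_min divr_gt0 ?invr_gt0 ?addr_gt0.
  have z1 : z <= 2^-1 by rewrite ge_min lexx.
  have zk : z * (hlen a + 1) <= k by rewrite -ler_pdivlMr ?addr_gt0 // ge_min lexx orbT.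
  (* The parameter is moved slightly towards the midpoint, into the open interval. *)
  exists (t + z * (1 - 2 * t)); first by apply/andP; split; nra.
  rewrite addrC addKr normrM gtr0_norm //.
  have : `|1 - 2 * t| <= 1 by rewrite ler_norml; apply/andP; split; lra.
  move=> n1; have : hlen a * (z * `|1 - 2 * t|) <= hlen a * z by rewrite ler_pM2l // ler_piMr // ltW.
  lra.
exists (epoint a u); split; first exact: int.
by apply: hk; rewrite epointB enormZ mulrC distrC.
Qed.

(** Orientation sign of an edge in the boundary of [r]: 1 if [nu a] points out of the region, -1 if
    it points into it, 0 for edges off the boundary. *)
Definition sideR r a : R :=
  (`[< side r a 1 2^-1 >] : bool)%:R - (`[< side r a (-1) 2^-1 >] : bool)%:R.

Lemma bedges_edge r a : a \in bedges r -> is_edge a.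
Proof. by rewrite inE => /andP[]. Qed.

Lemma bedges_side r a : is_edge a ->
  a \in bedges r <-> side r a 1 2^-1 \/ side r a (-1) 2^-1.
Proof.
move=> ea; have h0 := hlen_gt0 ea; split; last first.
  move=> h; rewrite inE ea /=; apply/asboolP.
  by case: h; apply: side_boundary; rewrite ?oppr_eq0 ?oner_eq0.
rewrite inE ea /= => /asboolP ab.
have [d1 d10 h1] := side_of_point r 1 ea half_unit.
have [d2 d20 h2] := side_of_point r (-1) ea half_unit.
have [d3 d30 h3] := edge_ball ea half_unit.
have /ab : eseg a (epoint a 2^-1) by apply: eseg_epoint; case/andP: half_unit => *; rewrite !ltW.
rewrite boundary_reg => -[cl _].
have [x [rx]] : reg r `&` [set x | enorm (epoint a 2^-1 - x) < Num.min d1 (Num.min d2 d3)] !=set0.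
  apply: cl; apply/nbhs_enorm; exists (Num.min d1 (Num.min d2 d3)) => //.
  by rewrite !lt_min d10 d20.
rewrite /= !lt_min => /and3P[x1 x2 x3].
case: (ltgtP 0 (rdot a (x - epoint a 2^-1))) => sx.
- by left; apply: h1 rx => //; rewrite mul1r.
- by right; apply: h2 rx => //; rewrite mulN1r oppr_gt0.
- by case: (reg_off rx); apply/(h3 x x3).
Qed.

Lemma sideR_out r a : is_edge a -> a \notin bedges r -> sideR r a = 0.
Proof.
move=> ea; rewrite /sideR => nb.
by rewrite !asboolF ?subrr // => h; move/negP: nb; apply; apply/bedges_side => //; [right|left].
Qed.

Lemma nuR_sideR r a : a \in bedges r -> (sideR r a = 1 \/ sideR r a = -1) /\ nuR r a = sideR r a *: nu a.
Proof.
move=> ab; have ea := bedges_edge ab; have h := (bedges_side r ea).1 ab.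
have E : (\forall t \near 0^'+, reg r (epoint a 2^-1 - t *: nu a)) <-> side r a 1 2^-1.
  rewrite -near_side ?oner_eq0 //.
  by split; apply: filterS => t; rewrite mulr1.
have [h1|h1] := pselect (side r a 1 2^-1).
  have -> : sideR r a = 1.
    by rewrite /sideR asboolT // asboolF ?subr0 // => h2; exact: side_excl h1 h2.
  by split; [left|rewrite /nuR asboolT ?scale1r //; exact/E].
have h2 : side r a (-1) 2^-1 by case: h.
have -> : sideR r a = -1 by rewrite /sideR asboolF // asboolT // sub0r.
by split; [right|rewrite /nuR asboolF ?scaleN1r //; move/E].
Qed.

End Geometry.

Lemma pred_mod_neq (m n : nat) : m.+1 = n -> (2 <= n)%N -> ((m + n).-1 %% n).+1 != n.
Proof.
move=> <-; case: m => // m _.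
by rewrite addSn /= modnDr modn_small ?ltnS ?leqnSn // neq_ltn ltnSn.
Qed.

(** * Boundary edges at a vertex *)

Section VertexBalance.
Context {R : realType} (Ga : network R) (hGa : is_network Ga).
Local Notation vpt j := (pos (vpos Ga) j).
Local Notation lvc a := (ell a (vpos Ga)).
Local Notation Sup := (support_set Ga).
Variables (r : 'I_(nbnd Ga).+1) (j : 'I_(nN Ga)).
Implicit Types (a : vidx Ga) (p q : vidx Ga * bool) (x y d : R * R).

Lemma side_value a t : is_edge a -> 0 < t < 1 -> exists2 d : R, 0 < d &
  forall x (s : R), enorm (epoint a t - x) < d -> s != 0 -> 0 < s * rdot a (x - epoint a t) ->
  reg r x <-> side r a s 2^-1.
Proof.
move=> ea t01; have [d d0 [h _]] := half_ball hGa ea t01; exists d => // x s xd s0 sx.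
split=> [rx|hs].
  apply: (side_constant hGa ea s0 t01 half_unit); exists d => // y yd sy.
  exact: (h r s x y).
have [k k0 hk] := side_constant hGa ea s0 half_unit t01 hs.
have [|z [zd zk sz _]] := common_point hGa (t := t) (t' := t) ea s0 d0 k0.
  by rewrite subrr normr0 mulr0 divr_gt0.
by apply: (h r s z x) => //; exact: hk.
Qed.

Let v := vpt j.
(** Half-edges at the vertex: the Boolean tells whether the edge leaves or enters it, and [raydir]
    points away from the vertex in both cases. *)
Definition is_ray p : bool := is_edge p.1 && (if p.2 then vx p.1 == j else vx (nxt p.1) == j).
Let os p : R := if p.2 then 1 else -1.
Definition raydir p : R * R := os p *: lvc p.1.

Let ray_point p (c : R) : is_ray p ->
  v + c *: raydir p = epoint p.1 (if p.2 then c else 1 - c).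
Proof.
case: p => a [] /andP[/= ea /eqP vj]; rewrite /v -vj /raydir /os /=.
  by rewrite scale1r.
by rewrite -epoint1 /epoint scaleN1r scalerN -addrA -scalerBl.
Qed.

(** Close to the vertex only its own rays are left; [k <= hlen a] keeps the points at distance
    [k / 2] inside their edges. *)
Let cone : exists2 k : R, 0 < k & (forall x, x != 0 -> enorm x < k -> Sup (v + x) ->
  exists p (c : R), [/\ is_ray p, 0 < c & x = c *: raydir p]) /\ (forall a, is_edge a -> k <= hlen a).
Proof.
have [b0 b0j] := vx_onto hGa j.
(* The index of the last vertex of an open curve is no edge; that vertex is the end of the edge
   indexed by its predecessor. *)
have [b eb bj] : exists2 b : vidx Ga, is_edge b & vx b = j \/ vx (nxt b) = j.
  have [eb0|] := boolP (is_edge b0); first by exists b0; [|left].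
  rewrite negbK => lb; have [op bn] := andP lb.
  have n2 := nv_open hGa op.
  have nx : nxt (prv b0) = b0.
    by case: (b0) => i k; rewrite /nxt /prv /ix /= ord_predK.
  exists (prv b0); last by right; rewrite nx.
  rewrite /is_edge /is_last /prv /ix /= op /=; apply: pred_mod_neq n2; exact/eqP.
have bv : eseg b v.
  rewrite /v; case: bj => <-; [rewrite -epoint0|rewrite -epoint1]; apply: eseg_epoint;
    by rewrite ?lexx ler01.
pose Q := [pred a | is_edge a & (vx a != j) && (vx (nxt a) != j)].
have [|d d0 hd] := @near_off_edges R Ga Q v.
  move=> a /andP[ea /andP[/eqP n1 /eqP n2]] av.
  have [ab|/eqP ab] := eqVneq a b; first by case: bj; rewrite -ab.
  have [j' [/(vpos_inj hGa) jj' ja _]] := edges_meet hGa ea eb ab av bv.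
  by case: ja => ja; [apply: n1|apply: n2]; rewrite jj'.
exists (Num.min d (\big[Num.min/1]_(a : vidx Ga | is_edge a) hlen a)).
  by rewrite lt_min d0 /=; apply: lt_bigmin => // a ea; exact: hlen_gt0.
split=> [x x0|a ea]; last first.
  by rewrite ge_min; apply/orP; right; exact: bigmin_le_cond.
rewrite lt_min => /andP[xd _] [a ea ax].
have [va|va] := eqVneq (vx a) j.
  case: ax => t /=; rewrite in_itv /= => /andP[t0 t1]; rewrite /epoint va => /addrI xE.
  exists (a, true), t; rewrite /is_ray /raydir /os /= ea va eqxx scale1r -xE; split => //.
  by rewrite lt_def t0 andbT; apply: contraNneq x0 => tE; rewrite -xE tE scale0r.
have [vna|vna] := eqVneq (vx (nxt a)) j.
  case: ax => t /=; rewrite in_itv /= => /andP[t0 t1] tE.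
  have xE : x = (1 - t) *: (- lvc a).
    have : epoint a t - epoint a 1 = x by rewrite tE epoint1 vna addrC addKr.
    by rewrite epointB => <-; rewrite scalerN -scaleNr opprB.
  exists (a, false), (1 - t); rewrite /is_ray /raydir /os /= ea vna eqxx scaleN1r; split => //.
  rewrite lt_def subr_ge0 t1 andbT; apply: contraNneq x0 => t1E.
  by rewrite xE t1E scale0r.
by case: (hd (v + x) _ a _ ax); rewrite /= ?ea ?va // opprD addrA subrr sub0r enormN.
Qed.

Let k := s2val (cid2 cone).
Let k0 : 0 < k := s2valP (cid2 cone).
Let kcone x : x != 0 -> enorm x < k -> Sup (v + x) ->
  exists p (c : R), [/\ is_ray p, 0 < c & x = c *: raydir p].
Proof. exact: (s2valP' (cid2 cone)).1. Qed.
Let khlen a : is_edge a -> k <= hlen a.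
Proof. exact: (s2valP' (cid2 cone)).2. Qed.

(** Radial projection onto the circle of radius [k / 2] around the vertex. *)
Let N x := v + (k / 2 / enorm x) *: x.

Let enorm_raydir p : enorm (raydir p) = hlen p.1.
Proof. by rewrite enormZ /os; case: p.2; rewrite ?normrN normr1 mul1r. Qed.

Let N_scale (c : R) x : 0 < c -> N (c *: x) = N x.
Proof.
move=> c0; rewrite /N enormZ (gtr0_norm c0) scalerA; congr (_ + _ *: _).
have [->|x0] := eqVneq (enorm x) 0; first by rewrite mulr0 invr0 mulr0 mul0r.
by field; rewrite x0 gt_eqF.
Qed.

Let N_off x : x != 0 -> (forall p (c : R), is_ray p -> 0 < c -> x <> c *: raydir p) -> ~ Sup (N x).
Proof.
move=> x0 nr; have nx : 0 < enorm x by rewrite enorm_gt0.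
have c0 : 0 < k / 2 / enorm x by rewrite !divr_gt0.
move=> /kcone[||p [c [rp cp xE]]].
- by rewrite scaler_eq0 negb_or gt_eqF.
- by rewrite enormZ gtr0_norm // divfK ?gt_eqF // ltr_pdivrMr // mulr_natr mulr2n ltrDl.
apply: (nr p ((k / 2 / enorm x)^-1 * c) rp); first by rewrite mulr_gt0 ?invr_gt0.
by rewrite -scalerA -xE scalerA mulVf ?scale1r // gt_eqF.
Qed.

Let N_continuous (h : R -> R * R) u : continuous_at u h -> h u != 0 ->
  forall e : R, 0 < e -> exists2 d : R, 0 < d & forall z, `|z - u| < d -> enorm (N (h u) - N (h z)) < e.
Proof.
move=> ch hu e e0.
have cN : continuous_at u (N \o h).
  apply: cvgD; first exact: cvg_cst.
  apply: cvgZ; last exact: ch.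
  apply: cvgM; first exact: cvg_cst.
  apply: cvgV; first by rewrite gt_eqF // enorm_gt0.
  apply: (continuous_comp ch); exact: continuous_enorm.
have : nbhs (N (h u)) [set y | enorm (N (h u) - y) < e] by apply/nbhs_enorm; exists e.
move=> /cN /nbhs_ballP[d d0 hd]; exists d => // z zu.
by apply: hd; rewrite /ball /= distrC.
Qed.

Let t0 p : R := if p.2 then k / 2 / hlen p.1 else 1 - k / 2 / hlen p.1.

Let t0_unit p : is_ray p -> 0 < t0 p < 1.
Proof.
move=> /andP[ea _]; have h0 := hlen_gt0 hGa ea; have kh := khlen ea.
have c0 : 0 < k / 2 / hlen p.1 by rewrite !divr_gt0.
have c1 : k / 2 / hlen p.1 < 1 by rewrite ltr_pdivrMr // mul1r; lra.
by rewrite /t0; case: p.2; apply/andP; split; lra.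
Qed.

Let N_ray p : is_ray p -> N (raydir p) = epoint p.1 (t0 p).
Proof. by move=> rp; rewrite /N enorm_raydir ray_point. Qed.

Let ray_inj p q (c c' : R) : is_ray p -> is_ray q -> 0 < c -> 0 < c' ->
  c *: raydir p = c' *: raydir q -> p = q.
Proof.
move=> rp rq c0 c'0 E.
have NE : epoint p.1 (t0 p) = epoint q.1 (t0 q).
  by rewrite -!N_ray // -(N_scale _ c0) E N_scale.
have [/andP[ep vp] /andP[eq vq]] := (rp, rq).
have ab : p.1 = q.1.
  apply: contrapT => pq; apply: (edge_interior hGa ep eq pq (t0_unit rp)).
  by rewrite NE; apply: eseg_epoint; have /andP[? ?] := t0_unit rq; rewrite !ltW.
case: p q ab vp vq ep {E NE rp rq eq} => [a o] [a' o'] /= <- vp vq ea.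
have ne := vx_nxt_neq hGa ea.
by case: o o' vp vq => [] [] //= /eqP vp /eqP vq; rewrite vp vq eqxx in ne.
Qed.

Let f x : R := (`[< reg r (N x) >] : bool)%:R.

(** The line [h u = e *: perp d + u *: d] meets exactly the rays on its side, once each. After
    radial projection the indicator of the region jumps there by a signed [sideR], and at infinity
    it takes its values in the directions [d] and [- d]. *)
Let jump_line d (e : R) : e = 1 \/ e = -1 -> d != 0 ->
  (forall p, is_ray p -> dot (perp d) (raydir p) != 0) ->
  \sum_(p | is_ray p && (0 < e * dot (perp d) (raydir p))) (- e * os p * sideR r p.1) = f d - f (- d).
Proof.
move=> e1 d0 nd.
have ee : e * e = 1 by case: e1 => ->; rewrite ?mulrNN mulr1.
have e0 : e != 0 by apply: contraPneq ee => ->; rewrite mul0r => /esym/eqP; rewrite oner_eq0.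
have dd0 : 0 < dot d d by rewrite dot_gt0.
pose h u := e *: perp d + u *: d.
have hpd u : dot (h u) (perp d) = e * dot d d.
  by rewrite /h /dot /perp /= /GRing.scale /=; ring.
have h0 u : h u != 0.
  apply/eqP => hu; have := hpd u; rewrite hu /dot /= !mul0r addr0 => /esym/eqP.
  by rewrite mulf_eq0 (negPf e0) gt_eqF.
have ch u : continuous_at u h.
  by apply: cvgD; [exact: cvg_cst|apply: cvgZr_tmp; exact: cvg_id].
(* Solution of [h (up p) = cp p *: raydir p], the crossing of the line with ray [p]. *)
pose up p := e * dot (raydir p) d / dot (perp d) (raydir p).
pose cp p := e * dot d d / dot (perp d) (raydir p).
have cross p : is_ray p -> h (up p) = cp p *: raydir p.
  move=> /nd; rewrite /h /up /cp /dot /perp; case: (raydir p) (d) => [x1 x2] [y1 y2] /= n0.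
  by apply: injective_projections; rewrite /= /GRing.scale /=; field.
have cp0 p : 0 < e * dot (perp d) (raydir p) -> 0 < cp p.
  move=> pe; rewrite /cp (_ : _ / _ = dot d d / (e * dot (perp d) (raydir p))).
    by rewrite divr_gt0.
  by rewrite invfM mulrA -[e^-1]mul1r -ee mulfK // [_ * e]mulrC.
pose Q := [pred p | is_ray p && (0 < e * dot (perp d) (raydir p))].
(* Moving along the line in the direction [d] crosses ray [p] into its side [sg p], by [sgd]. *)
pose sg p := - e * os p.
have sg0 p : sg p != 0.
  by rewrite mulf_neq0 ?oppr_eq0 // /os; case: p.2; rewrite ?oppr_eq0 oner_eq0.
have osos p : os p * os p = 1 by rewrite /os; case: p.2; rewrite ?mulrNN mulr1.
have sgd p : sg p * rdot p.1 d = e * dot (perp d) (raydir p).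
  have -> : rdot p.1 d = - (os p * dot (perp d) (raydir p)).
    rewrite /raydir dotZr mulrA osos mul1r /rdot.
    by rewrite /dot /perp /=; ring.
  by rewrite /sg mulNr mulNr mulrN opprK mulrA -[e * os p * os p]mulrA osos mulr1.
pose A p : R := (`[< side r p.1 (- sg p) 2^-1 >] : bool)%:R.
pose B p : R := (`[< side r p.1 (sg p) 2^-1 >] : bool)%:R.
have BA p : B p - A p = - e * os p * sideR r p.1.
  rewrite /A /B /sg /sideR /os; case: e1 => ->; case: p.2;
    rewrite ?mulNr ?mulrNN ?mulr1 ?mul1r ?opprK ?mulN1r ?opprK //; ring.
transitivity (\sum_(p | Q p) (B p - A p)); first by apply: eq_bigr.
have loc x y (eta : R) : enorm (N x - N y) < eta -> (forall z, enorm (N x - z) < eta -> forall r0 : 'I_(nbnd Ga).+1, reg r0 z <-> reg r0 (N x)) -> f y = f x.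
  by move=> xy hz; rewrite /f; congr (nat_of_bool _)%:R; apply/asbool_equiv_eq; exact: hz.
apply: (@sum_jumps R _ Q (f \o h) up).
- move=> p q /andP[rp /cp0 cp1] /andP[rq /cp0 cq1] pq.
  by apply: (ray_inj rp rq cp1 cq1); rewrite -!cross // pq.
- move=> x nx.
  have [|eta eta0 he] := reg_locally_constant hGa (x := N (h x)).
    apply: N_off => // p c rp c0 hE.
    have hc : c * dot (perp d) (raydir p) = e * dot d d.
      by rewrite -(hpd x) hE dotZl dotC.
    have Qp : Q p.
      rewrite /Q /= rp /= -(pmulr_rgt0 _ c0) mulrCA hc mulrA ee mul1r //.
    case/negP: (nx p Qp); apply/eqP.
    have cE : c = cp p by rewrite /cp -hc mulfK // nd.
    have : h (up p) = h x by rewrite cross // hE cE.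
    by move=> /addrI /eqP; rewrite -subr_eq0 -scalerBl scaler_eq0 (negPf d0) orbF subr_eq0 => /eqP.
  have [dl dl0 hd] := N_continuous (ch x) (h0 x) eta0.
  by exists dl => // y yx; apply: (loc _ _ eta) => //; exact: hd.
- move=> p /andP[rp pe]; have [ea _] := andP rp.
  have [eta eta0 he] := side_value ea (t0_unit rp).
  have [dl dl0 hd] := N_continuous (ch (up p)) (h0 (up p)) eta0.
  have NE : N (h (up p)) = epoint p.1 (t0 p) by rewrite cross // N_scale ?cp0 // N_ray.
  rewrite NE in hd.
  have rd (y : R) : rdot p.1 (N (h y) - epoint p.1 (t0 p)) = k / 2 / enorm (h y) * (y - up p) * rdot p.1 d.
    have -> : N (h y) - epoint p.1 (t0 p) = (k / 2 / enorm (h y)) *: h y - (k / 2 / enorm (raydir p)) *: raydir p.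
      by rewrite -N_ray // /N opprD addrACA subrr add0r.
    have -> : h y = cp p *: raydir p + (y - up p) *: d.
      by rewrite -cross // /h -addrA -scalerDl [up p + _]addrC subrK.
    by rewrite rdotD rdotN !rdotZ rdotD !rdotZ rdot_ell; ring.
  exists dl => // y /hd yd; have c0 : 0 < k / 2 / enorm (h y) by rewrite !divr_gt0 ?enorm_gt0.
  split=> yu; rewrite /f /A /B /=; congr (nat_of_bool _)%:R; apply/asbool_equiv_eq; apply: he => //.
  + by rewrite oppr_eq0.
  + rewrite rd (_ : - sg p * _ = k / 2 / enorm (h y) * (up p - y) * (sg p * rdot p.1 d)); last by ring.
    by rewrite sgd; apply: mulr_gt0 => //; apply: mulr_gt0 => //; rewrite subr_gt0.
  + rewrite rd (_ : sg p * _ = k / 2 / enorm (h y) * (y - up p) * (sg p * rdot p.1 d)); last by ring.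
    by rewrite sgd; apply: mulr_gt0 => //; apply: mulr_gt0 => //; rewrite subr_gt0.
- have nray : forall p (c : R), is_ray p -> 0 < c -> d <> c *: raydir p.
    move=> p c rp c0 dE; have := nd p rp; apply/negP; rewrite negbK.
    rewrite -(inj_eq (mulfI (lt0r_neq0 c0))) mulr0 -dotZr -dE.
    by apply/eqP; rewrite /dot /perp /=; ring.
  have [eta eta0 he] := reg_locally_constant hGa (N_off d0 nray).
  (* For large [y] the point [h y] is a positive multiple of [g y^-1], which is close to [d]. *)
  pose g s := d + s *: (e *: perp d).
  have g0 : g 0 = d by rewrite /g scale0r addr0.
  have cg : continuous_at 0 g by apply: cvgD; [exact: cvg_cst|apply: cvgZr_tmp; exact: cvg_id].
  have [|dl dl0 hd] := N_continuous cg _ eta0; first by rewrite g0.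
  rewrite g0 in hd.
  exists dl^-1 => y yd; have y0 : 0 < y by apply: lt_trans yd; rewrite invr_gt0.
  rewrite /=; have -> : h y = y *: g y^-1.
    by rewrite /h /g scalerDr [y *: (_ *: (_ *: _))]scalerA divff ?gt_eqF // scale1r addrC.
  rewrite /f N_scale //; apply: (loc _ _ eta) => //.
  by apply: hd; rewrite subr0 gtr0_norm ?invr_gt0 // invf_plt ?posrE.
- have nray : forall p (c : R), is_ray p -> 0 < c -> - d <> c *: raydir p.
    move=> p c rp c0 dE; have := nd p rp; apply/negP; rewrite negbK.
    rewrite -(inj_eq (mulfI (lt0r_neq0 c0))) mulr0 -dotZr -dE.
    by apply/eqP; rewrite /dot /perp /=; ring.
  have d0' : - d != 0 by rewrite oppr_eq0.
  have [eta eta0 he] := reg_locally_constant hGa (N_off d0' nray).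
  pose g s := - d + s *: (e *: perp d).
  have g0 : g 0 = - d by rewrite /g scale0r addr0.
  have cg : continuous_at 0 g by apply: cvgD; [exact: cvg_cst|apply: cvgZr_tmp; exact: cvg_id].
  have [|dl dl0 hd] := N_continuous cg _ eta0; first by rewrite g0.
  rewrite g0 in hd.
  exists (- dl^-1) => y; rewrite ltrNr => yd; have y0 : 0 < - y by apply: lt_trans yd; rewrite invr_gt0.
  rewrite /=; have -> : h y = (- y) *: g (- y)^-1.
    rewrite /h /g scalerDr [- y *: (_ *: (_ *: _))]scalerA divff ?gt_eqF //.
    by rewrite scale1r addrC scalerN scaleNr opprK.
  rewrite /f N_scale //; apply: (loc _ _ eta) => //.
  by apply: hd; rewrite subr0 gtr0_norm ?invr_gt0 // invf_plt ?posrE.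
Qed.

(** A slope above those of all edges; vertical edges, whose quotient is 0 by convention, are treated
    separately. *)
Lemma generic_direction : exists2 d, d != 0 & forall p, is_ray p -> dot (perp d) (raydir p) != 0.
Proof.
pose y := 1 + \sum_a `|(lvc a).2 / (lvc a).1|.
exists (1, y); first by apply/eqP => -[] /eqP; rewrite oner_eq0.
move=> p /andP[ea _]; rewrite /raydir dotZr mulf_neq0 //.
  by rewrite /os; case: p.2; rewrite ?oppr_eq0 oner_eq0.
have := ell_neq0 hGa ea; rewrite /dot /perp; case E : (lvc p.1) => [l1 l2] l0 /=.
have yp : `|l2 / l1| < y.
  have le : `|(lvc p.1).2 / (lvc p.1).1| <= \sum_a `|(lvc a).2 / (lvc a).1|.
    by rewrite (bigD1 p.1) // -[leLHS]addr0 lerD // sumr_ge0.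
  by rewrite E in le; rewrite (le_lt_trans le) // /y ltrDr.
have [l1E|n1] := eqVneq l1 0.
  rewrite l1E mulr0 add0r mul1r; apply: contraNneq l0 => l2E; by rewrite l1E l2E.
apply/eqP => h; have yE : l2 / l1 = y.
  by apply: (canLR (mulfK n1)); apply/eqP; rewrite -subr_eq0; apply/eqP; rewrite -h; ring.
by have := ler_norm (l2 / l1); rewrite yE in yp *; lra.
Qed.

(* The two lines [+-perp d + u d] project radially onto the two open arcs of a small circle
   around the vertex with ends [+-d]; on each arc the jumps of the indicator of the region
   add up to the difference of its end values, and the two differences cancel. *)
Lemma vertex_balance :
  \sum_(a | is_edge a) sideR r a * ((vx (nxt a) == j)%:R - (vx a == j)%:R) = 0.
Proof.
have [d d0 nd] := generic_direction.
have S1 := jump_line (or_introl erefl) d0 nd.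
have S2 := jump_line (or_intror erefl) d0 nd.
have tot : \sum_(p | is_ray p) os p * sideR r p.1 = 0.
  rewrite (bigID (fun p => 0 < 1 * dot (perp d) (raydir p))) /=.
  rewrite [X in X + _](_ : _ = - (f d - f (- d))); last first.
    by rewrite -S1 -sumrN; apply: eq_bigr => p _; rewrite mulN1r mulNr opprK.
  rewrite [X in _ + X](_ : _ = f d - f (- d)) ?addNr // -S2.
  apply: eq_big => [p|p _]; last by rewrite opprK mul1r.
  have [rp|//] := boolP (is_ray p); rewrite /= mul1r mulN1r oppr_gt0.
  by have := nd p rp; case: ltgtP.
transitivity (- \sum_(p | is_ray p) os p * sideR r p.1); last by rewrite tot oppr0.
rewrite [in RHS]big_mkcond -(pair_bigA _ (fun a o => if is_ray (a, o)
  then os (a, o) * sideR r a else 0)) /= -sumrN [in LHS]big_mkcond /=.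
apply: eq_bigr => a _; rewrite big_bool /= /is_ray /=; case: is_edge => /=; last by rewrite addr0 oppr0.
by rewrite /os /=; case: (vx a == j); case: (vx (nxt a) == j) => /=; ring.
Qed.

End VertexBalance.

(** * Double-layer potential of a segment *)

Section Calculus.
Context {R : realType}.
Local Notation leb := (@lebesgue_measure R).
Local Notation I01 := (`[0, 1]%classic : set R).
Implicit Types (c n w x : R * R) (f g phi : R -> R).

Lemma is_derive_quot f g (s f' g' : R) : is_derive s 1 f f' -> is_derive s 1 g g' -> g s != 0 ->
  is_derive s 1 (fun s => f s / g s) ((f' * g s - f s * g') / g s ^+ 2).
Proof.
move=> df dg g0.
have dV : is_derive s 1 (fun s => (g s)^-1) (- (g s) ^- 2 *: g') by exact: is_deriveV.
apply: (@is_derive_eq _ _ _ (f * (fun s => (g s)^-1)) s 1 _ _ (is_deriveM df dV)).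
by rewrite /GRing.scale /=; field.
Qed.

Lemma is_derive_lnf f (s f' : R) : is_derive s 1 f f' -> 0 < f s ->
  is_derive s 1 (fun s => ln (f s)) (f' / f s).
Proof.
move=> df f0; apply: is_derive_eq; first exact: (is_derive1_comp (is_derive1_ln f0) df).
by rewrite /GRing.scale /= mulrC.
Qed.

Lemma is_derive_dotl w n c (s : R) : is_derive s 1 (fun s => dot (w + s *: n) c) (dot n c).
Proof.
have -> : (fun s => dot (w + s *: n) c) = (fun s => dot w c + s * dot n c).
  by apply/funext => z; rewrite dotDl dotZl.
apply: is_derive_eq.
by rewrite /GRing.scale /=; ring.
Qed.

Lemma is_derive_sqn w n (s : R) :
  is_derive s 1 (fun s => dot (w + s *: n) (w + s *: n)) (2 * dot (w + s *: n) n).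
Proof.
have -> : (fun s => dot (w + s *: n) (w + s *: n)) = (fun s => dot w w + s * (2 * dot w n) + s ^+ 2 * dot n n).
  by apply/funext => z; rewrite /dot /= /GRing.scale /=; ring.
apply: is_derive_eq.
by rewrite /dot /= /GRing.scale /=; ring.
Qed.

(** [kq c] is the derivative of [ln |w|] in the direction [c], and [dkq c n] that of [kq c] in the
    direction [n]. *)
Definition kq c w : R := dot w c / dot w w.
Definition dkq c n w : R := (dot n c * dot w w - dot w c * (2 * dot w n)) / dot w w ^+ 2.

Lemma is_derive_kq c n w (s : R) : w + s *: n != 0 ->
  is_derive s 1 (fun s => kq c (w + s *: n)) (dkq c n (w + s *: n)).
Proof.
move=> w0; apply: is_derive_quot; first exact: is_derive_dotl.
  exact: is_derive_sqn.
by rewrite gt_eqF // dot_gt0.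
Qed.

Lemma is_derive_lnn n w (s : R) : w + s *: n != 0 ->
  is_derive s 1 (fun s => ln (enorm (w + s *: n))) (kq n (w + s *: n)).
Proof.
move=> w0; have d0 : 0 < dot (w + s *: n) (w + s *: n) by rewrite dot_gt0.
have -> : (fun s => ln (enorm (w + s *: n))) = (fun s => 2^-1 * ln (dot (w + s *: n) (w + s *: n))).
  by apply/funext => z; rewrite /enorm ln_sqrt ?dot_ge0.
apply: is_derive_eq.
  apply: (is_deriveM (is_derive_cst (2^-1 : R) s 1)).
  exact: (is_derive_lnf (is_derive_sqn w n s) d0).
by rewrite /GRing.scale /= /kq; field; rewrite gt_eqF.
Qed.

(* Maue: the normal derivative of the double-layer kernel is a tangential derivative. *)
Lemma is_derive_maue (e : (R * R) * (R * R)) x n (t : R) : x - seg e t != 0 ->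
  is_derive t 1 (fun t => - kq (perp n) (x - seg e t)) (dkq (perp e.2) n (x - seg e t)).
Proof.
have E t' : x - seg e t' = (x - e.1) + t' *: (- e.2).
  by rewrite /seg opprD addrA scalerN.
have -> : (fun t => - kq (perp n) (x - seg e t)) = (fun t => - kq (perp n) ((x - e.1) + t *: (- e.2))).
  by apply/funext => z; rewrite E.
rewrite E => w0.
apply: (@is_derive_eq _ _ _ (- (fun t : R => kq (perp n) ((x - e.1) + t *: (- e.2)))) t 1 _ _
  (is_deriveN (is_derive_kq (perp n) w0))).
have : dot (x - e.1 + t *: - e.2) (x - e.1 + t *: - e.2) != 0 by rewrite gt_eqF // dot_gt0.
rewrite /dkq; set w := x - e.1 + _; move: w (e.2) (n) => [w1 w2] [l1 l2] [n1 n2].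
by rewrite /dot /perp /= => h; field.
Qed.

Lemma continuous_dotl c : continuous (dot ^~ c : R * R -> R).
Proof.
by move=> x; apply: cvgD; apply: cvgM; (exact: cvg_cst || exact: cvg_fst || exact: cvg_snd).
Qed.

Lemma continuous_sqn : continuous (fun x : R * R => dot x x).
Proof.
by move=> x; apply: cvgD; apply: cvgM; (exact: cvg_fst || exact: cvg_snd).
Qed.

Lemma continuous_kq c w : w != 0 -> continuous_at w (kq c).
Proof.
move=> w0; apply: cvgM; first exact: continuous_dotl.
apply: cvgV; first by rewrite gt_eqF // dot_gt0.
exact: continuous_sqn.
Qed.

Lemma continuous_dkq c n w : w != 0 -> continuous_at w (dkq c n).
Proof.
move=> w0; apply: cvgM.
  apply: cvgB; first by apply: cvgM; [exact: cvg_cst|exact: continuous_sqn].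
  apply: cvgM; first exact: continuous_dotl.
  by apply: cvgM; [exact: cvg_cst|exact: continuous_dotl].
apply: cvgV; first by rewrite expf_neq0 // gt_eqF // dot_gt0.
have -> : (fun x : R * R => dot x x ^+ 2) = (fun x => dot x x * dot x x) by [].
by apply: cvgM; exact: continuous_sqn.
Qed.

Lemma norm_kq_le c w : `|kq c w| <= enorm c / enorm w.
Proof.
have [->|w0] := eqVneq w 0; first by rewrite /kq /dot /= !mul0r addr0 mul0r normr0 divr_ge0 ?enorm_ge0.
have nw : 0 < enorm w by rewrite enorm_gt0.
rewrite /kq normrM normfV (ger0_norm (dot_ge0 w)) -sqr_enorm.
rewrite ler_pdivrMr ?exprn_gt0 //; apply: le_trans (ler_dot _ _) _.
by rewrite le_eqVlt; apply/orP; left; apply/eqP; field; rewrite gt_eqF.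
Qed.

Lemma norm_dkq_le c n w : `|dkq c n w| <= 3 * enorm c * enorm n / enorm w ^+ 2.
Proof.
have [->|w0] := eqVneq w 0.
  by rewrite /dkq (_ : dot 0 0 = 0) ?expr0n ?invr0 ?mulr0 ?normr0 ?divr_ge0 ?sqr_ge0 ?mulr_ge0 ?enorm_ge0 // /dot /= !mul0r addr0.
have nw : 0 < enorm w by rewrite enorm_gt0.
rewrite /dkq normrM normfV (ger0_norm (sqr_ge0 (dot w w))) -sqr_enorm.
rewrite ler_pdivrMr ?exprn_gt0 //.
have -> : 3 * enorm c * enorm n / enorm w ^+ 2 * (enorm w ^+ 2) ^+ 2 =
  (enorm n * enorm c) * enorm w ^+ 2 + (enorm w * enorm c) * (2 * (enorm w * enorm n)).
  by field; rewrite gt_eqF.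
apply: le_trans (ler_normB _ _) _; rewrite (normrM (dot n c)) (normrM (dot w c)) (normrM 2) (ger0_norm (sqr_ge0 (enorm w))).
rewrite lerD ?ler_wpM2r ?sqr_ge0 ?ler_dot // ler_pM ?ler_dot ?mulr_ge0 //.
by rewrite ger0_norm // ler_wpM2l ?ler_dot.
Qed.

Section OffSegment.
Variables (e : (R * R) * (R * R)) (x : R * R).
Let S := [set seg e t | t in `[0, 1]].
Hypothesis xS : ~ S x.

Lemma off_seg_neq0 t : 0 <= t <= 1 -> x - seg e t != 0.
Proof.
move=> t01; rewrite subr_eq0; apply/eqP => xt; apply: xS.
by exists t; rewrite //= in_itv.
Qed.

Lemma off_seg_dist : exists2 d : R, 0 < d & forall t, 0 <= t <= 1 -> d <= enorm (x - seg e t).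
Proof.
have : \forall y \near x, ~ S y.
  apply: open_nbhs_nbhs; split => //; apply: closed_openC.
  exact: (@closed_segimg R unit (fun _ => e) tt).
move=> /nbhs_enorm[d d0 hd]; exists d => // t t01; rewrite leNgt; apply/negP => /hd; apply.
by exists t; rewrite //= in_itv.
Qed.

Lemma continuous_segF (F : R * R -> R) : (forall w, w != 0 -> continuous_at w F) ->
  {within I01, continuous (fun t => F (x - seg e t))}.
Proof.
move=> cF; apply: continuous_in_subspaceT => t; rewrite inE /= in_itv /= => t01.
apply: (@continuous_comp _ _ _ (fun t => x - seg e t) F).
  by apply: cvgB; [exact: cvg_cst|exact: continuous_seg].
exact: cF (off_seg_neq0 t01).
Qed.

Lemma continuous_within_M f g (A : set R) : {within A, continuous f} -> {within A, continuous g} ->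
  {within A, continuous (fun t => f t * g t)}.
Proof. by move=> cf cg t; apply: cvgM; [exact: cf|exact: cg]. Qed.

End OffSegment.

(** While [|s| < eta] the moving point keeps distance at least [d / 2] from the segment, so the
    bound on [F'] dominates the difference quotients. *)
Lemma deriv_under_seg (e : (R * R) * (R * R)) x n phi (F F' : R * R -> R) :
  ~ [set seg e t | t in `[0, 1]] x -> continuous phi ->
  (forall w, w != 0 -> continuous_at w F) ->
  (forall w (s : R), w + s *: n != 0 -> is_derive s 1 (fun s => F (w + s *: n)) (F' (w + s *: n))) ->
  (forall d : R, 0 < d -> exists M, forall w, d <= enorm w -> `|F' w| <= M) ->
  is_derive (0 : R) 1 (fun s => \int[leb]_(t in I01) (F (x + s *: n - seg e t) * phi t))
    (\int[leb]_(t in I01) (F' (x - seg e t) * phi t)).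
Proof.
move=> xS cphi cF dF bF.
have [d d0 hd] := off_seg_dist xS.
pose eta := d / 2 / (enorm n + 1).
have n1 : 0 < enorm n + 1 by rewrite ltr_wpDl ?enorm_ge0.
have eta0 : 0 < eta by rewrite !divr_gt0.
have far s t : `|s| < eta -> 0 <= t <= 1 -> d / 2 <= enorm (x + s *: n - seg e t).
  move=> sE t01; have -> : x + s *: n - seg e t = (x - seg e t) - (- (s *: n)) by rewrite opprK addrAC.
  have h2 := hd t t01; have h1 := ler_enormB (x - seg e t) (x - seg e t - - (s *: n)).
  have XE (X Y : R * R) : X - (X - Y) = Y by rewrite opprB addrC subrK.
  rewrite XE enormN enormZ in h1.
  have : `|s| * enorm n <= d / 2.
    have h3 : `|s| * (enorm n + 1) <= d / 2 by rewrite -ler_pdivlMr // ltW.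
    have := normr_ge0 s; lra.
  by move: h1; rewrite ler_norml => /andP[h1 h1'] h3; lra.
have farS s : `|s| < eta -> ~ [set seg e t | t in `[0, 1]] (x + s *: n).
  move=> sE [t /=]; rewrite in_itv /= => t01 E; have := far s t sE t01.
  by rewrite E subrr enorm0; lra.
have [M hM] := bF _ (divr_gt0 d0 (ltr0n R 2)).
have [L L0 hL] : exists2 L : R, 0 <= L & forall t, 0 <= t <= 1 -> `|phi t| <= L.
  have cn : {within I01, continuous (fun t => `|phi t|)}.
    by apply: continuous_subspaceT => z; apply: cvg_norm; exact: cphi.
  have [t0 _ ht] := EVT_max ler01 cn.
  by exists `|phi t0| => // t t01; apply: ht; rewrite in_itv.
have M0 : 0 <= M.
  have h0 := far 0 0; rewrite normr0 scale0r addr0 in h0.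
  by have := hM _ (h0 eta0 _); move=> /(_ _)/(le_trans (normr_ge0 _)); apply; rewrite lexx ler01.
pose f s t := F (x + s *: n - seg e t) * phi t.
have mI : measurable (I01 : set (measurableTypeR R)) by [].
have Ia : (`]-eta, eta[%classic : set R) 0 by rewrite /= in_itv /= eta0 oppr_lt0 eta0.
have inI (s : R) : (`]-eta, eta[%classic : set R) s -> `|s| < eta by rewrite /= in_itv /= ltr_norml.
have intf s : (`]-eta, eta[%classic : set R) s -> leb.-integrable I01 (EFin \o f s).
  move=> /inI sE; apply: integrable_I01; apply: continuous_within_M.
    exact: (@continuous_segF e (x + s *: n) (farS s sE) F cF).
  exact: continuous_subspaceT.
have df s t : (`]-eta, eta[%classic : set R) s -> I01 t -> is_derive s 1 (f ^~ t) (F' (x + s *: n - seg e t) * phi t).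
  move=> /inI sE; rewrite /= in_itv /= => t01.
  have E z : x + z *: n - seg e t = (x - seg e t) + z *: n by rewrite addrAC.
  rewrite /f E (_ : (fun z => _) = (fun z => F ((x - seg e t) + z *: n) * phi t)); last first.
    by apply/funext => z; rewrite E.
  have w0 : x - seg e t + s *: n != 0.
    by rewrite -E -enorm_gt0; apply: lt_le_trans (far s t sE t01); rewrite divr_gt0.
  apply: (@is_derive_eq _ _ _ ((fun z : R => F ((x - seg e t) + z *: n)) * cst (phi t)) s 1 _ _
    (is_deriveM (dF _ _ w0) (is_derive_cst (phi t) s 1))).
  by rewrite /GRing.scale /=; ring.
have Gub s t : (`]-eta, eta[%classic : set R) s -> I01 t -> `|partial1of2 f s t| <= M * L.
  move=> sI tI; rewrite partial1of2E (@derive_val _ _ _ _ _ _ _ (df s t sI tI)) normrM.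
  move: tI; rewrite /= in_itv /= => t01.
  by rewrite ler_pM ?normr_ge0 ?hL // hM // far // inI.
have derf s t : (`]-eta, eta[%classic : set R) s -> I01 t -> derivable (f ^~ t) s 1.
  by move=> sI tI; have [] := df s t sI tI.
have iG : leb.-integrable I01 (EFin \o (fun _ : R => M * L)) by exact: integrable_cst01.
have G0 (t : R) : 0 <= M * L by rewrite mulr_ge0.
have der := derivable_under_integral mI Ia intf derf G0 iG Gub.
have val := differentiation_under_integral mI Ia intf derf G0 iG Gub.
split; first exact: der.
rewrite -derive1E [LHS]val; apply: eq_Rintegral => t; rewrite inE => tI.
by rewrite partial1of2E (@derive_val _ _ _ _ _ _ _ (df 0 t Ia tI)) scale0r addr0.
Qed.

Lemma deriv_under_seg1 (e : (R * R) * (R * R)) x n (F F' : R * R -> R) :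
  ~ [set seg e t | t in `[0, 1]] x ->
  (forall w, w != 0 -> continuous_at w F) ->
  (forall w (s : R), w + s *: n != 0 -> is_derive s 1 (fun s => F (w + s *: n)) (F' (w + s *: n))) ->
  (forall d : R, 0 < d -> exists M, forall w, d <= enorm w -> `|F' w| <= M) ->
  is_derive (0 : R) 1 (fun s => \int[leb]_(t in I01) F (x + s *: n - seg e t))
    (\int[leb]_(t in I01) F' (x - seg e t)).
Proof.
move=> xS cF dF bF.
have E (G : R * R -> R) y : \int[leb]_(t in I01) G (y - seg e t) = \int[leb]_(t in I01) (G (y - seg e t) * cst 1 t).
  by apply: eq_Rintegral => t _; rewrite /cst mulr1.
rewrite E (_ : (fun s => _) = (fun s : R => \int[leb]_(t in I01) (F (x + s *: n - seg e t) * cst 1 t))).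
  by apply: deriv_under_seg => // z; exact: cvg_cst.
by apply/funext => s; rewrite -E.
Qed.

Lemma derivable_oo_within (a b : R) f : a < b -> {within `[a, b], continuous f} ->
  (forall x : R, a < x < b -> derivable f x 1) -> derivable_oo_LRcontinuous f a b.
Proof.
move=> ab /(continuous_within_itvP _ ab)[_ ca cb] df; split => //.
Qed.

(** The integrand may be unbounded at the ends, as logarithmic derivatives are at vertices: [H] is
    constant on the open interval and continuous up to its ends. *)
Lemma FTC_open (a b : R) f g : a < b -> {within `[a, b], continuous g} ->
  (forall x : R, a < x < b -> is_derive x 1 g (f x)) ->
  (forall x : R, a < x < b -> continuous_at x f) ->
  leb.-integrable `[a, b] (EFin \o f) ->
  \int[leb]_(x in `[a, b]) f x = g b - g a.
Proof.
move=> ab cg dg cf intf.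
pose H (x : R) := \int[leb]_(t in `[a, x]) f t - g x.
have /(continuous_within_itvP _ ab)[_ Ha Hb] : {within `[a, b], continuous H}.
  move=> x; apply: cvgB; last exact: cg.
  exact: (parameterized_integral_continuous (ltW ab) intf).
have HE (x y : R) : a < x -> x < y -> y < b -> H x = H y.
  move=> ax xy yb; have ay := lt_trans ax xy; have xb := lt_trans xy yb.
  have sub u v : a <= u -> v <= b -> leb.-integrable `[u, v] (EFin \o f).
    move=> au vb; apply: integrableS intf => //; apply: subset_itv; by rewrite bnd_simp.
  have E1 : \int[leb]_(t in `[a, y]) f t - \int[leb]_(t in `[a, x]) f t = \int[leb]_(t in `]x, y]) f t.
    by apply: Rintegral_itvB; [apply: sub => //; exact: ltW|rewrite bnd_simp ltW|rewrite bnd_simp ltW].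
  have E2 : \int[leb]_(t in `]x, y]) f t = \int[leb]_(t in `[x, y]) f t.
    apply: Rintegral_itv_obnd_cbnd; apply: integrableS (sub _ _ (ltW ax) (ltW yb)) => //.
    by apply: subset_itv; rewrite bnd_simp.
  have E3 : (\int[leb]_(t in `[x, y]) (f t)%:E = (g y)%:E - (g x)%:E)%E.
    apply: continuous_FTC2 => //.
    - apply: continuous_in_subspaceT => z; rewrite inE /= in_itv /= => /andP[xz zy].
      by apply: cf; rewrite (lt_le_trans ax) //= (le_lt_trans zy).
    - apply: derivable_oo_within => // [|z /andP[xz zy]].
        apply: (continuous_subspaceW _ cg) => z /=; rewrite !in_itv /= => /andP[xz zy].
        by rewrite (ltW (lt_le_trans ax xz)) (ltW (le_lt_trans zy yb)).
      have zab : a < z < b by rewrite (lt_trans ax) //= (lt_trans zy).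
      by have [] := dg z zab.
    - move=> z; rewrite in_itv /= => /andP[xz zy].
      have zab : a < z < b by rewrite (lt_trans ax) //= (lt_trans zy).
      by rewrite derive1E (@derive_val _ _ _ _ _ _ _ (dg z zab)).
  have E4 : \int[leb]_(t in `[x, y]) f t = g y - g x by rewrite /Rintegral E3.
  by rewrite /H; move: E1; rewrite E2 E4 => E1; lra.
pose m := (a + b) / 2.
have am : a < m by rewrite /m; lra.
have mb : m < b by rewrite /m; lra.
have Hm (x : R) : a < x -> x < b -> H x = H m.
  by move=> ax xb; case: (ltgtP x m) => [xm|xm|->] //; [exact: HE|apply/esym; exact: HE].
have Ea : H a = H m.
  apply: (cvg_unique _ Ha) => //; apply: cvg_near_cst.
  near=> x; apply: Hm; near: x; [exact: nbhs_right_gt|exact: nbhs_right_lt].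
have Eb : H b = H m.
  apply: (cvg_unique _ Hb) => //; apply: cvg_near_cst.
  near=> x; apply: Hm; near: x; [exact: nbhs_left_gt|exact: nbhs_left_lt].
move: Eb; rewrite -Ea /H set_itv1 Rintegral_set1 => /eqP.
by rewrite subr_eq => /eqP ->; ring.
Unshelve. all: by end_near. Qed.

Section OffSegmentIntegrals.
Variables (e : (R * R) * (R * R)) (x : R * R).
Hypothesis xS : ~ [set seg e t | t in `[0, 1]] x.

Lemma kq_bounded c (d : R) : 0 < d -> exists M, forall w, d <= enorm w -> `|kq c w| <= M.
Proof.
move=> d0; exists (enorm c / d) => w dw; apply: le_trans (norm_kq_le _ _) _.
by rewrite ler_wpM2l ?enorm_ge0 // lef_pV2 // posrE // (lt_le_trans d0).
Qed.

Lemma dkq_bounded c n (d : R) : 0 < d -> exists M, forall w, d <= enorm w -> `|dkq c n w| <= M.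
Proof.
move=> d0; exists (3 * enorm c * enorm n / d ^+ 2) => w dw; apply: le_trans (norm_dkq_le _ _ _) _.
have w0 := lt_le_trans d0 dw.
rewrite ler_wpM2l ?mulr_ge0 ?enorm_ge0 // lef_pV2 ?posrE ?exprn_gt0 //.
by rewrite lerXn2r ?nnegrE // ltW.
Qed.

Lemma is_derive_logpot n : is_derive (0 : R) 1
  (fun s => \int[leb]_(t in I01) ln (enorm (x + s *: n - seg e t)))
  (\int[leb]_(t in I01) kq n (x - seg e t)).
Proof.
apply: (deriv_under_seg1 (F := fun w => ln (enorm w)) (F' := kq n) xS).
- move=> w w0; apply: (@continuous_comp _ _ _ enorm (@ln R)); first exact: continuous_enorm.
  by apply: continuous_ln; rewrite enorm_gt0.
- by move=> w s; exact: is_derive_lnn.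
- exact: kq_bounded.
Qed.

Lemma continuous_kq_int c n : continuous_at (0 : R)
  (fun s => \int[leb]_(t in I01) kq c (x + s *: n - seg e t)).
Proof.
have [dv _] := deriv_under_seg1 xS (fun w => @continuous_kq c w)
  (fun w s => @is_derive_kq c n w s) (dkq_bounded c n).
by apply: differentiable_continuous; apply/derivable1_diffP.
Qed.

(** The normal derivative falls on the kernel, [is_derive_maue] turns it into a derivative along the
    segment, and integration by parts moves that to the affine factor. *)
Lemma is_derive_dlpot n (al be : R) : is_derive (0 : R) 1
  (fun s => \int[leb]_(t in I01) (kq (perp e.2) (x + s *: n - seg e t) * ((1 - t) * al + t * be)))
  (al * kq (perp n) (x - seg e 0) - be * kq (perp n) (x - seg e 1) +
   (be - al) * \int[leb]_(t in I01) kq (perp n) (x - seg e t)).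
Proof.
pose phi t := (1 - t) * al + t * be.
have dphi (t : R) : is_derive t 1 phi (be - al).
  by apply: is_derive_eq; rewrite /GRing.scale /=; ring.
have cphi : continuous phi.
  by move=> t; apply: differentiable_continuous; apply/derivable1_diffP; have [] := dphi t.
have D := @deriv_under_seg e x n phi (kq (perp e.2)) (dkq (perp e.2) n) xS cphi
  (fun w => @continuous_kq _ w) (fun w s => @is_derive_kq _ n w s) (dkq_bounded _ n).
apply: (is_derive_eq D).
under eq_Rintegral do rewrite mulrC.
have cG : {within I01, continuous (fun t => - kq (perp n) (x - seg e t))}.
  by move=> t; apply: cvgN; apply: (continuous_segF xS) => w; exact: continuous_kq.
rewrite (@Rintegration_by_parts _ phi (fun t => - kq (perp n) (x - seg e t)) (cst (be - al))
   (fun t => dkq (perp e.2) n (x - seg e t)) 0 1) //.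
- rewrite /phi; under [X in _ - _ - X]eq_Rintegral do rewrite mulrN.
  rewrite [X in _ - X = _](_ : _ = - ((be - al) * \int[leb]_(t in I01) kq (perp n) (x - seg e t))).
    by ring.
  have ik : leb.-integrable I01 (EFin \o (fun t => kq (perp n) (x - seg e t))).
    by apply: integrable_I01; apply: (continuous_segF xS) => w; exact: continuous_kq.
  rewrite -mulNr -RintegralZl //; apply: eq_Rintegral => t _; by rewrite /cst mulNr.
- by apply: continuous_subspaceT => z; exact: cvg_cst.
- apply: derivable_oo_within; [exact: ltr01|exact: continuous_subspaceT|].
  by move=> t _; have [] := dphi t.
- by move=> t _; rewrite derive1E (@derive_val _ _ _ _ _ _ _ (dphi t)).
- by apply: (continuous_segF xS) => w; exact: continuous_dkq.
- apply: derivable_oo_within; [exact: ltr01|exact: cG|move=> t /andP[t0 t1]].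
  have t01 : 0 <= t <= 1 by rewrite !ltW.
  have [dm _] := is_derive_maue n (off_seg_neq0 xS t01); exact: dm.
- move=> t; rewrite in_itv /= => /andP[t0 t1]; have t01 : 0 <= t <= 1 by rewrite !ltW.
  by rewrite derive1E (@derive_val _ _ _ _ _ _ _ (is_derive_maue n (off_seg_neq0 xS t01))).
Qed.

(** This closed form has a limit as [x] approaches an interior point of the segment, although the
    integrand becomes singular. *)
Lemma kq_tangent : \int[leb]_(t in I01) kq e.2 (x - seg e t) =
  ln (enorm (x - seg e 0)) - ln (enorm (x - seg e 1)).
Proof.
have ck : {within I01, continuous (fun t => kq e.2 (x - seg e t))}.
  by apply: (continuous_segF xS) => w; exact: continuous_kq.
pose g t := - ln (enorm (x - seg e t)).
have dg (t : R) : 0 <= t <= 1 -> is_derive t 1 g (kq e.2 (x - seg e t)).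
  move=> t01; have n0 := off_seg_neq0 xS t01.
  have E z : x - seg e z = (x - e.1) + z *: (- e.2) by rewrite /seg opprD addrA scalerN.
  rewrite /g (_ : (fun z => _) = - (fun z : R => ln (enorm ((x - e.1) + z *: (- e.2))))); last first.
    by apply/funext => z; rewrite E.
  rewrite E in n0 *; apply: (@is_derive_eq _ _ _ _ t 1 _ _ (is_deriveN (is_derive_lnn n0))).
  by rewrite /kq [dot _ (- e.2)]dotC dotNl dotC mulNr opprK.
have -> : \int[leb]_(t in I01) kq e.2 (x - seg e t) = g 1 - g 0.
  apply: FTC_open => //.
  - move=> t; apply: cvgN; apply: (continuous_segF xS (F := fun w => ln (enorm w))) => w w0.
    apply: (@continuous_comp _ _ _ enorm (@ln R)); first exact: continuous_enorm.
    by apply: continuous_ln; rewrite enorm_gt0.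
  - by move=> t /andP[t0 t1]; apply: dg; rewrite !ltW.
  - move=> t /andP[t0 t1]; apply: (@continuous_comp _ _ _ (fun t => x - seg e t) (kq e.2)).
      by apply: cvgB; [exact: cvg_cst|exact: continuous_seg].
    by apply: continuous_kq; apply: (off_seg_neq0 xS); rewrite !ltW.
  - exact: integrable_I01.
by rewrite /g opprK addrC.
Qed.

End OffSegmentIntegrals.

End Calculus.

(** * Singular integrals on one edge and between adjacent edges *)

Section SelfPotential.
Context {R : realType}.
Local Notation leb := (@lebesgue_measure R).
Local Notation I01 := (`[0, 1]%classic : set R).

Lemma ln_norm_sqr (y : R) : ln `|y| = 2^-1 * ln (y ^+ 2).
Proof. by rewrite -ln_sqrt ?sqr_ge0 // sqrtr_sqr. Qed.

Lemma norm_mul_ln_le (y : R) : `|y| <= 1 -> `|y * ln `|y| | <= 2 * Num.sqrt `|y|.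
Proof.
have [->|y0] := eqVneq y 0; first by rewrite mul0r normr0 mulr_ge0 ?sqrtr_ge0.
move=> y1; have ny : 0 < `|y| by rewrite normr_gt0.
have s0 : 0 < Num.sqrt `|y| by rewrite sqrtr_gt0.
have lnle : ln `|y| <= 0 by rewrite ln_le0.
rewrite normrM (ler0_norm lnle) -[X in - ln X](sqr_sqrtr (ltW ny)).
have -> : ln (Num.sqrt `|y| ^+ 2) = - (2 * ln (Num.sqrt `|y|)^-1).
  have -> : ln (Num.sqrt `|y|)^-1 = - ln (Num.sqrt `|y|) by apply: lnV.
  by rewrite lnXn // -mulr_natl; ring.
rewrite opprK -[X in X * _ <= _](sqr_sqrtr (ltW ny)).
have : ln (Num.sqrt `|y|)^-1 <= (Num.sqrt `|y|)^-1.
  have := @le_ln1Dx R ((Num.sqrt `|y|)^-1 - 1); rewrite addrCA subrr addr0 => h.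
  by apply: le_trans (h _) _; [rewrite ltrBrDl addrN invr_gt0|rewrite lerBlDr lerDl].
move: s0; set s := Num.sqrt `|y| => s0 h.
rewrite (_ : 2 * s = s ^+ 2 * (2 * s^-1)); last by field; rewrite gt_eqF.
by rewrite ler_wpM2l ?sqr_ge0 // ler_wpM2l.
Qed.

Lemma continuous_mul_ln : continuous (fun y : R => y * ln `|y|).
Proof.
move=> y; have [->|y0] := eqVneq y 0; last first.
  apply: cvgM; first exact: cvg_id.
  apply: (@continuous_comp _ _ _ (fun z : R => `|z|) (@ln R)).
    by apply: cvg_norm; exact: cvg_id.
  by apply: continuous_ln; rewrite normr_gt0.
rewrite /continuous_at mul0r; apply/cvgrPdist_lt => e e0.
have e22 : 0 < (e / 2) ^+ 2 by rewrite exprn_gt0 // divr_gt0.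
apply/nbhs_ballP; exists (Num.min 1 ((e / 2) ^+ 2)); first by rewrite /= lt_min ltr01.
move=> z; rewrite /ball /= sub0r normrN lt_min => /andP[z1 z2]; rewrite sub0r normrN.
apply: le_lt_trans (norm_mul_ln_le (ltW z1)) _; rewrite mulrC -ltr_pdivlMr //.
apply: (@lt_le_trans _ _ (Num.sqrt ((e / 2) ^+ 2))); first by rewrite ltr_sqrt.
by rewrite sqrtr_sqr ger0_norm // divr_ge0 // ltW.
Qed.

Lemma integral_ln_dist (t h : R) : 0 < t < 1 -> 0 < h ->
  leb.-integrable I01 (EFin \o (fun u => ln (h * `|t - u|))) ->
  \int[leb]_(u in I01) ln (h * `|t - u|) = ln h + t * ln t + (1 - t) * ln (1 - t) - 1.
Proof.
move=> /andP[t0 t1] h0 intf.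
pose f u := ln (h * `|t - u|).
(* Antiderivative on either side of [t], continuous at [t], where the integrand is singular. *)
pose g (u : R) := (u - t) * ln `|u - t| - u + u * ln h.
have cg : continuous g.
  move=> u; apply: cvgD; last by apply: cvgM; [exact: cvg_id|exact: cvg_cst].
  apply: cvgB; last exact: cvg_id.
  apply: (@continuous_comp _ _ _ (fun u => u - t) (fun y => y * ln `|y|)).
    by apply: cvgB; [exact: cvg_id|exact: cvg_cst].
  exact: continuous_mul_ln.
have dg u : u != t -> is_derive u 1 g (f u).
  move=> ut; have ut0 : u - t != 0 by rewrite subr_eq0.
  have sq : 0 < (u - t) ^+ 2 by rewrite exprn_even_gt0.
  have d1 : is_derive u 1 (fun u : R => (u - t) ^+ 2) (2 * (u - t)).
    by apply: is_derive_eq; rewrite /GRing.scale /=; ring.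
  have d2 : is_derive u 1 (fun u : R => ln ((u - t) ^+ 2)) (2 * (u - t) / (u - t) ^+ 2).
    exact: is_derive_lnf.
  have -> : g = fun u : R => (u - t) * (2^-1 * ln ((u - t) ^+ 2)) - u + u * ln h.
    by apply/funext => z; rewrite /g ln_norm_sqr.
  apply: is_derive_eq.
  rewrite /f distrC lnM ?posrE ?normr_gt0 // ln_norm_sqr /GRing.scale /=.
  by field.
have cf u : u != t -> continuous_at u f.
  move=> ut; apply: (@continuous_comp _ _ _ (fun u => h * `|t - u|) (@ln R)).
    apply: cvgM; first exact: cvg_cst.
    by apply: cvg_norm; apply: cvgB; [exact: cvg_cst|exact: cvg_id].
  by apply: continuous_ln; rewrite mulr_gt0 // normr_gt0 subr_eq0 eq_sym.
have sub u v : 0 <= u -> v <= 1 -> leb.-integrable `[u, v] (EFin \o f).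
  by move=> u0 v1; apply: integrableS intf => //; apply: subset_itv; rewrite bnd_simp.
have E1 : \int[leb]_(u in `[0, t]) f u = g t - g 0.
  apply: (FTC_open t0 _ _ _ (sub _ _ (lexx _) (ltW t1))).
  - exact: continuous_subspaceT.
  - by move=> u /andP[_ ut]; apply: dg; rewrite lt_eqF.
  - by move=> u /andP[_ ut]; apply: cf; rewrite lt_eqF.
have E2 : \int[leb]_(u in `[t, 1]) f u = g 1 - g t.
  apply: (FTC_open t1 _ _ _ (sub _ _ (ltW t0) (lexx _))).
  - exact: continuous_subspaceT.
  - by move=> u /andP[ut _]; apply: dg; rewrite gt_eqF.
  - by move=> u /andP[ut _]; apply: cf; rewrite gt_eqF.
have E3 : \int[leb]_(u in I01) f u - \int[leb]_(u in `[0, t]) f u = \int[leb]_(u in `]t, 1]) f u.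
  by apply: Rintegral_itvB => //; rewrite bnd_simp ltW.
have E4 : \int[leb]_(u in `]t, 1]) f u = \int[leb]_(u in `[t, 1]) f u.
  apply: Rintegral_itv_obnd_cbnd; apply: integrableS (sub _ _ (ltW t0) (lexx 1)) => //.
  by apply: subset_itv; rewrite bnd_simp.
move: E3; rewrite E4 E1 E2 /g subrr mul0r sub0r normrN (gtr0_norm t0).
rewrite (gtr0_norm (_ : 0 < 1 - t)) ?subr_gt0 // => E3.
rewrite -[LHS](subrK (g t - g 0)).
have -> : \int[leb]_(u in I01) ln (h * `|t - u|) - (g t - g 0) = \int[leb]_(u in I01) f u - (g t - g 0) by [].
move: E3; rewrite /g subrr mul0r sub0r normrN (gtr0_norm t0) => E3; lra.
Qed.

Lemma is_derive_entropy (t h : R) : 0 < t < 1 ->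
  is_derive t 1 (fun t : R => ln h + t * ln t + (1 - t) * ln (1 - t) - 1) (ln t - ln (1 - t)).
Proof.
move=> /andP[t0 t1]; have t1' : 0 < 1 - t by rewrite subr_gt0.
have d0 : is_derive t 1 (fun t : R => 1 - t) (-1).
  by apply: is_derive_eq; rewrite /GRing.scale /=; ring.
have d1 := is_derive_lnf d0 t1'.
have d2 := is_derive1_ln t0.
apply: is_derive_eq.
by rewrite /GRing.scale /=; field; rewrite !gt_eqF.
Qed.

Lemma nondeg1 (e : (R * R) * (R * R)) : e.2 != 0 -> nondeg [:: e].
Proof. by move=> e0 s; rewrite inE => /eqP ->. Qed.

(** The growth constant 4 is that of a single segment; dividing by the speed passes from arc length
    to the parameter. *)
Definition rootbound (e : (R * R) * (R * R)) : R := jmass (segm [:: e]) 4 / enorm e.2.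

Section Rootker.
Variable e : (R * R) * (R * R).
Hypothesis e0 : e.2 != 0.

Let h0 : 0 < enorm e.2. Proof. by rewrite enorm_gt0. Qed.
Let mureg (x : R * R) (r : R) : 0 < r -> (segm [:: e] [set y | (enorm (x - y) < r)%R] <= (4 * r)%:E)%E.
Proof. by move=> r0; have := segm_regular x (nondeg1 e0) r0; rewrite /= mulr1. Qed.

Lemma rootker_integrable x : leb.-integrable I01 (EFin \o (fun t => rootker x (seg e t))) /\
  \int[leb]_(t in I01) rootker x (seg e t) <= rootbound e.
Proof.
have le4 : (0 : R) <= 4 by [].
have ge0 (y : R * R) : (0 <= (rootker x y)%:E)%E by rewrite lee_fin rootker_ge0.
have mr : measurable_fun setT (fun y => (rootker x y)%:E) by apply/measurable_EFinP; exact: measurable_rootker1.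
have := integral_rootker_le le4 mureg x.
rewrite ge0_integral_segm // big_seq1 => h.
have h' : (\int[leb]_(t in I01) (rootker x (seg e t))%:E <= (rootbound e)%:E)%E.
  by rewrite /rootbound mulrC EFinM lee_pdivlMl // muleC.
have i : leb.-integrable I01 (EFin \o (fun t => rootker x (seg e t))).
  apply/integrableP; split; first exact: (measurable_fun_segleb e mr).
  under eq_integral do rewrite /= ger0_norm ?rootker_ge0 //.
  by apply: le_lt_trans h' _; rewrite ltry.
split => //; rewrite -lee_fin /Rintegral fineK //.
by apply: integrable_fin_num i.
Qed.

(** Of the singularity [1 / |w|] one half is estimated by the distance and the other left to the
    integrable [rootker]; the bound grows only like [d ^ (- 1 / 2)]. *)
Lemma kq_int_bound x c (d : R) : 0 < d ->
  (forall t, 0 <= t <= 1 -> d <= enorm (x - seg e t)) ->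
  `|\int[leb]_(t in I01) kq c (x - seg e t)| <= enorm c * (Num.sqrt d)^-1 * rootbound e.
Proof.
move=> d0 hd.
have xS : ~ [set seg e t | t in `[0, 1]] x.
  move=> [t /=]; rewrite in_itv /= => /hd ht xE; move: ht; rewrite xE subrr enorm0; lra.
have mI : measurable (I01 : set (measurableTypeR R)) by [].
have [ir ler] := rootker_integrable x.
have ik : leb.-integrable I01 (EFin \o (fun t => kq c (x - seg e t))).
  by apply: integrable_I01; apply: (continuous_segF xS) => w; exact: continuous_kq.
have s0 : 0 < Num.sqrt d by rewrite sqrtr_gt0.
have k0 : 0 <= enorm c * (Num.sqrt d)^-1 by rewrite mulr_ge0 ?enorm_ge0 // invr_ge0 ltW.
apply: le_trans (le_normr_Rintegral _ ik) _ => //.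
apply: (@le_trans _ _ (\int[leb]_(t in I01) (enorm c * (Num.sqrt d)^-1 * rootker x (seg e t)))).
  apply: le_Rintegral => //.
  - by have := integrable_norm ik; apply: eq_integrable.
  - by have := integrableZl mI (enorm c * (Num.sqrt d)^-1) ir; apply: eq_integrable.
  move=> t; rewrite /= in_itv /= => /hd ht; apply: le_trans (norm_kq_le _ _) _.
  have w0 := lt_le_trans d0 ht.
  rewrite /rootker -mulrA ler_wpM2l ?enorm_ge0 // -invfM lef_pV2 ?posrE //; last first.
    by rewrite mulr_gt0 // sqrtr_gt0.
  apply: (@le_trans _ _ (Num.sqrt (enorm (x - seg e t)) * Num.sqrt (enorm (x - seg e t)))).
    by rewrite ler_wpM2r ?sqrtr_ge0 // ler_sqrt // ltW.
  by rewrite -expr2 sqr_sqrtr // ltW.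
by rewrite RintegralZl // ler_wpM2l.
Qed.

End Rootker.

(** For independent directions the component normal to [l'] bounds the distance. Parallel directions
    must be opposite, as equal ones would make the segments overlap. *)
Lemma sector_dist (l l' : R * R) : l != 0 -> l' != 0 ->
  (forall t u, 0 < t < 1 -> 0 <= u <= 1 -> t *: l != u *: l') ->
  exists2 c : R, 0 < c & forall t u, 0 <= t -> 0 <= u -> c * t <= enorm (t *: l - u *: l').
Proof.
move=> l0 l'0 ne; have n0 : 0 < enorm l' by rewrite enorm_gt0.
have [par|npar] := eqVneq (dot l (perp l')) 0; last first.
  have d0 : 0 < `|dot l (perp l')| by rewrite normr_gt0.
  exists (`|dot l (perp l')| / enorm l'); first by rewrite divr_gt0.
  move=> t u t0 u0; rewrite mulrAC ler_pdivrMr //.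
  have -> : `|dot l (perp l')| * t = `|dot (t *: l - u *: l') (perp l')|.
    rewrite -[t in LHS]ger0_norm // -normrM; congr `|_|.
    by rewrite /dot /perp /= /GRing.scale /=; ring.
  apply: le_trans (ler_dot _ _) _; rewrite (_ : enorm (perp l') = enorm l') //.
  by rewrite /enorm /dot /perp /= mulrNN addrC.
have ll : 0 < dot l' l' by rewrite dot_gt0.
pose k := dot l l' / dot l' l'.
have lE : l = k *: l'.
  move: ll par; rewrite /k /dot /perp /=; case: l l' {l0 l'0 ne n0 k} => [l1 l2] [m1 m2] /= ll par.
  have p : l2 * m1 = l1 * m2 by apply/eqP; rewrite -subr_eq0; apply/eqP; rewrite -par; ring.
  apply: injective_projections; rewrite /= /GRing.scale /= mulrAC;
    apply: (canRL (mulfK (lt0r_neq0 ll))).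
  - by transitivity (l1 * m1 * m1 + m2 * (l1 * m2)); [ring|rewrite -p; ring].
  - by transitivity (l2 * m2 * m2 + m1 * (l2 * m1)); [ring|rewrite p; ring].
have k0 : k < 0.
  rewrite ltNge; apply/negP; rewrite le_eqVlt => /orP[/eqP k0|k0].
    by move: l0; rewrite lE -k0 scale0r eqxx.
  (* Both [t] and [t * k] lie strictly between 0 and 1, so the segments would share a point. *)
  pose t := (2 * (1 + k))^-1; have kk : 0 < 2 * (1 + k) by lra.
  have t0 : 0 < t by rewrite invr_gt0.
  have tk : t * (2 * (1 + k)) = 1 by rewrite mulVf // gt_eqF.
  have /eqP[] : t *: l != (t * k) *: l'; last by rewrite lE scalerA.
  apply: ne; apply/andP; split; nra.
exists (- k * enorm l') => [|t u t0 u0]; first by rewrite mulr_gt0 // oppr_gt0.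
rewrite lE scalerA -scalerBl enormZ mulrAC ler_wpM2r ?enorm_ge0 //.
rewrite ler0_norm; last by nra.
by rewrite opprB mulrC; nra.
Qed.

Lemma disjoint_segments_dist (e e' : (R * R) * (R * R)) :
  (forall t u, 0 <= t <= 1 -> 0 <= u <= 1 -> seg e t != seg e' u) ->
  exists2 c : R, 0 < c & forall t u, 0 <= t <= 1 -> 0 <= u <= 1 -> c <= enorm (seg e t - seg e' u).
Proof.
move=> ne; pose S := [set seg e z.1 - seg e' z.2 | z in I01 `*` I01].
have cS : compact S.
  apply: continuous_compact; last by apply: compact_setX; exact: segment_compact.
  apply: continuous_subspaceT => z; apply: cvgB.
    by apply: (@continuous_comp _ _ _ fst (seg e)); [exact: cvg_fst|exact: continuous_seg].
  by apply: (@continuous_comp _ _ _ snd (seg e')); [exact: cvg_snd|exact: continuous_seg].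
have clS : closed S by apply: compact_closed cS; exact: norm_hausdorff.
have : \forall y \near (0 : R * R), ~ S y.
  apply: open_nbhs_nbhs; split; first exact: closed_openC.
  move=> [[t u] /= []]; rewrite !in_itv /= => t01 u01 /eqP; rewrite subr_eq0.
  exact/negP/ne.
move=> /nbhs_enorm[c c0 hc]; exists c => // t u t01 u01; rewrite leNgt; apply/negP => lt.
apply: (hc (seg e t - seg e' u)); first by rewrite sub0r enormN.
by exists (t, u); rewrite //= !in_itv.
Qed.

End SelfPotential.

(** * Hypersingular operator on the boundary of a region *)

Section DoubleLayer.
Context {R : realType} (Ga : network R) (hGa : is_network Ga) (r : 'I_(nbnd Ga).+1).
Local Notation leb := (@lebesgue_measure R).
Local Notation I01 := (`[0, 1]%classic : set R).
Local Notation vpt j := (pos (vpos Ga) j).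
Local Notation lvc a := (ell a (vpos Ga)).
Local Notation Sup := (support_set Ga).
Local Notation sg := (sideR r).
Implicit Types (a b : vidx Ga) (x n w : R * R) (j : 'I_(nN Ga)).

Definition eseg_data a : (R * R) * (R * R) := (vpt (vx a), lvc a).
Local Notation eg := eseg_data.

(** Slope of the hat function of [j] in the parameter of edge [a]. It is also 1 on edges entering
    [j] and -1 on edges leaving it, which is how slopes and vertex balance meet. *)
Definition vjump j a : R := (vx (nxt a) == j)%:R - (vx a == j)%:R.

Lemma eg_neq0 a : a \in bedges r -> (eg a).2 != 0.
Proof. by move=> /bedges_edge; exact: ell_neq0. Qed.

Lemma bedges_balance j : \sum_(a in bedges r) sg a * vjump j a = 0.
Proof.
rewrite -[RHS](vertex_balance hGa r j) [RHS](bigID (mem (bedges r))) /=.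
rewrite [X in _ + X]big1 ?addr0 => [|a /andP[ea nb]]; last by rewrite sideR_out // mul0r.
by apply: eq_bigl => a; apply/idP/andP => [ab|[]//]; split => //; exact: bedges_edge ab.
Qed.

Lemma dir_derive (f : R * R -> R) x n (l : R) :
  is_derive (0 : R) 1 (fun s => f (x + s *: n)) l -> 'D_n f x = l.
Proof.
move=> [dv <-]; rewrite /derive.
suff -> : (fun h : R => h^-1 *: ((f \o shift x) (h *: n) - f x)) =
    (fun h : R => h^-1 *: (((fun s => f (x + s *: n)) \o shift 0) (h *: 1) - f (x + 0 *: n))) by [].
apply/funext => h; rewrite /= /shift /= scale0r !addr0 [h *: n + x]addrC.
by rewrite [h *: 1]mulr1.
Qed.

Lemma kqZ (c : R) w x : kq (c *: w) x = c * kq w x.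
Proof. by rewrite /kq dotZr mulrA. Qed.

Lemma derive_Gfun x w n : x != w -> 'D_n (fun y => Gfun (x - y)) w = (2 * pi)^-1 * kq n (x - w).
Proof.
move=> xw; apply: dir_derive.
have E : (fun s : R => Gfun (x - (w + s *: n))) =
    (cst (- (2 * pi)^-1) * (fun s : R => ln (enorm ((x - w) + s *: (- n)))))%R.
  apply/funext => s; rewrite /Gfun [RHS]/( _ * _) /=; congr (_ * ln (enorm _)).
  by rewrite opprD addrA scalerN.
have w0 : (x - w) + 0 *: (- n) != 0 by rewrite scale0r addr0 subr_eq0.
rewrite E; apply: (is_derive_eq (is_deriveM (is_derive_cst (- (2 * pi)^-1 : R) (0:R) 1) (is_derive_lnn w0))).
by rewrite scale0r addr0 /GRing.scale /= -[- n]scaleN1r kqZ; ring.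
Qed.

Definition dlseg j b x : R := \int[leb]_(t in I01)
  (kq (perp (eg b).2) (x - seg (eg b) t) * ((1 - t) * (vx b == j)%:R + t * (vx (nxt b) == j)%:R)).

Definition hatn j : bfun Ga := fun a t =>
  (1 - t) * (vx a == j)%:R + t * (vx (nxt a) == j)%:R.

Lemma off_edge b x : ~ Sup x -> is_edge b -> ~ [set seg (eg b) t | t in `[0, 1]] x.
Proof. by move=> Sx eb bx; apply: Sx; exists b. Qed.

Lemma dlpE j x : ~ Sup x ->
  dlp r (hatn j) x = - (2 * pi)^-1 * \sum_(b in bedges r) sg b * dlseg j b x.
Proof.
move=> Sx; rewrite /dlp /bint mulr_sumr; apply: eq_bigr => b bB.
have eb := bedges_edge bB; have xb := off_edge Sx eb.
have h0 := hlen_gt0 hGa eb; have [_ nE] := nuR_sideR hGa bB.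
transitivity (hlen b * \int[leb]_(t in I01) (- ((2 * pi)^-1 * sg b / hlen b) *
    (kq (perp (eg b).2) (x - seg (eg b) t) * hatn j b t))).
  congr (_ * _); apply: eq_Rintegral => t; rewrite inE /= in_itv /= => t01.
  have xt : x != seg (eg b) t.
    by apply/eqP => E; apply: xb; exists t; rewrite //= in_itv.
  have E : nuR r b = (- (sg b / hlen b)) *: perp (lvc b).
    by rewrite nE /nu scalerN scalerA scaleNr.
  rewrite derive_Gfun // E kqZ -[epoint b t]/(seg (eg b) t) -[perp (lvc b)]/(perp (eg b).2).
  by move: (kq _ _) (hatn _ _ _) => k h; ring.
have ik : leb.-integrable I01 (EFin \o (fun t => kq (perp (eg b).2) (x - seg (eg b) t) * hatn j b t)).
  apply: integrable_I01; apply: continuous_within_M.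
    by apply: (continuous_segF xb) => w; exact: continuous_kq.
  apply: continuous_subspaceT => t; apply: cvgD; (apply: cvgM; last exact: cvg_cst).
    by apply: cvgB; [exact: cvg_cst|exact: cvg_id].
  exact: cvg_id.
rewrite RintegralZl // -/(dlseg j b x); move: (dlseg j b x) => D.
by move: ((2 * pi)^-1) => c; field; exact: lt0r_neq0.
Qed.

Lemma is_derive_sum_seq (I : Type) (s : seq I) (P : pred I) (f : I -> R -> R) (df : I -> R) (x : R) :
  (forall i, P i -> is_derive x 1 (f i) (df i)) ->
  is_derive x 1 (fun z => \sum_(i <- s | P i) f i z) (\sum_(i <- s | P i) df i).
Proof.
move=> h; elim: s => [|i s IH].
  rewrite big_nil (_ : (fun z => _) = cst 0); first exact: is_derive_cst.
  by apply/funext => z; rewrite big_nil.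
rewrite big_cons (_ : (fun z => _) = fun z => (if P i then f i z + \sum_(j <- s | P j) f j z else \sum_(j <- s | P j) f j z)); last first.
  by apply/funext => z; rewrite big_cons.
by case: ifPn => // Pi; apply: is_deriveD => //; exact: h.
Qed.

(** All endpoint terms of [is_derive_dlpot] carry the same factor [kq (perp n) (x - vpt j)], and
    their coefficients add up to zero. *)
Lemma derive_dlp j x n : ~ Sup x -> 'D_n (dlp r (hatn j)) x =
  - (2 * pi)^-1 * \sum_(b in bedges r) sg b * vjump j b * \int[leb]_(t in I01) kq (perp n) (x - seg (eg b) t).
Proof.
move=> Sx; apply: dir_derive.
pose G (s : R) := - (2 * pi)^-1 * \sum_(b in bedges r) sg b * dlseg j b (x + s *: n).
have nearG : \forall s \near (0 : R), G s = dlp r (hatn j) (x + s *: n).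
  have [d d0 hd] := near_off_support Sx.
  have n1 : 0 < enorm n + 1 by rewrite ltr_wpDl ?enorm_ge0.
  apply/nbhs_ballP; exists (d / (enorm n + 1)); first by rewrite /= divr_gt0.
  move=> s; rewrite /ball /= sub0r normrN ltr_pdivlMr // => sd; rewrite dlpE //; apply: hd.
  by rewrite opprD addrA subrr sub0r enormN enormZ; have := normr_ge0 s; lra.
apply: (near_eq_is_derive nearG).
have dB b : b \in bedges r -> is_derive (0 : R) 1 (fun s => sg b * dlseg j b (x + s *: n))
   (sg b * ((vx b == j)%:R * kq (perp n) (x - seg (eg b) 0) - (vx (nxt b) == j)%:R * kq (perp n) (x - seg (eg b) 1) +
   vjump j b * \int[leb]_(t in I01) kq (perp n) (x - seg (eg b) t))).
  move=> bB; have xb := off_edge Sx (bedges_edge bB).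
  have D := is_derive_dlpot xb n (vx b == j)%:R (vx (nxt b) == j)%:R.
  apply: (is_derive_eq (is_deriveM (is_derive_cst (sg b) (0 : R) 1) D)).
  by rewrite scaler0 addr0.
have DS := is_derive_sum_seq (index_enum (vidx Ga)) dB.
apply: (is_derive_eq (is_deriveM (is_derive_cst (- (2 * pi)^-1 : R) (0 : R) 1) DS)).
rewrite /GRing.scale /= mulr0 addr0; congr (_ * _).
have E b : sg b * ((vx b == j)%:R * kq (perp n) (x - seg (eg b) 0) - (vx (nxt b) == j)%:R * kq (perp n) (x - seg (eg b) 1) +
   vjump j b * \int[leb]_(t in I01) kq (perp n) (x - seg (eg b) t)) =
   - kq (perp n) (x - vpt j) * (sg b * vjump j b) +
   sg b * vjump j b * \int[leb]_(t in I01) kq (perp n) (x - seg (eg b) t).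
  have -> : (vx b == j)%:R * kq (perp n) (x - seg (eg b) 0) = (vx b == j)%:R * kq (perp n) (x - vpt j).
    by case: eqP => [<-|]; rewrite ?mul0r // -[seg _ 0]/(epoint b 0) epoint0.
  have -> : (vx (nxt b) == j)%:R * kq (perp n) (x - seg (eg b) 1) = (vx (nxt b) == j)%:R * kq (perp n) (x - vpt j).
    by case: eqP => [<-|]; rewrite ?mul0r // -[seg _ 1]/(epoint b 1) epoint1.
  move: (\int[leb]_(t in I01) kq (perp n) (x - seg (eg b) t)) => I; rewrite /vjump; ring.
by rewrite (eq_bigr _ (fun b _ => E b)) big_split /= -mulr_sumr bedges_balance mulr0 add0r.
Qed.

(** Derivative along edge [a] of the logarithmic potential of edge [b]; for [b = a] the integral is
    replaced by its principal value. *)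
Definition Phi a b (t : R) : R := if b == a then ln t - ln (1 - t)
  else \int[leb]_(u in I01) kq (lvc a) (epoint a t - seg (eg b) u).

Lemma perp_nuR a : a \in bedges r -> perp (nuR r a) = (sg a / hlen a) *: lvc a.
Proof.
move=> /(nuR_sideR hGa)[_ ->]; rewrite /nu /perp.
by apply: injective_projections; rewrite /= /GRing.scale /=; ring.
Qed.

Lemma epoint_off_edge a b t : is_edge a -> is_edge b -> b != a -> 0 < t < 1 ->
  ~ [set seg (eg b) t | t in `[0, 1]] (epoint a t).
Proof.
move=> ea eb /eqP ba t01 h; apply: (edge_interior hGa ea eb _ t01 h).
exact/nesym.
Qed.

Lemma edge_normal_off a t : a \in bedges r -> 0 < t < 1 ->
  \forall e \near (0 : R)^'+, ~ Sup (epoint a t - e *: nuR r a).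
Proof.
move=> aB t01; have ea := bedges_edge aB; have h0 := hlen_gt0 hGa ea.
have [s1 nE] := nuR_sideR hGa aB; have [d d0 hd] := edge_ball hGa ea t01.
have n1 : enorm (nuR r a) = 1.
  by rewrite nE enormZ enorm_nu //; case: s1 => ->; rewrite ?normrN normr1 mulr1.
near=> e; have e0 : 0 < e by near: e; exact: nbhs_right_gt.
move=> /hd; rewrite opprB addrC subrK enormZ n1 mulr1 gtr0_norm //.
rewrite addrAC subrr add0r rdotN rdotZ nE rdotZ rdot_nu //.
have ed : e < d by near: e; apply: nbhs_right_lt.
move=> h; have := h ed; move=> /eqP; rewrite oppr_eq0 mulf_eq0 gt_eqF //= mulf_eq0 oppr_eq0 (gt_eqF h0) orbF.
by case: s1 => ->; rewrite ?oppr_eq0 oner_eq0.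
Unshelve. all: by end_near. Qed.

(** For [b = a] the limit cannot be taken under the integral; the closed form of [kq_tangent] is
    continuous up to interior points of the edge. *)
Lemma kq_int_limit a b t : a \in bedges r -> b \in bedges r -> 0 < t < 1 ->
  \int[leb]_(u in I01) kq (lvc a) (epoint a t - e *: nuR r a - seg (eg b) u) @[e --> (0 : R)^'+]
  --> Phi a b t.
Proof.
move=> aB bB t01; have ea := bedges_edge aB; have eb := bedges_edge bB.
rewrite /Phi; case: eqVneq => [ba|ba]; last first.
  have C := @continuous_kq_int R _ _ (epoint_off_edge ea eb ba t01) (lvc a) (- nuR r a).
  have := cvg_at_right_filter C; rewrite /= scale0r addr0.
  by under eq_fun do rewrite scalerN.
rewrite {}ba; have h0 := hlen_gt0 hGa ea; have [t0 t1] := andP t01.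
pose g (e : R) := ln (enorm (epoint a t - e *: nuR r a - seg (eg a) 0)) - ln (enorm (epoint a t - e *: nuR r a - seg (eg a) 1)).
have g0 : g 0 = ln t - ln (1 - t).
  rewrite /g scale0r subr0 -[seg _ 0]/(epoint a 0) -[seg _ 1]/(epoint a 1) !epointB !enormZ subr0.
  rewrite (gtr0_norm t0) ltr0_norm ?subr_lt0 // opprB -/(hlen a).
  by rewrite !lnM ?posrE ?subr_gt0 //; ring.
have cg u : (u = 0 \/ u = 1) -> continuous_at (0 : R) (fun e => ln (enorm (epoint a t - e *: nuR r a - seg (eg a) u))).
  move=> u01.
  change (continuous_at (0 : R) (@ln R \o (fun e : R => enorm (epoint a t - e *: nuR r a - seg (eg a) u)))).
  apply: continuous_comp.
    apply: (@continuous_comp _ _ _ (fun e : R => epoint a t - e *: nuR r a - seg (eg a) u) enorm); last exact: continuous_enorm.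
    apply: cvgB; last exact: cvg_cst.
    by apply: cvgB; [exact: cvg_cst|apply: cvgZr_tmp; exact: cvg_id].
  apply: continuous_ln; rewrite scale0r subr0 enorm_gt0 -[seg _ u]/(epoint a u) epointB.
  rewrite scaler_eq0 negb_or ell_neq0 // andbT subr_eq0.
  by case: u01 => ->; [rewrite gt_eqF|rewrite lt_eqF].
rewrite -g0; apply: (cvg_trans _ (cvg_at_right_filter (cvgB (cg 0 (or_introl erefl)) (cg 1 (or_intror erefl))))).
apply: near_eq_cvg; near=> e.
have Sx : ~ Sup (epoint a t - e *: nuR r a) by near: e; exact: edge_normal_off.
by rewrite -(kq_tangent (off_edge Sx ea)).
Unshelve. all: by end_near. Qed.

Lemma cvg_sum_seq (I : Type) (s : seq I) (P : pred I) (f : I -> R -> R) (l : I -> R) (F : set_system R) :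
  Filter F -> (forall i, P i -> f i e @[e --> F] --> l i) ->
  \sum_(i <- s | P i) f i e @[e --> F] --> \sum_(i <- s | P i) l i.
Proof.
move=> FF h; elim: s => [|i s IH].
  by under eq_fun do rewrite big_nil; rewrite big_nil; exact: cvg_cst.
rewrite big_cons; under eq_fun do rewrite big_cons.
by case: ifPn => // Pi; apply: cvgD => //; exact: h.
Qed.

(* Edgewise integration by parts, via [is_derive_maue]: the endpoint terms cancel by
   [bedges_balance], leaving tangential derivatives of logarithmic potentials. *)
Lemma hypersingE j a t : a \in bedges r -> 0 < t < 1 ->
  hypersing r (hatn j) a t =
  (2 * pi)^-1 * (sg a / hlen a) * \sum_(b in bedges r) sg b * vjump j b * Phi a b t.
Proof.
move=> aB t01; rewrite /hypersing.
suff : 'D_(nuR r a) (dlp r (hatn j)) (epoint a t - e *: nuR r a) @[e --> (0 : R)^'+] -->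
   - ((2 * pi)^-1 * (sg a / hlen a) * \sum_(b in bedges r) sg b * vjump j b * Phi a b t).
  by move=> /cvg_lim ->; rewrite ?opprK.
pose c := - ((2 * pi)^-1 * (sg a / hlen a)).
have lim1 : c * \sum_(b in bedges r) sg b * vjump j b *
     \int[leb]_(u in I01) kq (lvc a) (epoint a t - e *: nuR r a - seg (eg b) u) @[e --> (0 : R)^'+] -->
   c * \sum_(b in bedges r) sg b * vjump j b * Phi a b t.
  apply: cvgM; first exact: cvg_cst.
  apply: cvg_sum_seq => b bB; apply: cvgM; first exact: cvg_cst.
  exact: kq_int_limit.
rewrite -mulNr -/c; apply: cvg_trans lim1; apply: near_eq_cvg; near=> e.
have Sx : ~ Sup (epoint a t - e *: nuR r a) by near: e; exact: edge_normal_off.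
rewrite derive_dlp // /c -mulNr -mulrA; congr (_ * _).
rewrite mulr_sumr; apply: eq_bigr => b bB; rewrite [in LHS]mulrCA; congr (_ * _).
rewrite perp_nuR //.
under [RHS]eq_Rintegral do rewrite kqZ.
rewrite RintegralZl //; apply: integrable_I01.
by apply: (continuous_segF (off_edge Sx (bedges_edge bB))) => w; exact: continuous_kq.
Unshelve. all: by end_near. Qed.

End DoubleLayer.

(** * Integration by parts along the edges *)

Section Hypersingular.
Context {R : realType} (Ga : network R) (hGa : is_network Ga) (r : 'I_(nbnd Ga).+1).
Local Notation leb := (@lebesgue_measure R).
Local Notation I01 := (`[0, 1]%classic : set R).
Local Notation vpt j := (pos (vpos Ga) j).
Local Notation lvc a := (ell a (vpos Ga)).
Local Notation sg := (sideR r).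
Local Notation eg := eseg_data.
Implicit Types (a b : vidx Ga) (x n w : R * R) (j : 'I_(nN Ga)).

Let mI : measurable (I01 : set (measurableTypeR R)). Proof. by []. Qed.

Lemma integrableZ01 (c : R) (f : R -> R) : leb.-integrable I01 (EFin \o f) ->
  leb.-integrable I01 (EFin \o (fun t => c * f t)).
Proof. by move=> fi; apply: eq_integrable (integrableZl mI c fi) => // t _. Qed.

Lemma integrableD01 (f g : R -> R) : leb.-integrable I01 (EFin \o f) -> leb.-integrable I01 (EFin \o g) ->
  leb.-integrable I01 (EFin \o (fun t => f t + g t)).
Proof. by move=> fi gi; apply: eq_integrable (integrableD mI fi gi) => // t _. Qed.

Lemma dominated01 (f g : R -> R) : measurable_fun (`]0, 1[ : set R) f ->
  leb.-integrable I01 (EFin \o g) -> (forall t, 0 < t < 1 -> `|f t| <= g t) ->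
  (forall t, 0 <= t <= 1 -> 0 <= g t) -> f 0 = 0 -> f 1 = 0 -> leb.-integrable I01 (EFin \o f).
Proof.
move=> mf gi fg g0 f0 f1; apply: le_integrable gi => //.
  apply/measurable_EFinP.
  apply/measurable_fun_itv_bndo_bndcP; exact/measurable_fun_itv_obnd_cbndP.
move=> t; rewrite /= in_itv /= => /andP[t0 t1]; rewrite lee_fin.
rewrite [leRHS]ger0_norm; last by apply: g0; rewrite t0.
have [->|n0] := eqVneq t 0; first by rewrite f0 normr0 g0 // lexx ler01.
have [->|n1] := eqVneq t 1; first by rewrite f1 normr0 g0 // lexx ler01.
by apply: fg; rewrite !lt_def n0 t0 eq_sym n1.
Qed.

Lemma logker_seg_integrable (e : (R * R) * (R * R)) x : e.2 != 0 ->
  leb.-integrable I01 (EFin \o (fun u => logker x (seg e u))).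
Proof.
move=> e0; have [ir _] := rootker_integrable e0 x.
have bi : leb.-integrable I01 (EFin \o (fun u => 2 * rootker x (seg e u) + (enorm (x - e.1) + enorm e.2))).
  by apply: integrableD01; [exact: integrableZ01|exact: integrable_cst01].
apply: le_integrable bi => //.
  by apply/measurable_EFinP; apply: (measurable_fun_segleb e); exact: measurable_logker1.
move=> u; rewrite /= in_itv /= => /andP[u0 u1]; rewrite lee_fin [leRHS]ger0_norm; last first.
  by rewrite addr_ge0 ?mulr_ge0 ?rootker_ge0 // addr_ge0 ?enorm_ge0.
apply: le_trans (norm_logker_le _ _) _; rewrite lerD2l /seg opprD addrA.
apply: le_trans (ler_enormD _ _) _; rewrite lerD2l enormN enormZ ger0_norm //.
by rewrite ler_piMl // enorm_ge0.
Qed.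

Definition lpot b x : R := \int[leb]_(u in I01) ln (enorm (x - seg (eg b) u)).

Lemma lpotE b x : is_edge b -> lpot b x = - \int[leb]_(u in I01) logker x (seg (eg b) u).
Proof.
move=> eb; have e0 : (eg b).2 != 0 by exact: ell_neq0.
rewrite -mulN1r -RintegralZl //; last exact: logker_seg_integrable.
by apply: eq_Rintegral => u _; rewrite /logker mulN1r opprK.
Qed.

Lemma continuous_lpot b : is_edge b -> continuous (lpot b).
Proof.
move=> eb; have e0 : (eg b).2 != 0 by exact: ell_neq0.
have h0 := hlen_gt0 hGa eb.
have disj : almost_disjoint (fun _ : unit => eg b) by move=> [] [].
have c := @continuous_segpot R unit (fun _ => eg b) (fun _ => e0) disj tt.
have -> : lpot b = fun x => (- (hlen b)^-1) * (hlen b * \int[leb]_(u in I01) logker x (seg (eg b) u)).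
  by apply/funext => x; rewrite lpotE // mulNr mulrA mulVf ?mul1r // gt_eqF.
by move=> x; apply: cvgM; [exact: cvg_cst|exact: c].
Qed.

Lemma continuous_lpot_edge a b : is_edge b -> continuous (fun t => lpot b (epoint a t)).
Proof.
move=> eb t; apply: (@continuous_comp _ _ _ (epoint a) (lpot b)); last exact: continuous_lpot.
exact: (@continuous_seg R (eg a)).
Qed.

Lemma is_derive_shift (G : R -> R) (t l : R) : is_derive (0 : R) 1 G l ->
  is_derive t 1 (fun s => G (s - t)) l.
Proof.
move=> [dv <-].
have E : (fun h : R => h^-1 *: (((fun s => G (s - t)) \o shift t) (h *: 1) - G (t - t))) =
    (fun h : R => h^-1 *: ((G \o shift 0) (h *: 1) - G 0)).
  by apply/funext => h; rewrite /= /shift /= addrK addr0 subrr.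
by split; [rewrite /derivable E|rewrite /derive E].
Qed.

Lemma epoint_shift a (t s : R) : epoint a s = epoint a t + (s - t) *: lvc a.
Proof. by rewrite -epointB addrC subrK. Qed.

Lemma is_derive_lpot a b (t : R) : is_edge a -> is_edge b -> 0 < t < 1 ->
  is_derive t 1 (fun t => lpot b (epoint a t)) (Phi a b t).
Proof.
move=> ea eb t01; rewrite /Phi; case: eqVneq => [->|ba]; last first.
  rewrite (_ : (fun s => _) = (fun s => (fun z => lpot b (epoint a t + z *: lvc a)) (s - t))).
    apply: (@is_derive_shift (fun z => lpot b (epoint a t + z *: lvc a)) t).
    exact: (is_derive_logpot (epoint_off_edge hGa ea eb ba t01) (lvc a)).
  by apply/funext => s; rewrite (epoint_shift a t s).
have h0 := hlen_gt0 hGa ea.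
apply: near_eq_is_derive (is_derive_entropy (hlen a) t01).
near=> s; have s01 : 0 < s < 1.
  near: s; have /andP[t0 t1] := t01.
  apply: filterS2 (lt_nbhsr t0) (lt_nbhsl t1) => z ? ?; exact/andP.
have E u : ln (enorm (epoint a s - seg (eg a) u)) = ln (hlen a * `|s - u|).
  by rewrite -[seg _ u]/(epoint a u) epointB enormZ mulrC.
have -> : lpot a (epoint a s) = \int[leb]_(u in I01) ln (hlen a * `|s - u|).
  by apply: eq_Rintegral => u _; exact: E.
rewrite integral_ln_dist //.
apply: eq_integrable (integrableZ01 (-1) (logker_seg_integrable (epoint a s) (e := eg a) (ell_neq0 hGa ea))) => // u _.
by rewrite /= -E /logker mulN1r opprK.
Unshelve. all: by end_near. Qed.

Lemma continuous_Phi a b (t : R) : is_edge a -> is_edge b -> 0 < t < 1 -> continuous_at t (Phi a b).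
Proof.
move=> ea eb /[dup] t01 /andP[t0 t1]; rewrite /Phi; case: eqVneq => [_|ba].
  apply: cvgB; first exact: continuous_ln.
  apply: (@continuous_comp _ _ _ (fun t : R => 1 - t) (@ln R)).
    by apply: cvgB; [exact: cvg_cst|exact: cvg_id].
  by apply: continuous_ln; rewrite subr_gt0.
pose G s := \int[leb]_(u in I01) kq (lvc a) (epoint a t + s *: lvc a - seg (eg b) u).
have cG : continuous_at (0 : R) G.
  exact: (@continuous_kq_int R _ _ (epoint_off_edge hGa ea eb ba t01) (lvc a) (lvc a)).
have -> : (fun s => \int[leb]_(u in I01) kq (lvc a) (epoint a s - seg (eg b) u)) = G \o (fun s => s - t).
  by apply/funext => s; rewrite /= /G -epoint_shift.
apply: continuous_comp; last by rewrite subrr.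
by apply: cvgB; [exact: cvg_id|exact: cvg_cst].
Qed.

Let rk0 a t := rootker (epoint a 0) (epoint a t).
Let rk1 a t := rootker (epoint a 1) (epoint a t).

(** Distinct edges meet only in end points. If they do, they span a sector there; otherwise
    compactness keeps them apart. Either way the distance decays at most linearly towards one end of
    [a]. *)
Lemma edge_dist a b : is_edge a -> is_edge b -> b != a -> exists2 c : R, 0 < c &
  (forall t, 0 < t < 1 -> forall u, 0 <= u <= 1 -> c * t <= enorm (epoint a t - epoint b u)) \/
  (forall t, 0 < t < 1 -> forall u, 0 <= u <= 1 -> c * (1 - t) <= enorm (epoint a t - epoint b u)).
Proof.
move=> ea eb ba.
have off t u : 0 < t < 1 -> 0 <= u <= 1 -> epoint a t != epoint b u.
  move=> t01 u01; apply/eqP => E; apply: (epoint_off_edge hGa ea eb ba t01); rewrite E.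
  by exists u; rewrite //= in_itv.
have la := ell_neq0 hGa ea; have lb := ell_neq0 hGa eb.
have la' : - lvc a != 0 by rewrite oppr_eq0. have lb' : - lvc b != 0 by rewrite oppr_eq0.
have flip (t : R) : 0 < t < 1 -> 0 < 1 - t < 1 by move=> /andP[? ?]; apply/andP; split; lra.
have flip' (t : R) : 0 <= t <= 1 -> 0 <= 1 - t <= 1 by move=> /andP[? ?]; apply/andP; split; lra.
have flipK (t : R) : 1 - (1 - t) = t by rewrite opprB addrC subrK.
have end1 c t : vpt (vx (nxt c)) + t *: (- lvc c) = epoint c (1 - t).
  by rewrite -epoint1 (epoint_shift c 1 (1 - t)) scalerN -scaleNr; congr (_ + _ *: _); ring.
(* The four ways of sharing an end point are all two rays from [P], after reversing the parameter of
   an edge that ends there. *)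
have sec P l l' (fa fb : R -> R) : l != 0 -> l' != 0 ->
    (forall t, P + t *: l = epoint a (fa t)) -> (forall u, P + u *: l' = epoint b (fb u)) ->
    (forall t, 0 < t < 1 -> 0 < fa t < 1) -> (forall u, 0 <= u <= 1 -> 0 <= fb u <= 1) ->
    exists2 c : R, 0 < c & forall t u, 0 <= t -> 0 <= u -> c * t <= enorm (epoint a (fa t) - epoint b (fb u)).
  move=> l0 l'0 ha hb fa01 fb01; have [|c c0 hc] := sector_dist l0 l'0.
    move=> t u t01 u01; have := off _ _ (fa01 t t01) (fb01 u u01).
    by rewrite -ha -hb (inj_eq (addrI P)).
  by exists c => // t u t0 u0; rewrite -ha -hb opprD addrACA subrr add0r; exact: hc.
have id0 c t : vpt (vx c) + t *: lvc c = epoint c t by [].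
have [E|n1] := eqVneq (vx a) (vx b).
  have hb u : vpt (vx a) + u *: lvc b = epoint b u by rewrite E.
  have [//|//|c c0 hc] := sec _ _ _ id id la lb (id0 a) hb.
  by exists c => //; left => t /andP[t0 _] u /andP[u0 _]; exact: hc t u (ltW t0) u0.
have [E|n2] := eqVneq (vx a) (vx (nxt b)).
  have hb u : vpt (vx a) + u *: (- lvc b) = epoint b (1 - u) by rewrite E.
  have [//|//|c c0 hc] := sec _ _ _ id (fun u => 1 - u) la lb' (id0 a) hb.
  exists c => //; left => t /andP[t0 _] u /flip' /andP[u0 _].
  by have := hc t (1 - u) (ltW t0) u0; rewrite flipK.
have [E|n3] := eqVneq (vx (nxt a)) (vx b).
  have hb u : vpt (vx (nxt a)) + u *: lvc b = epoint b u by rewrite E.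
  have [//|//|c c0 hc] := sec _ _ _ (fun t => 1 - t) id la' lb (end1 a) hb.
  exists c => //; right => t /flip/andP[t0 _] u /andP[u0 _].
  by have := hc (1 - t) u (ltW t0) u0; rewrite flipK.
have [E|n4] := eqVneq (vx (nxt a)) (vx (nxt b)).
  have hb u : vpt (vx (nxt a)) + u *: (- lvc b) = epoint b (1 - u) by rewrite E.
  have [//|//|c c0 hc] := sec _ _ _ (fun t => 1 - t) (fun u => 1 - u) la' lb' (end1 a) hb.
  exists c => //; right => t /flip/andP[t0 _] u /flip' /andP[u0 _].
  by have := hc (1 - t) (1 - u) (ltW t0) u0; rewrite !flipK.
have [|c c0 hc] := @disjoint_segments_dist R (eg a) (eg b).
  move=> t u t01 u01; apply/eqP => h.
  have ta := eseg_epoint a t01; have ub := eseg_epoint b u01.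
  have ub' : eseg b (epoint a t) by rewrite [epoint a t]h.
  have [j [_ [ja|ja] [jb|jb]]] := edges_meet hGa ea eb (nesym (elimN eqP ba)) ta ub'.
  - by rewrite -ja -jb eqxx in n1.
  - by rewrite -ja -jb eqxx in n2.
  - by rewrite -ja -jb eqxx in n3.
  - by rewrite -ja -jb eqxx in n4.
exists c => //; left => t /andP[t0 t1] u u01; have t01 : 0 <= t <= 1 by rewrite !ltW.
by apply: le_trans (hc t u t01 u01); rewrite ler_piMr // ltW.
Qed.

Lemma rk_end a (t : R) : is_edge a -> 0 < t < 1 ->
  rk0 a t = (Num.sqrt (hlen a * t))^-1 /\ rk1 a t = (Num.sqrt (hlen a * (1 - t)))^-1.
Proof.
move=> ea /andP[t0 t1]; rewrite /rk0 /rk1 /rootker !epointB !enormZ sub0r normrN (gtr0_norm t0).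
have t1' : 0 < 1 - t by rewrite subr_gt0.
by rewrite (gtr0_norm t1'); split; congr (Num.sqrt _)^-1; exact: mulrC.
Qed.

(** On the edge itself the singularities are logarithmic; for another edge, [kq_int_bound] with the
    distance of [edge_dist] gives the order [t ^ (- 1 / 2)] or [(1 - t) ^ (- 1 / 2)]. *)
Lemma Phi_bound a b : is_edge a -> is_edge b ->
  exists2 C : R, 0 <= C & forall t, 0 < t < 1 -> `|Phi a b t| <= C * (rk0 a t + rk1 a t + 1).
Proof.
move=> ea eb; have h0 := hlen_gt0 hGa ea.
have rr a' t : 0 <= rk0 a' t /\ 0 <= rk1 a' t by split; exact: rootker_ge0.
have [ba|ba] := eqVneq b a.
  exists (2 + 2 * hlen a); first by have := ltW h0; lra.
  move=> t /andP[t0 t1]; rewrite /Phi ba eqxx.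
  have t1' : 0 < 1 - t by rewrite subr_gt0.
  have E : ln t - ln (1 - t) = logker (epoint a 1) (epoint a t) - logker (epoint a 0) (epoint a t).
    rewrite /logker !epointB !enormZ sub0r normrN (gtr0_norm t0) (gtr0_norm t1') -/(hlen a).
    by rewrite !lnM ?posrE //; ring.
  have n0 := norm_logker_le (epoint a 0) (epoint a t).
  have n1 := norm_logker_le (epoint a 1) (epoint a t).
  have D0 : enorm (epoint a 0 - epoint a t) = t * hlen a.
    by rewrite epointB enormZ sub0r normrN (gtr0_norm t0).
  have D1 : enorm (epoint a 1 - epoint a t) = (1 - t) * hlen a.
    by rewrite epointB enormZ (gtr0_norm t1').
  rewrite -/(rk0 a t) D0 in n0; rewrite -/(rk1 a t) D1 in n1.
  rewrite E; apply: le_trans (ler_normB _ _) _.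
  have [r0 r1] := rr a t; have hr0 := mulr_ge0 (ltW h0) r0; have hr1 := mulr_ge0 (ltW h0) r1.
  have : t * hlen a <= hlen a by rewrite ler_piMl // ltW.
  have : (1 - t) * hlen a <= hlen a by apply: ler_piMl; [exact: ltW|lra].
  move: n0 n1 hr0 hr1; move: (rk0 a t) (rk1 a t) (t * hlen a) ((1 - t) * hlen a) r0 r1 => *; lra.
have e0 : (eg b).2 != 0 by exact: ell_neq0.
have rb0 : 0 <= rootbound (eg b).
  have [ir le] := rootker_integrable e0 0; apply: le_trans le.
  by apply: Rintegral01_ge => // t _; exact: rootker_ge0.
have [c c0 hc] := edge_dist ea eb ba.
pose C := hlen a * ((Num.sqrt (c / hlen a))^-1 * rootbound (eg b)).
have C0 : 0 <= C.
  apply: mulr_ge0; first exact: ltW.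
  by apply: mulr_ge0 => //; rewrite invr_ge0 sqrtr_ge0.
exists C => // t t01; have [r0 r1] := rr a t; have [E0 E1] := rk_end ea t01.
have /andP[t0 t1] := t01; have t1' : 0 < 1 - t by rewrite subr_gt0.
rewrite /Phi (negPf ba).
have key z : 0 < z -> (forall u, 0 <= u <= 1 -> c * z <= enorm (epoint a t - seg (eg b) u)) ->
    `|\int[leb]_(u in I01) kq (lvc a) (epoint a t - seg (eg b) u)| <= C * (Num.sqrt (hlen a * z))^-1.
  move=> z0 hz; have cz : 0 < c * z by rewrite mulr_gt0.
  apply: le_trans (kq_int_bound (e := eg b) e0 (lvc a) cz hz) _.
  have -> : c * z = (c / hlen a) * (hlen a * z) by field; rewrite gt_eqF.
  have ch : 0 <= c / hlen a by rewrite ltW // divr_gt0.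
  rewrite sqrtrM // invfM /C -/(hlen a) le_eqVlt; apply/orP; left; apply/eqP; ring.
case: hc => hc.
  apply: le_trans (key t t0 (hc t t01)) _; rewrite -E0 ler_wpM2l //; lra.
apply: le_trans (key (1 - t) t1' (hc t t01)) _; rewrite -E1 ler_wpM2l //; lra.
Qed.

(** Cut off at 0 and 1, where [Phi_bound] gives no control. *)
Definition Phi0 a b (t : R) : R := if 0 < t < 1 then Phi a b t else 0.

Lemma measurable_cont_unit (f g : R -> R) : (forall t : R, 0 < t < 1 -> continuous_at t f) ->
  (forall t : R, 0 < t < 1 -> g t = f t) -> measurable_fun (`]0, 1[ : set R) g.
Proof.
move=> cf gf; apply: (eq_measurable_fun f).
  by move=> t; rewrite inE /= in_itv /= => /gf.
apply: open_continuous_measurable_fun; first exact: itv_open.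
by move=> t; rewrite inE /= in_itv /=; exact: cf.
Qed.

Lemma Phi0_integrable a b al be : is_edge a -> is_edge b ->
  leb.-integrable I01 (EFin \o (fun t => ((1 - t) * al + t * be) * Phi0 a b t)).
Proof.
move=> ea eb; have [C C0 hC] := Phi_bound ea eb.
have e0 : (eg a).2 != 0 by exact: ell_neq0.
have i0 := (rootker_integrable e0 (epoint a 0)).1; have i1 := (rootker_integrable e0 (epoint a 1)).1.
pose K := `|al| + `|be|.
have K0 : 0 <= K by rewrite addr_ge0.
apply: (dominated01 (g := fun t => K * C * (rk0 a t + rk1 a t + 1))).
- apply: (@measurable_cont_unit (fun t => ((1 - t) * al + t * be) * Phi a b t)).
    move=> t t01; apply: cvgM; last exact: continuous_Phi.
    apply: cvgD; (apply: cvgM; last exact: cvg_cst); last exact: cvg_id.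
    by apply: cvgB; [exact: cvg_cst|exact: cvg_id].
  by move=> t t01; rewrite /Phi0 t01.
- by apply: integrableZ01; apply: integrableD01; [exact: integrableD01|exact: integrable_cst01].
- move=> t t01; rewrite /Phi0 t01 normrM -mulrA; apply: ler_pM => //; last exact: hC.
  have /andP[t0 t1] := t01.
  apply: le_trans (ler_normD _ _) _; rewrite !normrM (gtr0_norm t0) gtr0_norm ?subr_gt0 //.
  by apply: lerD; apply: ler_piMl => //; lra.
- move=> t _; rewrite !mulr_ge0 // !addr_ge0 //; exact: rootker_ge0.
- by rewrite /Phi0 ltxx mulr0.
- by rewrite /Phi0 ltxx andbF mulr0.
Qed.

(** [Phi] is the derivative of [lpot] along the edge and may be unbounded at the ends, hence
    [FTC_open] for the product with the affine function. *)
Lemma pair_ibp a b al be : is_edge a -> is_edge b ->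
  \int[leb]_(t in I01) (((1 - t) * al + t * be) * Phi0 a b t) =
  be * lpot b (vpt (vx (nxt a))) - al * lpot b (vpt (vx a)) -
  (be - al) * \int[leb]_(t in I01) lpot b (epoint a t).
Proof.
move=> ea eb; pose phi t := (1 - t) * al + t * be.
have dphi (t : R) : is_derive t 1 phi (be - al).
  by apply: is_derive_eq; rewrite /GRing.scale /=; ring.
have cphi : continuous phi.
  by move=> t; apply: differentiable_continuous; apply/derivable1_diffP; have [] := dphi t.
have cl := @continuous_lpot_edge a b eb.
have il : leb.-integrable I01 (EFin \o (fun t => lpot b (epoint a t))).
  by apply: integrable_I01; exact: continuous_subspaceT.
have iP := Phi0_integrable al be ea eb.
pose f t := (be - al) * lpot b (epoint a t) + phi t * Phi0 a b t.
have fi : leb.-integrable I01 (EFin \o f).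
  by apply: integrableD01 => //; exact: integrableZ01.
have : \int[leb]_(t in I01) f t = phi 1 * lpot b (epoint a 1) - phi 0 * lpot b (epoint a 0).
  apply: (@FTC_open R 0 1 f (fun t => phi t * lpot b (epoint a t)) ltr01 _ _ _ fi).
  - by apply: continuous_subspaceT => t; apply: cvgM; [exact: cphi|exact: cl].
  - move=> t t01; apply: (is_derive_eq (is_deriveM (dphi t) (is_derive_lpot ea eb t01))).
    by rewrite /f /Phi0 t01 /GRing.scale /=; ring.
  - move=> t /[dup] t01 /andP[t0 t1].
    have nf : \forall s \near t, (be - al) * lpot b (epoint a s) + phi s * Phi a b s = f s.
      near=> s; have s01 : 0 < s < 1.
        by near: s; apply: filterS2 (lt_nbhsr t0) (lt_nbhsl t1) => z ? ?; apply/andP.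
      by rewrite /f /Phi0 s01.
    have ft : f t = (be - al) * lpot b (epoint a t) + phi t * Phi a b t by rewrite /f /Phi0 t01.
    rewrite /continuous_at ft; apply: cvg_trans (near_eq_cvg nf) _.
    apply: cvgD; first by apply: cvgM; [exact: cvg_cst|exact: cl].
    by apply: cvgM; [exact: cphi|exact: continuous_Phi].
rewrite /f RintegralD //; last exact: integrableZ01.
rewrite (RintegralZl _ mI il) epoint0 epoint1 /phi.
move: (lpot b (vpt (vx a))) (lpot b (vpt (vx (nxt a)))) (\int[leb]_(t in I01) lpot _ _) (\int[leb]_(t in I01) _).
by move=> La Lb I P; rewrite subrr mul0r add0r subr0 !mul1r mul0r addr0 => <-; ring.
Unshelve. all: by end_near. Qed.

End Hypersingular.

(** * Quadratic form of the hypersingular matrix *)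

Section MaueForm.
Context {R : realType} (Ga : network R) (hGa : is_network Ga) (r : 'I_(nbnd Ga).+1).
Local Notation leb := (@lebesgue_measure R).
Local Notation I01 := (`[0, 1]%classic : set R).
Local Notation vpt j := (pos (vpos Ga) j).
Local Notation sg := (sideR r).
Local Notation nY := #|bedges r|.
Implicit Types (a b : vidx Ga) (j : 'I_(nN Ga)).

Definition edge_family (k : 'I_nY) : (R * R) * (R * R) := eseg_data (enum_val k).
Local Notation V := (segV edge_family).

Lemma edge_family_neq0 k : (edge_family k).2 != 0.
Proof. by apply: (eg_neq0 hGa (r := r)); exact: enum_valP. Qed.

Lemma edge_family_disjoint : almost_disjoint edge_family.
Proof.
move=> k l t kl t01; apply: (edge_interior hGa) t01.
- exact: bedges_edge (enum_valP k).
- exact: bedges_edge (enum_valP l).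
- by move=> /enum_val_inj kl'; rewrite kl' eqxx in kl.
Qed.

Lemma segV_lpot k l : V k l = - (hlen (enum_val k) * hlen (enum_val l)) *
  \int[leb]_(t in I01) lpot (enum_val l) (epoint (enum_val k) t).
Proof.
have el := bedges_edge (enum_valP l).
rewrite /segV mulNr -mulrA -mulrN; congr (_ * _).
rewrite -mulrN -mulN1r -RintegralZl //; last first.
  by apply: integrable_I01; apply: continuous_subspaceT; exact: continuous_lpot_edge.
rewrite -RintegralZl //; last first.
  apply: integrableZ01.
  by apply: integrable_I01; apply: continuous_subspaceT; exact: continuous_lpot_edge.
by apply: eq_Rintegral => t _; rewrite lpotE // mulN1r opprK.
Qed.

(** Arc length derivative of the hat function along the boundary, in the orientation given by the
    outward normal: a column of [D] in the Maue identity [W = D^T V D]. *)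
Definition slope_weight j (k : 'I_nY) : R :=
  sg (enum_val k) * vjump j (enum_val k) / hlen (enum_val k).

Lemma indicator_subst (I : eqType) (i j : I) (F : I -> R) : (i == j)%:R * F i = (i == j)%:R * F j.
Proof. by have [->//|_] := eqVneq i j; rewrite !mul0r. Qed.

Lemma hat_hypersing_edge j j' k :
  let a := enum_val k in
  hlen a * \int[leb]_(t in I01) (hatn j a t * hypersing r (hatn j') a t) =
  (2 * pi)^-1 * \sum_(l < nY) (sg (enum_val l) * vjump j' (enum_val l) *
     (sg a * vjump j a * lpot (enum_val l) (vpt j)) + slope_weight j k * slope_weight j' l * V k l).
Proof.
move=> a; have aB : a \in bedges r := enum_valP k.
have ea := bedges_edge aB; have h0 := hlen_gt0 hGa ea.
set al := (vx a == j)%:R : R; set be := (vx (nxt a) == j)%:R : R.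
pose f (l : 'I_nY) t := ((1 - t) * al + t * be) * Phi0 a (enum_val l) t.
pose c (l : 'I_nY) := (2 * pi)^-1 * (sg a / hlen a) * (sg (enum_val l) * vjump j' (enum_val l)).
have fi l : leb.-integrable I01 (EFin \o f l).
  by apply: Phi0_integrable => //; exact: bedges_edge (enum_valP l).
have [gi gE] := integrable_sum01 (index_enum 'I_nY) c fi.
have mg : measurable_fun (`]0, 1[ : set R) (fun t => \sum_(l < nY) c l * f l t).
  apply/measurable_EFinP; apply: measurable_funS (measurable_int _ gi) => //.
  by apply: subset_itvScc; rewrite bnd_simp.
rewrite -(@eq_Rintegral_unit R (fun t => \sum_(l < nY) c l * f l t)) //; last first.
  move=> t t01; rewrite hypersingE // [X in _ = _ * (_ * X)]big_enum_val.
  rewrite mulrA mulr_sumr.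
  apply: eq_bigr => l _.
  by rewrite /f /c /Phi0 t01 /hatn -/al -/be; ring.
rewrite gE !mulr_sumr; apply: eq_bigr => l _.
have el := bedges_edge (enum_valP l); have k0 := hlen_gt0 hGa el.
rewrite /f (pair_ibp hGa al be ea el).
(* The indicator in front allows the value at a vertex of [a] to be replaced by the value at [j],
   which is the same for all edges. *)
rewrite (indicator_subst (vx (nxt a)) j (fun i => lpot (enum_val l) (vpt i))).
rewrite (indicator_subst (vx a) j (fun i => lpot (enum_val l) (vpt i))).
rewrite segV_lpot /c /slope_weight -/a /vjump -/al -/be.
move: (\int[leb]_(t in _) _) (lpot _ _) (2 * pi)^-1 => I L p.
by field; rewrite !gt_eqF.
Qed.

(** The vertex values of [lpot] are common to all edges at the vertex and cancel by
    [bedges_balance]; the bilinear form of the slopes remains. *)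
Lemma Wmx_form i i' : Wmx r i i' =
  (2 * pi)^-1 * segQ edge_family (slope_weight (enum_val i)) (slope_weight (enum_val i')).
Proof.
rewrite mxE /bpair /bint big_enum_val.
under eq_bigr => k _ do rewrite hat_hypersing_edge.
rewrite -mulr_sumr; congr (_ * _); rewrite /segQ.
under eq_bigr => k _ do rewrite big_split /=.
rewrite big_split /= exchange_big /= big1 ?add0r // => l _.
rewrite -mulr_sumr.
have -> : \sum_(k < nY) sg (enum_val k) * vjump (enum_val i) (enum_val k) *
    lpot (enum_val l) (vpt (enum_val i)) = 0.
  by rewrite -mulr_suml -(big_enum_val (fun a => sg a * vjump (enum_val i) a)) bedges_balance ?mul0r.
by rewrite mulr0.
Qed.

Lemma slope_weight_mean j : \sum_k slope_weight j k * enorm (edge_family k).2 = 0.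
Proof.
rewrite -[RHS](bedges_balance hGa r j) [RHS]big_enum_val; apply: eq_bigr => k _.
by rewrite /slope_weight divfK // gt_eqF // hlen_gt0 //; exact: bedges_edge (enum_valP k).
Qed.

Lemma segQ_sum (I : finType) (e : I -> (R * R) * (R * R)) (K : finType) (x : K -> R) (c : K -> I -> R) :
  segQ e (fun k => \sum_i x i * c i k) (fun k => \sum_i x i * c i k) =
  \sum_i \sum_j x i * x j * segQ e (c i) (c j).
Proof.
have E f g : segQ e f g = \sum_(p : I * I) f p.1 * g p.2 * segV e p.1 p.2.
  by rewrite /segQ pair_bigA.
rewrite E; under [RHS]eq_bigr => i _ do under eq_bigr => j _ do rewrite E mulr_sumr.
under [RHS]eq_bigr => i _ do rewrite exchange_big /=.
rewrite [RHS]exchange_big /=; apply: eq_bigr => p _.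
rewrite !mulr_suml; apply: eq_bigr => i _; rewrite mulr_sumr mulr_suml.
by apply: eq_bigr => j _; ring.
Qed.

Lemma Wmx_psd (x : 'cV[R]_#|bverts r|) : 0 <= (x^T *m Wmx r *m x) ord0 ord0.
Proof.
pose c k := \sum_i x i ord0 * slope_weight (enum_val i) k.
suff -> : (x^T *m Wmx r *m x) ord0 ord0 = (2 * pi)^-1 * segQ edge_family c c.
  apply: mulr_ge0; first by rewrite invr_ge0 mulr_ge0 ?pi_ge0.
  apply: segQ_mean0_ge0; [exact: edge_family_neq0|exact: edge_family_disjoint|].
  under eq_bigr => k _ do rewrite mulr_suml.
  rewrite exchange_big big1 // => i _.
  under eq_bigr => k _ do rewrite -mulrA.
  by rewrite -mulr_sumr slope_weight_mean mulr0.
have -> : (x^T *m Wmx r *m x) ord0 ord0 = \sum_i \sum_i' x i ord0 * x i' ord0 * Wmx r i i'.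
  rewrite mxE exchange_big; apply: eq_bigr => i' _.
  by rewrite mxE mulr_suml; apply: eq_bigr => i _; rewrite mxE mulrAC.
have -> : segQ edge_family c c = \sum_i \sum_i' x i ord0 * x i' ord0 *
    segQ edge_family (slope_weight (enum_val i)) (slope_weight (enum_val i')).
  exact: segQ_sum.
rewrite mulr_sumr; apply: eq_bigr => i _; rewrite mulr_sumr; apply: eq_bigr => i' _.
by rewrite Wmx_form mulrCA.
Qed.

End MaueForm.

(** * Single-layer matrix *)

Section SingleLayer.
Context {R : realType} (Ga : network R) (hGa : is_network Ga) (r : 'I_(nbnd Ga).+1).
Local Notation leb := (@lebesgue_measure R).
Local Notation I01 := (`[0, 1]%classic : set R).
Local Notation vpt j := (pos (vpos Ga) j).
Local Notation nY := #|bedges r|.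
Local Notation ef := (@edge_family R Ga r).
Implicit Types (a b : vidx Ga).

Lemma slp_chi (j : 'I_nY) x : slp r (chi j) x =
  (2 * pi)^-1 * (hlen (enum_val j) * \int[leb]_(u in I01) logker x (seg (ef j) u)).
Proof.
rewrite /slp /bint big_enum_val (bigD1 j) //= big1 ?addr0 => [|l lj]; last first.
  under eq_Rintegral => t _ do rewrite /chi (inj_eq enum_val_inj) (negPf lj) mulr0.
  by rewrite Rintegral_cst01 mulr0.
rewrite mulrCA; congr (_ * _).
rewrite -RintegralZl //; last by apply: logker_seg_integrable; exact: edge_family_neq0.
apply: eq_Rintegral => t _; rewrite /chi eqxx mulr1 /Gfun /logker /seg /epoint /edge_family /=.
by rewrite mulrN mulNr.
Qed.

Lemma Vmx_form i j : Vmx r i j = (2 * pi)^-1 * segV ef i j.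
Proof.
have c0 k : (ef k).2 != 0 by exact: edge_family_neq0.
rewrite mxE /bpair /bint big_enum_val (bigD1 i) //= big1 ?addr0 => [|k ki]; last first.
  under eq_Rintegral => t _ do rewrite /chi (inj_eq enum_val_inj) (negPf ki) mul0r.
  by rewrite Rintegral_cst01 mulr0.
rewrite /segV mulrCA; congr (_ * _); rewrite -RintegralZl //; last first.
  apply: integrable_I01; apply: continuous_subspaceT => t.
  apply: (@continuous_comp _ _ _ (seg (ef i))
    (fun x => enorm (ef j).2 * \int[leb]_(u in I01) logker x (seg (ef j) u))); first exact: continuous_seg.
  by have := continuous_segpot (edge_family_neq0 hGa (r := r)) (edge_family_disjoint hGa (r := r)) (j := j); apply.
by apply: eq_Rintegral => t _; rewrite /chi eqxx mul1r /trace slp_chi.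
Qed.

Lemma Vmx_quad (x : 'cV[R]_nY) :
  (x^T *m Vmx r *m x) ord0 ord0 = (2 * pi)^-1 * segQ ef (x ^~ ord0) (x ^~ ord0).
Proof.
rewrite mxE /segQ exchange_big mulr_sumr; apply: eq_bigr => j _.
rewrite mxE mulr_suml mulr_sumr; apply: eq_bigr => i _.
by rewrite mxE Vmx_form; ring.
Qed.

Lemma Vmx_capacity_psd (x : 'cV[R]_nY) : (capacity (boundary (reg r)) < 1)%E ->
  0 <= (x^T *m Vmx r *m x) ord0 ord0.
Proof.
move=> hc; rewrite Vmx_quad mulr_ge0 ?invr_ge0 ?mulr_ge0 ?pi_ge0 //.
apply: (@segQ_capacity_ge0 _ _ ef _ _ (boundary (reg r))) => //.
- exact: edge_family_neq0.
- exact: edge_family_disjoint.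
- apply: closed_measurable_plane; rewrite /boundary setDE.
  by apply: closedI; [exact: closed_closure|apply: open_closedC; exact: open_interior].
- by move=> k; have := enum_valP k; rewrite inE => /andP[_ /asboolP].
Qed.

Lemma Vmx_mean0_psd (x : 'cV[R]_nY) : \sum_k x k ord0 * hlen (enum_val k) = 0 ->
  0 <= (x^T *m Vmx r *m x) ord0 ord0.
Proof.
move=> hx; rewrite Vmx_quad mulr_ge0 ?invr_ge0 ?mulr_ge0 ?pi_ge0 //.
by apply: segQ_mean0_ge0; [exact: edge_family_neq0|exact: edge_family_disjoint|].
Qed.

Lemma Vmx_mean0_eq0 (x : 'cV[R]_nY) : \sum_k x k ord0 * hlen (enum_val k) = 0 ->
  (x^T *m Vmx r *m x) ord0 ord0 = 0 -> x = 0.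
Proof.
move=> hx; rewrite Vmx_quad => /eqP; rewrite mulf_eq0 invr_eq0 mulf_eq0 pnatr_eq0 (gt_eqF (pi_gt0 R)) /=.
move=> /eqP q0; apply/matrixP => k o; rewrite ord1 mxE.
exact: (segQ_strict (edge_family_neq0 hGa (r := r)) (edge_family_disjoint hGa (r := r)) hx q0).
Qed.

Lemma bverts_edge a : a \in bedges r -> (vx a \in bverts r) && (vx (nxt a) \in bverts r).
Proof.
rewrite inE => /andP[ea /asboolP sub]; rewrite !inE; apply/andP; split; apply/asboolP; apply: sub.
  by exists 0; rewrite ?epoint0 //= in_itv /= lexx ler01.
by exists 1; rewrite ?epoint1 //= in_itv /= lexx ler01.
Qed.

(** The hat functions add up to 1 on every boundary edge. Orthogonality to [lvec] therefore means
    total charge zero. *)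
Lemma lvecE (k : 'I_nY) o : lvec r k o = hlen (enum_val k).
Proof.
have aB := enum_valP k; set a := enum_val k in aB *.
rewrite mxE; pose f (j : 'I_#|bverts r|) t := hat j a t.
have fi j : leb.-integrable I01 (EFin \o f j).
  apply: integrable_I01; apply: continuous_subspaceT => t.
  apply: cvgD; (apply: cvgM; last exact: cvg_cst); last exact: cvg_id.
  by apply: cvgB; [exact: cvg_cst|exact: cvg_id].
have [_ fE] := integrable_sum01 (index_enum 'I_#|bverts r|) (fun _ => 1) fi.
transitivity (hlen a * \sum_j 1 * \int[leb]_(t in I01) f j t).
  rewrite mulr_sumr; apply: eq_bigr => j _; rewrite !mxE mulr1 mul1r.
  rewrite /bpair /bint big_enum_val (bigD1 k) //= big1 ?addr0 => [|l lk]; last first.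
    under eq_Rintegral => t _ do rewrite /chi (inj_eq enum_val_inj) (negPf lk) mul0r.
    by rewrite Rintegral_cst01 mulr0.
  by congr (_ * _); apply: eq_Rintegral => t _; rewrite /chi eqxx mul1r.
rewrite -fE -[RHS]mulr1; congr (_ * _); rewrite -[RHS]Rintegral_cst01; apply: eq_Rintegral => t _.
have /andP[a0 a1] := bverts_edge aB.
have pick j : j \in bverts r -> \sum_(i < #|bverts r|) (j == enum_val i)%:R = 1 :> R.
  move=> jB; rewrite -(big_enum_val (fun i => (j == i)%:R)) (bigD1 j) //= eqxx big1 ?addr0 // => i.
  by rewrite andbC eq_sym => /andP[/negPf ->].
under eq_bigr => i _ do rewrite mul1r /f /hat.
by rewrite big_split /= -!mulr_sumr !pick // !mulr1 subrK.
Qed.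

End SingleLayer.

(** * Semidefiniteness of the Dirichlet-to-Neumann matrices *)

Section Semidefinite.
Context {R : realType}.

Definition psd n (A : 'M[R]_n) : Prop := forall x : 'cV[R]_n, 0 <= (x^T *m A *m x) ord0 ord0.

Lemma psdD n (A B : 'M[R]_n) : psd A -> psd B -> psd (A + B).
Proof. by move=> pA pB x; rewrite mulmxDr mulmxDl mxE addr_ge0. Qed.

Lemma psd_sum n (I : finType) (A : I -> 'M[R]_n) : (forall i, psd (A i)) -> psd (\sum_i A i).
Proof.
move=> pA; apply: (big_ind (@psd n)) => // [x|A1 B1]; last exact: psdD.
by rewrite mulmx0 mul0mx mxE.
Qed.

Lemma psd_congr m n (A : 'M[R]_m) (J : 'M[R]_(m, n)) : psd A -> psd (J^T *m A *m J).
Proof. by move=> pA x; have := pA (J *m x); rewrite trmx_mul !mulmxA. Qed.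

Lemma psd_invmx n (A : 'M[R]_n) : psd A -> psd (invmx A).
Proof.
(* [invmx] of a singular matrix is the matrix itself. *)
move=> pA x; have [uA|nA] := boolP (A \in unitmx); last by rewrite /invmx (negPf nA).
have := pA (invmx A *m x); rewrite trmx_mul -!mulmxA mulKVmx //.
by rewrite -[_ *m _ in X in X -> _]trmxK mxE !trmx_mul !trmxK mulmxA.
Qed.

(** Strictness on the kernel of [l^T] makes the bordered matrix invertible. The block then maps [y]
    to some [x] with [l^T x = 0], and pairing [y] with [x] gives the form of [V] at [x]. *)
Lemma psd_saddle n (V : 'M[R]_n) (l : 'cV[R]_n) :
  (n = 0%N \/ l != 0) ->
  (forall x : 'cV[R]_n, l^T *m x = 0 -> 0 <= (x^T *m V *m x) ord0 ord0) ->
  (forall x : 'cV[R]_n, l^T *m x = 0 -> (x^T *m V *m x) ord0 ord0 = 0 -> x = 0) ->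
  psd (ulsubmx (invmx (block_mx V l l^T 0))).
Proof.
move=> [n0|l0] pV sV.
  by case: _ / (esym n0) V l pV sV => V l _ _ x; rewrite mxE big1 // => -[].
set B := block_mx _ _ _ _.
have uB : B \in unitmx.
  rewrite -unitmx_tr -row_free_unit -kermx_eq0; apply/rowV0P => v /sub_kermxP vB.
  have : B *m v^T = 0 by rewrite -[LHS]trmxK trmx_mul trmxK vB trmx0.
  rewrite -[v^T]vsubmxK /B mul_block_col mul0mx addr0 -[0]vsubmxK !linear0 => /eq_col_mx [E1 E2].
  have x0 : usubmx v^T = 0.
    apply: sV => //; rewrite -mulmxA; move/eqP: E1; rewrite addr_eq0 => /eqP ->.
    rewrite mulmxN mulmxA -[_^T *m l]trmxK trmx_mul trmxK E2 trmx0 mul0mx.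
    by rewrite oppr0 mxE.
  move: E1; rewrite x0 mulmx0 add0r [dsubmx _]mx11_scalar mul_mx_scalar => /eqP.
  rewrite scaler_eq0 (negPf l0) orbF => /eqP d0.
  have y0 : dsubmx v^T = 0 by rewrite [LHS]mx11_scalar d0 raddf0.
  by rewrite -[v]trmxK -[v^T]vsubmxK x0 y0 col_mx0 trmx0.
move=> y; pose z := invmx B *m col_mx y 0.
have : B *m z = col_mx y 0 by rewrite /z mulKVmx.
rewrite -[z]vsubmxK /B mul_block_col mul0mx addr0 => /eq_col_mx [E1 E2].
have -> : y^T *m ulsubmx (invmx B) *m y = y^T *m usubmx z.
  rewrite -mulmxA; congr (_ *m _).
  by rewrite /z -[invmx B in RHS]submxK mul_block_col !mulmx0 !addr0 col_mxKu.
(* Here [y = V x + l c], and the multiplier [c] disappears against [l^T x = 0]. *)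
rewrite -E1 linearD mulmxDl /= !trmx_mul -[_ *m l^T *m _]mulmxA E2 mulmx0 addr0.
have := pV _ E2; suff -> : ((usubmx z)^T *m V *m usubmx z) ord0 ord0 =
    ((usubmx z)^T *m V^T *m usubmx z) ord0 ord0 by [].
by rewrite -[in LHS](trmxK (_ *m _)) mxE !trmx_mul trmxK mulmxA.
Qed.

Lemma psd_Smx (Ga : network R) (hGa : is_network Ga) (r : 'I_(nbnd Ga).+1) :
  (r <> ord_max -> (capacity (boundary (reg r)) < 1)%E) -> psd (Smx r).
Proof.
move=> hc; apply: psdD; first exact: Wmx_psd.
apply: psd_congr; case: eqVneq => [_|/eqP/hc rc]; last first.
  by apply: psd_invmx => x; exact: Vmx_capacity_psd.
have lE (x : 'cV[R]_#|bedges r|) : (lvec r)^T *m x = 0 ->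
    \sum_k x k ord0 * hlen (enum_val k) = 0.
  move=> /matrixP /(_ ord0 ord0); rewrite mxE [RHS]mxE => h; rewrite -[RHS]h; apply: eq_bigr => k _.
  by rewrite [_^T _ _]mxE lvecE // mulrC.
apply: psd_saddle => [|x /lE|x /lE].
- have [k|n0] := pickP 'I_#|bedges r|; last by left; rewrite -[LHS]card_ord; exact: eq_card0.
  move=> _; right; apply/eqP => /matrixP /(_ k ord0).
  rewrite lvecE // mxE => /eqP; rewrite gt_eqF //.
  by rewrite (hlen_gt0 hGa) //; exact: bedges_edge (enum_valP k).
- exact: Vmx_mean0_psd.
- exact: Vmx_mean0_eq0.
Qed.

Lemma psd_Lambda (Ga : network R) (hGa : is_network Ga) :
  (forall r : 'I_(nbnd Ga).+1, r <> ord_max -> (capacity (boundary (reg r)) < 1)%E) ->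
  psd (Lambda Ga).
Proof.
by move=> hc; apply: psd_sum => r; apply: psd_congr; apply: psd_Smx => //; exact: hc.
Qed.

End Semidefinite.

(** * Energy stability *)

Section EnergyStability.
Context {R : realType} (Ga : network R) (g : anisotropy R (nS Ga)).
Local Notation npos := 'cV[R]_(\sum_(j < nN Ga) 2).

Lemma mxE00_tr n (A : 'M[R]_n) (x y : 'cV[R]_n) : (x^T *m A *m y) ord0 ord0 = (y^T *m A^T *m x) ord0 ord0.
Proof. by rewrite -[in LHS](trmxK (_ *m _)) mxE !trmx_mul trmxK mulmxA. Qed.

Lemma colvB (p q : R * R) : colv (p - q) = colv p - colv q.
Proof. by apply/matrixP => i j; rewrite !mxE /crd; case: ifP. Qed.

Lemma gtform_ge0 (hg : is_anisotropy g) i (l : 'I_(nL g i)) q : 0 <= gtform l q q.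
Proof.
case: hg => _ _ /(_ i l) [_ pG].
rewrite /gtform /Gt -!mulmxA mulmxA -trmx_mul; set v := rotmx *m _.
have [->|v0] := eqVneq v 0; first by rewrite trmx0 mul0mx mxE.
by rewrite mulmxA ltW // pG.
Qed.

Lemma gtformC (hg : is_anisotropy g) i (l : 'I_(nL g i)) p q : gtform l p q = gtform l q p.
Proof.
case: hg => _ _ /(_ i l) [sG _].
by rewrite /gtform mxE00_tr /Gt !trmx_mul trmxK sG mulmxA.
Qed.

(** Multiplied by [sdens l q], the difference of the two sides is half the sum of the square of
    [sdens l p - sdens l q] and the form at [p - q]. *)
Lemma sdens_convex (hg : is_anisotropy g) i (l : 'I_(nL g i)) p q : 0 < sdens l q ->
  sdens l p <= sdens l q + gtform l p (p - q) / sdens l q.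
Proof.
move=> q0.
have sp : sdens l p ^+ 2 = gtform l p p by rewrite sqr_sqrtr // gtform_ge0.
have sq : sdens l q ^+ 2 = gtform l q q by rewrite sqr_sqrtr // gtform_ge0.
have gB x : gtform l x (p - q) = gtform l x p - gtform l x q.
  by rewrite /gtform colvB mulmxBr !mxE.
have := gtform_ge0 hg l (p - q); rewrite gB ![gtform l (p - q) _]gtformC // !gB.
rewrite (gtformC hg l q p) -sp -sq.
have := sqr_ge0 (sdens l p - sdens l q).
move: (sdens l p) (sdens l q) (gtform l p q) q0 => a b c b0 H1 H2.
rewrite -lerBlDl -(ler_pM2r b0) divfK ?gt_eqF //; nra.
Qed.

Lemma Eh_convex (hg : is_anisotropy g) (hnd : nondegenerate_network g) (X : npos) :
  Eh g X <= Eh g (vpos Ga) + Aform g (X - vpos Ga) X.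
Proof.
have [cpos _ _] := hg.
rewrite /Eh /Aform -big_split; apply: ler_sum => i _ /=.
rewrite -mulrDr ler_wpM2l // -?big_split /=; first exact: ltW.
apply: ler_sum => k ek; rewrite -big_split /=; apply: ler_sum => l _.
have -> : ell (ix k) (X - vpos Ga) = ell (ix k) X - ell (ix k) (vpos Ga).
  have posB (a b : npos) j : pos (a - b) j = pos a j - pos b j by rewrite /pos /submxcol !mxE.
  by rewrite /ell !posB [in LHS]opprD addrACA -opprD.
by apply: sdens_convex => //; exact: hnd.
Qed.

Lemma tr_Mv : (Mv Ga)^T = Mv Ga.
Proof. by rewrite tr_mxdiag; apply: eq_mxdiag => i; rewrite tr_diag_mx. Qed.

Lemma dissipation_identity (dt : R) (W : 'cV[R]_(\sum_(p < nP Ga) nN Ga))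
    (kappa : 'cV[R]_(\sum_(i < nS Ga) nv i)) (X : npos) : 0 < dt ->
  ILambda Ga *m W - dt^-1 *: (Dh Ga *m Mv Ga *m Bn Ga *m (X - vpos Ga)) = 0 ->
  (Dh Ga)^T *m W - kappa = 0 -> (Bn Ga)^T *m Mv Ga *m kappa + Agamma g *m X = 0 ->
  dt * (\sum_(p < nP Ga) ((submxcol W p)^T *m Lambda Ga *m submxcol W p) ord0 ord0) =
  - Aform g (X - vpos Ga) X.
Proof.
move=> dt0 /eqP; rewrite subr_eq0 => /eqP eqW /eqP; rewrite subr_eq0 => /eqP eqk.
move=> /eqP; rewrite addrC addr_eq0 => /eqP eqX; set Y := X - _ in eqW *.
have -> : \sum_(p < nP Ga) ((submxcol W p)^T *m Lambda Ga *m submxcol W p) ord0 ord0 =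
    (W^T *m (ILambda Ga *m W)) ord0 ord0.
  rewrite -[W in W^T]submxcolK tr_mxcol -[ILambda Ga *m W]submxcolK mul_mxrow_mxcol summxE.
  by apply: eq_bigr => p _; rewrite submxcol_ILambda mulmxA.
rewrite eqW -scalemxAr mxE mulrA divff ?gt_eqF // mul1r -AgammaE -[in RHS]mulmxA eqX mulmxN [X in _ = - X]mxE opprK.
rewrite -eqk !mulmxA.
have -> : W^T *m Dh Ga *m Mv Ga *m Bn Ga *m Y = (Y^T *m (Bn Ga)^T *m Mv Ga *m (Dh Ga)^T *m W)^T.
  by rewrite !trmx_mul !trmxK tr_Mv !mulmxA.
by rewrite [LHS]mxE.
Qed.

End EnergyStability.

Theorem theorem6p4 (R : realType) (Ga : network R) (g : anisotropy R (nS Ga))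
    (hGa : is_network Ga) (hg : is_anisotropy g)
    (hcap : forall r : 'I_(nbnd Ga).+1, r <> ord_max ->
      (capacity (boundary (reg r)) < 1)%E)
    (hnd : nondegenerate_network g)
    (dt : R) (hdt : 0 < dt)
    (W : 'cV[R]_(\sum_(p < nP Ga) nN Ga))
    (kappa : 'cV[R]_(\sum_(i < nS Ga) nv i))
    (X : 'cV[R]_(\sum_(j < nN Ga) 2))
    (eqW : ILambda Ga *m W - dt^-1 *: (Dh Ga *m Mv Ga *m Bn Ga *m (X - vpos Ga)) = 0)
    (eqkappa : (Dh Ga)^T *m W - kappa = 0)
    (eqX : (Bn Ga)^T *m Mv Ga *m kappa + Agamma g *m X = 0) :
  Eh g X + dt * (\sum_(p < nP Ga)
      ((submxcol W p)^T *m Lambda Ga *m submxcol W p) ord0 ord0) <= Eh g (vpos Ga)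
  /\ Eh g X <= Eh g (vpos Ga).
Proof.
have E := dissipation_identity hdt eqW eqkappa eqX.
have stable : Eh g X + dt * (\sum_(p < nP Ga)
      ((submxcol W p)^T *m Lambda Ga *m submxcol W p) ord0 ord0) <= Eh g (vpos Ga).
  by rewrite E lerBlDr; exact: Eh_convex.
split=> //; apply: le_trans stable; rewrite lerDl mulr_ge0 //; first exact: ltW.
by apply: sumr_ge0 => p _; exact: psd_Lambda.
Qed.
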